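(* Let $k>0$ be a fixed wave number. Let $\Gamma_1,\Gamma_2$ be two locally rough surfaces, $\Gamma_j=\{(x_1,x_2)\in\mathbb{R}^2 : x_2=h_j(x_1),\ x_1\in\mathbb{R}\}$ with $h_j\in C^2(\mathbb{R})$ compactly supported, and let $u_j(x,d)$ be the total field corresponding to $\Gamma_j$ and to the incident plane wave with direction $d$ ($j=1,2$). Let $\Omega$ be a (nonempty) bounded open domain above $\Gamma_1$ and $\Gamma_2$, i.e. $\Omega\subset D_{+,1}\cap D_{+,2}$. Let $d_n\in\mathbb{S}^1_-$, $n\in\mathbb{N}$, be (infinitely many) pairwise distinct directions. If $|u_1(x,d_n)|=|u_2(x,d_n)|$ for all $x\in\Omega$ and all $n\in\mathbb{N}$, then $\Gamma_1=\Gamma_2$.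
   Context: $\mathbb{S}^1_-=\{x\in\mathbb{R}^2:|x|=1,\ x_2<0\}$. For $j=1,2$, $D_{+,j}=\{(x_1,x_2): x_2>h_j(x_1)\}$ is the domain above $\Gamma_j$. For $d=(d_1,d_2)\in\mathbb{S}^1_-$ put $d'=(d_1,-d_2)$, $u^i(x,d)=e^{ikx\cdot d}$ (incident plane wave) and $u^r(x,d)=-e^{ikx\cdot d'}$ (wave reflected by the plane $x_2=0$). The total field is $u_j=u^i+u^r+u^s_j$, where the scattered field $u^s_j(\cdot,d)$ is the unique classical solution (in $C^2(D_{+,j})\cap C(\overline{D_{+,j}})$; well-posedness is known) such that: $\Delta u_j+k^2u_j=0$ in $D_{+,j}$; $u_j=0$ on $\Gamma_j$; and $u^s_j$ satisfies the Sommerfeld radiation condition $\lim_{r\to\infty}r^{1/2}\left(\partial u^s_j/\partial r-iku^s_j\right)=0$, $r=|x|$, $x\in D_{+,j}$ (uniformly in directions). *)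

(* Defs.v *)
From HB Require Import structures.
From mathcomp Require Import all_boot all_order all_algebra.
From mathcomp Require Import all_classical all_reals all_analysis.
From mathcomp Require Import complex.

Set Implicit Arguments.
Unset Strict Implicit.
Unset Printing Implicit Defensive.

Import Order.TTheory GRing.Theory Num.Theory.
Import numFieldNormedType.Exports.

Local Open Scope classical_set_scope.
Local Open Scope ring_scope.
Local Open Scope complex_scope.

Section Plane.
Variable R : realType.

(* The library norm on [R * R] is the max norm; it induces the same topology
   and the same bounded sets as the Euclidean norm below. *)
Definition enorm (x : R * R) : R := Num.sqrt (x.1 ^+ 2 + x.2 ^+ 2).

Definition dotp (x y : R * R) : R := x.1 * y.1 + x.2 * y.2.

Definition e1 : R * R := (1, 0).
Definition e2 : R * R := (0, 1).

(* Meant for open [D]: all partial derivatives of order at most [n] exist and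
   are continuous at every point of [D]. *)
Fixpoint Ck_on (n : nat) (D : set (R * R)) (f : R * R -> R) : Prop :=
  (forall x, D x -> {for x, continuous f}) /\
  match n with
  | 0%N => True
  | m.+1 => forall v, v \in [:: e1; e2] ->
      (forall x, D x -> derivable f x v) /\ Ck_on m D ('D_v f)
  end.

(* The library has no real normed module structure on [R[i]], so real
   differentiation of complex-valued functions is done componentwise. *)
Definition C2_on (D : set (R * R)) (u : R * R -> R[i]) : Prop :=
  Ck_on 2 D (fun x => complex.Re (u x)) /\ Ck_on 2 D (fun x => complex.Im (u x)).

Definition cderive (u : R * R -> R[i]) (v x : R * R) : R[i] :=
  'D_v (fun y => complex.Re (u y)) x +i* 'D_v (fun y => complex.Im (u y)) x.

Definition laplacian (u : R * R -> R[i]) (x : R * R) : R[i] :=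
  cderive (cderive u e1) e1 x + cderive (cderive u e2) e2 x.

Definition radial_derive (u : R * R -> R[i]) (x : R * R) : R[i] :=
  cderive u ((enorm x)^-1 *: x) x.

Definition expi (t : R) : R[i] := cos t +i* sin t.

Definition locally_rough (h : R -> R) : Prop :=
  [/\ forall (n : nat) (x : R), (n < 2)%N -> derivable (derive1n n h) x 1,
      continuous (derive1n 2 h)
    & compact (closure [set x : R | h x != 0])].

Definition surface (h : R -> R) : set (R * R) := [set x | x.2 = h x.1].

Definition domain_above (h : R -> R) : set (R * R) := [set x | h x.1 < x.2].

Definition lower_directions : set (R * R) := [set d | enorm d = 1 /\ d.2 < 0].

Definition incident_wave (k : R) (x d : R * R) : R[i] := expi (k * dotp x d).

Definition reflected_wave (k : R) (x d : R * R) : R[i] :=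
  - expi (k * dotp x (d.1, - d.2)).

Definition total_field (k : R) (us : R * R -> R * R -> R[i]) (x d : R * R)
    : R[i] :=
  incident_wave k x d + reflected_wave k x d + us x d.

(* The bound [M] depends on [eps] only, so the limit is uniform in directions. *)
Definition sommerfeld (k : R) (D : set (R * R)) (u : R * R -> R[i]) : Prop :=
  forall eps : R, 0 < eps -> exists M : R, forall x, D x -> M < enorm x ->
    `|(Num.sqrt (enorm x))%:C * (radial_derive u x - 'i * k%:C * u x)| < eps%:C.

(* [R[i]^o] is [R[i]] with the topology of the complex modulus. *)
Definition is_scattered_field (k : R) (h : R -> R)
    (us : R * R -> R * R -> R[i]) (d : R * R) : Prop :=
  let D := domain_above h in
  let us_d := fun x => us x d in
  let u_d := fun x => total_field k us x d in
  [/\ C2_on D us_d,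
      {within closure D, continuous (us_d : R * R -> R[i]^o)},
      forall x, D x -> laplacian u_d x + (k ^+ 2)%:C * u_d x = 0,
      forall x, surface h x -> u_d x = 0
    & sommerfeld k D us_d].

End Plane.

(* Main.v *)
(* The complex fields are split into real and imaginary parts, and every real
   solution of the Helmholtz equation in a domain of the plane is handled
   through weighted integrals over circles.

   Unique continuation. The mean of a solution over a circle against
   [v . (cos t, sin t)] is a universal multiple of its derivative along [v]. So
   directional derivatives satisfy the same formula, and the bounds
   [|d_v^m u| <= C A^m m!] follow: solutions are real analytic along lines. Hence
   the identity [|u_1| = |u_2|] spreads from [Omega] to the whole domain above
   both surfaces, and solutions vanishing on an open set vanish.

   Removing the phase. Outside a large disc the domain is a half plane and the
   total fields vanish on the axis, so the sine modes in the angle of a scattered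
   field [v] obey [f'' = (n^2 - k^2 e^(2s)) f] in [s = ln r]. With Sommerfeld's
   condition, the constancy of the Wronskian of the real and imaginary modes, and
   the inequalities of Bessel and Parseval, [r] times the integral of [|v|^2] over
   the half circle of radius [r] is bounded. Subtracting
   [|u_1|^2 = |u_2|^2] cancels the term [|u^i + u^r|^2]; what remains says that
   [w = u_1 - u_2] satisfies [sin (k r d_2 sin t) Im (e^(- i k r d_1 cos t) w) =
   (|u_2^s|^2 - |u_1^s|^2) / 4]. As [e^(- i k r) w] varies slowly in [r],
   comparing four nearby radii recovers both its components. Every mode of [w] is
   therefore [o (r^(-1/2))], and an energy argument for the mode equation yields
   [w = 0].

   The surfaces. If they differ, say [h_2 < h_1] somewhere, then on the bounded
   set between them all the fields [u_2 (., d_n)] solve the Helmholtz equation with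
   zero boundary values. By a Poincare inequality on small squares, a solution
   whose means over finitely many squares vanish is zero; so some nontrivial
   real combination of finitely many [u_2 (., d_n)] vanishes there, hence
   everywhere above [Gamma_2]. Then the same combination of the waves [u^i + u^r]
   satisfies Sommerfeld's condition, which independence of exponentials with
   distinct frequencies along a generic ray excludes. *)

Require Import Defs.
From HB Require Import structures.
From mathcomp Require Import all_boot all_order all_algebra.
From mathcomp Require Import all_classical all_reals all_analysis.
From mathcomp Require Import complex.
From mathcomp Require Import ring lra zify.

Set Implicit Arguments.
Unset Strict Implicit.
Unset Printing Implicit Defensive.

Import Order.TTheory GRing.Theory Num.Theory.
Import numFieldNormedType.Exports.

Local Open Scope classical_set_scope.
Local Open Scope ring_scope.

(** Two difficulties shape the proof. One is regularity: a field is merely continuous up to the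
    surface, so its normal derivative must not appear there. The mode equations are therefore
    obtained as limits from the interior, and between the surfaces the energy identity is tested
    with a [C^1] truncation that vanishes wherever the solution is small, so that the shape of that
    set, cusps included, is irrelevant. The other is information: Sommerfeld's condition controls
    [u_r - i k u] and not [u], while the modulus gives one real equation for the two components of
    [w], multiplied by a sine with zeros at arbitrarily large radii. The size of a field has to be
    extracted from its modes, where the conserved Wronskian ties it to the radiation defect. The
    radii compared differ by multiples of [1 / (2 k)]: the phases then turn by angles of modulus at
    most [1], for which elementary lower bounds of the sine hold. Compactness of the embedding of
    [H^1_0] is replaced by counting: there are more directions than linear conditions on the means
    over squares. Hankel functions and far field patterns do not occur. *)

Lemma continuous_epsP (R : realType) (V : normedModType R) (f : V -> R) (x : V) :
  {for x, continuous f} <->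
  forall e : R, 0 < e ->
    exists2 d : R, 0 < d & forall y, `|y - x| < d -> `|f y - f x| < e.
Proof.
split=> [cf e e0|H].
  move/cvgrPdist_lt : cf => /(_ e e0) /nbhs_ballP[d /= d0 Hd].
  exists d => // y yx; rewrite distrC; apply: Hd.
  by rewrite -ball_normE /= distrC.
apply/cvgrPdist_lt => e e0; have [d d0 Hd] := H e e0.
apply/nbhs_ballP; exists d => //= y; rewrite -ball_normE /= => yx.
by rewrite distrC; apply: Hd; rewrite distrC.
Qed.

(** No quotient appears, so [h = 0] is allowed; differentiation under an integral and the chain rule
    in the plane are proved in this form. *)
Lemma is_derive_epsP (R : realType) (f : R -> R) (x l : R) :
  is_derive x 1 f l <->
  forall e : R, 0 < e -> exists2 d : R, 0 < d &
    forall h : R, `|h| < d -> `|f (x + h) - f x - l * h| <= e * `|h|.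
Proof.
split=> [df e e0|H].
  have dx : derivable f x 1 by apply: ex_derive.
  have vx : 'D_1 f x = l by apply: derive_val.
  have : h^-1 *: ((f \o shift x) h%:A - f x) @[h --> 0^'] --> l.
    rewrite -vx; exact: dx.
  move=> /cvgrPdist_le /(_ e e0) /nbhs_ballP[d /= d0 Hd]; exists d => // h hd.
  have [->|h0] := eqVneq h 0; first by rewrite addr0 mulr0 subr0 subrr normr0 mulr0.
  have := Hd h; rewrite -ball_normE /= sub0r normrN => /(_ hd h0).
  rewrite [h *: 1]mulr1 /= (addrC h x) => Hh.
  have -> : f (x + h) - f x - l * h = - (l - h^-1 *: (f (x + h) - f x)) * h.
    rewrite mulNr mulrBl opprB; congr (_ - _).
    by rewrite [_ *: _]mulrC mulrVK ?unitfE.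
  by rewrite normrM normrN ler_wpM2r.
have C : h^-1 *: ((f \o shift x) h%:A - f x) @[h --> 0^'] --> l.
  apply/cvgrPdist_le => e e0; have [d d0 Hd] := H e e0.
  apply/nbhs_ballP; exists d => //= h; rewrite -ball_normE /= sub0r normrN => hd h0.
  rewrite [h *: 1]mulr1 /= (addrC h x).
  have -> : l - h^-1 *: (f (x + h) - f x) = - (f (x + h) - f x - l * h) / h.
    by rewrite mulNr mulrBl mulfK// opprB [_ *: _]mulrC.
  by rewrite normrM normrN normfV ler_pdivrMr ?normr_gt0//; apply: Hd.
split; first by apply/cvg_ex; exists l.
by apply/cvg_lim.
Qed.

Lemma is_derive_continuous (R : realType) (f : R -> R) (x l : R) :
  is_derive x 1 f l -> {for x, continuous f}.
Proof.
move=> df; apply: differentiable_continuous; apply/derivable1_diffP.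
by apply: ex_derive.
Qed.

Lemma is_derive_near_eq (R : realType) (f g : R -> R) (x l e : R) : 0 < e ->
  (forall y, `|y - x| < e -> f y = g y) -> is_derive x 1 f l -> is_derive x 1 g l.
Proof.
move=> e0 fg /is_derive_epsP H; apply/is_derive_epsP => e1 e10.
have [d d0 Hd] := H e1 e10; exists (Num.min d e); first by rewrite lt_min d0.
move=> h; rewrite lt_min => /andP[hd he]; rewrite -!fg; first exact: Hd.
  by rewrite subrr normr0.
by rewrite addrC addKr.
Qed.

Lemma is_derive_congr (R : realType) (f g : R -> R) (x l m : R) :
  is_derive x 1 f l -> (forall y, f y = g y) -> l = m -> is_derive x 1 g m.
Proof. by move=> H /funext <- <-. Qed.

Lemma is_derive_compR (R : realType) (f g : R -> R) (x df dg : R) :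
  is_derive x 1 f df -> is_derive (f x) 1 g dg ->
  is_derive x 1 (fun t => g (f t)) (dg * df).
Proof.
move=> Hf Hg; have H := @is_derive1_comp R g f x dg df Hg Hf.
by apply: is_derive_congr H _ _.
Qed.

(** * One-variable calculus *)

(** Two-sided continuity also at the end points: stronger than continuity on the segment, but closed
    under the pointwise rules and compatible with [is_derive] at [a] and [b]. The integrands met
    below extend past the interval. *)
Definition ctsI (R : realType) (a b : R) (f : R -> R) :=
  forall x, a <= x <= b -> {for x, continuous f}.

Definition itg (R : realType) (a b : R) (f : R -> R) : R :=
  (\int[@lebesgue_measure R]_(x in `[a, b]) f x)%R.

Section integral.
Variable R : realType.
Implicit Types (a b : R) (f g F : R -> R).

Lemma ctsI_within a b f : ctsI a b f -> {within `[a, b], continuous f}.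
Proof.
move=> cf; apply: continuous_in_subspaceT => x.
by rewrite inE /= in_itv /=; apply: cf.
Qed.

Lemma ctsI_integrable a b f : ctsI a b f ->
  (@lebesgue_measure R).-integrable `[a, b] (EFin \o f).
Proof.
move=> cf; apply: continuous_compact_integrable; first exact: segment_compact.
exact: ctsI_within.
Qed.

Lemma ctsID a b f g : ctsI a b f -> ctsI a b g -> ctsI a b (fun x => f x + g x).
Proof. by move=> cf cg x xab; apply: cvgD; [exact: cf|exact: cg]. Qed.

Lemma ctsIB a b f g : ctsI a b f -> ctsI a b g -> ctsI a b (fun x => f x - g x).
Proof. by move=> cf cg x xab; apply: cvgB; [exact: cf|exact: cg]. Qed.

Lemma ctsIM a b f g : ctsI a b f -> ctsI a b g -> ctsI a b (fun x => f x * g x).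
Proof. by move=> cf cg x xab; apply: cvgM; [exact: cf|exact: cg]. Qed.

Lemma ctsI_cst a b (c : R) : ctsI a b (fun=> c).
Proof. by move=> x _; exact: cvg_cst. Qed.

Lemma ctsIZ a b (c : R) f : ctsI a b f -> ctsI a b (fun x => c * f x).
Proof. by move=> cf; apply: ctsIM => //; exact: ctsI_cst. Qed.

Lemma ctsIN a b f : ctsI a b f -> ctsI a b (fun x => - f x).
Proof. by move=> cf x xab; apply: cvgN; exact: cf. Qed.

Lemma ctsIX a b f n : ctsI a b f -> ctsI a b (fun x => f x ^+ n).
Proof.
move=> cf; elim: n => [|n IH]; first by move=> x _; apply: cvg_cst.
have := ctsIM cf IH; congr ctsI; apply/funext => x; by rewrite exprS.
Qed.

Lemma ctsI_sub a b (c d : R) f : a <= c -> d <= b -> ctsI a b f -> ctsI c d f.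
Proof.
move=> ac db cf x /andP[cx xd]; apply: cf.
by rewrite (le_trans ac cx) (le_trans xd db).
Qed.

Lemma ctsI_abs a b f : ctsI a b f -> ctsI a b (fun x => `|f x|).
Proof. by move=> cf x xab; apply: cvg_norm; exact: cf. Qed.

Lemma ctsI_sum a b n (f : nat -> R -> R) : (forall i, ctsI a b (f i)) ->
  ctsI a b (fun x => \sum_(i < n) f i x).
Proof.
move=> cf; elim: n => [|n IH].
  rewrite (_ : (fun x => _) = fun=> 0); first exact: ctsI_cst.
  by apply/funext => x; rewrite big_ord0.
rewrite (_ : (fun x => _) = fun x => \sum_(i < n) f i x + f n x).
  by apply: ctsID => //; exact: cf.
by apply/funext => x; rewrite big_ord_recr.
Qed.

Lemma eq_itg a b f g : (forall x, a <= x <= b -> f x = g x) ->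
  itg a b f = itg a b g.
Proof.
by move=> fg; apply: eq_Rintegral => x; rewrite inE /= in_itv /=; exact: fg.
Qed.

Lemma itgD a b f g : ctsI a b f -> ctsI a b g ->
  itg a b (fun x => f x + g x) = itg a b f + itg a b g.
Proof. by move=> cf cg; apply: RintegralD => //; exact: ctsI_integrable. Qed.

Lemma itgB a b f g : ctsI a b f -> ctsI a b g ->
  itg a b (fun x => f x - g x) = itg a b f - itg a b g.
Proof. by move=> cf cg; apply: RintegralB => //; exact: ctsI_integrable. Qed.

Lemma itgZ a b (c : R) f : ctsI a b f ->
  itg a b (fun x => c * f x) = c * itg a b f.
Proof. by move=> cf; apply: RintegralZl => //; exact: ctsI_integrable. Qed.

Lemma le_itg a b f g : ctsI a b f -> ctsI a b g ->
  (forall x, a <= x <= b -> f x <= g x) -> itg a b f <= itg a b g.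
Proof.
move=> cf cg fg; apply: le_Rintegral; [done|exact: ctsI_integrable|exact: ctsI_integrable|].
by move=> x /=; rewrite in_itv /=; exact: fg.
Qed.

Lemma itg_cst a b (c : R) : a <= b -> itg a b (fun=> c) = c * (b - a).
Proof.
move=> ab; rewrite /itg Rintegral_cst//= lebesgue_measure_itv /= lte_fin.
by case: ltgtP ab => //= ->; rewrite subrr.
Qed.

Lemma itg0 a b : itg a b (fun=> 0) = 0.
Proof.
have := @itgZ a b 0 (fun=> 0) (@ctsI_cst a b 0).
by under eq_itg do rewrite mul0r; rewrite mul0r.
Qed.

Lemma itg_ge0 a b f : (forall x, a <= x <= b -> 0 <= f x) -> 0 <= itg a b f.
Proof. by move=> f0; apply: Rintegral_ge0 => x /=; rewrite in_itv /=; exact: f0. Qed.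

Lemma itg_abs_le a b f : ctsI a b f -> `|itg a b f| <= itg a b (fun x => `|f x|).
Proof. by move=> cf; apply: le_normr_Rintegral => //; exact: ctsI_integrable. Qed.

Lemma itg_bound a b f (M : R) : a <= b -> ctsI a b f ->
  (forall x, a <= x <= b -> `|f x| <= M) -> `|itg a b f| <= M * (b - a).
Proof.
move=> ab cf fM; apply: le_trans (itg_abs_le cf) _; rewrite -itg_cst//.
by apply: le_itg => //; [exact: ctsI_abs|exact: ctsI_cst].
Qed.

Lemma itg_sum a b n (f : nat -> R -> R) : (forall i, ctsI a b (f i)) ->
  itg a b (fun x => \sum_(i < n) f i x) = \sum_(i < n) itg a b (f i).
Proof.
move=> cf; elim: n => [|n IH].
  by rewrite big_ord0 -[RHS](itg0 a b); apply: eq_itg => x _; rewrite big_ord0.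
rewrite big_ord_recr /= -IH -itgD//; last exact: ctsI_sum.
by apply: eq_itg => x _; rewrite big_ord_recr.
Qed.

Lemma itg_FTC2 a b f F : a <= b -> ctsI a b f ->
  (forall x, a <= x <= b -> is_derive x 1 F (f x)) -> itg a b f = F b - F a.
Proof.
rewrite le_eqVlt => /predU1P[->|ab] cf dF.
  by rewrite subrr /itg set_itv1 Rintegral_set1.
rewrite /itg /Rintegral (@continuous_FTC2 _ f F) => //; last 2 first.
- have cF x : a <= x <= b -> {for x, continuous F}.
    by move=> xab; exact: is_derive_continuous (dF x xab).
  split.
  + move=> x; rewrite in_itv /= => /andP[ax xb].
    by apply: ex_derive; apply: dF; rewrite !ltW.
  + by apply: cvg_at_right_filter; apply: cF; rewrite lexx ltW.
  + by apply: cvg_at_left_filter; apply: cF; rewrite lexx ltW.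
- move=> x; rewrite in_itv /= => /andP[ax xb]; rewrite derive1E.
  by have H := dF x; rewrite (@derive_val _ _ _ _ _ _ _ (H _))// !ltW.
exact: ctsI_within.
Qed.

Lemma itg_cat a c b f : a <= c -> c <= b -> ctsI a b f ->
  itg a b f = itg a c f + itg c b f.
Proof.
move=> ac cb cf; have ab := le_trans ac cb.
have := @Rintegral_itvB R f (BLeft a) (BRight b) c (ctsI_integrable cf).
rewrite !bnd_simp => /(_ ac cb) H.
rewrite /itg -(@Rintegral_itv_obnd_cbnd _ c) -?H; first by rewrite addrC subrK.
apply: integrableS (ctsI_integrable cf) => //.
by move=> x /=; rewrite !in_itv /= => /andP[cx ->]; rewrite (le_trans ac (ltW cx)).
Qed.

Lemma itg_FTC1 a b f x : ctsI a b f -> a < x < b ->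
  is_derive x 1 (fun t => itg a t f) (f x).
Proof.
move=> cf /andP[ax xb].
have cx : {for x, continuous f} by apply: cf; rewrite !ltW.
have [dF F'] := continuous_FTC1_closed xb (ctsI_integrable cf) ax cx.
by split; [exact: dF|rewrite -derive1E; exact: F'].
Qed.

End integral.

Section calculus.
Variable R : realType.

Lemma mvt_ball (f df : R -> R) (x y : R) :
  (forall z, `|z - x| <= `|y - x| -> is_derive z 1 f (df z)) ->
  exists2 c, `|c - x| <= `|y - x| & f y - f x = df c * (y - x).
Proof.
move=> H; have [xy|yx] := leP x y.
  have dz z : x <= z <= y -> is_derive z 1 f (df z).
    move=> /andP[xz zy]; apply: H.
    by rewrite !ger0_norm ?subr_ge0 ?(le_trans xz)// lerD2r.
  have [||c cxy E] := @MVT_segment R f df x y xy.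
  - by move=> z; rewrite in_itv /= => /andP[xz zy]; apply: dz; rewrite !ltW.
  - apply: ctsI_within => z xzy; apply: is_derive_continuous; exact: dz.
  move: cxy; rewrite in_itv /= => /andP[xc cy]; exists c => //.
  by rewrite !ger0_norm ?subr_ge0 ?(le_trans xc)// lerD2r.
have dz z : y <= z <= x -> is_derive z 1 f (df z).
  move=> /andP[xz zy]; apply: H.
  by rewrite !ler0_norm ?subr_le0// ?(ltW yx)// lerN2 lerD2r.
have [||c cxy E] := @MVT_segment R f df y x (ltW yx).
- by move=> z; rewrite in_itv /= => /andP[xz zy]; apply: dz; rewrite !ltW.
- apply: ctsI_within => z xzy; apply: is_derive_continuous; exact: dz.
move: cxy; rewrite in_itv /= => /andP[xc cy]; exists c.
  by rewrite !ler0_norm ?subr_le0// ?(ltW yx)// lerN2 lerD2r.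
by rewrite -opprB E -mulrN opprB.
Qed.

Lemma mvt_itv (f df : R -> R) (a b x y : R) :
  (forall z, a <= z <= b -> is_derive z 1 f (df z)) ->
  a <= x <= b -> a <= y <= b ->
  exists2 c, a <= c <= b & f y - f x = df c * (y - x).
Proof.
move=> H; wlog xy : x y / x <= y => [W|] xab yab.
  have [xy|/ltW yx] := leP x y; first exact: W.
  have [c cab E] := W y x yx yab xab; exists c => //.
  by rewrite -opprB E -mulrN opprB.
have dz z : x <= z <= y -> is_derive z 1 f (df z).
  move=> /andP[xz zy]; apply: H.
  by case/andP: xab => ax _; case/andP: yab => _ yb; rewrite (le_trans ax) ?(le_trans zy).
have [||c cxy E] := @MVT_segment R f df x y xy.
- by move=> z; rewrite in_itv /= => /andP[xz zy]; apply: dz; rewrite !ltW.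
- apply: ctsI_within => z xzy; apply: is_derive_continuous; exact: dz.
move: cxy; rewrite in_itv /= => /andP[xc cy]; exists c => //.
by case/andP: xab => ax _; case/andP: yab => _ yb; rewrite (le_trans ax) ?(le_trans cy).
Qed.

Lemma mvt_le (f df : R -> R) (a b x y M : R) :
  (forall z, a <= z <= b -> is_derive z 1 f (df z)) ->
  (forall z, a <= z <= b -> `|df z| <= M) ->
  a <= x <= b -> a <= y <= b -> `|f y - f x| <= M * `|y - x|.
Proof.
move=> H HM xab yab; have [c cab ->] := mvt_itv H xab yab.
by rewrite normrM ler_wpM2r// HM.
Qed.

Lemma der0_cst (f : R -> R) (a b : R) :
  (forall z, a <= z <= b -> is_derive z 1 f 0) ->
  forall x y, a <= x <= b -> a <= y <= b -> f x = f y.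
Proof.
move=> H x y xab yab; apply/eqP; rewrite -subr_eq0 -normr_le0.
rewrite -[leRHS](mul0r `|x - y|); apply: mvt_le H _ yab xab => z _.
by rewrite normr0.
Qed.

(** Only [x] is confined to [K]; [y] may leave it. This is what allows comparison with shifted
    circles and perturbed parameters. *)
Lemma heine (V : normedModType R) (K : set V) (g : V -> R) :
  compact K -> (forall x, K x -> {for x, continuous g}) ->
  forall e : R, 0 < e -> exists2 d : R, 0 < d &
    forall x y, K x -> `|y - x| < d -> `|g y - g x| < e.
Proof.
move=> /compact_near_coveringP cK cg e e0.
have := cK R (0^'+)%R (fun d x => forall y, `|y - x| < d -> `|g y - g x| < e) _.
case=> [x Kx|d0 /= d00 Hd].
  have /continuous_epsP/(_ (e / 2)) := cg x Kx.
  rewrite divr_gt0// => /(_ isT)[d d0 Hd].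
  exists (ball x (d / 2), [set t | t < d / 2]) => /=.
    split; first by apply: nbhsx_ballx; rewrite divr_gt0.
    by apply: nbhs_right_lt; rewrite divr_gt0.
  move=> [z t] /= [+ td] y yz; rewrite -ball_normE /= => xz.
  have zx : `|z - x| < d by rewrite distrC (lt_trans xz)// ltr_pdivrMr// ltr_pMr// ltr1n.
  have yx : `|y - x| < d.
    rewrite (_ : y - x = (y - z) + (z - x)); last by rewrite addrA subrK.
    rewrite (le_lt_trans (ler_normD _ _))// (splitr d) ltrD//.
      exact: lt_trans yz td.
    by rewrite distrC.
  rewrite (_ : g y - g z = (g y - g x) - (g z - g x)); last by rewrite opprB addrA subrK.
  by rewrite (le_lt_trans (ler_normB _ _))// (splitr e) ltrD// Hd.
exists (d0 / 2); first by rewrite divr_gt0.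
move=> x y Kx; apply: (Hd (d0 / 2)) => //=; last by rewrite divr_gt0.
by rewrite sub0r normrN gtr0_norm ?divr_gt0// ltr_pdivrMr// ltr_pMr// ltr1n.
Qed.

Lemma prod_norm_lt (V W : normedModType R) (z : V * W) (d : R) :
  (`|z| < d) = (`|z.1| < d) && (`|z.2| < d).
Proof. by rewrite prod_normE gt_max. Qed.

Lemma heine_itv (V : normedModType R) (f : V -> R -> R) (x0 : V) (a b : R) :
  (forall t, a <= t <= b -> {for (x0, t), continuous (fun z => f z.1 z.2)}) ->
  forall e : R, 0 < e -> exists2 d : R, 0 < d &
    forall x t, `|x - x0| < d -> a <= t <= b -> `|f x t - f x0 t| <= e.
Proof.
move=> cf e e0.
have cK : compact ([set x0] `*` `[a, b]%classic).
  by apply: compact_setX; [exact: compact_set1|exact: segment_compact].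
have [|d d0 Hd] := heine (g := fun z : V * R => f z.1 z.2) cK _ e0.
  by move=> [x t] [/= ->]; rewrite in_itv /=; exact: cf.
exists d => // x t xd tab.
have := Hd (x0, t) (x, t); rewrite /= in_itv /= => H.
by apply/ltW/H => //; rewrite prod_norm_lt /= subrr normr0 d0 andbT.
Qed.

Lemma ctsI_param (V : normedModType R) (f : V -> R -> R) (x0 : V) (a b : R) :
  (forall t, a <= t <= b -> {for (x0, t), continuous (fun z => f z.1 z.2)}) ->
  ctsI a b (f x0).
Proof.
move=> cf t tab.
apply/continuous_epsP => e e0.
move/continuous_epsP : (cf t tab) => /(_ e e0)[d d0 Hd]; exists d => // y yt.
by apply: (Hd (x0, y)); rewrite prod_norm_lt /= subrr normr0 d0.
Qed.

Lemma continuous_itg (V : normedModType R) (f : V -> R -> R) (x0 : V) (a b e0 : R) :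
  a <= b -> 0 < e0 ->
  (forall x t, `|x - x0| < e0 -> a <= t <= b ->
    {for (x, t), continuous (fun z => f z.1 z.2)}) ->
  {for x0, continuous (fun x => itg a b (f x))}.
Proof.
move=> ab e00 cf; apply/continuous_epsP => e ep.
have cx x : `|x - x0| < e0 -> ctsI a b (f x).
  by move=> xe; apply: ctsI_param => t tab; exact: cf.
have x0x0 : `|x0 - x0| < e0 by rewrite subrr normr0.
(* The [1] covers the case [a = b]. *)
have ba : 0 < b - a + 1 by rewrite ltr_wpDl// subr_ge0.
have eba : 0 < e / (b - a + 1) by rewrite divr_gt0.
have [|d d0 Hd] := heine_itv (f := f) (x0 := x0) (a := a) (b := b) _ eba.
  by move=> t tab; exact: cf.
exists (Num.min d e0); first by rewrite lt_min d0.
move=> y; rewrite lt_min => /andP[yd ye].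
rewrite -itgB; [|exact: cx|exact: cx].
apply: (@le_lt_trans _ _ (e / (b - a + 1) * (b - a))).
  apply: itg_bound => //; last by move=> t tab; exact: Hd.
  by apply: ctsIB; exact: cx.
by rewrite mulrAC ltr_pdivrMr// ltr_pM2l// ltrDl.
Qed.

(** For each [x] the mean value theorem turns the increment into a value of [f'] at an intermediate
    time; [heine_itv] makes its distance to [f' t0 x] small uniformly in [x]. *)
Lemma is_derive_itg (f f' : R -> R -> R) (t0 a b e0 : R) : a <= b -> 0 < e0 ->
  (forall t x, `|t - t0| < e0 -> a <= x <= b ->
    is_derive t 1 (f ^~ x) (f' t x)) ->
  (forall t x, `|t - t0| < e0 -> a <= x <= b ->
    {for (t, x), continuous (fun z => f z.1 z.2)}) ->
  (forall x, a <= x <= b -> {for (t0, x), continuous (fun z => f' z.1 z.2)}) ->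
  is_derive t0 1 (fun t => itg a b (f t)) (itg a b (f' t0)).
Proof.
move=> ab e00 df cf cf'; apply/is_derive_epsP => e ep.
have cx x : `|x - t0| < e0 -> ctsI a b (f x).
  by move=> xe; apply: ctsI_param => t tab; exact: cf.
have t0t0 : `|t0 - t0| < e0 by rewrite subrr normr0.
have ba : 0 < b - a + 1 by rewrite ltr_wpDl// subr_ge0.
have eba : 0 < e / (b - a + 1) by rewrite divr_gt0.
have [d d0 Hd] := heine_itv cf' eba.
exists (Num.min d e0); first by rewrite lt_min d0.
move=> h; rewrite lt_min => /andP[hd he].
have the : `|t0 + h - t0| < e0 by rewrite addrC addKr.
rewrite -itgB; [|exact: cx|exact: cx].
rewrite [itg _ _ _ * _]mulrC -itgZ; last exact: ctsI_param.
rewrite -itgB; last 2 first.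
- by apply: ctsIB; exact: cx.
- by apply: ctsIZ; exact: ctsI_param.
apply: (@le_trans _ _ ((e / (b - a + 1) * `|h|) * (b - a))).
  apply: itg_bound => //.
    by apply: ctsIB; [apply: ctsIB; exact: cx|apply: ctsIZ; exact: ctsI_param].
  move=> x xab.
  have [|c ch E] := @mvt_ball (f ^~ x) (f' ^~ x) t0 (t0 + h).
    by move=> z zh; apply: df => //; rewrite (le_lt_trans zh).
  rewrite E addrAC subrr add0r mulrC -mulrBr normrM mulrC ler_wpM2r//.
  by apply: Hd => //; rewrite (le_lt_trans ch)// addrAC subrr add0r.
rewrite mulrAC ler_wpM2r// -mulrA ler_piMr ?(ltW ep)// mulrC.
by rewrite ler_pdivrMr// mul1r lerDl.
Qed.

(** The increment of [u] is split along a path parallel to the axes and the mean value theorem is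
    applied to each edge; continuity of [p] and [q] at [z] alone then gives total differentiability
    there. *)
Lemma chain2 (u p q : R * R -> R) (z : R * R) (e0 : R) (x y : R -> R) (t dx dy : R) :
  0 < e0 ->
  (forall w, `|w - z| < e0 -> is_derive w.1 1 (fun s => u (s, w.2)) (p w)) ->
  (forall w, `|w - z| < e0 -> is_derive w.2 1 (fun s => u (w.1, s)) (q w)) ->
  {for z, continuous p} -> {for z, continuous q} ->
  is_derive t 1 x dx -> is_derive t 1 y dy -> z = (x t, y t) ->
  is_derive t 1 (fun s => u (x s, y s)) (p z * dx + q z * dy).
Proof.
move=> e00 dp dq /continuous_epsP cp /continuous_epsP cq.
move=> /is_derive_epsP Dx /is_derive_epsP Dy ztE.
have lin e : 0 < e -> exists2 d : R, 0 < d & forall w, `|w - z| < d ->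
    `|u w - u z - p z * (w.1 - z.1) - q z * (w.2 - z.2)|
      <= e * (`|w.1 - z.1| + `|w.2 - z.2|).
  move=> ep; have [d1 d10 H1] := cp e ep; have [d2 d20 H2] := cq e ep.
  exists (Num.min e0 (Num.min d1 d2)); first by rewrite !lt_min e00 d10.
  move=> w; rewrite !lt_min => /and3P[].
  rewrite !prod_norm_lt => /andP[we1 we2] /andP[wd11 wd12] /andP[wd21 wd22].
  have [|c ch E] := @mvt_ball (fun s => u (s, w.2)) (fun s => p (s, w.2)) z.1 w.1.
    move=> s hs; apply: (dp (s, w.2)); rewrite prod_norm_lt /= we2 andbT.
    exact: le_lt_trans we1.
  have [|c' ch' E'] := @mvt_ball (fun s => u (z.1, s)) (fun s => q (z.1, s)) z.2 w.2.
    move=> s hs; apply: (dq (z.1, s)); rewrite prod_norm_lt /= subrr normr0 e00 /=.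
    exact: le_lt_trans we2.
  have -> : u w - u z - p z * (w.1 - z.1) - q z * (w.2 - z.2) =
     (p (c, w.2) - p z) * (w.1 - z.1) + (q (z.1, c') - q z) * (w.2 - z.2).
    rewrite !mulrBl -E -E'; case: (w) (z) => w1 w2 [z1 z2] /=; ring.
  apply: (le_trans (ler_normD _ _)); rewrite [leRHS]mulrDr.
  apply: lerD; rewrite normrM ler_wpM2r//.
    apply/ltW/H1; rewrite prod_norm_lt /= wd12 andbT; exact: le_lt_trans wd11.
  apply/ltW/H2; rewrite prod_norm_lt /= subrr normr0 d20 /=; exact: le_lt_trans wd22.
apply/is_derive_epsP => e ep.
(* [S] collects the coefficients of [e1 * |h|] in the final estimate; the [2] comes from the terms
   in [e1 ^+ 2], absorbed thanks to [e1 <= 1]. *)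
set S := `|dx| + `|dy| + 2 + `|p z| + `|q z|.
have S0 : 0 < S by rewrite /S; have := normr_ge0 dx; have := normr_ge0 dy;
  have := normr_ge0 (p z); have := normr_ge0 (q z); lra.
set e1 := Num.min 1 (e / S).
have e10 : 0 < e1 by rewrite lt_min ltr01 divr_gt0.
have e11 : e1 <= 1 by rewrite ge_min lexx.
have e1S : e1 * S <= e by rewrite -ler_pdivlMr// ge_min lexx orbT.
have [d d0 Hd] := lin e1 e10.
have [d1 d10 H1] := Dx e1 e10; have [d2 d20 H2] := Dy e1 e10.
set L := `|dx| + `|dy| + 1.
have L0 : 0 < L by rewrite /L; have := normr_ge0 dx; have := normr_ge0 dy; lra.
exists (Num.min (d / L) (Num.min d1 d2)); first by rewrite !lt_min divr_gt0//= d10.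
move=> h; rewrite !lt_min => /and3P[hd hd1 hd2].
have {}H1 := H1 h hd1; have {}H2 := H2 h hd2.
have X1 : `|x (t + h) - x t| <= (`|dx| + e1) * `|h|.
  rewrite (_ : x (t + h) - x t = (x (t + h) - x t - dx * h) + dx * h); last by rewrite subrK.
  by rewrite (le_trans (ler_normD _ _))// mulrDl addrC lerD// normrM.
have Y1 : `|y (t + h) - y t| <= (`|dy| + e1) * `|h|.
  rewrite (_ : y (t + h) - y t = (y (t + h) - y t - dy * h) + dy * h); last by rewrite subrK.
  by rewrite (le_trans (ler_normD _ _))// mulrDl addrC lerD// normrM.
move: hd; rewrite ltr_pdivlMr// => hd.
have z1 : z.1 = x t by rewrite ztE.
have z2 : z.2 = y t by rewrite ztE.
have Hw : `|(x (t + h), y (t + h)) - z| < d.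
  have dx0 := normr_ge0 dx; have dy0 := normr_ge0 dy; have h0 := normr_ge0 h.
  rewrite prod_norm_lt /= z1 z2.
  apply/andP; split; [apply: le_lt_trans X1 _|apply: le_lt_trans Y1 _];
    by apply: le_lt_trans hd; rewrite mulrC ler_wpM2l// /L; lra.
have := Hd _ Hw; rewrite z1 z2 /= => H3.
set A := u _ - u z - _ - _ in H3.
have -> : u (x (t + h), y (t + h)) - u (x t, y t) - (p z * dx + q z * dy) * h =
  A + p z * (x (t + h) - x t - dx * h) + q z * (y (t + h) - y t - dy * h).
  by rewrite /A ztE; ring.
have h0 := normr_ge0 h.
apply: (@le_trans _ _ (e1 * ((`|dx| + e1) * `|h| + (`|dy| + e1) * `|h|)
   + `|p z| * (e1 * `|h|) + `|q z| * (e1 * `|h|))).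
  rewrite (le_trans (ler_normD _ _))// lerD//.
    rewrite (le_trans (ler_normD _ _))// lerD//.
      by apply: le_trans H3 _; apply: ler_wpM2l; [exact: ltW|exact: lerD].
    by rewrite normrM ler_wpM2l.
  by rewrite normrM ler_wpM2l.
apply: (@le_trans _ _ (e1 * S * `|h|)); last by rewrite ler_wpM2r.
rewrite /S; have := mulr_ge0 (ltW e10) h0; set k := e1 * `|h| => k0.
have : e1 * k <= 1 * k by rewrite ler_wpM2r.
rewrite (_ : _ + `|q z| * _ = (`|dx| + `|dy| + `|p z| + `|q z|) * k + 2 * (e1 * k)); last by rewrite /k; ring.
rewrite (_ : e1 * _ * `|h| = (`|dx| + `|dy| + `|p z| + `|q z|) * k + 2 * k); last by rewrite /k; ring.
lra.
Qed.

End calculus.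

Section combinators.
Variables (R : realType) (V : normedModType R).
Implicit Types (f g : V -> R) (x : V).

Lemma ct_cst x (c : R) : {for x, continuous (fun _ : V => c)}.
Proof. exact: cvg_cst. Qed.
Lemma ctD f g x : {for x, continuous f} -> {for x, continuous g} ->
  {for x, continuous (fun z => f z + g z)}.
Proof. by move=> cf cg; apply: cvgD. Qed.
Lemma ctB f g x : {for x, continuous f} -> {for x, continuous g} ->
  {for x, continuous (fun z => f z - g z)}.
Proof. by move=> cf cg; apply: cvgB. Qed.
Lemma ctM f g x : {for x, continuous f} -> {for x, continuous g} ->
  {for x, continuous (fun z => f z * g z)}.
Proof. by move=> cf cg; apply: cvgM. Qed.
Lemma ctN f x : {for x, continuous f} -> {for x, continuous (fun z => - f z)}.
Proof. by move=> cf; apply: cvgN. Qed.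
Lemma ctX f x n : {for x, continuous f} -> {for x, continuous (fun z => f z ^+ n)}.
Proof.
move=> cf; elim: n => [|n IH]; first exact: ct_cst.
rewrite (_ : (fun z => _) = fun z => f z * f z ^+ n); first exact: ctM.
by apply/funext => z; rewrite exprS.
Qed.
Lemma ct_abs f x : {for x, continuous f} -> {for x, continuous (fun z => `|f z|)}.
Proof. by move=> cf; apply: cvg_norm. Qed.
Lemma ct_inv f x : f x != 0 -> {for x, continuous f} ->
  {for x, continuous (fun z => (f z)^-1)}.
Proof. by move=> f0 cf; apply: cvgV. Qed.
Lemma ct_comp (h : R -> R) f x : {for f x, continuous h} -> {for x, continuous f} ->
  {for x, continuous (fun z => h (f z))}.
Proof. by move=> ch cf; exact: (@continuous_comp _ _ _ f h x cf ch). Qed.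
Lemma ct_cos f x : {for x, continuous f} -> {for x, continuous (fun z => cos (f z))}.
Proof. by apply: ct_comp; exact: continuous_cos. Qed.
Lemma ct_sin f x : {for x, continuous f} -> {for x, continuous (fun z => sin (f z))}.
Proof. by apply: ct_comp; exact: continuous_sin. Qed.
Lemma ct_exp f x : {for x, continuous f} -> {for x, continuous (fun z => expR (f z))}.
Proof. by apply: ct_comp; exact: continuous_expR. Qed.
Lemma ct_comp2 (h : R * R -> R) f g x : {for (f x, g x), continuous h} ->
  {for x, continuous f} -> {for x, continuous g} ->
  {for x, continuous (fun z => h (f z, g z))}.
Proof.
move=> ch cf cg; move/continuous_epsP : ch => ch; move/continuous_epsP : cf => cf.
move/continuous_epsP : cg => cg; apply/continuous_epsP => e e0.
have [d d0 Hd] := ch e e0; have [d1 d10 H1] := cf d d0; have [d2 d20 H2] := cg d d0.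
exists (Num.min d1 d2); first by rewrite lt_min d10.
move=> y; rewrite lt_min => /andP[y1 y2]; apply: Hd.
by rewrite prod_norm_lt /= H1 ?H2.
Qed.
Lemma ct_near f g x (e : R) : 0 < e -> (forall y, `|y - x| < e -> f y = g y) ->
  {for x, continuous f} -> {for x, continuous g}.
Proof.
move=> e0 fg /continuous_epsP cf; apply/continuous_epsP => e1 e10.
have [d d0 Hd] := cf e1 e10; exists (Num.min d e); first by rewrite lt_min d0.
move=> y; rewrite lt_min => /andP[yd ye]; rewrite -!fg ?subrr ?normr0//.
exact: Hd.
Qed.

End combinators.

Lemma ct_id (R : realType) (x : R) : {for x, continuous (fun z : R => z)}.
Proof. exact: cvg_id. Qed.

Lemma ct_mull (R : realType) (c x : R) : {for x, continuous ( *%R c)}.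
Proof.
change {for x, continuous (fun z : R => c * z)}.
by apply: ctM; [exact: ct_cst|exact: ct_id].
Qed.

Lemma ct_addl (R : realType) (c x : R) : {for x, continuous (+%R c)}.
Proof.
change {for x, continuous (fun z : R => c + z)}.
by apply: ctD; [exact: ct_cst|exact: ct_id].
Qed.

Lemma ct_fst (R : realType) (V W : normedModType R) (x : V * W) :
  {for x, continuous (fun z : V * W => z.1)}.
Proof. exact: cvg_fst. Qed.

Lemma ct_snd (R : realType) (V W : normedModType R) (x : V * W) :
  {for x, continuous (fun z : V * W => z.2)}.
Proof. exact: cvg_snd. Qed.

(** Recursion on the body of the function; leaves must be available in the context. The cases
    [*%R c] and [+%R c] catch eta-reduced forms. *)
Ltac ct :=
  lazymatch goal with
  | |- prop_for _ (inPhantom (continuous (fun _ => ?c))) => apply: ct_cst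
  | |- prop_for _ (inPhantom (continuous (fun x => x))) => apply: ct_id
  | |- prop_for _ (inPhantom (continuous fst)) => apply: ct_fst
  | |- prop_for _ (inPhantom (continuous snd)) => apply: ct_snd
  | |- prop_for _ (inPhantom (continuous ( *%R ?c))) => exact: ct_mull
  | |- prop_for _ (inPhantom (continuous (+%R ?c))) => exact: ct_addl
  | |- prop_for _ (inPhantom (continuous cos)) => exact: continuous_cos
  | |- prop_for _ (inPhantom (continuous sin)) => exact: continuous_sin
  | |- prop_for _ (inPhantom (continuous expR)) => exact: continuous_expR
  | |- prop_for _ (inPhantom (continuous (fun x => x.1))) => apply: ct_fst
  | |- prop_for _ (inPhantom (continuous (fun x => x.2))) => apply: ct_snd
  | |- prop_for _ (inPhantom (continuous (fun x => _ + _))) => apply: ctD; ct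
  | |- prop_for _ (inPhantom (continuous (fun x => - _))) => apply: ctN; ct
  | |- prop_for _ (inPhantom (continuous (fun x => _ * _))) => apply: ctM; ct
  | |- prop_for _ (inPhantom (continuous (fun x => _ ^+ _))) => apply: ctX; ct
  | |- prop_for _ (inPhantom (continuous (fun x => `|_|))) => apply: ct_abs; ct
  | |- prop_for _ (inPhantom (continuous (fun x => cos _))) => apply: ct_cos; ct
  | |- prop_for _ (inPhantom (continuous (fun x => sin _))) => apply: ct_sin; ct
  | |- prop_for _ (inPhantom (continuous (fun x => expR _))) => apply: ct_exp; ct
  | |- _ => try eassumption
  end.

Section derivatives.
Variable R : realType.
Implicit Types (f g : R -> R) (x : R).

Lemma dC x (c : R) : is_derive x 1 (fun=> c) 0.
Proof. exact: is_derive_cst. Qed.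
Lemma dId x : is_derive x 1 (fun t : R => t) 1.
Proof. exact: is_derive_id. Qed.
Lemma dD f g x a b : is_derive x 1 f a -> is_derive x 1 g b ->
  is_derive x 1 (fun t => f t + g t) (a + b).
Proof. by move=> df dg; exact: is_deriveD. Qed.
Lemma dB f g x a b : is_derive x 1 f a -> is_derive x 1 g b ->
  is_derive x 1 (fun t => f t - g t) (a - b).
Proof. by move=> df dg; exact: is_deriveB. Qed.
Lemma dN f x a : is_derive x 1 f a -> is_derive x 1 (fun t => - f t) (- a).
Proof. by move=> df; exact: is_deriveN. Qed.
Lemma dM f g x a b : is_derive x 1 f a -> is_derive x 1 g b ->
  is_derive x 1 (fun t => f t * g t) (a * g x + f x * b).
Proof.
move=> df dg; apply: (is_derive_congr (is_deriveM df dg)) => //.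
by rewrite addrC [g x *: a]mulrC.
Qed.
Lemma dZ f x a (c : R) : is_derive x 1 f a -> is_derive x 1 (fun t => c * f t) (c * a).
Proof.
move=> df; apply: (is_derive_congr (dM (dC x c) df)) => //.
by rewrite mul0r add0r.
Qed.
Lemma dX2 f x a : is_derive x 1 f a -> is_derive x 1 (fun t => f t ^+ 2) (2 * f x * a).
Proof.
move=> df; apply: (is_derive_congr (dM df df)) => [y|]; first by rewrite expr2.
ring.
Qed.
Lemma dcos f x a : is_derive x 1 f a ->
  is_derive x 1 (fun t => cos (f t)) (- sin (f x) * a).
Proof. by move=> df; apply: is_derive_compR => //; exact: is_derive_cos. Qed.
Lemma dsin f x a : is_derive x 1 f a ->
  is_derive x 1 (fun t => sin (f t)) (cos (f x) * a).
Proof. by move=> df; apply: is_derive_compR => //; exact: is_derive_sin. Qed.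
Lemma dexp f x a : is_derive x 1 f a ->
  is_derive x 1 (fun t => expR (f t)) (expR (f x) * a).
Proof. by move=> df; apply: is_derive_compR => //; exact: is_derive_expR. Qed.

End derivatives.

Ltac drv :=
  lazymatch goal with
  | |- is_derive _ _ (fun _ => ?c) _ => notypeclasses refine (dC _ _)
  | |- is_derive _ _ (fun x => x) _ => notypeclasses refine (dId _)
  | |- is_derive _ _ ( *%R ?c) _ => notypeclasses refine (dZ c (dId _))
  | |- is_derive _ _ (+%R ?c) _ => notypeclasses refine (dD (dC _ c) (dId _))
  | |- is_derive _ _ cos _ => notypeclasses refine (is_derive_cos _)
  | |- is_derive _ _ sin _ => notypeclasses refine (is_derive_sin _)
  | |- is_derive _ _ expR _ => notypeclasses refine (is_derive_expR _)
  | |- is_derive _ _ (fun x => _ + _) _ => notypeclasses refine (dD _ _); drv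
  | |- is_derive _ _ (fun x => - _) _ => notypeclasses refine (dN _); drv
  | |- is_derive _ _ (fun x => _ * _) _ => notypeclasses refine (dM _ _); drv
  | |- is_derive _ _ (fun x => _ ^+ 2) _ => notypeclasses refine (dX2 _); drv
  | |- is_derive _ _ (fun x => cos _) _ => notypeclasses refine (dcos _); drv
  | |- is_derive _ _ (fun x => sin _) _ => notypeclasses refine (dsin _); drv
  | |- is_derive _ _ (fun x => expR _) _ => notypeclasses refine (dexp _); drv
  | |- _ => try eassumption
  end.

(** Computes a derivative and leaves its equality with the stated one, usually for [ring] or
    [field]. *)
Ltac drvR := notypeclasses refine (is_derive_congr _ (fun _ => erefl) _); [drv|cbv beta].

Definition C1on (R : realType) (D : set (R * R)) (u p q : R * R -> R) : Prop :=
  forall x, D x -> [/\ {for x, continuous u}, {for x, continuous p},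
    {for x, continuous q}, is_derive x.1 1 (fun t => u (t, x.2)) (p x)
    & is_derive x.2 1 (fun t => u (x.1, t)) (q x)].

(* The partial derivatives are carried along as functions. *)
Definition helm (R : realType) (k : R) (D : set (R * R)) (u : R * R -> R) : Prop :=
  exists p q p1 p2 q1 q2, [/\ C1on D u p q, C1on D p p1 p2, C1on D q q1 q2
    & forall x, D x -> p1 x + q2 x = - k ^+ 2 * u x].

Definition pol (R : realType) (z : R * R) (s t : R) : R * R :=
  (z.1 + expR s * cos t, z.2 + expR s * sin t).

(* In terms of [s = ln r], so that the Helmholtz equation reads
   [u_ss + u_tt = - k^2 e^(2s) u]. *)
Definition polT (R : realType) (u : R * R -> R) (psi : R -> R) (z : R * R)
  (al be s : R) : R := itg al be (fun t => u (pol z s t) * psi t).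

Definition polT1 (R : realType) (p q : R * R -> R) (psi : R -> R) (z : R * R)
    (al be s : R) : R :=
  itg al be (fun t => expR s * (p (pol z s t) * cos t + q (pol z s t) * sin t) * psi t).

(** * Polar coordinates *)

Section polar.
Variable R : realType.

Lemma open_box (D : set (R * R)) (x : R * R) : open D -> D x ->
  exists2 e : R, 0 < e & forall y, `|y - x| < e -> D y.
Proof.
move=> oD Dx; have /nbhs_ballP[e /= e0 He] := oD x Dx; exists e => // y yx.
by apply: He; rewrite -ball_normE /= distrC.
Qed.

Lemma C1on_chain (D : set (R * R)) (u p q : R * R -> R) (x y : R -> R) (t dx dy : R) :
  open D -> C1on D u p q -> is_derive t 1 x dx -> is_derive t 1 y dy ->
  D (x t, y t) ->
  is_derive t 1 (fun s => u (x s, y s)) (p (x t, y t) * dx + q (x t, y t) * dy).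
Proof.
move=> oD Du Dx Dy Dxy; have [e e0 He] := open_box oD Dxy.
have [_ cp cq _ _] := Du _ Dxy.
by apply: (@chain2 R u p q (x t, y t) e) => // w wz; have [] := Du w (He w wz).
Qed.

Lemma ct_pol (u : R * R -> R) (z : R * R) (s t : R) : {for pol z s t, continuous u} ->
  {for (s, t), continuous (fun w : R * R => u (pol z w.1 w.2))}.
Proof. move=> cu; apply: (@ct_comp2 _ _ u (fun w : R * R => z.1 + expR w.1 * cos w.2)
  (fun w : R * R => z.2 + expR w.1 * sin w.2)) => //; by ct. Qed.

Lemma ct_polt (u : R * R -> R) (z : R * R) (s t : R) : {for pol z s t, continuous u} ->
  {for t, continuous (fun t => u (pol z s t))}.
Proof. move=> cu; apply: (@ct_comp2 _ _ u (fun w : R => z.1 + expR s * cos w)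
  (fun w : R => z.2 + expR s * sin w)) => //; by ct. Qed.

Lemma dpolr (z : R * R) (s t : R) : is_derive s 1 (fun s => z.1 + expR s * cos t) (expR s * cos t) /\
  is_derive s 1 (fun s => z.2 + expR s * sin t) (expR s * sin t).
Proof. by split; drvR; ring. Qed.

Lemma dpolt (z : R * R) (s t : R) : is_derive t 1 (fun t => z.1 + expR s * cos t) (- expR s * sin t) /\
  is_derive t 1 (fun t => z.2 + expR s * sin t) (expR s * cos t).
Proof. by split; drvR; ring. Qed.

Variables (D : set (R * R)) (k : R) (u p q p1 p2 q1 q2 : R * R -> R).
Hypotheses (oD : open D) (Du : C1on D u p q) (Dp : C1on D p p1 p2)
  (Dq : C1on D q q1 q2) (Hu : forall x, D x -> p1 x + q2 x = - k ^+ 2 * u x).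
Variables (z : R * R) (al be : R) (psi psi' : R -> R) (nu2 : R).
Hypotheses (albe : al <= be)
  (dpsi : forall t : R, is_derive t 1 psi (psi' t))
  (dpsi' : forall t : R, is_derive t 1 psi' (- nu2 * psi t)).
Variables (s e0 : R).
Hypotheses (e00 : 0 < e0)
  (HD : forall s' t, `|s' - s| < e0 -> al <= t <= be -> D (pol z s' t)).

Lemma psi_ct (t : R) : {for t, continuous psi}.
Proof. exact: is_derive_continuous (dpsi t). Qed.

Lemma polT_derive : is_derive s 1 (polT u psi z al be) (polT1 p q psi z al be s).
Proof.
apply: (@is_derive_itg R (fun s t => u (pol z s t) * psi t)
  (fun s t => expR s * (p (pol z s t) * cos t + q (pol z s t) * sin t) * psi t) s al be e0
  albe e00).
- move=> s' t hs ht.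
  have [d1 d2] := dpolr z s' t; have Hd := HD hs ht.
  have Hu' := C1on_chain oD Du d1 d2 Hd.
  by drvR; rewrite /pol; ring.
- move=> s' t hs ht; have [cu cp cq _ _] := Du (HD hs ht).
  apply: ctM; first exact: ct_pol.
  by apply: ct_comp; [exact: psi_ct|exact: ct_snd].
- move=> t ht; have ss : `|s - s| < e0 by rewrite subrr normr0.
  have [cu cp cq _ _] := Du (HD ss ht).
  apply: ctM; last by apply: ct_comp; [exact: psi_ct|exact: ct_snd].
  have /= cp' := ct_pol cp; have /= cq' := ct_pol cq.
  apply: ctM; first by ct.
  by apply: ctD; apply: ctM => //; ct.
Qed.

(** The angular derivative of [u (pol z s t)]. *)
Definition polUt t := expR s * (q (pol z s t) * cos t - p (pol z s t) * sin t).

(** The equation [U_ss = - U_tt - k^2 e^(2s) U] is inserted under the integral. Two integrations by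
    parts in [t] move [U_tt] onto [psi], where [psi'' = - nu2 psi], and leave the boundary terms. *)
Lemma polT1_derive : is_derive s 1 (polT1 p q psi z al be)
  ((nu2 - k ^+ 2 * expR (2 * s)) * polT u psi z al be s
   + ((u (pol z s be) * psi' be - polUt be * psi be)
      - (u (pol z s al) * psi' al - polUt al * psi al))).
Proof.
(* In [Uss + Utt] the terms in [p2] and in [q1] cancel separately, so symmetry of the mixed
   derivatives is not invoked. *)
pose Uss s t := expR s * (p (pol z s t) * cos t + q (pol z s t) * sin t)
  + expR s * expR s * ((p1 (pol z s t) * cos t + p2 (pol z s t) * sin t) * cos t
               + (q1 (pol z s t) * cos t + q2 (pol z s t) * sin t) * sin t).
pose Utt t := - (expR s * (p (pol z s t) * cos t + q (pol z s t) * sin t))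
  + expR s * expR s * ((p1 (pol z s t) * sin t - p2 (pol z s t) * cos t) * sin t
               + (q2 (pol z s t) * cos t - q1 (pol z s t) * sin t) * cos t).
have H : is_derive s 1 (polT1 p q psi z al be) (itg al be (fun t => Uss s t * psi t)).
  apply: (@is_derive_itg R
   (fun s t => expR s * (p (pol z s t) * cos t + q (pol z s t) * sin t) * psi t)
   (fun s t => Uss s t * psi t) s al be e0 albe e00).
  - move=> s' t hs ht.
    have [d1 d2] := dpolr z s' t; have Hd := HD hs ht.
    have Hp' := C1on_chain oD Dp d1 d2 Hd.
    have Hq' := C1on_chain oD Dq d1 d2 Hd.
    by drvR; rewrite /Uss /pol; ring.
  - move=> s' t hs ht; have [cu cp cq _ _] := Du (HD hs ht).
    apply: ctM; last by apply: ct_comp; [exact: psi_ct|exact: ct_snd].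
    have /= cp' := ct_pol cp; have /= cq' := ct_pol cq.
    apply: ctM; first by ct.
    by apply: ctD; apply: ctM => //; ct.
  - move=> t ht; have ss : `|s - s| < e0 by rewrite subrr normr0.
    have [_ cp cp1 cp2 _] := Dp (HD ss ht); have [cq cq1 cq2 _ _] := Dq (HD ss ht).
    have [_ cp0 _ _ _] := Du (HD ss ht).
    apply: ctM; last by apply: ct_comp; [exact: psi_ct|exact: ct_snd].
    have /= cp' := ct_pol cp0; have /= cq' := ct_pol cq.
    have [_ cp1'' cp2'' _ _] := Dp (HD ss ht).
    have /= cp1' := ct_pol cp1''; have /= cp2' := ct_pol cp2''.
    have /= cq1' := ct_pol cq1; have /= cq2' := ct_pol cq2.
    by rewrite /Uss; ct.
apply: is_derive_eq H _.
have ss : `|s - s| < e0 by rewrite subrr normr0.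
have E (t : R) : al <= t <= be ->
    Uss s t = - Utt t - k ^+ 2 * expR (2 * s) * u (pol z s t).
  move=> ht; have Hd := Hu (HD ss ht).
  have -> : expR (2 * s) = expR s * expR s by rewrite -expRD; congr expR; ring.
  have cs := cos2Dsin2 t.
  have -> : Uss s t = - Utt t + expR s * expR s *
      ((p1 (pol z s t) + q2 (pol z s t)) * (cos t ^+ 2 + sin t ^+ 2)).
    by rewrite /Uss /Utt; ring.
  by rewrite cs Hd; ring.
have dU (t : R) : al <= t <= be ->
    is_derive t 1 (fun t => u (pol z s t)) (polUt t).
  move=> ht; have [d1 d2] := dpolt z s t; have Hd := HD ss ht.
  have Hu' := C1on_chain oD Du d1 d2 Hd.
  by drvR; rewrite /polUt /pol; ring.
have dUt (t : R) : al <= t <= be -> is_derive t 1 polUt (Utt t).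
  move=> ht; have [d1 d2] := dpolt z s t; have Hd := HD ss ht.
  have Hp' := C1on_chain oD Dp d1 d2 Hd.
  have Hq' := C1on_chain oD Dq d1 d2 Hd.
  by rewrite /polUt; drvR; rewrite /Utt /pol; ring.
have cU : ctsI al be (fun t => u (pol z s t)).
  by move=> t ht; have [cu _ _ _ _] := Du (HD ss ht); exact: ct_polt.
have cUss : ctsI al be (Uss s).
  move=> t ht; have [_ cp cp1 cp2 _] := Dp (HD ss ht).
  have [cq cq1 cq2 _ _] := Dq (HD ss ht).
  have [_ cp0 _ _ _] := Du (HD ss ht).
  have := ct_polt cp0; have := ct_polt cq.
  have [_ cp1'' cp2'' _ _] := Dp (HD ss ht).
  have := ct_polt cp1''; have := ct_polt cp2''.
  have := ct_polt cq1; have := ct_polt cq2.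
  by move=> *; rewrite /Uss; ct.
have cpsi : ctsI al be psi by move=> t _; exact: psi_ct.
have cUtt : ctsI al be Utt.
  move=> t ht; have [_ cp cp1 cp2 _] := Dp (HD ss ht).
  have [cq cq1 cq2 _ _] := Dq (HD ss ht).
  have [_ cp0 _ _ _] := Du (HD ss ht).
  have := ct_polt cp0; have := ct_polt cq.
  have [_ cp1'' cp2'' _ _] := Dp (HD ss ht).
  have := ct_polt cp1''; have := ct_polt cp2''.
  have := ct_polt cq1; have := ct_polt cq2.
  by move=> *; rewrite /Utt; ct.
rewrite (@eq_itg _ _ _ _ (fun t => (- Utt t * psi t - nu2 * (u (pol z s t) * psi t))
    + (nu2 - k ^+ 2 * expR (2 * s)) * (u (pol z s t) * psi t))); last first.
  by move=> t ht; rewrite E//; ring.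
rewrite itgD; last 2 first.
- by apply: ctsIB; [apply: ctsIM => //; exact: ctsIN|apply: ctsIZ; exact: ctsIM].
- by apply: ctsIZ; exact: ctsIM.
rewrite itgZ; last exact: ctsIM.
rewrite addrC; congr (_ + _).
(* Lagrange's identity: [U psi' - U_t psi] is an antiderivative of [- U_tt psi - nu2 U psi]. *)
apply: (itg_FTC2 (F := fun t => u (pol z s t) * psi' t - polUt t * psi t)) => //.
- by apply: ctsIB; [apply: ctsIM => //; exact: ctsIN|apply: ctsIZ; exact: ctsIM].
move=> t ht; have d1 := dU t ht; have d2 := dUt t ht.
have d3 := dpsi t; have d4 := dpsi' t.
by drvR; ring.
Qed.

End polar.

(** * Derivatives of a solution as weighted integrals over circles *)

Section disc.
Variable R : realType.

Lemma compact_abs_bound (V : normedModType R) (K : set V) (f : V -> R) :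
  compact K -> (forall x, K x -> {for x, continuous f}) ->
  exists2 B : R, 0 <= B & forall x, K x -> `|f x| <= B.
Proof.
move=> cK cf; have [[x Kx]|/nonemptyPn K0] := pselect (K !=set0); last first.
  by exists 0 => // x; rewrite K0.
have [||c _ Hc] := @compact_EVT_max V R (fun x => `|f x|) K _ cK.
- by exists x.
- apply: continuous_in_subspaceT => y /set_mem Ky; apply: ct_abs; exact: cf.
by exists `|f c| => // y Ky; apply: Hc; exact/mem_set.
Qed.

Lemma compact_box (z : R * R) (r : R) : compact [set y : R * R | `|y - z| <= r].
Proof.
rewrite (_ : mkset _ = `[z.1 - r, z.1 + r]%classic `*` `[z.2 - r, z.2 + r]%classic).
  by apply: compact_setX; exact: segment_compact.
by apply/seteqP; split=> y /=; rewrite prod_normE ge_max /= !in_itv /= !ler_distl => /andP.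
Qed.

Lemma dinv (f : R -> R) (x a : R) : f x != 0 -> is_derive x 1 f a ->
  is_derive x 1 (fun t => (f t)^-1) (- (f x)^-2 * a).
Proof. by move=> f0 df; apply: is_derive_congr (is_deriveV _ df) _ _. Qed.

Lemma is_derive_uniq (f : R -> R) (x a b : R) :
  is_derive x 1 f a -> is_derive x 1 f b -> a = b.
Proof. by move=> Ha Hb; rewrite -(@derive_val _ _ _ _ _ _ _ Ha) (@derive_val _ _ _ _ _ _ _ Hb). Qed.

Lemma itg_sin_cos (a b c d : R) :
  itg 0 (pi *+ 2) (fun t => (a * cos t + b * sin t) * (c * cos t + d * sin t))
  = pi * (a * c + b * d).
Proof.
have pi0 := @pi_ge0 R.
pose F t := a * c * (t + sin t * cos t) / 2
   + (a * d + b * c) * (sin t ^+ 2 / 2) + b * d * (t - sin t * cos t) / 2.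
have dF (t : R) : is_derive t 1 F ((a * cos t + b * sin t) * (c * cos t + d * sin t)).
  rewrite /F; drvR; have := cos2Dsin2 t; set C := cos t; set S := sin t => E.
  have -> : (a * C + b * S) * (c * C + d * S)
     = a * c * C ^+ 2 + (a * d + b * c) * (S * C) + b * d * S ^+ 2 by ring.
  have C2 : C * C = 1 - S * S by rewrite -E; ring.
  by rewrite !expr2 C2; field.
have tp : 0 <= (pi *+ 2 : R) by rewrite mulr2n addr_ge0.
rewrite (itg_FTC2 tp _ (fun t _ => dF t)); last by move=> t _; ct.
by rewrite /F sin2pi sin0 cos0; field.
Qed.

Lemma sin_le (x : R) : 0 <= x -> sin x <= x.
Proof.
move=> x0; have E0 : 0 <= (0 : R) <= x by rewrite lexx.
have E1 : 0 <= x <= x by rewrite x0 lexx.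
have dF (t : R) : is_derive t 1 (fun t => t - sin t) (1 - cos t) by drvR.
have [c _] := mvt_itv (fun t _ => dF t) E0 E1; rewrite sin0 !subr0 => E. rewrite -subr_ge0 E mulr_ge0// subr_ge0; exact: cos_le1.
Qed.

Lemma cos_ge (x : R) : 0 <= x -> 1 - x ^+ 2 / 2 <= cos x.
Proof.
move=> x0; have E0 : 0 <= (0 : R) <= x by rewrite lexx.
have E1 : 0 <= x <= x by rewrite x0 lexx.
have dF (t : R) : is_derive t 1 (fun t => cos t + t ^+ 2 / 2) (t - sin t).
  by drvR; field.
have [c /andP[c0 _]] := mvt_itv (fun t _ => dF t) E0 E1; rewrite cos0 expr0n /= mul0r addr0 subr0 => E.
have : 0 <= cos x + x ^+ 2 / 2 - 1.
  by rewrite E mulr_ge0// subr_ge0 sin_le.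
lra.
Qed.

Lemma cos_half (x : R) : `|x| <= 1 -> 1 / 2 <= cos x.
Proof.
move=> x1; rewrite -cos_norm; apply: le_trans (cos_ge (normr_ge0 x)).
have : `|x| ^+ 2 <= 1 by rewrite exprn_ile1.
lra.
Qed.

Lemma sin_half (x : R) : 0 <= x <= 1 -> x / 2 <= sin x.
Proof.
move=> /andP[x0 x1].
have E0 : 0 <= (0 : R) <= x by rewrite lexx.
have E1 : 0 <= x <= x by rewrite x0 lexx.
have dF (t : R) : is_derive t 1 (fun t => sin t - t / 2) (cos t - 1 / 2).
  by drvR; field.
have [c /andP[c0 cx]] := mvt_itv (fun t _ => dF t) E0 E1; rewrite sin0 mul0r !subr0 => E; rewrite -subr_ge0 E mulr_ge0// subr_ge0.
by apply: cos_half; rewrite ger0_norm// (le_trans cx).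
Qed.

Lemma sin_mul_half (x : R) : `|x| <= 1 -> x ^+ 2 / 2 <= sin x * x.
Proof.
move=> x1; have [x0|/ltW x0] := leP 0 x.
  rewrite expr2 mulrAC ler_wpM2r// sin_half// x0.
  by rewrite -(ger0_norm x0).
have : - x / 2 <= sin (- x) by apply: sin_half; rewrite oppr_ge0 x0 -(ler0_norm x0).
rewrite sinN => H; have : (- x / 2) * (- x) <= - sin x * (- x).
  by rewrite ler_wpM2r// oppr_ge0.
by rewrite mulrNN; apply: le_trans; rewrite expr2 le_eqVlt; apply/orP; left; apply/eqP; ring.
Qed.

Definition dirc (v : R * R) (t : R) := v.1 * cos t + v.2 * sin t.

(** The weighted circle integral of the plane wave [sin (k v . (x - z))]; for a unit vector [v] it
    equals [2 pi J_1(k e^s)]. *)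
Definition discm (k : R) (v : R * R) (s : R) : R :=
  itg 0 (pi *+ 2) (fun t => sin (k * expR s * dirc v t) * dirc v t).

Variables (k : R) (v : R * R).
Hypotheses (k0 : 0 < k) (v1 : v.1 ^+ 2 + v.2 ^+ 2 = 1).

Lemma dirc_le1 (t : R) : `|dirc v t| <= 1.
Proof.
rewrite -(@ler_pXn2r _ 2)// ?nnegrE// expr1n real_normK ?num_real//.
have H : (v.1 ^+ 2 + v.2 ^+ 2) * (cos t ^+ 2 + sin t ^+ 2) - dirc v t ^+ 2 =
  (v.1 * sin t - v.2 * cos t) ^+ 2 by rewrite /dirc; ring.
by rewrite -subr_ge0; move: H; rewrite v1 cos2Dsin2 mulr1 => ->; exact: sqr_ge0.
Qed.

Lemma ct_dirc (t : R) : {for t, continuous (dirc v)}.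
Proof. by rewrite /dirc; ct. Qed.

Lemma tp0 : 0 <= (pi *+ 2 : R).
Proof. by have := @pi_ge0 R; rewrite mulr2n => pi0; rewrite addr_ge0. Qed.

Lemma itg_dirc2 : itg 0 (pi *+ 2) (fun t => dirc v t ^+ 2) = pi.
Proof.
rewrite -[RHS]mulr1 -v1 !expr2 -itg_sin_cos; apply: eq_itg => t _.
by rewrite expr2.
Qed.

(** [y sin y >= y^2 / 2] for [|y| <= 1], with [y = k e^s dirc v t]; the square of [dirc v] has
    integral [pi]. *)
Lemma discm_ge (s : R) : k * expR s <= 1 -> k * expR s * pi / 2 <= discm k v s.
Proof.
move=> ks; have kp : 0 < k * expR s by rewrite mulr_gt0// expR_gt0.
rewrite mulrAC -itg_dirc2 -itgZ; last first.
  by move=> t _; apply: ctX; exact: ct_dirc.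
apply: le_itg.
- by move=> t _; apply: ctM; [ct|apply: ctX; exact: ct_dirc].
- by move=> t _; have := @ct_dirc t => H; ct.
move=> t _; have : (k * expR s * dirc v t) ^+ 2 / 2 <=
    sin (k * expR s * dirc v t) * (k * expR s * dirc v t).
  apply: sin_mul_half; rewrite normrM gtr0_norm//.
  by apply: le_trans ks; rewrite ler_piMr ?(ltW kp)// dirc_le1.
set S := sin _; set C := dirc v t => H.
rewrite -(ler_pM2r kp); apply: le_trans; last first.
  by move: H; rewrite [in leRHS](mulrC _ C) mulrA; apply: le_trans.
by rewrite le_eqVlt; apply/orP; left; apply/eqP; ring.
Qed.

Lemma discm_gt0 (s : R) : k * expR s <= 1 -> 0 < discm k v s.
Proof.
move=> ks; apply: lt_le_trans (discm_ge ks).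
by rewrite divr_gt0// mulr_gt0 ?pi_gt0// mulr_gt0// expR_gt0.
Qed.

Section formula.
Variables (D : set (R * R)) (u p q p1 p2 q1 q2 : R * R -> R) (z : R * R) (S : R).
Hypotheses (oD : open D) (Du : C1on D u p q) (Dp : C1on D p p1 p2)
  (Dq : C1on D q q1 q2) (Hu : forall x, D x -> p1 x + q2 x = - k ^+ 2 * u x)
  (zD : forall y, `|y - z| < expR S -> D y).

Lemma pol_box (s t : R) : `|pol z s t - z| <= expR s.
Proof.
have es := @expR_ge0 R s.
rewrite prod_normE ge_max /= !(addrC z.1) !(addrC z.2) !addrK !normrM !(ger0_norm es)//.
by rewrite !ler_piMr// ?normr_ge0 ?cos_max ?sin_max.
Qed.

Lemma pol_boxD (s t : R) : s < S -> D (pol z s t).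
Proof. by move=> sS; apply: zD; rewrite (le_lt_trans (pol_box s t))// ltr_expR. Qed.

Let M := polT u (dirc v) z 0 (pi *+ 2).
Let M1 := polT1 p q (dirc v) z 0 (pi *+ 2).

Lemma disc_M_derive (s : R) : s < S ->
  is_derive s 1 M (M1 s) /\ is_derive s 1 M1 ((1 - k ^+ 2 * expR (2 * s)) * M s).
Proof.
move=> sS; pose psi' t := v.2 * cos t - v.1 * sin t.
have d1 (t : R) : is_derive t 1 (dirc v) (psi' t).
  by rewrite /dirc; drvR; rewrite /psi'; ring.
have d2 (t : R) : is_derive t 1 psi' (- 1 * dirc v t).
  by rewrite /psi'; drvR; rewrite /dirc; ring.
have HD s' t : `|s' - s| < S - s -> 0 <= t <= pi *+ 2 -> D (pol z s' t).
  by move=> hs _; apply: pol_boxD; have := ler_norm (s' - s); lra.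
have e0 : 0 < S - s by rewrite subr_gt0.
split; first exact: (polT_derive oD Du tp0 d1 e0 HD).
apply: is_derive_congr (polT1_derive oD Du Dp Dq Hu tp0 d1 d2 e0 HD) _ _ => //.
rewrite /M /polUt /pol /psi' /dirc cos2pi sin2pi cos0 sin0; ring.
Qed.

(** Behaviour at the centre, [s -> -oo]: these bounds single out the regular solution of the Bessel
    equation in [s]. *)
Lemma disc_M_bound (s1 : R) : s1 < S -> exists2 B : R, 0 <= B &
  forall s, s <= s1 -> `|M s| <= B /\ `|M1 s| <= expR s * B.
Proof.
move=> s1S; pose K := [set y : R * R | `|y - z| <= expR s1].
have KD y : K y -> D y by move=> Ky; apply: zD; rewrite (le_lt_trans Ky)// ltr_expR.
have cK : compact K := @compact_box z _.
have [|Bu Bu0 HBu] := compact_abs_bound cK (f := u).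
  by move=> x /KD /Du[].
have [|Bp Bp0 HBp] := compact_abs_bound cK (f := p).
  by move=> x /KD /Du[].
have [|Bq Bq0 HBq] := compact_abs_bound cK (f := q).
  by move=> x /KD /Du[].
exists ((Bu + Bp + Bq) * (pi *+ 2)); first by rewrite mulr_ge0 ?tp0// !addr_ge0.
move=> s ss1; have Kp t : K (pol z s t).
  by rewrite /K /=; apply: le_trans (pol_box s t) _; rewrite ler_expR.
have cu t : {for t, continuous (fun t => u (pol z s t))}.
  by apply: ct_polt; have [] := Du (KD _ (Kp t)).
have cp t : {for t, continuous (fun t => p (pol z s t))}.
  by apply: ct_polt; have [] := Du (KD _ (Kp t)).
have cq t : {for t, continuous (fun t => q (pol z s t))}.
  by apply: ct_polt; have [] := Du (KD _ (Kp t)).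
have es := @expR_ge0 R s.
split.
  rewrite -(subr0 (pi *+ 2)); apply: itg_bound; first exact: tp0.
    by move=> t _; have := cu t; have := @ct_dirc t => *; ct.
  move=> t _; rewrite normrM -[leRHS]mulr1 ler_pM// ?dirc_le1//.
  by apply: le_trans (HBu _ (Kp t)) _; rewrite -addrA lerDl addr_ge0.
rewrite mulrA -(subr0 (pi *+ 2)); apply: itg_bound; first exact: tp0.
  by move=> t _; have := cp t; have := cq t; have := @ct_dirc t => *; ct.
move=> t _; rewrite normrM -[leRHS]mulr1 ler_pM// ?dirc_le1//.
rewrite normrM ger0_norm// ler_wpM2l//; apply: (le_trans (ler_normD _ _)).
rewrite !normrM -addrA ler_wpDl//; apply: lerD.
  by rewrite -[leRHS]mulr1 ler_pM ?HBp// cos_max.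
by rewrite -[leRHS]mulr1 ler_pM ?HBq// sin_max.
Qed.

(** To leading order on small circles [M1] sees only the gradient at the centre, since the products
    of [cos] and [sin] integrate to [pi] or [0]. *)
Lemma disc_M1_lim (e : R) : 0 < e -> exists2 s0 : R, s0 < S &
  forall s, s <= s0 -> `|M1 s - expR s * (pi * (p z * v.1 + q z * v.2))| <= expR s * e.
Proof.
move=> e0; have Dz : D z by apply: zD; rewrite subrr normr0 expR_gt0.
have e1 : 0 < e / (2 * (pi *+ 2)).
  by rewrite divr_gt0// mulr_gt0// mulr2n addr_gt0// pi_gt0.
have [_ cp cq _ _] := Du Dz.
have [d1 d10 H1] := (continuous_epsP p z).1 cp _ e1.
have [d2 d20 H2] := (continuous_epsP q z).1 cq _ e1.
have [s3 Hs3] : exists s3 : R, expR s3 = Num.min d1 d2.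
  by apply: expR_total; rewrite lt_min d10.
exists (Num.min (S - 1) (s3 - 1)).
  by rewrite gt_min ltrBlDr ltrDl ltr01.
move=> s; rewrite le_min => /andP[sS ss3].
have sS' : s < S by lra.
have near t : `|pol z s t - z| < Num.min d1 d2.
  rewrite -Hs3; apply: le_lt_trans (pol_box s t) _; rewrite ltr_expR; lra.
have cp' t : {for t, continuous (fun t => p (pol z s t))}.
  by apply: ct_polt; have [] := Du (pol_boxD t sS').
have cq' t : {for t, continuous (fun t => q (pol z s t))}.
  by apply: ct_polt; have [] := Du (pol_boxD t sS').
have es := @expR_ge0 R s.
rewrite -itg_sin_cos -itgZ; last by move=> t _; ct.
rewrite /M1 /polT1 -itgB; last 2 first.
- by move=> t _; have := cp' t; have := cq' t; have := @ct_dirc t => *; ct.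
- by move=> t _; ct.
have pt : 0 < (pi *+ 2 : R) by rewrite mulr2n addr_gt0// pi_gt0.
have -> : expR s * e = expR s * (e / (2 * (pi *+ 2)) * 2) * (pi *+ 2 - 0).
  move: (pi *+ 2) pt => P P0; rewrite subr0; field; exact: lt0r_neq0.
apply: itg_bound; first exact: tp0.
  by move=> t _; have := cp' t; have := cq' t; have := @ct_dirc t => *; ct.
move=> t _; rewrite -/(dirc v t).
rewrite (_ : _ - _ = expR s * (((p (pol z s t) - p z) * cos t + (q (pol z s t) - q z) * sin t)
   * dirc v t)); last by ring.
rewrite normrM ger0_norm// ler_wpM2l// normrM -[leRHS]mulr1 ler_pM// ?dirc_le1//.
apply: (le_trans (ler_normD _ _)); rewrite !normrM mulrDr !mulr1.
have := near t; rewrite lt_min => /andP[n1 n2].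
apply: lerD; rewrite -[leRHS]mulr1; apply: ler_pM => //; rewrite ?cos_max ?sin_max//.
  exact/ltW/H1.
exact/ltW/H2.
Qed.

End formula.

Lemma exp_small (a b e : R) : 0 < e -> exists2 s : R, s <= b & expR s * a <= e.
Proof.
move=> e0; have [t Ht] : exists t : R, expR t = e / (`|a| + 1).
  by apply: expR_total; rewrite divr_gt0// ltr_wpDl.
exists (Num.min b t); first by rewrite ge_min lexx.
have a1 : 0 < `|a| + 1 by rewrite ltr_wpDl.
apply: (@le_trans _ _ (expR t * (`|a| + 1))); last by rewrite Ht divfK// lt0r_neq0.
apply: (@le_trans _ _ (expR (Num.min b t) * (`|a| + 1))).
  rewrite ler_wpM2l ?expR_ge0//; apply: le_trans (ler_norm a) _; by rewrite lerDl.
by rewrite ler_wpM2r ?(ltW a1)// ler_expR ge_min lexx orbT.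
Qed.

Lemma plane_wave_C1 (z : R * R) :
  let u := fun x : R * R => sin (k * (v.1 * (x.1 - z.1) + v.2 * (x.2 - z.2))) in
  let c := fun x : R * R => cos (k * (v.1 * (x.1 - z.1) + v.2 * (x.2 - z.2))) in
  [/\ C1on setT u (fun x => k * v.1 * c x) (fun x => k * v.2 * c x),
    C1on setT (fun x => k * v.1 * c x)
      (fun x => - (k ^+ 2 * v.1 ^+ 2) * u x) (fun x => - (k ^+ 2 * v.1 * v.2) * u x),
    C1on setT (fun x => k * v.2 * c x)
      (fun x => - (k ^+ 2 * v.1 * v.2) * u x) (fun x => - (k ^+ 2 * v.2 ^+ 2) * u x)
    & forall x, - (k ^+ 2 * v.1 ^+ 2) * u x + - (k ^+ 2 * v.2 ^+ 2) * u x
        = - k ^+ 2 * u x].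
Proof.
move=> u c; rewrite /u /c; split.
- by move=> x _; split; [ct|ct|ct|rewrite /=; drvR; ring|rewrite /=; drvR; ring].
- by move=> x _; split; [ct|ct|ct|rewrite /=; drvR; ring|rewrite /=; drvR; ring].
- by move=> x _; split; [ct|ct|ct|rewrite /=; drvR; ring|rewrite /=; drvR; ring].
- by move=> x; rewrite -mulrDl -opprD -mulrDr v1 mulr1.
Qed.

(* Both sides are regular solutions of the same second order equation in [s], so
   their Wronskian vanishes; compare with the plane wave in the direction [v]. *)
Lemma disc_formula (D : set (R * R)) (u p q p1 p2 q1 q2 : R * R -> R)
    (z : R * R) (S s : R) :
  open D -> C1on D u p q -> C1on D p p1 p2 -> C1on D q q1 q2 ->
  (forall x, D x -> p1 x + q2 x = - k ^+ 2 * u x) ->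
  (forall y, `|y - z| < expR S -> D y) -> s < S -> k * expR s <= 1 ->
  discm k v s * (p z * v.1 + q z * v.2) = k * polT u (dirc v) z 0 (pi *+ 2) s.
Proof.
move=> oD Du Dp Dq Hu zD sS ks.
pose us (x : R * R) := sin (k * (v.1 * (x.1 - z.1) + v.2 * (x.2 - z.2))).
pose c (x : R * R) := cos (k * (v.1 * (x.1 - z.1) + v.2 * (x.2 - z.2))).
pose ps x := k * v.1 * c x; pose qs x := k * v.2 * c x.
pose p1s x := - (k ^+ 2 * v.1 ^+ 2) * us x.
pose p2s x := - (k ^+ 2 * v.1 * v.2) * us x.
pose q2s x := - (k ^+ 2 * v.2 ^+ 2) * us x.
have [Dus Dps Dqs Hus] : [/\ C1on setT us ps qs, C1on setT ps p1s p2s,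
  C1on setT qs p2s q2s & forall x, p1s x + q2s x = - k ^+ 2 * us x] := plane_wave_C1 z.
pose M := polT u (dirc v) z 0 (pi *+ 2); pose M1 := polT1 p q (dirc v) z 0 (pi *+ 2).
pose N := polT us (dirc v) z 0 (pi *+ 2); pose N1 := polT1 ps qs (dirc v) z 0 (pi *+ 2).
have NE s' : N s' = discm k v s'.
  apply: eq_itg => t _; rewrite /us /pol /dirc /=; congr (sin _ * _); ring.
have N0 s' : k * expR s' <= 1 -> 0 < N s' by rewrite NE; exact: discm_gt0.
have zT y : `|y - z| < expR S -> setT y by [].
have Hus' x : setT x -> p1s x + q2s x = - k ^+ 2 * us x by move=> _; exact: Hus.
have dM s' : s' < S -> _ := @disc_M_derive D u p q p1 p2 q1 q2 z S oD Du Dp Dq Hu zD s'.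
have dN s' : s' < S -> _ := @disc_M_derive setT us ps qs p1s p2s p2s q2s z S openT Dus Dps Dqs Hus' zT s'.
rewrite -/M -/M1 in dM; rewrite -/N -/N1 in dN.
have [B B0 HB] := disc_M_bound Du zD sS.
have [B' B0' HB'] := disc_M_bound Dus zT sS.
rewrite -/M -/M1 in HB; rewrite -/N -/N1 in HB'.
pose W s' := M1 s' * N s' - M s' * N1 s'.
have W0 s' : s' <= s -> W s' = 0.
  move=> ss'; apply/eqP; rewrite -normr_le0; apply/ler_addgt0Pl => e e0.
  have [s2 s2s Hs2] := exp_small (2 * B * B') s' e0.
  have -> : W s' = W s2.
    apply: (@der0_cst R W s2 s'); rewrite ?lexx ?s2s//.
    move=> x /andP[_ xs]; have xS : x < S by rewrite (le_lt_trans xs)// (le_lt_trans ss').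
    have [d1 d2] := dM x xS; have [d3 d4] := dN x xS.
    by rewrite /W; drvR; ring.
  have s2s' := le_trans s2s ss'.
  have [b1 b2] := HB s2 s2s'; have [b3 b4] := HB' s2 s2s'.
  rewrite addr0; apply: le_trans Hs2; apply: (le_trans (ler_normB _ _)).
  have -> : expR s2 * (2 * B * B') = (expR s2 * B) * B' + B * (expR s2 * B') by ring.
  by rewrite !normrM; apply: lerD; apply: ler_pM.
(* As the Wronskian vanishes, [M / N] is constant; the limit at the centre will identify [ka] with
   the derivative of [u] along [v], divided by [k]. *)
pose ka := M s / N s.
have N0' s' : s' <= s -> 0 < N s'.
  move=> ss'; apply: N0; apply: le_trans ks; by rewrite ler_pM2l// ler_expR.
have Mka s' : s' <= s -> M s' = ka * N s'.
  move=> ss'; rewrite /ka; apply: (@mulIf _ (N s')^-1); first by rewrite invr_eq0 gt_eqF ?N0'.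
  have Ns' : N s' != 0 by rewrite gt_eqF// N0'.
  rewrite (mulfK Ns').
  apply: (@der0_cst R (fun x => M x / N x) s' s); rewrite ?lexx ?ss'//.
  move=> x /andP[sx xs]; have xS : x < S by rewrite (le_lt_trans xs).
  have [d1 _] := dM x xS; have [d3 _] := dN x xS.
  have Nx : N x != 0 by rewrite gt_eqF ?N0'.
  have d5 := dinv Nx d3; drvR.
  have /eqP := W0 x xs; rewrite /W subr_eq0 => /eqP E.
  have -> : M1 x / N x + M x * (- N x ^- 2 * N1 x) = (M1 x * N x - M x * N1 x) / N x ^+ 2.
    by field.
  by rewrite E subrr mul0r.
have M1ka s' : s' < s -> M1 s' = ka * N1 s'.
  move=> ss'; have s'S := lt_trans ss' sS.
  have [d1 _] := dM s' s'S; have [d3 _] := dN s' s'S.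
  apply: is_derive_uniq d1 _.
  have e0 : 0 < s - s' by rewrite subr_gt0.
  apply: (@is_derive_near_eq R (fun x => ka * N x) M s' _ _ e0).
    move=> y ys; rewrite Mka//; have := ler_norm (y - s'); lra.
(* Leading terms of [M1 = ka N1] on shrinking circles; the comparison wave has derivative [k] along
   [v] at [z]. *)
have pz : p z * v.1 + q z * v.2 = ka * k.
  apply/eqP; rewrite -subr_eq0 -normr_le0; apply/ler_addgt0Pl => e e0; rewrite addr0.
  have e1 : 0 < e / (1 + `|ka|) by rewrite divr_gt0// ltr_wpDr.
  have [sa saS Ha] := disc_M1_lim Du zD e1; have [sb sbS Hb] := disc_M1_lim Dus zT e1.
  pose s' := Num.min (s - 1) (Num.min sa sb).
  have ss' : s' < s by rewrite gt_min ltrBlDr ltrDl ltr01.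
  have {}Ha := Ha s'; have {}Hb := Hb s'.
  rewrite -/M1 in Ha; rewrite -/N1 in Hb.
  rewrite !ge_min !lexx !orbT /= in Ha Hb.
  have {}Ha := Ha isT; have {}Hb := Hb isT.
  have E1 : ps z * v.1 + qs z * v.2 = k.
    rewrite /ps /qs /c !subrr !mulr0 addr0 mulr0 cos0 !mulr1 -!mulrA -mulrDr.
    by rewrite -!expr2 v1 mulr1.
  rewrite E1 in Hb; set Dz := p z * v.1 + q z * v.2 in Ha *.
  have es := @expR_gt0 R s'; have pip := @pi_gt0 R; have pi2 := @pi_ge2 R.
  have H : expR s' * pi * `|Dz - ka * k| <= expR s' * e.
    rewrite -[X in X * `|_|]gtr0_norm ?mulr_gt0// -normrM.
    have -> : expR s' * pi * (Dz - ka * k) =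
      ka * (N1 s' - expR s' * (pi * k)) - (M1 s' - expR s' * (pi * Dz)).
      by rewrite M1ka//; ring.
    apply: (le_trans (ler_normB _ _)); rewrite normrM.
    apply: (@le_trans _ _ (`|ka| * (expR s' * (e / (1 + `|ka|))) + expR s' * (e / (1 + `|ka|)))).
      by apply: lerD => //; apply: ler_wpM2l.
    rewrite le_eqVlt; apply/orP; left; apply/eqP; field.
    by rewrite gt_eqF// ltr_wpDr.
  move: H; rewrite -mulrA ler_pM2l// => H; apply: le_trans H.
  by rewrite ler_peMl// (le_trans _ pi2)// ler1n.
have Ns : N s != 0 by rewrite gt_eqF// N0'.
rewrite pz -NE -/(M s) /ka; move: (M s) (N s) Ns => Ms Ns Ns0; by field.
Qed.

End disc.

(** * Unique continuation *)

Section analytic1.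
Variable R : realType.

(* [G m] plays the role of the [m]-th derivative of a function that is analytic
   on [a, b]. *)
Definition anseq (a b C A : R) (G : nat -> R -> R) : Prop :=
  forall m t, a <= t <= b ->
    is_derive t 1 (G m) (G m.+1 t) /\ `|G m t| <= C * A ^+ m * m`!%:R.

Lemma der0_left (f : R -> R) (t l e : R) : 0 < e -> is_derive t 1 f l ->
  (forall y, t - e <= y <= t -> f y = 0) -> l = 0.
Proof.
move=> e0 /is_derive_epsP df f0; apply/eqP; rewrite -normr_le0.
apply/ler_addgt0Pl => e1 e10; rewrite addr0.
have [d d0 Hd] := df e1 e10; pose h := Num.min e (d / 2).
have h0 : 0 < h by rewrite lt_min e0 divr_gt0.
have := Hd (- h); rewrite normrN gtr0_norm//.
have hd : h < d by rewrite gt_min ltr_pdivrMr// ltr_pMr// ltr1n orbT.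
move=> /(_ hd); rewrite !f0 ?lexx ?lerBlDr ?lerDl ?(ltW e0) ?(ltW h0)//; last first.
  by rewrite andbT -lerBlDr lerD2l lerN2 ge_min lexx.
by rewrite subrr sub0r mulrN opprK normrM (gtr0_norm h0) ler_pM2r.
Qed.

Lemma der0_right (f : R -> R) (t l e : R) : 0 < e -> is_derive t 1 f l ->
  (forall y, t <= y <= t + e -> f y = 0) -> l = 0.
Proof.
move=> e0 /is_derive_epsP df f0; apply/eqP; rewrite -normr_le0.
apply/ler_addgt0Pl => e1 e10; rewrite addr0.
have [d d0 Hd] := df e1 e10; pose h := Num.min e (d / 2).
have h0 : 0 < h by rewrite lt_min e0 divr_gt0.
have := Hd h; rewrite gtr0_norm//.
have hd : h < d by rewrite gt_min ltr_pdivrMr// ltr_pMr// ltr1n orbT.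
move=> /(_ hd); rewrite !f0 ?lexx ?lerDl ?(ltW e0) ?(ltW h0)//; last first.
  by rewrite lerD2l ge_min lexx.
by rewrite subrr sub0r normrN normrM (gtr0_norm h0) ler_pM2r.
Qed.

Lemma dX (f : R -> R) (x a : R) (n : nat) : is_derive x 1 f a ->
  is_derive x 1 (fun t => f t ^+ n.+1) (n.+1%:R * f x ^+ n * a).
Proof.
move=> df; elim: n => [|n IH].
  by apply: (is_derive_congr df) => [y|]; rewrite ?expr1// expr0 !mul1r.
apply: (is_derive_congr (dM df IH)) => [y|]; first by rewrite [RHS]exprS.
by rewrite -(natr1 n.+1) exprS; ring.
Qed.

(** Induction on [m]: the bound for [G 1] makes both [phi + G 0] and [phi - G 0] nondecreasing, and
    both vanish at [c]. *)
Lemma taylor_zero (m : nat) (G : nat -> R -> R) (c t K : R) : c <= t ->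
  (forall i s, c <= s <= t -> is_derive s 1 (G i) (G i.+1 s)) ->
  (forall i, (i < m)%N -> G i c = 0) ->
  (forall s, c <= s <= t -> `|G m s| <= K) ->
  forall s, c <= s <= t -> `|G 0%N s| <= K * (s - c) ^+ m / m`!%:R.
Proof.
move=> ct; elim: m G => [|m IH] G dG G0 GK s cst.
  by rewrite expr0 fact0 mulr1 divr1; exact: GK.
have {}IH := IH (fun i => G i.+1) (fun i => dG i.+1) (fun i im => G0 i.+1 im) GK.
have c0 : c <= c <= t by rewrite lexx.
pose phi s := K / (m.+1)`!%:R * (s - c) ^+ m.+1.
have dphi (x : R) : is_derive x 1 phi (K / m`!%:R * (x - c) ^+ m).
  have H : is_derive x 1 (fun s => (s - c) ^+ m.+1) (m.+1%:R * (x - c) ^+ m).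
    have H1 : is_derive x 1 (fun s => s - c) 1 by drvR; ring.
    by apply: (is_derive_congr (dX m H1)) => //; ring.
  apply: (is_derive_congr (dZ (K / (m.+1)`!%:R) H)) => //.
  rewrite factS natrM; field; rewrite !pnatr_eq0 /=.
  by rewrite -lt0n fact_gt0 addrC natr1 pnatr_eq0.
have E : K * (s - c) ^+ m.+1 / (m.+1)`!%:R = phi s by rewrite /phi mulrAC.
have phic : phi c = 0 by rewrite /phi subrr expr0n mulr0.
rewrite E ler_norml; apply/andP; split.
  have [x cx Hx] := @mvt_itv R (fun s => G 0%N s + phi s) (fun x => G 1%N x + K / m`!%:R * (x - c) ^+ m)
    c t c s (fun x cx => dD (dG 0%N x cx) (dphi x)) c0 cst.
  have : 0 <= G 0%N s + phi s - (G 0%N c + phi c).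
    rewrite Hx mulr_ge0 ?subr_ge0 ?(andP cst).1//.
    have := IH x cx; rewrite ler_norml => /andP[+ _].
    rewrite (mulrAC K); lra.
  rewrite (G0 0%N)// phic; lra.
have [x cx Hx] := @mvt_itv R (fun s => phi s - G 0%N s) (fun x => K / m`!%:R * (x - c) ^+ m - G 1%N x)
    c t c s (fun x cx => dB (dphi x) (dG 0%N x cx)) c0 cst.
have : 0 <= phi s - G 0%N s - (phi c - G 0%N c).
  rewrite Hx mulr_ge0 ?subr_ge0 ?(andP cst).1//.
  have := IH x cx; rewrite ler_norml => /andP[_].
  rewrite (mulrAC K); lra.
rewrite (G0 0%N)// phic; lra.
Qed.

Lemma pow_half_small (C e : R) : 0 <= C -> 0 < e -> exists m : nat, C * (1 / 2) ^+ m <= e.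
Proof.
move=> C0 e0; have C1 : 0 < C + 1 by rewrite ltr_wpDl.
have := @cvg_geometric R 1 (1 / 2); rewrite gtr0_norm ?divr_gt0//.
move=> /(_ _)/cvgr0Pnorm_lt H; have h12 : 1 / 2 < 1 :> R by lra.
have := H h12 (e / (C + 1)) (divr_gt0 e0 C1) => -[N _ /(_ N (leqnn N))] /=.
rewrite mul1r => HN; exists N.
have p0 : 0 <= (1 / 2) ^+ N :> R by rewrite exprn_ge0// divr_ge0.
move: HN; rewrite ger0_norm// ltr_pdivlMr// mulrC => HN.
by apply: le_trans (ltW HN); rewrite mul1r mulrDl mul1r lerDl -div1r.
Qed.

(** The zero set grows by steps of the fixed length [1 / (2 A)]. At the right end [c] of an interval
    of zeros all the [G m] vanish, and Taylor's formula bounds [G 0 t] by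
    [C (A (t - c))^m <= C 2^(-m)] for every [m]. *)
Lemma anseq_identity (a b C A e : R) (G : nat -> R -> R) :
  0 <= C -> 0 < A -> 0 < e -> anseq a b C A G ->
  (forall t, a <= t <= b -> t <= a + e -> G 0%N t = 0) ->
  forall t, a <= t <= b -> G 0%N t = 0.
Proof.
move=> C0 A0 e0 HG G0.
pose del := 1 / (2 * A).
have del0 : 0 < del by rewrite divr_gt0// mulr_gt0.
suff H : forall n t, a <= t <= b -> t <= a + e + n%:R * del -> G 0%N t = 0.
  move=> t tab; apply: (H (Num.bound ((t - a) / del)) t tab).
  have [ta tb] := andP tab.
  have q0 : 0 <= (t - a) / del by rewrite divr_ge0 ?subr_ge0// ltW.
  have := archi_boundP q0; rewrite ltr_pdivrMr// => H1; lra.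
elim=> [|n IH] t tab; first by rewrite mul0r addr0; exact: G0.
have [tc|ct] := leP t (a + e + n%:R * del); first by move=> _; exact: IH.
set c := a + e + n%:R * del in IH ct; rewrite -natr1 mulrDl mul1r addrA -/c => tcd.
have [ta tb] := andP tab.
have ac : a < c by rewrite /c -addrA ltrDl ltr_wpDr// mulr_ge0// ltW.
have Gc m s : a <= s <= c -> G m s = 0.
  elim: m s => [|m IHm] s sac.
    by have [sa sc] := andP sac; apply: IH => //; rewrite sa (le_trans sc)// (le_trans (ltW ct)).
  have [sa sc] := andP sac.
  have sab : a <= s <= b by rewrite sa (le_trans sc)// (le_trans (ltW ct)).
  have {}dm := (HG m s sab).1.
  have [sc'|cs'] := ltP s c.
    apply: (@der0_right _ _ _ (c - s) _ dm); first by rewrite subr_gt0.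
    move=> y /andP[sy yc]; apply: IHm; rewrite (le_trans sa sy) /=.
    by rewrite (le_trans yc)// addrC subrK.
  have sE : s = c by apply/eqP; rewrite eq_le sc.
  apply: (@der0_left _ _ _ (c - a) _ dm); first by rewrite subr_gt0.
  move=> y; rewrite sE opprB addrC subrK => yac; exact: IHm.
apply/eqP; rewrite -normr_le0; apply/ler_addgt0Pl => e1 e10; rewrite addr0.
have [m Hm] := pow_half_small C0 e10; apply: le_trans Hm.
have cc : c <= t <= t by rewrite ltW //= lexx.
have inab s : c <= s <= t -> a <= s <= b.
  by move=> /andP[cs st]; rewrite (le_trans (ltW ac) cs) (le_trans st tb).
apply: (le_trans (@taylor_zero m G c t (C * A ^+ m * m`!%:R) (ltW ct) _ _ _ t cc)).
- by move=> i s /inab sab; exact: (HG i s sab).1.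
- by move=> i _; apply: Gc; rewrite ltW//= lexx.
- by move=> s /inab sab; exact: (HG m s sab).2.
rewrite -mulrA mulrC -!mulrA (mulrC C) !mulrA.
have -> : (t - c) ^+ m / m`!%:R * A ^+ m * m`!%:R * C = C * (A * (t - c)) ^+ m.
  by rewrite exprMn; field; rewrite pnatr_eq0 -lt0n fact_gt0.
rewrite ler_wpM2l// lerXn2r ?nnegrE//.
- by rewrite mulr_ge0 ?(ltW A0)// subr_ge0 ltW.
rewrite mulrC -ler_pdivlMr//; have -> : 1 / 2 / A = del by rewrite /del; field; exact: lt0r_neq0.
by rewrite lerBlDl.
Qed.

(** Leibniz' rule. The binomial coefficients cancel against the factorials, so each of the [m + 1]
    terms is at most [C C' A^m m!]; the new rate [2 A] comes from [m + 1 <= 2^m]. *)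
Lemma anseq_mul (a b C A C' : R) (G H : nat -> R -> R) : 0 <= C -> 0 < A -> 0 <= C' ->
  anseq a b C A G -> anseq a b C' A H ->
  anseq a b (C * C') (2 * A)
    (fun m t => \sum_(i < m.+1) 'C(m, i)%:R * (G i t * H (m - i)%N t)).
Proof.
move=> C0 A0 C'0 HG HH m t tab; split.
  have dterm i : (i < m.+1)%N -> is_derive t 1 (fun t => 'C(m, i)%:R * (G i t * H (m - i)%N t))
      ('C(m, i)%:R * (G i.+1 t * H (m - i)%N t + G i t * H (m - i).+1 t)).
    move=> _; have d1 := (HG i t tab).1; have d2 := (HH (m - i)%N t tab).1.
    exact: (dZ _ (dM d1 d2)).
  have dsum n : (n <= m.+1)%N -> is_derive t 1
      (fun t => \sum_(i < n) 'C(m, i)%:R * (G i t * H (m - i)%N t))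
      (\sum_(i < n) 'C(m, i)%:R * (G i.+1 t * H (m - i)%N t + G i t * H (m - i).+1 t)).
    elim: n => [|n IH] nm.
      apply: (is_derive_congr (dC t 0)) => [y|]; by rewrite big_ord0.
    apply: (is_derive_congr (dD (IH (ltnW nm)) (dterm n nm))) => [y|];
      by rewrite big_ord_recr.
  apply: (is_derive_congr (dsum m.+1 (leqnn _))) => //.
  under eq_bigr do rewrite mulrDr; rewrite big_split /=.
  rewrite [RHS]big_ord_recl /= bin0 subn0.
  under [X in _ = _ + X]eq_bigr => i _ do
    rewrite /bump leq0n add1n binS natrD mulrDl subSS.
  rewrite big_split /= addrA [LHS]addrC; congr (_ + _).
  rewrite [in LHS]big_ord_recl /= bin0 subn0; congr (_ + _).
  rewrite [RHS]big_ord_recr /= bin_small// mul0r addr0.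
  by apply: eq_bigr => i _; rewrite /bump leq0n add1n subnSK.
apply: (le_trans (ler_norm_sum _ _ _)).
apply: (@le_trans _ _ (\sum_(i < m.+1) C * C' * A ^+ m * m`!%:R)).
  apply: ler_sum => i _; have im : (i <= m)%N by rewrite -ltnS.
  have b1 := (HG i t tab).2; have b2 := (HH (m - i)%N t tab).2.
  rewrite normrM ger0_norm ?ler0n// normrM.
  apply: (@le_trans _ _ ('C(m, i)%:R * ((C * A ^+ i * i`!%:R) * (C' * A ^+ (m - i) * (m - i)`!%:R)))).
    by rewrite ler_wpM2l ?ler0n// ler_pM.
  have -> : A ^+ m = A ^+ i * A ^+ (m - i) by rewrite -exprD subnKC.
  have -> : m`!%:R = 'C(m, i)%:R * (i`!%:R * (m - i)`!%:R) :> R.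
    by rewrite -(bin_fact im) !natrM.
  by rewrite le_eqVlt; apply/orP; left; apply/eqP; ring.
rewrite sumr_const card_ord -[X in X <= _]mulr_natr exprMn.
have : (m.+1%:R : R) <= 2 ^+ m by rewrite -natrX ler_nat; elim: m {t tab} => // m IH; rewrite expnS; lia.
move=> H2.
have -> : C * C' * (2 ^+ m * A ^+ m) * m`!%:R = C * C' * A ^+ m * m`!%:R * 2 ^+ m by ring.
apply: ler_wpM2l => //; apply: mulr_ge0; rewrite ?ler0n//.
by apply: mulr_ge0; [exact: mulr_ge0|rewrite exprn_ge0// ltW].
Qed.

Lemma anseqD (a b C A C' : R) (G H : nat -> R -> R) :
  anseq a b C A G -> anseq a b C' A H -> anseq a b (C + C') A (fun m t => G m t + H m t).
Proof.
move=> HG HH m t tab; have [d1 b1] := HG m t tab; have [d2 b2] := HH m t tab; split.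
  exact: dD.
by apply: (le_trans (ler_normD _ _)); rewrite !mulrDl lerD.
Qed.

Lemma anseqN (a b C A : R) (G : nat -> R -> R) :
  anseq a b C A G -> anseq a b C A (fun m t => - G m t).
Proof.
move=> HG m t tab; have [d1 b1] := HG m t tab; split; first exact: dN.
by rewrite normrN.
Qed.

End analytic1.

(** * Iterated directional derivatives and Cauchy estimates *)

Definition line (R : realType) (v x : R * R) (t : R) : R * R :=
  (x.1 + t * v.1, x.2 + t * v.2).

Definition dline (R : realType) (v : R * R) (g : R * R -> R) (x : R * R) : R :=
  'D_1 (fun t => g (line v x t)) 0.

(* The derivative along [v] is determined by the values on small circles; this
   property passes from [g] to [dline v g]. *)
Definition meanv (R : realType) (k : R) (v : R * R) (D : set (R * R)) (g : R * R -> R) :=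
  forall x, D x -> [/\ {for x, continuous g},
    is_derive (0 : R) 1 (fun t => g (line v x t)) (dline v g x)
    & forall S s, (forall y, `|y - x| < expR S -> D y) -> s < S -> k * expR s <= 1 ->
        discm k v s * dline v g x = k * polT g (dirc v) x 0 (pi *+ 2) s].

Section meanvalue.
Variables (R : realType) (k : R) (v : R * R) (D : set (R * R)).
Hypotheses (k0 : 0 < k) (v1 : v.1 ^+ 2 + v.2 ^+ 2 = 1) (oD : open D).

Lemma line0 (x : R * R) : line v x 0 = x.
Proof. by rewrite /line !mul0r !addr0 -surjective_pairing. Qed.

Lemma line_add (x : R * R) (s t : R) : line v x (s + t) = line v (line v x s) t.
Proof. by rewrite /line /= !mulrDl !addrA. Qed.

Lemma pol_line (x : R * R) (s t a : R) : pol (line v x t) s a = line v (pol x s a) t.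
Proof. by rewrite /pol /line /=; congr (_, _); ring. Qed.

Lemma v_le1 : `|v.1| <= 1 /\ `|v.2| <= 1.
Proof.
have h1 := sqr_ge0 v.1; have h2 := sqr_ge0 v.2.
have E (a : R) : a ^+ 2 <= 1 -> `|a| <= 1.
  by move=> H; rewrite -(@ler_pXn2r _ 2)// ?nnegrE// expr1n real_normK ?num_real.
by split; apply: E; move: v1 h1 h2; lra.
Qed.

Lemma line_dist (x : R * R) (s t : R) : `|line v x s - line v x t| <= `|s - t|.
Proof.
have [h1 h2] := v_le1; rewrite prod_normE ge_max /=.
have E (a b c e : R) : a + s * b - (a + t * b) = (s - t) * b by ring.
by rewrite !E// !normrM !ler_piMr.
Qed.

Lemma helm_meanv (u : R * R -> R) : helm k D u -> meanv k v D u.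
Proof.
move=> [p [q [p1 [p2 [q1 [q2 [Du Dp Dq Hu]]]]]]] x Dx.
have [cu _ _ _ _] := Du x Dx.
have d : is_derive (0 : R) 1 (fun t => u (line v x t)) (p x * v.1 + q x * v.2).
  have d1 : is_derive (0 : R) 1 (fun t => x.1 + t * v.1) v.1 by drvR; ring.
  have d2 : is_derive (0 : R) 1 (fun t => x.2 + t * v.2) v.2 by drvR; ring.
  have := C1on_chain oD Du d1 d2; rewrite -/(line v x 0) line0.
  by move=> /(_ Dx).
have dE : dline v u x = p x * v.1 + q x * v.2 by apply: derive_val.
split; [exact: cu|by rewrite dE|].
move=> S s xD sS ks; rewrite dE.
exact: (disc_formula k0 v1 oD Du Dp Dq Hu xD sS ks).
Qed.

Lemma open_radius (x : R * R) : D x -> exists2 S : R, k * expR S <= 1 &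
  forall y, `|y - x| < expR S -> D y.
Proof.
move=> Dx; have [e e0 He] := open_box oD Dx.
have [S HS] : exists S : R, expR S = Num.min e k^-1.
  by apply: expR_total; rewrite lt_min e0 invr_gt0.
exists S.
  have : expR S <= k^-1 by rewrite HS ge_min lexx orbT.
  by rewrite -(ler_pM2l k0) divff// lt0r_neq0.
move=> y yx; apply: He; apply: lt_le_trans yx _.
by rewrite HS ge_min lexx.
Qed.

Lemma meanv_line (g : R * R -> R) (x : R * R) (t : R) : meanv k v D g -> D (line v x t) ->
  is_derive t 1 (fun t => g (line v x t)) (dline v g (line v x t)).
Proof.
move=> Hg Dx; have [_ /is_derive_epsP H _] := Hg _ Dx.
apply/is_derive_epsP => e e0; have [d d0 Hd] := H e e0; exists d => // h hd.
by have := Hd h hd; rewrite add0r line0 line_add.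
Qed.

(** A single radius [e^s] serves all centres near [x0], so that the formula can be differentiated
    with respect to the centre. *)
Lemma meanv_near (g : R * R -> R) (x0 : R * R) (S s : R) :
  meanv k v D g -> (forall y, `|y - x0| < expR S -> D y) -> s < S -> k * expR s <= 1 ->
  exists2 e : R, 0 < e & forall x, `|x - x0| < e ->
    dline v g x = k / discm k v s * polT g (dirc v) x 0 (pi *+ 2) s /\
    forall t, D (pol x s t).
Proof.
move=> Hg x0D sS ks; pose S' := (s + S) / 2.
have sS' : s < S' by rewrite /S'; lra.
have S'S : S' < S by rewrite /S'; lra.
have e0 : 0 < expR S - expR S' by rewrite subr_gt0 ltr_expR.
exists (expR S - expR S') => // x xx0.
have xD y : `|y - x| < expR S' -> D y.
  move=> yx; apply: x0D.
  rewrite (_ : y - x0 = (y - x) + (x - x0)); last by rewrite addrA subrK.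
  apply: (le_lt_trans (ler_normD _ _)); lra.
have m0 := discm_gt0 k0 v1 ks.
have Dx : D x by apply: xD; rewrite subrr normr0 expR_gt0.
have [_ _ H] := Hg x Dx; split.
  by rewrite mulrAC -(H S' s)// mulrAC divff ?mul1r// gt_eqF.
move=> t; apply: xD; apply: le_lt_trans (@pol_box R x s t) _.
by rewrite ltr_expR.
Qed.

Lemma ct_polxt (g : R * R -> R) (x : R * R) (s t : R) : {for pol x s t, continuous g} ->
  {for (x, t), continuous (fun w : (R * R) * R => g (pol w.1 s w.2))}.
Proof.
move=> cg; apply: (@ct_comp2 _ _ g (fun w : (R * R) * R => w.1.1 + expR s * cos w.2)
    (fun w : (R * R) * R => w.1.2 + expR s * sin w.2)) => //.
- apply: ctD; last by ct.
  by apply: (@continuous_comp _ _ _ fst fst); [exact: cvg_fst|exact: cvg_fst].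
- apply: ctD; last by ct.
  by apply: (@continuous_comp _ _ _ fst snd); [exact: cvg_fst|exact: cvg_snd].
Qed.

Lemma ct_polline (g : R * R -> R) (x : R * R) (s t a : R) :
  {for pol (line v x t) s a, continuous g} ->
  {for (t, a), continuous (fun w : R * R => g (pol (line v x w.1) s w.2))}.
Proof.
move=> cg; apply: (@ct_comp2 _ _ g (fun w : R * R => x.1 + w.1 * v.1 + expR s * cos w.2)
  (fun w : R * R => x.2 + w.1 * v.2 + expR s * sin w.2)) => //; by ct.
Qed.

Lemma ct_dirc2 (V : normedModType R) (x : V) (t : R) :
  {for (x, t), continuous (fun w : V * R => dirc v w.2)}.
Proof. by rewrite /dirc; ct. Qed.

Lemma meanv_dline_ct (g : R * R -> R) (x : R * R) : meanv k v D g -> D x ->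
  {for x, continuous (dline v g)}.
Proof.
move=> Hg Dx; have [S kS xD] := open_radius Dx.
have sS : S - 1 < S by lra.
have ks : k * expR (S - 1) <= 1.
  by apply: le_trans kS; rewrite ler_pM2l// ler_expR; lra.
have [e e0 He] := meanv_near Hg xD sS ks.
apply: (@ct_near _ _ (fun x => k / discm k v (S - 1) * polT g (dirc v) x 0 (pi *+ 2) (S - 1))
     _ _ e e0).
  by move=> y yx; have [-> _] := He y yx.
apply: ctM; first exact: ct_cst.
apply: (@continuous_itg R _ (fun x t => g (pol x (S - 1) t) * dirc v t) x 0 (pi *+ 2)
    e (tp0 _) e0).
move=> y t yx _; apply: ctM; last exact: ct_dirc2.
by apply: ct_polxt; have [_ /(_ t)/Hg[]] := He y yx.
Qed.

(** Translation commutes with integration over circles: differentiating the formula for [dline v g]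
    along [v] puts [dline v g] under the integral. With [meanv_dline_ct] this closes the property
    under [dline v]. *)
Lemma meanv_dline2 (g : R * R -> R) (x0 : R * R) (S s : R) :
  meanv k v D g -> (forall y, `|y - x0| < expR S -> D y) -> s < S -> k * expR s <= 1 ->
  is_derive (0 : R) 1 (fun t => dline v g (line v x0 t))
    (k / discm k v s * polT (dline v g) (dirc v) x0 0 (pi *+ 2) s).
Proof.
move=> Hg x0D sS ks; have [e e0 He] := meanv_near Hg x0D sS ks.
have near t : `|t - 0| < e -> `|line v x0 t - x0| < e.
  by move=> ht; rewrite -{2}(line0 x0) (le_lt_trans (line_dist _ _ _)).
apply: (@is_derive_near_eq R (fun t => k / discm k v s * polT g (dirc v) (line v x0 t) 0 (pi *+ 2) s)
     _ _ _ e e0).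
  by move=> t ht; have [-> _] := He _ (near t ht).
apply: dZ.
have := @is_derive_itg R (fun t a => g (pol (line v x0 t) s a) * dirc v a)
    (fun t a => dline v g (pol (line v x0 t) s a) * dirc v a) 0 0 (pi *+ 2) e (tp0 _) e0.
rewrite line0; apply.
- move=> t a ht _; have [_ /(_ a) Dp] := He _ (near t ht).
  rewrite pol_line in Dp; have dg := meanv_line Hg Dp.
  apply: (is_derive_congr (dM dg (dC t (dirc v a)))) => [y|]; first by rewrite pol_line.
  by rewrite pol_line mulr0 addr0.
- move=> t a ht _; have [_ /(_ a) Dp] := He _ (near t ht).
  by apply: ctM; [apply: ct_polline; have [] := Hg _ Dp|exact: ct_dirc2].
- move=> a _; have h0 : `|0 - 0 : R| < e by rewrite subrr normr0.
  have [_ /(_ a) Dp] := He _ (near 0 h0).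
  apply: ctM; last exact: ct_dirc2.
  by apply: ct_polline; exact: meanv_dline_ct.
Qed.

Lemma meanv_step (g : R * R -> R) : meanv k v D g -> meanv k v D (dline v g).
Proof.
move=> Hg x0 Dx0; have [S kS x0D] := open_radius Dx0.
split; first exact: meanv_dline_ct.
  have sS : S - 1 < S by lra.
  have ks : k * expR (S - 1) <= 1.
    by apply: le_trans kS; rewrite ler_pM2l// ler_expR; lra.
  have H := meanv_dline2 Hg x0D sS ks.
  by rewrite [dline v (dline v g) x0](@derive_val _ _ _ _ _ _ _ H).
move=> S1 s1 x0D1 s1S1 ks1; have m0 := discm_gt0 k0 v1 ks1.
have H := meanv_dline2 Hg x0D1 s1S1 ks1.
rewrite [dline v (dline v g) x0](@derive_val _ _ _ _ _ _ _ H).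
by rewrite -mulrA mulrCA mulVKf// gt_eqF.
Qed.

(** On the circle of radius [r / 2] the factor [discm] is at least [k r pi / 4], and the right side
    at most [2 pi k B]; the quotient is [8 B / r]. *)
Lemma meanv_bound (g : R * R -> R) (x : R * R) (r B : R) : meanv k v D g ->
  0 < r -> k * r <= 1 -> (forall y, `|y - x| < r -> D y /\ `|g y| <= B) ->
  `|dline v g x| <= 8 / r * B.
Proof.
move=> Hg r0 kr HB.
have [S HS] : exists S : R, expR S = r by exact: expR_total.
have [s Hs] : exists s : R, expR s = r / 2 by apply: expR_total; rewrite divr_gt0.
have sS : s < S by rewrite -ltr_expR HS Hs ltr_pdivrMr// ltr_pMr// ltr1n.
have Dx : D x by have [] := HB x; rewrite ?subrr ?normr0.
have B0 : 0 <= B.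
  have xx : `|x - x| < r by rewrite subrr normr0.
  by apply: le_trans (HB x xx).2.
have ks : k * expR s <= 1.
  by apply: le_trans kr; rewrite ler_pM2l// -HS ler_expR ltW.
have [_ _ H] := Hg x Dx.
have xD y : `|y - x| < expR S -> D y by rewrite HS => /HB[].
have {}H := H S s xD sS ks.
have near t : `|pol x s t - x| < r.
  by apply: le_lt_trans (@pol_box R x s t) _; rewrite -HS ltr_expR.
have b1 : `|polT g (dirc v) x 0 (pi *+ 2) s| <= B * (pi *+ 2).
  rewrite -[X in _ <= _ * X]subr0; apply: itg_bound; first exact: tp0.
    move=> t _; apply: ctM; last exact: ct_dirc.
    by apply: ct_polt; have [Dp _] := HB _ (near t); have [] := Hg _ Dp.
  move=> t _; rewrite normrM -[leRHS]mulr1 ler_pM// ?dirc_le1//.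
  by have [] := HB _ (near t).
have b2 := discm_ge k0 v1 ks; have m0 := discm_gt0 k0 v1 ks.
have pip := @pi_gt0 R.
have : k * r * pi / 4 * `|dline v g x| <= k * B * (pi *+ 2).
  apply: (@le_trans _ _ (discm k v s * `|dline v g x|)).
    rewrite ler_wpM2r//; apply: le_trans b2; rewrite Hs.
    by rewrite le_eqVlt; apply/orP; left; apply/eqP; field.
  rewrite -{1}(gtr0_norm m0) -normrM H normrM gtr0_norm// -mulrA.
  by rewrite ler_wpM2l// ltW.
move=> H1; have kp : 0 < k * r * pi / 4 by rewrite divr_gt0// !mulr_gt0.
rewrite -(ler_pM2l kp); apply: le_trans H1 _.
rewrite le_eqVlt; apply/orP; left; apply/eqP; field; exact: lt0r_neq0.
Qed.

(** A substitute for Stirling's formula: [m^m] is at most the falling factorial of [2 m] of length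
    [m], that is [C(2m, m) m!], and [C(2m, m) <= 4^m]. *)
Lemma expnn_le_fact (m : nat) : (m ^ m <= 4 ^ m * m`!)%N.
Proof.
have H j : (j <= m -> m ^ j <= (m + m) ^_ j)%N.
  elim: j => // j IH jm; rewrite expnSr ffactnSr leq_mul ?IH ?(ltnW jm)//.
  by rewrite -addnBA ?(ltnW jm)// leq_addr.
apply: leq_trans (H m (leqnn m)) _; rewrite -bin_ffact leq_mul2r.
rewrite (_ : 4%N = (1 + 1) ^ 2)%N// -expnM mul2n -addnn expnDn.
rewrite (bigD1 (inord m : 'I_(m + m).+1))//= inordK ?ltnS ?leq_addr//.
by rewrite !exp1n !muln1 leq_addr orbT.
Qed.

Lemma meanv_iter (g : R * R -> R) (m : nat) : meanv k v D g -> meanv k v D (iter m (dline v) g).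
Proof. by move=> Hg; elim: m => // m IH; rewrite iterS; exact: meanv_step. Qed.

(** Each of the [m] derivatives is taken at the cost of shrinking the ball by [r / (m + 1)], hence
    with a factor [8 (m + 1) / r]; finally [(m + 1)^m <= 4^(m + 1) m!]. *)
Lemma meanv_iter_bound (g : R * R -> R) (x : R * R) (r B : R) (m : nat) :
  meanv k v D g -> 0 < r -> k * r <= 1 ->
  (forall y, `|y - x| < r -> D y /\ `|g y| <= B) ->
  `|iter m (dline v) g x| <= 4 * B * (32 / r) ^+ m * m`!%:R.
Proof.
move=> Hg r0 kr HB; pose M : R := m.+1%:R.
have M0 : 0 < M by rewrite ltr0n.
have H j : (j <= m)%N -> forall y, `|y - x| < r * (1 - j%:R / M) ->
    `|iter j (dline v) g y| <= (8 * M / r) ^+ j * B.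
  elim: j => [|j IH] jm y yx.
    by rewrite expr0 mul1r; have [] := HB y; move: yx; rewrite mul0r subr0 mulr1.
  have := @meanv_bound _ y (r / M) ((8 * M / r) ^+ j * B) (meanv_iter j Hg).
  rewrite -iterS => H; apply: le_trans (H _ _ _) _.
  - by rewrite divr_gt0.
  - apply: le_trans kr; rewrite ler_pM2l// ler_pdivrMr// ler_peMr ?(ltW r0)//.
    by rewrite /M ler1n.
  - move=> z zy; have zx : `|z - x| < r * (1 - j%:R / M).
      rewrite (_ : z - x = (z - y) + (y - x)); last by rewrite addrA subrK.
      apply: (le_lt_trans (ler_normD _ _)).
      have -> : r * (1 - j%:R / M) = r / M + r * (1 - j.+1%:R / M).
        by rewrite -natr1; field; exact: lt0r_neq0.
      exact: ltrD.
    split; last exact: (IH (ltnW jm)).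
    have [] := HB z => //; apply: lt_le_trans zx _.
    by rewrite ler_piMr ?(ltW r0)// gerBl divr_ge0// ler0n.
  rewrite exprS le_eqVlt; apply/orP; left; apply/eqP; field.
  by rewrite !lt0r_neq0.
have B0 : 0 <= B.
  have xx : `|x - x| < r by rewrite subrr normr0.
  by apply: le_trans (HB x xx).2.
have := H m (leqnn m) x; rewrite subrr normr0 => /(_ _)/le_trans; apply.
  by rewrite mulr_gt0// subr_gt0 ltr_pdivrMr// mul1r /M ltr_nat.
have E : M ^+ m <= 4 * 4 ^+ m * m`!%:R.
  rewrite /M -!natrX -!natrM ler_nat -expnS.
  have := expnn_le_fact m.+1; rewrite factS expnS; set a := (_ ^ m)%N; set b := (_ ^ _)%N.
  by rewrite mulnCA leq_pmul2l.
have -> : (8 * M / r) ^+ m = (8 / r) ^+ m * M ^+ m by rewrite -exprMn; congr (_ ^+ _); ring.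
have -> : 4 * B * (32 / r) ^+ m * m`!%:R = (8 / r) ^+ m * (4 * 4 ^+ m * m`!%:R) * B.
  have -> : (32 / r) ^+ m = (8 / r) ^+ m * 4 ^+ m by rewrite -exprMn; congr (_ ^+ _); ring.
  ring.
by apply: ler_wpM2r => //; apply: ler_wpM2l => //; rewrite exprn_ge0// divr_ge0// ltW.
Qed.

End meanvalue.

(** * The identity principle along segments and above a graph *)

Section identity.
Variables (R : realType) (k : R) (D : set (R * R)).
Hypotheses (k0 : 0 < k) (oD : open D).

(** One parameter governs both the width [r] of the tube and the bound [1 / r], so a single covering
    argument for [r -> 0] yields both. *)
Lemma compact_tube (K : set (R * R)) (g : R * R -> R) : compact K -> K `<=` D ->
  (forall x, D x -> {for x, continuous g}) ->
  exists2 r : R, 0 < r & forall x y, K x -> `|y - x| < r -> D y /\ `|g y| <= 1 / r.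
Proof.
move=> /compact_near_coveringP cK KD cg.
have := cK R (0^'+)%R (fun r x => forall y, `|y - x| < r -> D y /\ `|g y| <= 1 / r) _.
case=> [x Kx|d0 /= d00 Hd].
  have Dx := KD x Kx; have [e e0 He] := open_box oD Dx.
  have [d d0 Hd] := (continuous_epsP g x).1 (cg x Dx) 1 ltr01.
  pose B := `|g x| + 1; have B0 : 0 < B by rewrite ltr_wpDl.
  pose m := Num.min (Num.min e d) B^-1.
  have m0 : 0 < m by rewrite !lt_min e0 d0 invr_gt0.
  exists (ball x (m / 2), [set t | t < m / 2]) => /=.
    split; first by apply: nbhsx_ballx; rewrite divr_gt0.
    by apply: nbhs_right_lt; rewrite divr_gt0.
  move=> [z t] /= [+ tm] y yz; rewrite -ball_normE /= => xz.
  have t0 : 0 < t by apply: le_lt_trans yz.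
  have yx : `|y - x| < m.
    rewrite (_ : y - x = (y - z) + (z - x)); last by rewrite addrA subrK.
    rewrite (le_lt_trans (ler_normD _ _))// (splitr m) ltrD//.
      exact: lt_trans yz tm.
    by rewrite distrC.
  move: (yx); rewrite !lt_min -andbA => /and3P[ye yd _]; split; first exact: He.
  apply: (@le_trans _ _ B).
    have h1 := Hd y yd; have h2 := ler_normD (g x) (g y - g x).
    by move: h2; rewrite addrC subrK /B; lra.
  have : t <= B^-1.
    apply: ltW; apply: lt_le_trans tm _; apply: (@le_trans _ _ m).
      by rewrite ler_pdivrMr// ler_peMr ?ler1n// ltW.
    by rewrite ge_min lexx orbT.
  by rewrite div1r => H; rewrite -[B]invrK lef_pV2 ?posrE ?invr_gt0.
have d20 : 0 < d0 / 2 by rewrite divr_gt0.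
exists (d0 / 2) => // x y Kx; apply: (Hd (d0 / 2)) => //=.
by rewrite sub0r normrN gtr0_norm// ltr_pdivrMr// ltr_pMr// ltr1n.
Qed.

(** The rate may be any [A] above a threshold, so that several functions can be given a common rate
    before they are multiplied. *)
Lemma meanv_anseq (v : R * R) (g : R * R -> R) (x : R * R) (T : R) :
  v.1 ^+ 2 + v.2 ^+ 2 = 1 -> meanv k v D g ->
  (forall t, 0 <= t <= T -> D (line v x t)) ->
  exists2 C : R, 0 <= C & exists2 A0 : R, 0 < A0 & forall A, A0 <= A ->
    anseq 0 T C A (fun m t => iter m (dline v) g (line v x t)).
Proof.
move=> v1 Hg HD; pose K := (fun t : R => line v x t) @` `[0, T]%classic.
have cK : compact K.
  apply: (@continuous_compact R _ (fun t : R => line v x t)); last exact: segment_compact.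
  apply: continuous_in_subspaceT => t _; apply/cvgrPdist_lt => e e0.
  exists e => //= s hs.
  exact: le_lt_trans (line_dist v1 _ _ _) hs.
have KD : K `<=` D by move=> _ [t /= + <-]; rewrite in_itv /= => /HD.
have cg y : D y -> {for y, continuous g} by move=> /Hg[].
have [r r0 Hr] := compact_tube cK KD cg.
pose r' := Num.min r k^-1.
have r'0 : 0 < r' by rewrite lt_min r0 invr_gt0.
have kr' : k * r' <= 1.
  by rewrite -ler_pdivlMl// mulr1 ge_min lexx orbT.
exists (4 * (1 / r)); first by rewrite mulr_ge0// divr_ge0// ltW.
exists (32 / r') => [|A HA m t tT]; first by rewrite divr_gt0.
have Dl := HD t tT.
split; first exact: (meanv_line (meanv_iter k0 v1 oD m Hg) Dl).
apply: (@le_trans _ _ (4 * (1 / r) * (32 / r') ^+ m * m`!%:R)).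
  apply: (@meanv_iter_bound R k v D k0 v1 oD g (line v x t) r' (1 / r) m Hg r'0 kr') => y yx.
  apply: (Hr (line v x t)); first by exists t => //=; rewrite in_itv /=.
  by apply: lt_le_trans yx _; rewrite ge_min lexx.
rewrite ler_wpM2r ?ler0n// ler_wpM2l//.
  by rewrite mulr_ge0// divr_ge0// ltW.
by rewrite lerXn2r// nnegrE ?(le_trans _ HA)// divr_ge0// ltW.
Qed.

(** The difference of the squared moduli of [g1 + i g2] and [g3 + i g4]. *)
Definition sqsum (g1 g2 g3 g4 : R * R -> R) (x : R * R) : R :=
  g1 x ^+ 2 + g2 x ^+ 2 - (g3 x ^+ 2 + g4 x ^+ 2).

Lemma line_identity (v : R * R) (g1 g2 g3 g4 : R * R -> R) (x : R * R) (T e : R) :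
  v.1 ^+ 2 + v.2 ^+ 2 = 1 -> 0 < e ->
  meanv k v D g1 -> meanv k v D g2 -> meanv k v D g3 -> meanv k v D g4 ->
  (forall t, 0 <= t <= T -> D (line v x t)) ->
  (forall t, 0 <= t <= T -> t <= e -> sqsum g1 g2 g3 g4 (line v x t) = 0) ->
  forall t, 0 <= t <= T -> sqsum g1 g2 g3 g4 (line v x t) = 0.
Proof.
move=> v1 e0 H1 H2 H3 H4 HD H0.
have [C1 C10 [A1 A10 a1]] := meanv_anseq v1 H1 HD.
have [C2 C20 [A2 A20 a2]] := meanv_anseq v1 H2 HD.
have [C3 C30 [A3 A30 a3]] := meanv_anseq v1 H3 HD.
have [C4 C40 [A4 A40 a4]] := meanv_anseq v1 H4 HD.
pose A := A1 + A2 + A3 + A4.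
have A0 : 0 < A by rewrite /A !addr_gt0.
have {}a1 : anseq _ _ _ _ _ := a1 A _; have {}a2 : anseq _ _ _ _ _ := a2 A _.
have {}a3 : anseq _ _ _ _ _ := a3 A _; have {}a4 : anseq _ _ _ _ _ := a4 A _.
have {}a1 := a1 ltac:(rewrite /A; lra); have {}a2 := a2 ltac:(rewrite /A; lra).
have {}a3 := a3 ltac:(rewrite /A; lra); have {}a4 := a4 ltac:(rewrite /A; lra).
have s1 := anseq_mul C10 A0 C10 a1 a1; have s2 := anseq_mul C20 A0 C20 a2 a2.
have s3 := anseq_mul C30 A0 C30 a3 a3; have s4 := anseq_mul C40 A0 C40 a4 a4.
have s := anseqD (anseqD s1 s2) (anseqN (anseqD s3 s4)).
pose G m t := \sum_(i < m.+1) 'C(m, i)%:R * (iter i (dline v) g1 (line v x t) * iter (m - i) (dline v) g1 (line v x t))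
 + \sum_(i < m.+1) 'C(m, i)%:R * (iter i (dline v) g2 (line v x t) * iter (m - i) (dline v) g2 (line v x t))
 + - (\sum_(i < m.+1) 'C(m, i)%:R * (iter i (dline v) g3 (line v x t) * iter (m - i) (dline v) g3 (line v x t))
 + \sum_(i < m.+1) 'C(m, i)%:R * (iter i (dline v) g4 (line v x t) * iter (m - i) (dline v) g4 (line v x t))).
have E t : sqsum g1 g2 g3 g4 (line v x t) = G 0%N t.
  by rewrite /G !big_ord1 /= /sqsum !expr2 !mul1r.
have {}s : anseq 0 T (C1 * C1 + C2 * C2 + (C3 * C3 + C4 * C4)) (2 * A) G := s.
move=> t tT; rewrite E.
apply: (anseq_identity (C := (C1 * C1 + C2 * C2 + (C3 * C3 + C4 * C4))) _ _ e0 s) => //.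
- by rewrite !addr_ge0// mulr_ge0.
- by rewrite mulr_gt0.
- by move=> t' t'T; rewrite add0r => t'e; rewrite -E H0.
Qed.

End identity.

Section region.
Variables (R : realType) (k : R) (H : R -> R) (H0 : R).
Hypotheses (k0 : 0 < k) (cH : continuous H) (HH0 : forall x, H x <= H0).

Local Notation above := (domain_above H).

Lemma open_above : open above.
Proof.
rewrite openE => x; rewrite /above /= => Hx.
have d0 : 0 < (x.2 - H x.1) / 2 by rewrite divr_gt0// subr_gt0.
have [d dp Hd] := (continuous_epsP H x.1).1 (@cH x.1) _ d0.
apply/nbhs_ballP; exists (Num.min d ((x.2 - H x.1) / 2)) => /=; first by rewrite lt_min dp.
move=> y; rewrite -ball_normE /= distrC lt_min => /andP[].
rewrite !prod_norm_lt => /andP[y1 _] /andP[_]; have := Hd y.1 y1.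
rewrite !ltr_distl => /andP[_ h1] /andP[h2 _].
rewrite /above /=; lra.
Qed.

(** Every point above the graph is reached from the disc by three segments: up, sideways above the
    level [H0], and down. With [g3 = g4 = 0] this is unique continuation for the complex field
    [g1 + i g2]. *)
Lemma region_identity (g1 g2 g3 g4 : R * R -> R) (x0 : R * R) (e : R) :
  helm k above g1 -> helm k above g2 -> helm k above g3 -> helm k above g4 ->
  0 < e -> (forall x, `|x - x0| < e -> above x /\ sqsum g1 g2 g3 g4 x = 0) ->
  forall x, above x -> sqsum g1 g2 g3 g4 x = 0.
Proof.
move=> h1 h2 h3 h4 e0 Hx0; have oA := open_above.
have main (v x : R * R) (T e' : R) : v.1 ^+ 2 + v.2 ^+ 2 = 1 -> 0 < e' ->
  (forall t, 0 <= t <= T -> above (line v x t)) ->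
  (forall t, 0 <= t <= T -> t <= e' -> sqsum g1 g2 g3 g4 (line v x t) = 0) ->
  forall t, 0 <= t <= T -> sqsum g1 g2 g3 g4 (line v x t) = 0.
  by move=> v1 e'0; apply: (line_identity k0 oA v1 e'0); apply: helm_meanv.
have L (v x : R * R) t : line v x t = (x.1 + t * v.1, x.2 + t * v.2) by [].
have up x y : `|x - x0.1| < e -> x0.2 <= y -> sqsum g1 g2 g3 g4 (x, y) = 0.
  move=> xx y0; have e20 : 0 < e / 2 by rewrite divr_gt0.
  have l t : line (0, 1) (x, x0.2) t = (x, x0.2 + t) by rewrite L /=; congr pair; ring.
  have -> : (x, y) = line (0, 1) (x, x0.2) (y - x0.2) by rewrite l addrC subrK.
  apply: (main _ _ (y - x0.2) (e / 2)) => //=.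
  - by rewrite expr0n expr1n add0r.
  - move=> t /andP[t0 _]; have [] := Hx0 (x, x0.2).
      by rewrite prod_norm_lt /= xx subrr normr0.
    by rewrite l /above /= => h _; rewrite ltr_wpDr.
  - move=> t /andP[t0 _] te; rewrite l.
    have [] := Hx0 (x, x0.2 + t) => //.
    rewrite prod_norm_lt /= xx addrC addrA addNr add0r ger0_norm//; lra.
  - by rewrite subr_ge0 y0 lexx.
have far x y : x0.2 <= y -> H0 < y -> sqsum g1 g2 g3 g4 (x, y) = 0.
  move=> y0 Hy; have e20 : 0 < e / 2 by rewrite divr_gt0.
  have [xx|xx] := leP x0.1 x.
    have l t : line (1, 0) (x0.1, y) t = (x0.1 + t, y) by rewrite L /=; congr pair; ring.
    have -> : (x, y) = line (1, 0) (x0.1, y) (x - x0.1) by rewrite l addrC subrK.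
    apply: (main _ _ (x - x0.1) (e / 2)) => //=.
    - by rewrite expr0n expr1n addr0.
    - by move=> t _; rewrite l /above /= (le_lt_trans (HH0 _)).
    - move=> t /andP[t0 _] te; rewrite l; apply: up => //.
      rewrite addrC addrA addNr add0r ger0_norm//; lra.
    - by rewrite subr_ge0 xx lexx.
  have l t : line (-1, 0) (x0.1, y) t = (x0.1 - t, y) by rewrite L /=; congr pair; ring.
  have -> : (x, y) = line (-1, 0) (x0.1, y) (x0.1 - x) by rewrite l subKr.
  apply: (main _ _ (x0.1 - x) (e / 2)) => //=.
  - by rewrite expr0n sqrrN expr1n addr0.
  - by move=> t _; rewrite l /above /= (le_lt_trans (HH0 _)).
  - move=> t /andP[t0 _] te; rewrite l; apply: up => //.
    rewrite addrAC subrr sub0r normrN ger0_norm//; lra.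
  - by rewrite subr_ge0 ltW //= lexx.
move=> [x y] Hxy.
(* The margin [2] keeps the first unit of the descent above both [H0] and [x0.2], where [far]
   applies. *)
pose Y := Num.max (Num.max H0 x0.2) y + 2.
have Y1 : H0 + 2 <= Y by rewrite lerD2r !le_max lexx.
have Y2 : x0.2 + 2 <= Y by rewrite lerD2r !le_max lexx orbT.
have Y3 : y + 2 <= Y by rewrite lerD2r le_max lexx orbT.
have l t : line (0, -1) (x, Y) t = (x, Y - t) by rewrite L /=; congr pair; ring.
have -> : (x, y) = line (0, -1) (x, Y) (Y - y) by rewrite l subKr.
apply: (main _ _ (Y - y) 1) => //=.
- by rewrite expr0n sqrrN expr1n add0r.
- move=> t /andP[_ tY]; rewrite l /above /=.
  by apply: lt_le_trans Hxy _ => /=; lra.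
- move=> t /andP[t0 _] t1; rewrite l; apply: far; lra.
- by rewrite lexx andbT subr_ge0; lra.
Qed.

End region.

(** * Sine series *)

Section bernstein.
Variable R : realType.

(* The Bernstein operator, presented through the Pascal recursion so that no
   binomial sum has to be manipulated. *)
Fixpoint bern (n : nat) (f : nat -> R) (x : R) : R :=
  if n is m.+1 then x * bern m (fun k => f k.+1) x + (1 - x) * bern m f x else f 0%N.

Lemma bernB n f g x : bern n (fun k => f k - g k) x = bern n f x - bern n g x.
Proof. by elim: n f g => //= n IH f g; rewrite !IH; ring. Qed.

Lemma bern_cst n a x : bern n (fun=> a) x = a.
Proof. by elim: n => //= n ->; ring. Qed.

(** The mean [n x] and the variance [n x (1 - x)] of the binomial law, read off from the
    recursion. *)
Lemma bern_quad n (a b c x : R) :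
  bern n (fun k => a + b * k%:R + c * k%:R ^+ 2) x =
  a + b * (n%:R * x) + c * (n%:R * x * (1 - x) + (n%:R * x) ^+ 2).
Proof.
elim: n a b c => [|n IH] a b c /=; first by rewrite !mul0r; ring.
rewrite (_ : (fun k : nat => a + b * k.+1%:R + c * k.+1%:R ^+ 2) =
  fun k : nat => (a + b + c) + (b + 2 * c) * k%:R + c * k%:R ^+ 2); last first.
  by apply/funext => k; rewrite -natr1; ring.
by rewrite !IH -natr1; ring.
Qed.

Lemma bern_le n (f g : nat -> R) x : 0 <= x <= 1 ->
  (forall k, (k <= n)%N -> f k <= g k) -> bern n f x <= bern n g x.
Proof.
move=> /andP[x0 x1]; elim: n f g => [|n IH] f g fg /=; first exact: fg.
apply: lerD; apply: ler_wpM2l; rewrite ?subr_ge0//; apply: IH => k kn.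
  exact: fg.
by apply: fg; rewrite (leq_trans kn).
Qed.

(** Chebyshev's argument: the deviation is dominated by a quadratic polynomial in [k], on which the
    positive operator [bern] is explicit. *)
Lemma bern_approx n (f : nat -> R) (a e C x : R) : 0 <= x <= 1 -> 0 <= C ->
  (forall k, (k <= n.+1)%N -> `|a - f k| <= e + C * (x - k%:R / n.+1%:R) ^+ 2) ->
  `|a - bern n.+1 f x| <= e + C / n.+1%:R.
Proof.
move=> x01 C0 H; have [x0 x1] := andP x01.
have n0 : 0 < n.+1%:R :> R by rewrite ltr0n.
pose up k : R := (e + C * x ^+ 2) + (- (2 * C * x / n.+1%:R)) * k%:R + (C / n.+1%:R ^+ 2) * k%:R ^+ 2.
have upE k : e + C * (x - k%:R / n.+1%:R) ^+ 2 = up k.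
  by rewrite /up; field; exact: lt0r_neq0.
have Bup : bern n.+1 up x <= e + C / n.+1%:R.
  rewrite bern_quad.
  have -> : e + C * x ^+ 2 + - (2 * C * x / n.+1%:R) * (n.+1%:R * x) +
    C / n.+1%:R ^+ 2 * (n.+1%:R * x * (1 - x) + (n.+1%:R * x) ^+ 2) =
    e + C / n.+1%:R * (x * (1 - x)) by field; exact: lt0r_neq0.
  rewrite lerD2l ler_piMr ?divr_ge0 ?(ltW n0)//.
  by rewrite -[leRHS]mulr1 ler_pM ?subr_ge0// gerBl.
have aE : bern n.+1 (fun=> a) x = a := bern_cst _ _ _.
rewrite -{1}aE -bernB ler_norml; apply/andP; split.
  rewrite lerNl; apply: le_trans Bup.
  rewrite -sub0r -(bern_cst n.+1 0 x).
  rewrite -bernB; apply: bern_le => // k kn; rewrite sub0r -upE.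
  by apply: le_trans (H k kn); rewrite -normrN ler_norm.
apply: le_trans Bup; apply: bern_le => // k kn; rewrite -upE.
by apply: le_trans (H k kn); rewrite ler_norm.
Qed.

Definition sinpoly (q : R -> R) : Prop := exists N (c : nat -> R),
  forall t, q t = \sum_(j < N) c j * sin (j.+1%:R * t).

Lemma sinpoly_pad N M (c : nat -> R) : (N <= M)%N -> exists c' : nat -> R,
  forall t, \sum_(j < N) c j * sin (j.+1%:R * t) = \sum_(j < M) c' j * sin (j.+1%:R * t).
Proof.
move=> NM; exists (fun j => if (j < N)%N then c j else 0) => t.
rewrite (big_ord_widen M (fun j => c j * sin (j.+1%:R * t)))// big_mkcond /=.
by apply: eq_bigr => j _; case: ifP => // _; rewrite mul0r.
Qed.

Lemma sinpolyD q1 q2 : sinpoly q1 -> sinpoly q2 -> sinpoly (fun t => q1 t + q2 t).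
Proof.
move=> [N1 [c1 H1]] [N2 [c2 H2]].
have [d1 E1] := sinpoly_pad c1 (leq_maxl N1 N2).
have [d2 E2] := sinpoly_pad c2 (leq_maxr N1 N2).
exists (maxn N1 N2), (fun j => d1 j + d2 j) => t.
by rewrite H1 H2 E1 E2 -big_split /=; apply: eq_bigr => j _; rewrite mulrDl.
Qed.

Lemma sinpolyZ a q : sinpoly q -> sinpoly (fun t => a * q t).
Proof.
move=> [N [c H]]; exists N, (fun j => a * c j) => t.
by rewrite H mulr_sumr; apply: eq_bigr => j _; rewrite mulrA.
Qed.

Lemma sinpoly_ext q1 q2 : (forall t, q1 t = q2 t) -> sinpoly q1 -> sinpoly q2.
Proof. by move=> E [N [c H]]; exists N, c => t; rewrite -E. Qed.

Lemma sinpoly_sin j : sinpoly (fun t => sin (j%:R * t)).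
Proof.
case: j => [|j].
  by exists 0%N, (fun=> 0) => t; rewrite big_ord0 mul0r sin0.
exists j.+1, (fun i => (i == j)%:R) => t.
rewrite big_ord_recr /= eqxx mul1r big1 ?add0r// => i _.
by rewrite (ltn_eqF (ltn_ord i)) mul0r.
Qed.

Lemma sinpoly_cos q : sinpoly q -> sinpoly (fun t => q t * cos t).
Proof.
move=> [N [c H]].
apply: (@sinpoly_ext (fun t => \sum_(j < N) c j * sin (j.+1%:R * t) * cos t)).
  by move=> t; rewrite H mulr_suml.
elim: N {H} => [|N IH].
  by exists 0%N, c => t; rewrite !big_ord0.
apply: sinpoly_ext; last first.
  apply: sinpolyD IH (sinpolyZ (c N / 2) (sinpolyD (sinpoly_sin N.+2) (sinpoly_sin N))).
move=> t; rewrite big_ord_recr /=; congr (_ + _).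
have -> : N.+2%:R * t = N.+1%:R * t + t by rewrite -(natr1 N.+1); ring.
have -> : N%:R * t = N.+1%:R * t - t by rewrite -(natr1 N); ring.
by rewrite sinD sinB; field.
Qed.

(** Each step of the recursion multiplies by [(1 - cos t) / 2] or [(1 + cos t) / 2], and sine
    polynomials are stable under multiplication by [cos]. *)
Lemma sinpoly_bern q n f : sinpoly q ->
  sinpoly (fun t => q t * bern n f ((1 - cos t) / 2)).
Proof.
elim: n f q => [|n IH] f q Hq /=.
  by apply: sinpoly_ext (sinpolyZ (f 0%N) Hq) => t; rewrite mulrC.
have Hm := sinpolyD (sinpolyZ (1 / 2) Hq) (sinpolyZ (- (1 / 2)) (sinpoly_cos Hq)).
have Hp := sinpolyD (sinpolyZ (1 / 2) Hq) (sinpolyZ (1 / 2) (sinpoly_cos Hq)).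
apply: sinpoly_ext (sinpolyD (IH (fun k => f k.+1) _ Hm) (IH f _ Hp)) => t.
by field.
Qed.

Lemma sin_quarter (a : R) : 0 <= a <= pi / 2 -> a / 4 <= sin a.
Proof.
move=> /andP[a0 api]; have pi2 := @pihalf_lt2 R; have pi1 := @pihalf_ge1 R.
have [a1|a1] := leP a 1.
  by apply: le_trans (@sin_half R a _); [lra|rewrite a0].
have s1 : 1 / 2 <= sin (1 : R) by apply: sin_half; rewrite ler01 lexx.
have : sin 1 <= sin a.
  apply/ltW; rewrite ltr_sin ?in_itv /=; [done|apply/andP; split; lra|apply/andP; split; lra].
lra.
Qed.

Lemma sin_mono (x y : R) : - (pi / 2) <= x -> x <= y -> y <= pi / 2 -> sin x <= sin y.
Proof.
move=> hx; rewrite le_eqVlt => /predU1P[->//|xy] hy.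
by rewrite ltW// ltr_sin ?in_itv /=; [done|apply/andP; split; lra|apply/andP; split; lra].
Qed.

(** Quantitative injectivity of [cos] on [[0, pi]]: with half distance [a] and midpoint [m],
    [cos t - cos p = 2 sin m sin a] and [sin m >= sin a >= a / 4]. *)
Lemma cos_dist (t p : R) : 0 <= t <= pi -> 0 <= p <= pi ->
  (t - p) ^+ 2 <= 32 * `|cos t - cos p|.
Proof.
wlog tp : t p / t <= p => [W|] ht hp.
  have [|/ltW pt] := leP t p; first by move=> tp; exact: W.
  by rewrite -sqrrN opprB distrC; exact: W.
have [t0 tpi] := andP ht; have [p0 ppi] := andP hp.
have [a Ea] : exists a, a = (p - t) / 2 by eexists.
have [m Em] : exists m, m = (p + t) / 2 by eexists.
have a0 : 0 <= a <= pi / 2 by apply/andP; split; lra.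
have sa := sin_quarter a0; have [a00 api] := andP a0.
have pi0 := @pi_gt0 R.
have sm : sin a <= sin m.
  have [mpi|mpi] := leP m (pi / 2); first by apply: sin_mono; lra.
  have -> : sin m = sin (pi - m) by rewrite sinB sinpi cospi; ring.
  by apply: sin_mono; lra.
have -> : cos t - cos p = 2 * (sin m * sin a).
  have -> : t = m - a by rewrite Em Ea; field.
  have -> : p = m + a by rewrite Em Ea; field.
  by rewrite cosB cosD; ring.
apply: le_trans (ler_wpM2l _ (ler_norm _)) => //.
have -> : (t - p) ^+ 2 = 64 * ((a / 4) * (a / 4)) by rewrite Ea; field.
have : (a / 4) * (a / 4) <= sin m * sin a.
  apply: ler_pM => //; try lra.
lra.
Qed.

Lemma unif_bernstein (G : R -> R) (e : R) : ctsI 0 pi G -> 0 < e ->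
  exists n f, forall t, 0 <= t <= pi ->
    `|G t - bern n f ((1 - cos t) / 2)| <= e.
Proof.
move=> cG e0; have pi0 := @pi_ge0 R.
have e20 : 0 < e / 2 by rewrite divr_gt0.
have cK := @segment_compact R 0 pi.
have cG' x : `[0, pi]%classic x -> {for x, continuous G}.
  by rewrite /= in_itv /= => /cG.
have [d d0 Hd] := heine cK cG' e20.
have [M M0 HM] := compact_abs_bound cK cG'.
(* For [|t - p| >= d], [d^4 <= (32 |cos t - cos p|)^2 = 64^2 (x - y)^2] in the variables [x, y] of
   the Bernstein polynomial; the trivial bound [2 M] is then below [C (x - y)^2]. *)
pose C := 2 * M / d ^+ 4 * 64 ^+ 2.
have C0 : 0 <= C.
  by rewrite /C mulr_ge0 ?exprn_ge0// mulr_ge0 ?mulr_ge0// invr_ge0 exprn_ge0// ltW.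
pose n := Num.bound (C / (e / 2)).
have Cn : C / n.+1%:R <= e / 2.
  rewrite ler_pdivrMr ?ltr0n// -ler_pdivrMl//.
  have := archi_boundP (divr_ge0 C0 (ltW e20)); rewrite [ltLHS]mulrC => H.
  by apply: le_trans (ltW H) _; rewrite ler_nat.
pose f k := G (acos (1 - 2 * (k%:R / n.+1%:R))).
exists n.+1, f => t ht; have [t0 tpi] := andP ht.
have c1 := cos_le1 t; have c2 := cos_geN1 t.
have x01 : 0 <= (1 - cos t) / 2 <= 1 by apply/andP; split; lra.
suff Hk k : (k <= n.+1)%N ->
    `|G t - f k| <= e / 2 + C * ((1 - cos t) / 2 - k%:R / n.+1%:R) ^+ 2.
  apply: le_trans (bern_approx x01 C0 Hk) _.
  by rewrite [leRHS](splitr e) lerD2l.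
move=> kn; pose y : R := k%:R / n.+1%:R.
have y0 : 0 <= y by rewrite divr_ge0 ?ler0n.
have y1 : y <= 1 by rewrite ler_pdivrMr ?ltr0n// mul1r ler_nat.
have hy : -1 <= 1 - 2 * y <= 1 by apply/andP; split; lra.
have hp : 0 <= acos (1 - 2 * y) <= pi by rewrite acos_ge0// acos_lepi.
rewrite /f -/y; set p := acos _ in hp *.
have cp : cos p = 1 - 2 * y by apply: acosK; rewrite in_itv /=.
have dist := cos_dist ht hp; rewrite cp in dist.
have [tpd|tpd] := ltP `|t - p| d.
  apply: le_trans (ltW (Hd p t _ tpd)) _; first by rewrite /= in_itv.
  by rewrite lerDl mulr_ge0// sqr_ge0.
apply: (@le_trans _ _ (2 * M)).
  apply: (le_trans (ler_normB _ _)); rewrite mulr_natl mulr2n.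
  by apply: lerD; apply: HM; rewrite /= in_itv.
apply: (@le_trans _ _ (C * ((1 - cos t) / 2 - y) ^+ 2)); last by rewrite lerDr ltW.
have d4 : d ^+ 4 <= 64 ^+ 2 * ((1 - cos t) / 2 - y) ^+ 2.
  apply: (@le_trans _ _ ((t - p) ^+ 2 * (t - p) ^+ 2)).
    rewrite -(@real_normK _ (t - p)) ?num_real// -exprD.
    by rewrite lerXn2r// nnegrE ltW.
  apply: le_trans (ler_pM (sqr_ge0 _) (sqr_ge0 _) dist dist) _.
  have -> : 32 * `|cos t - (1 - 2 * y)| * (32 * `|cos t - (1 - 2 * y)|) = 32 ^+ 2 * `|cos t - (1 - 2 * y)| ^+ 2 by ring.
  by rewrite real_normK ?num_real// le_eqVlt; apply/orP; left; apply/eqP; field.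
have d4p : 0 < d ^+ 4 by rewrite exprn_gt0.
rewrite /C -mulrA mulrAC ler_pdivlMr//.
by rewrite ler_wpM2l// mulr_ge0.
Qed.

End bernstein.

(** * Orthogonality of sines, Bessel and Parseval *)

Section parseval.
Variable R : realType.

Lemma sin_nat_pi n : sin (n%:R * pi : R) = 0.
Proof.
elim: n => [|n IH]; first by rewrite mul0r sin0.
by rewrite -natr1 mulrDl mul1r sinD IH sinpi mul0r mulr0 addr0.
Qed.

Lemma sin_orth (m n : nat) :
  itg 0 pi (fun t : R => sin (m.+1%:R * t) * sin (n.+1%:R * t)) =
  if m == n then pi / 2 else 0.
Proof.
have pi0 := @pi_ge0 R; case: eqVneq => [->|mn].
  pose F (t : R) := t / 2 - sin (n.+1%:R * t) * cos (n.+1%:R * t) / (2 * n.+1%:R).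
  have n0 : n.+1%:R != 0 :> R by rewrite pnatr_eq0.
  have dF (t : R) : is_derive t 1 F (sin (n.+1%:R * t) * sin (n.+1%:R * t)).
    rewrite /F; drvR; have := cos2Dsin2 (n.+1%:R * t).
    set C := cos _; set S := sin _ => E.
    have C2 : C * C = 1 - S * S by rewrite -E; ring.
    set N := n.+1%:R in n0 *.
    transitivity (1 / 2 - (C * C - S * S) / 2); first by field.
    by rewrite C2; field.
  rewrite (itg_FTC2 pi0 _ (fun t _ => dF t)); last by move=> t _; ct.
  by rewrite /F sin_nat_pi mulr0 sin0; field.
set a : R := m.+1%:R; set b : R := n.+1%:R.
have ab : a - b != 0 by rewrite subr_eq0 eqr_nat.
have ab' : a + b != 0 by rewrite -natrD pnatr_eq0.
pose F (t : R) := (sin (a * t) * cos (b * t) - cos (a * t) * sin (b * t)) / (2 * (a - b))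
  - (sin (a * t) * cos (b * t) + cos (a * t) * sin (b * t)) / (2 * (a + b)).
have dF (t : R) : is_derive t 1 F (sin (a * t) * sin (b * t)).
  by rewrite /F; clearbody a b; drvR; field; rewrite ?ab ?ab'.
rewrite (itg_FTC2 pi0 _ (fun t _ => dF t)); last by move=> t _; ct.
by rewrite /F !sin_nat_pi !mulr0 sin0; ring.
Qed.

(** Not normalised, and shifted by one: index [n] stands for the frequency [n + 1]. *)
Definition scoef (f : R -> R) (n : nat) : R := itg 0 pi (fun t => f t * sin (n.+1%:R * t)).

Lemma ct_sinn (n : nat) (t : R) : {for t, continuous (fun t : R => sin (n.+1%:R * t))}.
Proof. by ct. Qed.

Lemma ctsI_sinsum N (c : nat -> R) : ctsI 0 pi (fun t => \sum_(j < N) c j * sin (j.+1%:R * t)).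
Proof.
have H i : ctsI 0 pi (fun t : R => c i * sin (i.+1%:R * t)).
  by apply: ctsIZ => t _; exact: ct_sinn.
exact: (@ctsI_sum R 0 pi N (fun i t => c i * sin (i.+1%:R * t)) H).
Qed.

Lemma itg_sub_sinsum (f : R -> R) N (c : nat -> R) : ctsI 0 pi f ->
  itg 0 pi (fun t => (f t - \sum_(j < N) c j * sin (j.+1%:R * t)) ^+ 2) =
  itg 0 pi (fun t => f t ^+ 2) - 2 * \sum_(j < N) c j * scoef f j
    + pi / 2 * \sum_(j < N) c j ^+ 2.
Proof.
move=> cf; elim: N => [|N IH].
  rewrite !big_ord0 !mulr0 subr0 addr0; apply: eq_itg => t _.
  by rewrite big_ord0 subr0.
pose q t := \sum_(j < N) c j * sin (j.+1%:R * t).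
have cq : ctsI 0 pi q := @ctsI_sinsum N c.
have cs : ctsI 0 pi (fun t : R => sin (N.+1%:R * t)) by move=> t _; exact: ct_sinn.
have cfq := ctsIB cf cq.
have qs : itg 0 pi (fun t => q t * sin (N.+1%:R * t)) = 0.
  rewrite (@eq_itg _ _ _ _ (fun t => \sum_(j < N) c j * (sin (j.+1%:R * t) * sin (N.+1%:R * t)))).
    have H i : ctsI 0 pi (fun t : R => c i * (sin (i.+1%:R * t) * sin (N.+1%:R * t))).
      by move=> t _; ct.
    rewrite (@itg_sum R 0 pi N (fun i t => c i * (sin (i.+1%:R * t) * sin (N.+1%:R * t))) H).
    rewrite big1// => i _; rewrite itgZ; last by move=> t _; ct.
    by rewrite sin_orth (ltn_eqF (ltn_ord i)) mulr0.
  by move=> t _; rewrite /q mulr_suml; apply: eq_bigr => j _; rewrite mulrA.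
rewrite (@eq_itg _ _ _ _ (fun t => (f t - q t) ^+ 2 + ((- 2 * c N) * ((f t - q t) * sin (N.+1%:R * t))
   + c N ^+ 2 * (sin (N.+1%:R * t) * sin (N.+1%:R * t))))); last first.
  by move=> t _; rewrite big_ord_recr /= -/(q t); ring.
rewrite itgD; [|exact: ctsIX|]; last first.
  by apply: ctsID; apply: ctsIZ; exact: ctsIM.
rewrite itgD; [|by apply: ctsIZ; exact: ctsIM|by apply: ctsIZ; exact: ctsIM].
rewrite !itgZ; [|exact: ctsIM|exact: ctsIM].
rewrite IH sin_orth eqxx.
have -> : itg 0 pi (fun t => (f t - q t) * sin (N.+1%:R * t)) = scoef f N.
  rewrite (@eq_itg _ _ _ _ (fun t => f t * sin (N.+1%:R * t) - q t * sin (N.+1%:R * t))).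
    by rewrite itgB ?qs ?subr0//; exact: ctsIM.
  by move=> t _; rewrite mulrBl.
by rewrite !big_ord_recr /=; ring.
Qed.

(** The squared distance is nonnegative at its minimiser, whose coefficients are [2 / pi] times
    [scoef f j]. *)
Lemma bessel (f : R -> R) N : ctsI 0 pi f ->
  \sum_(j < N) scoef f j ^+ 2 <= pi / 2 * itg 0 pi (fun t => f t ^+ 2).
Proof.
move=> cf; have pi0 := @pi_gt0 R.
have := itg_sub_sinsum N (fun j => 2 / pi * scoef f j) cf.
set S := \sum_(j < N) scoef f j ^+ 2.
have -> : \sum_(j < N) 2 / pi * scoef f j * scoef f j = 2 / pi * S.
  by rewrite mulr_sumr; apply: eq_bigr => j _; ring.
have -> : \sum_(j < N) (2 / pi * scoef f j) ^+ 2 = (2 / pi) ^+ 2 * S.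
  by rewrite mulr_sumr; apply: eq_bigr => j _; ring.
have H : 0 <= itg 0 pi (fun t => (f t - \sum_(j < N) 2 / pi * scoef f j * sin (j.+1%:R * t)) ^+ 2).
  by apply: itg_ge0 => t _; exact: sqr_ge0.
move=> E; move: H; rewrite E.
have -> : itg 0 pi (fun t => f t ^+ 2) - 2 * (2 / pi * S) + pi / 2 * ((2 / pi) ^+ 2 * S)
  = itg 0 pi (fun t => f t ^+ 2) - 2 / pi * S.
  have key (I P : R) : 0 < P -> I - 2 * (2 / P * S) + P / 2 * ((2 / P) ^+ 2 * S) = I - 2 / P * S.
    by move=> P0; field; exact: lt0r_neq0.
  exact: key.
rewrite subr_ge0 => H; have p2 : 0 < pi / 2 :> R by rewrite divr_gt0.
have := ler_wpM2l (ltW p2) H; apply: le_trans.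
rewrite le_eqVlt; apply/orP; left; apply/eqP.
move: (pi) (pi0) => P P0; field; exact: lt0r_neq0.
Qed.

(* Divide by [sin], and approximate the quotient by Bernstein polynomials in
   [cos]. *)
Lemma sine_density (f : R -> R) (e : R) : ctsI 0 pi f -> f 0 = 0 -> f pi = 0 -> 0 < e ->
  exists2 q, sinpoly q & forall t, 0 <= t <= pi -> `|f t - q t| <= e.
Proof.
move=> cf f0 fpi e0; have pi0 := @pi_gt0 R; have pi1 := @pihalf_ge1 R.
have e20 : 0 < e / 2 by rewrite divr_gt0.
have cK' x : `[0, pi]%classic x -> {for x, continuous f}.
  by rewrite /= in_itv /= => /cf.
have [M M0 HM] := compact_abs_bound (@segment_compact R 0 pi) cK'.
have [d1 d10 H1] := (continuous_epsP f 0).1 (cf 0 ltac:(by rewrite lexx ltW)) _ e20.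
have [d2 d20 H2] := (continuous_epsP f pi).1 (cf pi ltac:(by rewrite lexx ltW)) _ e20.
pose eta := Num.min (1 / 2) (Num.min (d1 / 2) (d2 / 2)).
have eta0 : 0 < eta by rewrite !lt_min !divr_gt0.
have eta1 : eta <= 1 / 2 by rewrite ge_min lexx.
have etad1 : eta <= d1 / 2 by rewrite !ge_min lexx orbT.
have etad2 : eta <= d2 / 2 by rewrite !ge_min lexx !orbT.
have ends t : 0 <= t <= pi -> t <= eta \/ pi - eta <= t -> `|f t| <= e / 2.
  move=> /andP[t0 tpi] [te|te].
    by have := H1 t; rewrite f0 !subr0 ger0_norm// => H; apply/ltW/H; lra.
  have := H2 t; rewrite fpi !subr0 ler0_norm ?subr_le0// => H; apply/ltW/H; lra.
pose sg := sin eta.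
have sg0 : 0 < sg.
  have : eta / 2 <= sg by apply: sin_half; apply/andP; split; lra.
  lra.
have mid t : eta <= t -> t <= pi - eta -> sg <= sin t.
  move=> te tpe; have [h|h] := leP t (pi / 2).
    by apply: sin_mono => //; lra.
  have -> : sin t = sin (pi - t) by rewrite sinB sinpi cospi; ring.
  by apply: sin_mono; lra.
(* [del] keeps the quotient continuous at [0] and [pi]. The resulting error [f del / (sin^2 + del)]
   is small near the ends because [f] is, and elsewhere because [sin >= sg] and
   [M del <= sg^2 e / 2]. *)
pose del := Num.min 1 (sg ^+ 2 * (e / 2) / (M + 1)).
have M1 : 0 < M + 1 by rewrite ltr_wpDl.
have del0 : 0 < del by rewrite lt_min ltr01 divr_gt0// mulr_gt0// exprn_gt0.
have delM : M * del <= sg ^+ 2 * (e / 2).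
  apply: (@le_trans _ _ ((M + 1) * del)); first by rewrite ler_wpM2r ?(ltW del0)// lerDl.
  by rewrite -ler_pdivlMl// mulrC ge_min lexx orbT.
have den t : 0 < sin t ^+ 2 + del by rewrite ltr_wpDl// sqr_ge0.
pose G t := f t * sin t / (sin t ^+ 2 + del).
have cG : ctsI 0 pi G.
  move=> t ht; have ft := cf t ht; rewrite /G.
  apply: ctM; first by ct.
  by apply: ct_inv; [exact: lt0r_neq0|ct].
have [n [g Hg]] := unif_bernstein cG e20.
exists (fun t => sin t * bern n g ((1 - cos t) / 2)).
  apply: sinpoly_bern; apply: sinpoly_ext (sinpoly_sin R 1) => t.
  by rewrite mul1r.
move=> t ht; have [t0 tpi] := andP ht.
have -> : f t - sin t * bern n g ((1 - cos t) / 2) =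
   f t * (del / (sin t ^+ 2 + del)) + sin t * (G t - bern n g ((1 - cos t) / 2)).
  rewrite /G; field; exact: lt0r_neq0.
apply: (le_trans (ler_normD _ _)); rewrite (splitr e); apply: lerD; last first.
  rewrite normrM -[leRHS]mul1r; apply: ler_pM => //; [exact: sin_max|exact: Hg].
rewrite normrM [`|del / _|]ger0_norm; last by rewrite divr_ge0// ltW.
have [te|te] := leP t eta.
  apply: (@le_trans _ _ `|f t|); last by apply: ends => //; left.
  by rewrite ler_piMr// ler_pdivrMr// mul1r lerDr sqr_ge0.
have [tpe|tpe] := leP (pi - eta) t.
  apply: (@le_trans _ _ `|f t|); last by apply: ends => //; right.
  by rewrite ler_piMr// ler_pdivrMr// mul1r lerDr sqr_ge0.
have st := mid t (ltW te) (ltW tpe).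
rewrite mulrA ler_pdivrMr//.
apply: (@le_trans _ _ (M * del)).
  by rewrite ler_wpM2r ?(ltW del0)//; apply: HM; rewrite /= in_itv.
apply: le_trans delM _; rewrite mulrC ler_wpM2l ?(ltW e20)//.
apply: (@le_trans _ _ (sin t ^+ 2)); last by rewrite lerDl ltW.
by rewrite lerXn2r// nnegrE ?(ltW sg0)// (le_trans _ st)// ltW.
Qed.

(** Take a uniformly close sine polynomial. In the formula for the squared distance each of its
    coefficients [c] enters through [2 c I - (pi / 2) c^2], which is at most [(2 / pi) I^2] with [I]
    the coefficient of [f]. *)
Lemma parseval_le (f : R -> R) (C : R) : ctsI 0 pi f -> f 0 = 0 -> f pi = 0 ->
  (forall N, \sum_(j < N) scoef f j ^+ 2 <= C) ->
  itg 0 pi (fun t => f t ^+ 2) <= 2 / pi * C.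
Proof.
move=> cf f0 fpi HC; have pi0 := @pi_gt0 R.
apply/ler_addgt0Pl => e e0.
pose e1 := Num.min 1 (e / pi); have e10 : 0 < e1 by rewrite lt_min ltr01 divr_gt0.
have [q [N [c Hq]] Hfq] := sine_density cf f0 fpi e10.
have E := itg_sub_sinsum N c cf.
have cr : ctsI 0 pi (fun t => f t - \sum_(j < N) c j * sin (j.+1%:R * t)).
  by apply: ctsIB => //; exact: ctsI_sinsum.
have H1 : itg 0 pi (fun t => (f t - \sum_(j < N) c j * sin (j.+1%:R * t)) ^+ 2) <= e.
  apply: (@le_trans _ _ (e1 ^+ 2 * (pi - 0))).
    apply: le_trans (ler_norm _) _; apply: itg_bound; [exact: ltW|exact: ctsIX|].
    move=> t ht; rewrite normrX lerXn2r ?nnegrE ?normr_ge0 ?(ltW e10)//.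
    by rewrite -Hq; exact: Hfq.
  rewrite subr0 -ler_pdivlMr// expr2; apply: (@le_trans _ _ (1 * e1)).
    by rewrite ler_wpM2r ?(ltW e10)// ge_min lexx.
  by rewrite mul1r ge_min lexx orbT.
have H2 : \sum_(j < N) (2 * (c j * scoef f j) - pi / 2 * c j ^+ 2) <= \sum_(j < N) 2 / pi * scoef f j ^+ 2.
  apply: ler_sum => j _; rewrite -subr_ge0.
  have -> : 2 / pi * scoef f j ^+ 2 - (2 * (c j * scoef f j) - pi / 2 * c j ^+ 2) =
    pi / 2 * (c j - 2 / pi * scoef f j) ^+ 2.
    move: (scoef f j) (pi) (pi0) => I P P0; field; exact: lt0r_neq0.
  by rewrite mulr_ge0 ?sqr_ge0// divr_ge0// ltW.
rewrite sumrB -!mulr_sumr in H2.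
have p2 : 0 <= 2 / pi :> R by rewrite divr_ge0// ltW.
have := ler_wpM2l p2 (HC N); lra.
Qed.

End parseval.

(** * Angular modes *)

Section limits_of_ode.
Variable R : realType.

Lemma double_antiderivative (q : R -> R) (a b s1 s2 : R) : ctsI a b q ->
  a < s1 -> s1 <= s2 -> s2 < b -> exists Q1 Q2, forall s, s1 <= s <= s2 ->
    is_derive s 1 Q2 (Q1 s) /\ is_derive s 1 Q1 (q s).
Proof.
move=> cq as1 s12 s2b.
pose a' := (a + s1) / 2; pose b' := (s2 + b) / 2.
have a1 : a < a' by rewrite /a'; lra.
have a2 : a' < s1 by rewrite /a'; lra.
have b1 : b' < b by rewrite /b'; lra.
have b2 : s2 < b' by rewrite /b'; lra.
pose Q1 t := itg a t q; pose Q2 t := itg a' t Q1.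
have dQ1 s : a < s < b -> is_derive s 1 Q1 (q s) by move=> /(itg_FTC1 cq).
have cQ1 : ctsI a' b' Q1.
  move=> t /andP[t1 t2]; apply: (is_derive_continuous (dQ1 t _)).
  by apply/andP; split; lra.
exists Q1, Q2 => s /andP[h1 h2]; split.
  by apply: (itg_FTC1 cQ1); apply/andP; split; lra.
by apply: dQ1; apply/andP; split; lra.
Qed.

Lemma near_affine (z z1 z2 : R -> R) (s1 s2 e : R) : s1 < s2 ->
  (forall s, s1 <= s <= s2 -> is_derive s 1 z (z1 s) /\ is_derive s 1 z1 (z2 s)) ->
  (forall s, s1 <= s <= s2 -> `|z2 s| <= e) ->
  forall s, s1 <= s <= s2 ->
    `|z s - z s1 - (s - s1) / (s2 - s1) * (z s2 - z s1)| <= e * (s2 - s1) ^+ 2.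
Proof.
move=> s12 Hd He s hs; have [hs1 hs2] := andP hs.
have dz t : s1 <= t <= s2 -> is_derive t 1 z (z1 t) by move=> /Hd[].
have dz1 t : s1 <= t <= s2 -> is_derive t 1 z1 (z2 t) by move=> /Hd[].
have I1 : s1 <= s1 <= s2 by rewrite lexx ltW.
have I2 : s1 <= s2 <= s2 by rewrite lexx ltW.
have [c hc ->] := mvt_itv dz I1 I2; have [c' hc' ->] := mvt_itv dz I1 hs.
have -> : z1 c' * (s - s1) - (s - s1) / (s2 - s1) * (z1 c * (s2 - s1)) =
   (z1 c' - z1 c) * (s - s1) by field; rewrite subr_eq0 gt_eqF.
have e0 : 0 <= e by apply: le_trans (He _ I1).
rewrite normrM (ger0_norm (_ : 0 <= s - s1)) ?subr_ge0// expr2 mulrA.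
apply: ler_pM => //; rewrite ?subr_ge0//; last by rewrite lerD2r.
apply: (le_trans (mvt_le dz1 He hc hc')); rewrite ler_wpM2l//.
by rewrite ler_norml; apply/andP; split; lra.
Qed.

(** Subtracting a double antiderivative [Q2] of [c A] leaves approximations with small second
    derivative, hence nearly affine. So [A - Q2] is affine, and [A] inherits two derivatives from
    [Q2] although only uniform closeness of [y] to [A] is given. *)
Lemma ode2_limit (A c : R -> R) (a b s1 s2 : R) :
  ctsI a b A -> ctsI a b c -> a < s1 -> s1 < s2 -> s2 < b ->
  (forall e, 0 < e -> exists y y1 y2 : R -> R, forall s, s1 <= s <= s2 ->
    [/\ is_derive s 1 y (y1 s), is_derive s 1 y1 (y2 s), `|y s - A s| <= e
      & `|y2 s - c s * A s| <= e]) ->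
  exists A1, forall s, s1 < s < s2 ->
    is_derive s 1 A (A1 s) /\ is_derive s 1 A1 (c s * A s).
Proof.
move=> cA cc as1 s12 s2b H.
have [Q1 [Q2 HQ]] := double_antiderivative (ctsIM cc cA) as1 (ltW s12) s2b.
pose B s := A s - Q2 s.
have I1 : s1 <= s1 <= s2 by rewrite lexx ltW.
have I2 : s1 <= s2 <= s2 by rewrite lexx ltW.
have s21 : 0 < s2 - s1 by rewrite subr_gt0.
have aff s : s1 <= s <= s2 -> B s = B s1 + (s - s1) / (s2 - s1) * (B s2 - B s1).
  move=> hs; have [hs1 hs2] := andP hs.
  apply/eqP; rewrite -subr_eq0 -normr_le0; apply/ler_addgt0Pl => e e0; rewrite addr0.
  (* The square is the cost of [near_affine]; the [4] counts the replacements of [z] by [B] at [s],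
     at [s2] and twice at [s1]. *)
  have P0 : 0 < (s2 - s1) ^+ 2 + 4 by rewrite ltr_wpDl// sqr_ge0.
  have e1 : 0 < e / ((s2 - s1) ^+ 2 + 4) by rewrite divr_gt0.
  have [y [y1 [y2 Hy]]] := H _ e1.
  pose z s := y s - Q2 s; pose z1 s := y1 s - Q1 s; pose z2 s := y2 s - c s * A s.
  have dz t : s1 <= t <= s2 -> is_derive t 1 z (z1 t) /\ is_derive t 1 z1 (z2 t).
    move=> ht; have [d1 d2 _ _] := Hy t ht; have [d3 d4] := HQ t ht.
    by split; [exact: dB|exact: dB].
  have z2e t : s1 <= t <= s2 -> `|z2 t| <= e / ((s2 - s1) ^+ 2 + 4) by move=> /Hy[].
  have := near_affine s12 dz z2e hs.
  have zB t : s1 <= t <= s2 -> `|B t - z t| <= e / ((s2 - s1) ^+ 2 + 4).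
    by move=> ht; have [_ _ h _] := Hy t ht; rewrite /B /z opprB addrA subrK distrC.
  have h0 := zB _ hs; have h1 := zB _ I1; have h2 := zB _ I2.
  set d := e / _ in h0 h1 h2 *; set la := (s - s1) / (s2 - s1).
  have la0 : 0 <= la by rewrite divr_ge0 ?subr_ge0// ltW.
  have la1 : la <= 1 by rewrite ler_pdivrMr// mul1r lerD2r.
  have eE : e = d * (s2 - s1) ^+ 2 + 4 * d.
    by rewrite /d; field; exact: lt0r_neq0.
  move=> h3.
  have -> : B s - (B s1 + la * (B s2 - B s1)) =
    (z s - z s1 - la * (z s2 - z s1)) + ((B s - z s) - (B s1 - z s1) - la * (B s2 - z s2) + la * (B s1 - z s1)) by ring.
  rewrite eE; apply: (le_trans (ler_normD _ _)); apply: lerD => //.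
  have lz t : `|B t - z t| <= d -> `|la * (B t - z t)| <= d.
    by move=> h; rewrite normrM (ger0_norm la0) -[leRHS]mul1r; apply: ler_pM.
  have -> : 4 * d = d + d + d + d by ring.
  apply: (le_trans (ler_normD _ _)); apply: lerD; last exact: lz.
  apply: (le_trans (ler_normB _ _)); apply: lerD; last exact: lz.
  by apply: (le_trans (ler_normB _ _)); apply: lerD.
pose A1 s := (B s2 - B s1) / (s2 - s1) + Q1 s.
exists A1 => s /andP[h1 h2]; have hs : s1 <= s <= s2 by rewrite !ltW.
have [dQ2 dQ1] := HQ s hs.
split; last by rewrite /A1; drvR; rewrite add0r.
have e0 : 0 < Num.min (s - s1) (s2 - s) by rewrite lt_min !subr_gt0 h1.
apply: (@is_derive_near_eq R (fun s => B s1 + (s - s1) / (s2 - s1) * (B s2 - B s1) + Q2 s) A s _ _ e0).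
  move=> y; rewrite lt_min => /andP[y1 y2].
  have ny := ler_norm (y - s); have ny' := ler_norm (s - y); rewrite distrC in ny'.
  rewrite -aff; first by rewrite /B subrK.
  by apply/andP; split; lra.
by drvR; rewrite /A1; field; exact: lt0r_neq0.
Qed.

End limits_of_ode.

(** * Sine modes of a solution vanishing on the axis *)

Section half_annulus.
Variable R : realType.

Definition upper (a : R) : set (R * R) := [set x | 0 < x.2 /\ a ^+ 2 < x.1 ^+ 2 + x.2 ^+ 2].

Definition ext (u : R * R -> R) (x : R * R) : R := if 0 < x.2 then u x else 0.

(** The Dirichlet condition on the axis outside the disc, in its weakest form: the extension by zero
    is continuous. *)
Definition ext_cts (a : R) (u : R * R -> R) : Prop :=
  forall x : R * R, a ^+ 2 < x.1 ^+ 2 + x.2 ^+ 2 -> {for x, continuous (ext u)}.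

(** As a function of [s = ln r]; index [n] stands for the frequency [n + 1]. *)
Definition sinmode (u : R * R -> R) (n : nat) : R -> R :=
  polT (ext u) (fun t => sin (n.+1%:R * t)) (0, 0) 0 pi.

Definition amode u n : R -> R := 'D_1 (sinmode u n).

Lemma open_upper a : open (upper a).
Proof.
have c1 x : {for x, continuous (fun x : R * R => x.1 ^+ 2 + x.2 ^+ 2)} by ct.
have c2 x : {for x, continuous (fun x : R * R => x.2)} by ct.
have -> : upper a = (fun x : R * R => x.2) @^-1` [set y | 0 < y] `&`
   (fun x : R * R => x.1 ^+ 2 + x.2 ^+ 2) @^-1` [set y | a ^+ 2 < y].
  by apply/seteqP; split.
apply: openI.
  by apply: open_comp => [? _|]; [exact: c2|exact: open_gt].
by apply: open_comp => [? _|]; [exact: c1|exact: open_gt].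
Qed.

Lemma pol_norm2 (s t : R) : (pol (0, 0) s t).1 ^+ 2 + (pol (0, 0) s t).2 ^+ 2 = expR (2 * s).
Proof.
have -> : expR (2 * s) = expR s * expR s by rewrite -expRD; congr expR; ring.
have := cos2Dsin2 t; rewrite /pol /= => E.
by rewrite -[RHS]mulr1 -E; ring.
Qed.

Lemma sin_ge0 (t : R) : 0 <= t <= pi -> 0 <= sin t.
Proof. by move=> H; apply: sin_ge0_pi. Qed.

(** Raising the centre brings the two ends of the half circle into the open domain and only
    increases the distance to the origin. *)
Lemma pol_shift_upper (a s t eta : R) : a ^+ 2 < expR (2 * s) -> 0 <= t <= pi -> 0 < eta ->
  upper a (pol (0, eta) s t).
Proof.
move=> hs ht eta0; have st := sin_ge0 ht; have es := @expR_ge0 R s.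
split; rewrite /pol /=; first by rewrite ltr_wpDr// mulr_ge0.
apply: lt_le_trans hs _; rewrite -(pol_norm2 s t) /pol /= !add0r -subr_ge0.
have -> : (expR s * cos t) ^+ 2 + (eta + expR s * sin t) ^+ 2 -
   ((expR s * cos t) ^+ 2 + (expR s * sin t) ^+ 2) = eta ^+ 2 + 2 * eta * (expR s * sin t).
  by ring.
by rewrite addr_ge0 ?sqr_ge0// !mulr_ge0// ltW.
Qed.

Lemma compact_annulus (b c : R) : compact [set x : R * R | b <= x.1 ^+ 2 + x.2 ^+ 2 <= c].
Proof.
have cf x : {for x, continuous (fun x : R * R => x.1 ^+ 2 + x.2 ^+ 2)} by ct.
apply: (subclosed_compact _ (@compact_box R (0, 0) (1 + `|c|))).
  rewrite (_ : mkset _ = (fun x : R * R => x.1 ^+ 2 + x.2 ^+ 2) @^-1` `[b, c]%classic).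
    by apply: closed_comp => [? _|]; [exact: cf|exact: itv_closed].
  by apply/seteqP; split=> x /=; rewrite in_itv.
move=> x /= /andP[_ xc]; rewrite prod_normE ge_max /= !subr0.
have key (y z : R) : y ^+ 2 + z ^+ 2 <= c -> `|y| <= 1 + `|c|.
  move=> H; rewrite -(@ler_pXn2r _ 2)// ?nnegrE ?addr_ge0// real_normK ?num_real//.
  have := sqr_ge0 z; have := ler_norm c; have := normr_ge0 c; nra.
by rewrite (key _ _ xc) (key x.2 x.1)// addrC.
Qed.

Section modes.
Variables (a k : R) (u : R * R -> R).
Hypotheses (Hu : helm k (upper a) u) (cu : ext_cts a u).

Lemma ext_pol_cts (s t : R) : a ^+ 2 < expR (2 * s) -> {for pol (0, 0) s t, continuous (ext u)}.
Proof. by move=> hs; apply: cu; rewrite pol_norm2. Qed.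

Lemma sinmode_cts (n : nat) (s : R) : a ^+ 2 < expR (2 * s) -> {for s, continuous (sinmode u n)}.
Proof.
move=> hs.
have cE : {for s, continuous (fun s : R => expR (2 * s) - a ^+ 2)} by ct.
have e2 : 0 < expR (2 * s) - a ^+ 2 by rewrite subr_gt0.
have [d d0 Hd] := (continuous_epsP _ _).1 cE _ e2.
apply: (@continuous_itg R R (fun s t => ext u (pol (0, 0) s t) * sin (n.+1%:R * t)) s 0 pi d) => //.
  exact: pi_ge0.
move=> s' t hs' _; apply: ctM.
  apply: (@ct_pol R (ext u)); apply: ext_pol_cts.
  have := Hd s' hs'; rewrite ltr_norml => /andP[h _]; lra.
by ct.
Qed.

Lemma sinmode_approx (n : nat) (s1 s2 e : R) : s1 <= s2 -> a ^+ 2 < expR (2 * s1) -> 0 < e ->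
  exists2 eta0, 0 < eta0 & forall eta s t, 0 < eta < eta0 -> s1 <= s <= s2 -> 0 <= t <= pi ->
    `|u (pol (0, eta) s t) - ext u (pol (0, 0) s t)| <= e.
Proof.
move=> s12 hs1 e0.
have cK := @compact_annulus (expR (2 * s1)) (expR (2 * s2)).
have [|d d0 Hd] := heine cK (g := ext u) _ e0.
  by move=> x /= /andP[hx _]; apply: cu; apply: lt_le_trans hx.
exists d => // eta s t /andP[eta0 etad] /andP[h1 h2] ht.
have hs : a ^+ 2 < expR (2 * s) by apply: lt_le_trans hs1 _; rewrite ler_expR ler_pM2l.
have := Hd (pol (0, 0) s t) (pol (0, eta) s t).
have [up _] := pol_shift_upper hs ht eta0.
have -> : ext u (pol (0, eta) s t) = u (pol (0, eta) s t) by rewrite /ext up.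
move=> H; apply/ltW/H.
  by rewrite /= pol_norm2 !ler_expR !ler_pM2l// h1.
rewrite prod_normE /pol /= !add0r subrr normr0 addrK.
by rewrite max_r// gtr0_norm.
Qed.

(* Integrate over half circles centred at [(0, eta)], which stay inside the
   domain, and let [eta] tend to [0]. *)
Lemma sinmode_derive (n : nat) (s : R) : a ^+ 2 < expR (2 * s) ->
  is_derive s 1 (sinmode u n) (amode u n s) /\
  is_derive s 1 (amode u n) ((n.+1%:R ^+ 2 - k ^+ 2 * expR (2 * s)) * sinmode u n s).
Proof.
move=> hs.
have cE : {for s, continuous (fun s : R => expR (2 * s) - a ^+ 2)} by ct.
have e2 : 0 < expR (2 * s) - a ^+ 2 by rewrite subr_gt0.
have [d d0 Hd] := (continuous_epsP _ _).1 cE _ e2.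
have hd s' : `|s' - s| < d -> a ^+ 2 < expR (2 * s').
  by move=> /Hd; rewrite ltr_norml => /andP[h _]; lra.
set nu : R := n.+1%:R; set A := sinmode u n.
pose c s := nu ^+ 2 - k ^+ 2 * expR (2 * s).
have cI x : s - d / 2 <= x <= s + d / 2 -> a ^+ 2 < expR (2 * x).
  by move=> /andP[h1 h2]; apply: hd; rewrite ltr_norml; apply/andP; split; lra.
suff [A1 HA1] : exists A1, forall x, s - d / 4 < x < s + d / 4 ->
    is_derive x 1 A (A1 x) /\ is_derive x 1 A1 (c x * A x).
  have near y : `|y - s| < d / 4 -> s - d / 4 < y < s + d / 4.
    by rewrite ltr_norml => /andP[h1 h2]; apply/andP; split; lra.
  have d4 : 0 < d / 4 by rewrite divr_gt0.
  have D1 y : `|y - s| < d / 4 -> A1 y = amode u n y.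
    by move=> /near /HA1[dA _]; rewrite /amode derive_val.
  have ss : `|s - s| < d / 4 by rewrite subrr normr0.
  have [dA dA1] := HA1 s (near s ss).
  split; first by rewrite -D1.
  exact: (is_derive_near_eq d4 D1 dA1).
have cI4 x : s - d / 4 <= x <= s + d / 4 -> a ^+ 2 < expR (2 * x).
  by move=> /andP[h1 h2]; apply: cI; apply/andP; split; lra.
have dI x y : s - d / 4 <= x <= s + d / 4 -> `|y - x| < d / 4 -> s - d / 2 <= y <= s + d / 2.
  by move=> /andP[h1 h2]; rewrite ltr_norml => /andP[g1 g2]; apply/andP; split; lra.
have h1 : s - d / 2 < s - d / 4 by lra.
have h2 : s - d / 4 < s + d / 4 by lra.
have h3 : s + d / 4 < s + d / 2 by lra.
have cA : ctsI (s - d / 2) (s + d / 2) A by move=> x /cI; exact: sinmode_cts.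
have cc : ctsI (s - d / 2) (s + d / 2) c by move=> x _; rewrite /c; ct.
apply: (ode2_limit cA cc h1 h2 h3) => e e0.
have [K K0 HK] := compact_abs_bound (@segment_compact R (s - d / 4) (s + d / 4)) (f := c)
   (fun x _ => ltac:(rewrite /c; ct)).
have pi0 := @pi_gt0 R; have nu0 : 0 <= nu by rewrite ler0n.
(* With closeness [e / L] of the fields, the modes differ by [pi e / L]; the equation loses a
   further factor [K] from the coefficient and two boundary terms of size [nu e / L]. *)
pose L := 1 + pi + K * pi + 2 * nu.
have L0 : 0 < L.
  by have := mulr_ge0 K0 (ltW pi0); rewrite /L; lra.
have eL : 0 < e / L by rewrite divr_gt0.
have hs1 : a ^+ 2 < expR (2 * (s - d / 4)).
  by apply: cI; apply/andP; split; lra.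
have [eta0 eta00 Heta] := sinmode_approx n (ltW h2) hs1 eL.
pose eta := eta0 / 2.
have etab : 0 < eta < eta0 by rewrite /eta; apply/andP; split; lra.
have [etap _] := andP etab.
move: Hu => [p [q [p1 [p2 [q1 [q2 [Du Dp Dq Hl]]]]]]].
pose psi (t : R) := sin (nu * t); pose psi' (t : R) := nu * cos (nu * t).
have dpsi (t : R) : is_derive t 1 psi (psi' t) by rewrite /psi; drvR; rewrite /psi'; ring.
have dpsi' (t : R) : is_derive t 1 psi' (- (nu ^+ 2) * psi t).
  by rewrite /psi'; drvR; rewrite /psi; ring.
pose y := polT u psi (0, eta) 0 pi.
(* All that remains of the boundary terms: the sine vanishes at [0] and [pi], which removes the
   uncontrolled angular derivatives of [u], and the values of [u] itself are small near the axis. *)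
pose bt s := u (pol (0, eta) s pi) * psi' pi - u (pol (0, eta) s 0) * psi' 0.
exists y, (polT1 p q psi (0, eta) 0 pi), (fun s => c s * y s + bt s).
move=> x hx; have [hx1 hx2] := andP hx.
have px0 : 0 < d / 4 by lra.
have HD s' t : `|s' - x| < d / 4 -> 0 <= t <= pi -> upper a (pol (0, eta) s' t).
  by move=> hs' ht; apply: pol_shift_upper => //; apply: cI; exact: (dI x).
have dy := polT_derive (@open_upper a) Du (ltW pi0) dpsi px0 HD.
have dy1 := polT1_derive (@open_upper a) Du Dp Dq Hl (ltW pi0) dpsi dpsi' px0 HD.
have xx : `|x - x| < d / 4 by rewrite subrr normr0.
have ap t (ht : 0 <= t <= pi) := Heta eta x t etab hx ht.
have yA : `|y x - A x| <= e / L * pi.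
  rewrite -[pi]subr0 /y /A /sinmode /polT -itgB; last 2 first.
  - move=> t ht; have [cu' _ _ _ _] := Du _ (HD x t xx ht).
    by apply: ctM; [exact: ct_polt|rewrite /psi; ct].
  - move=> t ht; apply: ctM; last by ct.
    by apply: ct_polt; apply: ext_pol_cts; exact: cI4.
  apply: itg_bound; first exact: ltW.
    move=> t ht; have [cu' _ _ _ _] := Du _ (HD x t xx ht).
    apply: ctB; apply: ctM; [exact: ct_polt|rewrite /psi; ct| |ct].
    by apply: ct_polt; apply: ext_pol_cts; exact: cI4.
  move=> t ht; rewrite -mulrBl normrM -[leRHS]mulr1; apply: ler_pM => //.
    exact: ap.
  exact: sin_max.
have btE : `|bt x| <= 2 * nu * (e / L).
  have E0 : ext u (pol (0, 0) x 0) = 0 by rewrite /ext /pol /= sin0 mulr0 addr0 ltxx.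
  have Epi : ext u (pol (0, 0) x pi) = 0 by rewrite /ext /pol /= sinpi mulr0 addr0 ltxx.
  have I0 : 0 <= (0 : R) <= pi by rewrite lexx ltW.
  have I1 : 0 <= (pi : R) <= pi by rewrite lexx ltW.
  have B0 := ap _ I0; have B1 := ap _ I1; rewrite E0 subr0 in B0; rewrite Epi subr0 in B1.
  apply: (le_trans (ler_normB _ _)).
  have -> : 2 * nu * (e / L) = e / L * nu + e / L * nu by ring.
  have pb t : `|psi' t| <= nu.
    by rewrite /psi' normrM (ger0_norm nu0) ler_piMr// cos_max.
  rewrite (normrM _ (psi' pi)) (normrM _ (psi' 0)).
  by apply: lerD; apply: ler_pM.
have sum_le (m : R) : m <= L -> e / L * m <= e.
  by move=> mL; rewrite mulrAC ler_pdivrMr// ler_pM2l.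
split.
- exact: dy.
- apply: is_derive_congr dy1 _ _ => //.
  have -> : psi pi = 0 by exact: sin_nat_pi.
  have -> : psi 0 = 0 by rewrite /psi mulr0 sin0.
  by rewrite -/(y x) /c /bt; ring.
- apply: le_trans yA (sum_le _ _); rewrite /L.
  have := mulr_ge0 K0 (ltW pi0); lra.
apply: (@le_trans _ _ (e / L * (K * pi + 2 * nu))); last first.
  by apply: sum_le; rewrite /L; lra.
have -> : c x * y x + bt x - c x * A x = c x * (y x - A x) + bt x by ring.
apply: (le_trans (ler_normD _ _)).
have -> : e / L * (K * pi + 2 * nu) = K * (e / L * pi) + 2 * nu * (e / L) by ring.
apply: lerD => //; rewrite normrM; apply: ler_pM => //.
by apply: HK; rewrite /= in_itv.
Qed.

End modes.
End half_annulus.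

(** Carries a bound on difference quotients over to derivatives: in
    [q^2 = f^2 + 2 f (q - f) + (q - f)^2] the last square is dropped and the middle term is small
    for small [h]. *)
Lemma sum_sqr_diffquot (R : realType) (F : nat -> R -> R) (F1 : nat -> R) (s d : R) N :
  (forall n, is_derive s 1 (F n) (F1 n)) -> 0 < d ->
  exists2 h0, 0 < h0 & forall h, 0 < h < h0 ->
    \sum_(n < N) F1 n ^+ 2 <= \sum_(n < N) ((F n (s + h) - F n s) / h) ^+ 2 + d.
Proof.
move=> dF; elim: N d => [|N IH] d d0.
  by exists 1 => // h _; rewrite !big_ord0 add0r ltW.
have d2 : 0 < d / 2 by rewrite divr_gt0.
have [h1 h10 H1] := IH _ d2.
pose c := 2 * `|F1 N| + 1; have c0 : 0 < c by rewrite ltr_wpDl.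
have e0 : 0 < d / 2 / c by rewrite divr_gt0.
have [h2 h20 H2] := (is_derive_epsP _ _ _).1 (dF N) _ e0.
exists (Num.min h1 h2); first by rewrite lt_min h10.
move=> h /andP[h0]; rewrite lt_min => /andP[hh1 hh2].
have hh0 : 0 < h < h1 by rewrite h0.
rewrite !big_ord_recr /= (splitr d) addrACA; apply: lerD; first exact: H1.
have := H2 h; rewrite (gtr0_norm h0) => /(_ hh2).
set D := F N (s + h) - F N s; set q := D / h.
have -> : D - F1 N * h = (q - F1 N) * h by rewrite /q mulrBl divfK// gt_eqF.
rewrite normrM (gtr0_norm h0) ler_pM2r// => Hq.
rewrite -/c in Hq; clear H2; move: @c c0 e0 Hq; set f := F1 N => c c0 e0 Hq.
have q0 := sqr_ge0 (q - f).
have -> : q ^+ 2 = f ^+ 2 + 2 * f * (q - f) + (q - f) ^+ 2 by ring.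
have H3 : `|2 * f * (q - f)| <= d / 2.
  have -> : d / 2 = c * (d / 2 / c) by rewrite mulrCA mulfV ?mulr1// lt0r_neq0.
  rewrite normrM; apply: ler_pM => //; rewrite normrM (gtr0_norm (ltr0n _ 2))//.
  by rewrite /c lerDl.
move: H3; rewrite ler_norml => /andP[H3 _]; lra.
Qed.

(** Multiplication of [A + i B] by [exp (- i k e^s)] turns [d/ds - i k e^s] into [d/ds]. *)
Lemma rot_derive (R : realType) (k s : R) (A B : R -> R) (A1 B1 : R) :
  is_derive s 1 A A1 -> is_derive s 1 B B1 ->
  is_derive s 1 (fun s => A s * cos (k * expR s) + B s * sin (k * expR s))
    ((A1 + k * expR s * B s) * cos (k * expR s) + (B1 - k * expR s * A s) * sin (k * expR s)) /\
  is_derive s 1 (fun s => B s * cos (k * expR s) - A s * sin (k * expR s))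
    ((B1 - k * expR s * A s) * cos (k * expR s) - (A1 + k * expR s * B s) * sin (k * expR s)).
Proof. by move=> dA dB; split; drvR; ring. Qed.

Lemma rot_sqr (R : realType) (x y t : R) :
  (x * cos t + y * sin t) ^+ 2 + (y * cos t - x * sin t) ^+ 2 = x ^+ 2 + y ^+ 2.
Proof. by rewrite -[RHS]mulr1 -(cos2Dsin2 t); ring. Qed.

Lemma wronskian_derive (R : realType) (s c : R) (A B A1 B1 : R -> R) :
  is_derive s 1 A (A1 s) -> is_derive s 1 A1 (c * A s) ->
  is_derive s 1 B (B1 s) -> is_derive s 1 B1 (c * B s) ->
  is_derive s 1 (fun s => A s * B1 s - B s * A1 s) 0.
Proof. by move=> dA dA1 dB dB1; drvR; ring. Qed.

(** * Decay of radiating fields *)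

Section radiation.
Variable R : realType.

(* Sommerfeld's condition for [ua + i ub], written in the variable [s = ln r]. *)
Definition radiating (k : R) (ua ub : R * R -> R) : Prop :=
  forall e : R, 0 < e -> exists M : R, forall s t, M < s -> 0 < t < pi ->
    exists da db, [/\ is_derive s 1 (fun s => ua (pol (0, 0) s t)) da,
      is_derive s 1 (fun s => ub (pol (0, 0) s t)) db,
      `|da + k * expR s * ub (pol (0, 0) s t)| <= e * expR (s / 2)
      & `|db - k * expR s * ua (pol (0, 0) s t)| <= e * expR (s / 2)].

Lemma expR_sqr (s : R) : expR s ^+ 2 = expR (2 * s).
Proof. by rewrite expr2 -expRD; congr expR; ring. Qed.

Lemma expR_half (s : R) : expR (s / 2) ^+ 2 = expR s.
Proof. by rewrite expr2 -expRD; congr expR; field. Qed.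

Lemma expR_lt2 (sa s : R) : sa < s -> expR sa ^+ 2 < expR (2 * s).
Proof. by move=> h; rewrite expR_sqr ltr_expR ltr_pM2l. Qed.

Variables (k sa : R) (ua ub : R * R -> R).
Hypotheses (k0 : 0 < k) (Ha : helm k (upper (expR sa)) ua) (Hb : helm k (upper (expR sa)) ub)
  (ca : ext_cts (expR sa) ua) (cb : ext_cts (expR sa) ub) (Hrad : radiating k ua ub).

(* [rotP + i rotQ] is [exp (- i k r) (ua + i ub)]. *)
Definition rotP s t := ext ua (pol (0, 0) s t) * cos (k * expR s) + ext ub (pol (0, 0) s t) * sin (k * expR s).
Definition rotQ s t := ext ub (pol (0, 0) s t) * cos (k * expR s) - ext ua (pol (0, 0) s t) * sin (k * expR s).

Lemma ext_pol0 (u : R * R -> R) s t : t = 0 \/ t = pi -> ext u (pol (0, 0) s t) = 0.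
Proof. by move=> [->|->]; rewrite /ext /pol /= ?sin0 ?sinpi mulr0 addr0 ltxx. Qed.

Lemma ext_polE (u : R * R -> R) s t : 0 < t < pi -> ext u (pol (0, 0) s t) = u (pol (0, 0) s t).
Proof.
move=> ht; rewrite /ext /pol /= add0r mulr_gt0 ?expR_gt0//.
exact: sin_gt0_pi.
Qed.

Lemma itvcc_cases (t : R) : 0 <= t <= pi -> (t = 0 \/ t = pi) \/ 0 < t < pi.
Proof.
move=> /andP[]; rewrite le_eqVlt => /predU1P[->|t0]; first by left; left.
rewrite le_eqVlt => /predU1P[->|t1]; first by left; right.
by right; rewrite t0.
Qed.

(** Up to a factor of modulus one, the [s]-derivative of [exp (- i k r) u] is [r (u_r - i k u)],
    whose two components Sommerfeld's condition bounds by [e e^(s/2)]; the mean value theorem does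
    the rest. *)
Lemma rot_lip (e : R) : 0 < e -> exists2 M, sa <= M & forall s1 s2 t, M < s1 -> s1 <= s2 ->
  0 <= t <= pi -> `|rotP s2 t - rotP s1 t| <= 2 * e * expR (s2 / 2) * (s2 - s1) /\
    `|rotQ s2 t - rotQ s1 t| <= 2 * e * expR (s2 / 2) * (s2 - s1).
Proof.
move=> e0; have [M HM] := Hrad e0; exists (Num.max sa M); first by rewrite le_max lexx.
move=> s1 s2 t; rewrite gt_max => /andP[sas1 Ms1] s12 ht.
have s21 : 0 <= s2 - s1 by rewrite subr_ge0.
have B0 : 0 <= 2 * e * expR (s2 / 2) * (s2 - s1).
  by rewrite !mulr_ge0 ?expR_ge0// ltW.
have [h|{}ht] := itvcc_cases ht.
  by rewrite /rotP /rotQ !ext_pol0// !mul0r !subrr normr0.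
pose va s := ua (pol (0, 0) s t); pose vb s := ub (pol (0, 0) s t).
have HM' s : s1 <= s <= s2 -> [/\ is_derive s 1 va ('D_1 va s), is_derive s 1 vb ('D_1 vb s),
    `|'D_1 va s + k * expR s * vb s| <= e * expR (s2 / 2) & `|'D_1 vb s - k * expR s * va s| <= e * expR (s2 / 2)].
  move=> /andP[h1 h2]; have [da [db [dda ddb E1 E2]]] := HM s t (lt_le_trans Ms1 h1) ht.
  have Eda : 'D_1 va s = da by apply: derive_val.
  have Edb : 'D_1 vb s = db by apply: derive_val.
  rewrite Eda Edb; split => //; [apply: le_trans E1 _|apply: le_trans E2 _];
    by rewrite ler_wpM2l ?(ltW e0)// ler_expR ler_pM2r.
pose X s := 'D_1 va s + k * expR s * vb s; pose Y s := 'D_1 vb s - k * expR s * va s.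
have I1 : s1 <= s1 <= s2 by rewrite lexx.
have I2 : s1 <= s2 <= s2 by rewrite lexx andbT.
have eE : 2 * e * expR (s2 / 2) = e * expR (s2 / 2) + e * expR (s2 / 2) by ring.
have bd x y c d : `|x| <= e * expR (s2 / 2) -> `|y| <= e * expR (s2 / 2) -> `|c| <= 1 -> `|d| <= 1 ->
   `|x * c + y * d| <= 2 * e * expR (s2 / 2).
  move=> hx hy hc hd; rewrite eE; apply: (le_trans (ler_normD _ _)).
  by rewrite !normrM -[X in X + _ <= _]mulr1 -[X in _ <= X + _]mulr1 -[X in _ <= _ + X]mulr1 mulr1;
   apply: lerD; apply: ler_pM.
rewrite -(ger0_norm s21); split.
  pose P s := va s * cos (k * expR s) + vb s * sin (k * expR s).
  have dP s : s1 <= s <= s2 -> is_derive s 1 P (X s * cos (k * expR s) + Y s * sin (k * expR s)).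
    by move=> /HM'[dva dvb _ _]; rewrite /P; drvR; rewrite /X /Y; ring.
  have := mvt_le (M := 2 * e * expR (s2 / 2)) dP _ I1 I2.
  rewrite /rotP !ext_polE//; apply => s /HM'[_ _ E1 E2].
  by apply: bd => //; [exact: cos_max|exact: sin_max].
pose Q s := vb s * cos (k * expR s) - va s * sin (k * expR s).
have dQ s : s1 <= s <= s2 -> is_derive s 1 Q (Y s * cos (k * expR s) + X s * (- sin (k * expR s))).
  by move=> /HM'[dva dvb _ _]; rewrite /Q; drvR; rewrite /X /Y; ring.
have := mvt_le (M := 2 * e * expR (s2 / 2)) dQ _ I1 I2.
rewrite /rotQ !ext_polE//; apply => s /HM'[_ _ E1 E2].
by apply: bd => //; rewrite ?normrN; [exact: cos_max|exact: sin_max].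
Qed.

Lemma ext_ctsI (u : R * R -> R) s : ext_cts (expR sa) u -> sa < s ->
  ctsI 0 pi (fun t => ext u (pol (0, 0) s t)).
Proof.
move=> cu hs t _; apply: ct_polt; apply: cu; rewrite pol_norm2; exact: expR_lt2.
Qed.

Lemma scoef_sinmode (u : R * R -> R) n s : scoef (fun t => ext u (pol (0, 0) s t)) n = sinmode u n s.
Proof. by []. Qed.

Lemma scoefD (f g : R -> R) n : ctsI 0 pi f -> ctsI 0 pi g ->
  scoef (fun t => f t + g t) n = scoef f n + scoef g n.
Proof.
move=> cf cg; rewrite /scoef -itgD; try by move=> t ht; apply: ctM; [exact: cf|ct].
  by apply: eq_itg => t _; rewrite mulrDl.
by move=> t ht; apply: ctM; [exact: cg|ct].
Qed.

Lemma scoefZ (c : R) (f : R -> R) n : ctsI 0 pi f -> scoef (fun t => c * f t) n = c * scoef f n.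
Proof.
move=> cf; rewrite /scoef -itgZ; last by move=> t ht; apply: ctM; [exact: cf|ct].
by apply: eq_itg => t _; rewrite mulrA.
Qed.

Local Notation al := (sinmode ua).
Local Notation be := (sinmode ub).
Local Notation al1 := (amode ua).
Local Notation be1 := (amode ub).

Definition rotPmode n s := al n s * cos (k * expR s) + be n s * sin (k * expR s).
Definition rotQmode n s := be n s * cos (k * expR s) - al n s * sin (k * expR s).
Local Notation cP := rotPmode.
Local Notation cQ := rotQmode.

Lemma rotP_cts s : sa < s -> ctsI 0 pi (rotP s).
Proof.
move=> hs t ht; have h1 := ext_ctsI ca hs ht; have h2 := ext_ctsI cb hs ht.
by rewrite /rotP; ct.
Qed.

Lemma rotQ_cts s : sa < s -> ctsI 0 pi (rotQ s).
Proof.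
move=> hs t ht; have h1 := ext_ctsI ca hs ht; have h2 := ext_ctsI cb hs ht.
by rewrite /rotQ; ct.
Qed.

Lemma scoef_rotP n s : sa < s -> scoef (rotP s) n = cP n s.
Proof.
move=> hs; have c1 := ext_ctsI ca hs; have c2 := ext_ctsI cb hs.
transitivity (scoef (fun t => cos (k * expR s) * ext ua (pol (0, 0) s t) + sin (k * expR s) * ext ub (pol (0, 0) s t)) n).
  by apply: eq_itg => t _; rewrite /rotP; ring.
rewrite scoefD; [|exact: ctsIZ|exact: ctsIZ].
by rewrite !scoefZ// !scoef_sinmode /cP; ring.
Qed.

Lemma scoef_rotQ n s : sa < s -> scoef (rotQ s) n = cQ n s.
Proof.
move=> hs; have c1 := ext_ctsI ca hs; have c2 := ext_ctsI cb hs.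
transitivity (scoef (fun t => cos (k * expR s) * ext ub (pol (0, 0) s t) + (- sin (k * expR s)) * ext ua (pol (0, 0) s t)) n).
  by apply: eq_itg => t _; rewrite /rotQ; ring.
rewrite scoefD; [|exact: ctsIZ|exact: ctsIZ].
by rewrite !scoefZ// !scoef_sinmode /cQ; ring.
Qed.

(* Bessel's inequality for difference quotients in [s], in the limit. *)
Lemma bessel_derive (f : R -> R -> R) (F F1 : nat -> R -> R) (s B : R) N : sa < s ->
  (forall s', sa < s' -> ctsI 0 pi (f s')) ->
  (forall n s', sa < s' -> scoef (f s') n = F n s') ->
  (forall n, is_derive s 1 (F n) (F1 n s)) ->
  (forall h t, 0 < h < 1 -> 0 <= t <= pi -> `|f (s + h) t - f s t| <= B * h) ->
  \sum_(n < N) F1 n s ^+ 2 <= pi / 2 * (B ^+ 2 * pi).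
Proof.
move=> hs cf Ff dF HB; have pi0 := @pi_gt0 R.
have B0 : 0 <= B.
  have h1 : 0 < (1 / 2 : R) < 1 by apply/andP; split; lra.
  have h2 : 0 <= (0 : R) <= pi by rewrite lexx ltW.
  have := le_trans (normr_ge0 _) (HB _ _ h1 h2); lra.
have Q h : 0 < h < 1 -> \sum_(n < N) ((F n (s + h) - F n s) / h) ^+ 2 <= pi / 2 * (B ^+ 2 * pi).
  move=> h01; have [h0 h1] := andP h01.
  pose g t := h^-1 * (f (s + h) t + (-1) * f s t).
  have sh : sa < s + h by rewrite ltr_wpDr// ltW.
  have cg : ctsI 0 pi g.
    by apply: ctsIZ; apply: ctsID; [exact: cf|apply: ctsIZ; exact: cf].
  have gE n : scoef g n = (F n (s + h) - F n s) / h.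
    rewrite scoefZ; last by apply: ctsID; [exact: cf|apply: ctsIZ; exact: cf].
    rewrite scoefD ?scoefZ ?Ff//; [by ring|exact: cf|exact: cf|].
    by apply: ctsIZ; exact: cf.
  have := bessel N cg.
  under eq_bigr do rewrite gE.
  move=> H; apply: le_trans H _; apply: ler_wpM2l; first by rewrite divr_ge0 ?ltW.
  apply: le_trans (ler_norm _) _; rewrite -[X in _ * X](subr0 pi).
  apply: itg_bound; [exact: ltW|exact: ctsIX|].
  move=> t ht; rewrite normrX lerXn2r// ?nnegrE//.
  rewrite /g mulN1r normrM (gtr0_norm (_ : 0 < h^-1)) ?invr_gt0// mulrC ler_pdivrMr//.
  exact: HB.
apply/ler_addgt0Pl => d d0; rewrite addrC.
have [h0 h00 Hh0] := sum_sqr_diffquot N dF d0.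
pose h := Num.min h0 1 / 2.
have m0 : 0 < Num.min h0 1 by rewrite lt_min h00 ltr01.
have mh : Num.min h0 1 <= h0 by rewrite ge_min lexx.
have m1 : Num.min h0 1 <= 1 by rewrite ge_min lexx orbT.
apply: le_trans (Hh0 h _) _; first by rewrite /h; apply/andP; split; lra.
by rewrite lerD2r; apply: Q; rewrite /h; apply/andP; split; lra.
Qed.

Lemma rotmode_derive n s : sa < s ->
  is_derive s 1 (cP n) ((al1 n s + k * expR s * be n s) * cos (k * expR s)
     + (be1 n s - k * expR s * al n s) * sin (k * expR s)) /\
  is_derive s 1 (cQ n) ((be1 n s - k * expR s * al n s) * cos (k * expR s)
     - (al1 n s + k * expR s * be n s) * sin (k * expR s)).
Proof.
move=> hs; have [d1 _] := sinmode_derive Ha ca n (expR_lt2 hs).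
have [d2 _] := sinmode_derive Hb cb n (expR_lt2 hs).
exact: (rot_derive k d1 d2).
Qed.

(** The squared modulus of [(d/ds - i k e^s)] applied to the [n]-th mode of [ua + i ub]. *)
Definition radmode n s := (al1 n s + k * expR s * be n s) ^+ 2 + (be1 n s - k * expR s * al n s) ^+ 2.

Local Notation W := radmode.

(** Bessel's inequality is applied to the rotated field, because Sommerfeld's condition bounds its
    increments pointwise; the rotation preserves the sum of the two squares, which is [radmode].
    Increments [h < 1] cost a factor [e^(1/2) <= 2]. *)
Lemma radiating_modes (e : R) : 0 < e -> exists2 M, sa <= M & forall s N, M < s ->
  \sum_(n < N) W n s <= (8 * e * pi) ^+ 2 * expR s.
Proof.
move=> e0; have pi0 := @pi_gt0 R; have [M saM HM] := rot_lip e0; exists M => // s N Ms.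
have hs : sa < s := le_lt_trans saM Ms.
have e2 : expR (1 / 2 : R) <= 2.
  have h : 1 / 2 <= expR (- (1 / 2) : R).
    by apply: le_trans (expR_ge1Dx _); lra.
  have : expR (1 / 2 : R) * expR (- (1 / 2)) = 1 by rewrite -expRD subrr expR0.
  have := @expR_gt0 R (1 / 2); nra.
have lip (h t : R) : 0 < h < 1 -> 0 <= t <= pi ->
   `|rotP (s + h) t - rotP s t| <= 4 * e * expR (s / 2) * h /\
   `|rotQ (s + h) t - rotQ s t| <= 4 * e * expR (s / 2) * h.
  move=> /andP[h0 h1] ht; have sh : s <= s + h by rewrite lerDl ltW.
  have [E1 E2] := HM s (s + h) t Ms sh ht.
  have E : 2 * e * expR ((s + h) / 2) * (s + h - s) <= 4 * e * expR (s / 2) * h.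
    rewrite (addrC s h) addrK ler_wpM2r ?(ltW h0)//.
    have -> : (h + s) / 2 = s / 2 + h / 2 by field.
    rewrite expRD; have eh : expR (h / 2) <= 2 by apply: le_trans e2; rewrite ler_expR; lra.
    have -> : 2 * e * (expR (s / 2) * expR (h / 2)) = 2 * e * expR (s / 2) * expR (h / 2) by ring.
    have -> : 4 * e * expR (s / 2) = 2 * e * expR (s / 2) * 2 by ring.
    by apply: ler_wpM2l => //; rewrite !mulr_ge0 ?expR_ge0// ltW.
  by split; [exact: le_trans E1 E|exact: le_trans E2 E].
have BP := @bessel_derive rotP cP (fun n s => (al1 n s + k * expR s * be n s) * cos (k * expR s)
     + (be1 n s - k * expR s * al n s) * sin (k * expR s)) s (4 * e * expR (s / 2)) N hs rotP_cts scoef_rotP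
  (fun n => (rotmode_derive n hs).1) (fun h t hh ht => (lip h t hh ht).1).
have BQ := @bessel_derive rotQ cQ (fun n s => (be1 n s - k * expR s * al n s) * cos (k * expR s)
     - (al1 n s + k * expR s * be n s) * sin (k * expR s)) s (4 * e * expR (s / 2)) N hs rotQ_cts scoef_rotQ
  (fun n => (rotmode_derive n hs).2) (fun h t hh ht => (lip h t hh ht).2).
have := lerD BP BQ; rewrite -big_split /=.
have -> : \sum_(i < N) (((al1 i s + k * expR s * be i s) * cos (k * expR s) +
     (be1 i s - k * expR s * al i s) * sin (k * expR s)) ^+ 2 +
    ((be1 i s - k * expR s * al i s) * cos (k * expR s) -
     (al1 i s + k * expR s * be i s) * sin (k * expR s)) ^+ 2) = \sum_(n < N) W n s.
  by apply: eq_bigr => n _; exact: rot_sqr.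
move=> H; apply: le_trans H _.
rewrite exprMn expR_half.
have -> : pi / 2 * ((4 * e) ^+ 2 * expR s * pi) + pi / 2 * ((4 * e) ^+ 2 * expR s * pi) = (e * pi) ^+ 2 * expR s * 16 :> R by field.
have -> : (8 * e * pi) ^+ 2 * expR s = (e * pi) ^+ 2 * expR s * 64 :> R by ring.
by apply: ler_wpM2l; [rewrite mulr_ge0 ?sqr_ge0 ?expR_ge0|lra].
Qed.

(** For the complex mode [f = al + i be] this is [Im (conj f * f')], the energy flux carried by the
    mode through a half circle, conserved because the mode equation is real. *)
Lemma flux_const n s1 s2 : sa < s1 -> s1 <= s2 ->
  al n s1 * be1 n s1 - be n s1 * al1 n s1 = al n s2 * be1 n s2 - be n s2 * al1 n s2.
Proof.
move=> h1 h12.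
apply: (@der0_cst R (fun s => al n s * be1 n s - be n s * al1 n s) s1 s2); rewrite ?lexx ?h12//.
move=> s /andP[hs _]; have {}hs := lt_le_trans h1 hs.
have [d1 d3] := sinmode_derive Ha ca n (expR_lt2 hs).
have [d2 d4] := sinmode_derive Hb cb n (expR_lt2 hs).
exact: (wronskian_derive d1 d3 d2 d4).
Qed.

(* [W = al1^2 + be1^2 + k^2 r^2 (al^2 + be^2) - 2 k r F] with a Wronskian [F] that
   does not depend on [s]. *)
Lemma mode_decay : exists2 M, sa <= M & exists C, forall s N, M < s ->
  expR s * \sum_(n < N) (al n s ^+ 2 + be n s ^+ 2) <= C.
Proof.
have [M saM HM] := radiating_modes ltr01.
pose s0 := M + 1; have s0M : M < s0 by rewrite /s0 ltrDl.
have sas0 : sa < s0 := le_lt_trans saM s0M.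
have B0 N : \sum_(n < N) (al n s0 ^+ 2 + be n s0 ^+ 2) <=
   pi / 2 * itg 0 pi (fun t => ext ua (pol (0, 0) s0 t) ^+ 2) + pi / 2 * itg 0 pi (fun t => ext ub (pol (0, 0) s0 t) ^+ 2).
  rewrite big_split /=; apply: lerD; apply: bessel; exact: ext_ctsI.
set B := _ + _ in B0.
(* Bounds the total flux at the single radius [e^s0], hence at all larger ones, through [x y1 - y x1
   <= (x^2 + y^2) (1 + k e^s0) + W] mode by mode. *)
pose CF := B * (1 + k * expR s0) + (8 * 1 * pi) ^+ 2 * expR s0.
pose F n := al n s0 * be1 n s0 - be n s0 * al1 n s0.
have es0 := @expR_gt0 R s0.
have FB N : \sum_(n < N) F n <= CF.
  apply: (@le_trans _ _ (\sum_(n < N) ((al n s0 ^+ 2 + be n s0 ^+ 2) * (1 + k * expR s0) + W n s0))).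
    apply: ler_sum => n _; rewrite /F /W; set r := k * expR s0.
    have r0 : 0 < r by rewrite mulr_gt0.
    set x := al n s0; set y := be n s0; set x1 := al1 n s0; set y1 := be1 n s0.
    rewrite -subr_ge0.
    have -> : (x ^+ 2 + y ^+ 2) * (1 + r) + ((x1 + r * y) ^+ 2 + (y1 - r * x) ^+ 2) - (x * y1 - y * x1) =
      (x - (y1 - r * x) / 2) ^+ 2 + (y + (x1 + r * y) / 2) ^+ 2 + 3 / 4 * ((x1 + r * y) ^+ 2 + (y1 - r * x) ^+ 2) by field.
    rewrite addr_ge0 ?addr_ge0 ?sqr_ge0//.
    by apply: mulr_ge0; [lra|rewrite addr_ge0 ?sqr_ge0].
  rewrite big_split /= -mulr_suml; apply: lerD; last exact: HM.
  apply: ler_wpM2r; last exact: B0.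
  by rewrite addr_ge0// mulr_ge0// ltW.
exists s0; first exact: ltW.
exists (((8 * 1 * pi) ^+ 2 + 2 * k * CF) / k ^+ 2) => s N s0s.
rewrite ler_pdivlMr ?exprn_gt0//.
have es := @expR_gt0 R s; rewrite -(ler_pM2l es).
have Ms : M < s := lt_trans s0M s0s.
apply: (@le_trans _ _ (\sum_(n < N) W n s + 2 * k * expR s * \sum_(n < N) F n)); last first.
  rewrite mulrDr; apply: lerD; first by rewrite mulrC; exact: HM.
  rewrite mulrCA !mulrA ler_wpM2l//; first by rewrite !mulr_ge0// ltW.
rewrite [2 * k * expR s * _]mulr_sumr -big_split /= [expR s * \sum_(_ < _) _]mulr_sumr.
rewrite mulr_suml mulr_sumr; apply: ler_sum => n _.
rewrite /F (flux_const n sas0 (ltW s0s)) /W -subr_ge0.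
set x := al n s; set y := be n s; set x1 := al1 n s; set y1 := be1 n s; set r := expR s.
have -> : (x1 + k * r * y) ^+ 2 + (y1 - k * r * x) ^+ 2 + 2 * k * r * (x * y1 - y * x1)
   - r * (r * (x ^+ 2 + y ^+ 2) * k ^+ 2) = x1 ^+ 2 + y1 ^+ 2 by ring.
by rewrite addr_ge0 ?sqr_ge0.
Qed.

Lemma radiating_decay : exists2 M, sa <= M & exists2 C, 0 <= C & forall s, M < s ->
  expR s * itg 0 pi (fun t => ext ua (pol (0, 0) s t) ^+ 2) <= C /\
  expR s * itg 0 pi (fun t => ext ub (pol (0, 0) s t) ^+ 2) <= C.
Proof.
have pi0 := @pi_gt0 R; have [M saM [C HC]] := mode_decay; exists M => //.
have C0 : 0 <= C.
  have M1 : M < M + 1 by rewrite ltrDl.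
  by have := HC _ 0%N M1; rewrite big_ord0 mulr0.
exists (2 / pi * C); first by rewrite mulr_ge0// divr_ge0// ltW.
move=> s Ms; have es := @expR_gt0 R s; have hs : sa < s := le_lt_trans saM Ms.
have key u : ext_cts (expR sa) u ->
    (forall N, \sum_(n < N) sinmode u n s ^+ 2 <= \sum_(n < N) (al n s ^+ 2 + be n s ^+ 2)) ->
    expR s * itg 0 pi (fun t => ext u (pol (0, 0) s t) ^+ 2) <= 2 / pi * C.
  move=> cu Hu; rewrite mulrC -ler_pdivlMr// -[leRHS]mulrA.
  apply: parseval_le; [exact: ext_ctsI|by rewrite ext_pol0//; left|by rewrite ext_pol0//; right|].
  move=> N; apply: le_trans (Hu N) _; rewrite ler_pdivlMr// mulrC; exact: HC.
by split; apply: key => // N; apply: ler_sum => n _; rewrite ?lerDl ?lerDr sqr_ge0.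
Qed.

End radiation.

(** * Phaseless data *)

Section phaseless_pointwise.
Variable R : realType.

(** By the product formulas, [cos (2 s + 5 a)] and [cos (2 s + a)] add up to
    [2 cos (2 a) cos (2 s + 3 a)], so the position [s] drops out: four consecutive sines cannot all
    be small unless [cos a sin^2 a] is. *)
Lemma sin_shift_identity (s a : R) :
  sin (s + 2 * a) * sin (s + 3 * a) + sin s * sin (s + a)
    - 2 * cos (2 * a) * (sin (s + a) * sin (s + 2 * a)) = 2 * cos a * sin a ^+ 2.
Proof.
have prod x y : sin x * sin y = (cos (x - y) - cos (x + y)) / 2 :> R.
  by rewrite cosB cosD; field.
have cos2 : cos (2 * a) = 1 - 2 * sin a ^+ 2.
  have -> : 2 * a = a + a by ring.
  rewrite cosD; have E := cos2Dsin2 a.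
  have -> : cos a * cos a = 1 - sin a ^+ 2 by rewrite -E; ring.
  ring.
have sumc m : cos (m + 2 * a) + cos (m - 2 * a) = 2 * cos (2 * a) * cos m :> R.
  by rewrite cosB cosD; ring.
rewrite !prod.
have -> : s + 2 * a - (s + 3 * a) = - a by ring.
have -> : s - (s + a) = - a by ring.
have -> : s + a - (s + 2 * a) = - a by ring.
have -> : s + 2 * a + (s + 3 * a) = (2 * s + 3 * a) + 2 * a by ring.
have -> : s + (s + a) = (2 * s + 3 * a) - 2 * a by ring.
have -> : s + a + (s + 2 * a) = 2 * s + 3 * a by ring.
have := sumc (2 * s + 3 * a).
rewrite cosN; set A := cos (_ + 2 * a); set B := cos (_ - 2 * a) => E.
have -> : A = 2 * cos (2 * a) * cos (2 * s + 3 * a) - B by rewrite -E; ring.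
by rewrite cos2; field.
Qed.

Lemma norm_mul4 (a b c z : R) : `|a| <= 1 -> `|b| <= 1 -> `|c| <= 1 -> `|a * b * c * z| <= `|z|.
Proof.
move=> ha hb hc; rewrite 3!normrM ler_piMl// !mulr_ile1 ?mulr_ge0//.
Qed.

(* Two consecutive values of [y] determine [P] and [Q] up to [sin de]; the sine
   factors are removed by the preceding identity. *)
Lemma phaseless_pointwise (P Q ph de si al : R) :
  let y j := P * sin (ph + j * de) + Q * cos (ph + j * de) in
  let Z j := sin (si + j * al) * y j in
  let rho := 2 * (sin de * cos al * sin al ^+ 2) in
  `|rho * P| <= 4 * (`|Z 0| + `|Z 1| + `|Z 2| + `|Z 3|) /\
  `|rho * Q| <= 4 * (`|Z 0| + `|Z 1| + `|Z 2| + `|Z 3|).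
Proof.
move=> y Z rho.
pose S j := sin (si + j * al); pose c j := cos (ph + j * de); pose s j := sin (ph + j * de).
have S1 j : `|S j| <= 1 by exact: sin_max.
have s1 j : `|s j| <= 1 by exact: sin_max.
have c1 j : `|c j| <= 1 by exact: cos_max.
have C1 : `|cos (2 * al)| <= 1 by exact: cos_max.
have rhoE : rho = sin de * (S 2 * S 3 + S 0 * S 1 - 2 * cos (2 * al) * (S 1 * S 2)).
  by rewrite /rho /S mul0r addr0 mul1r sin_shift_identity; ring.
have sde i j : (j - i) * de = de -> sin de = s j * c i - c j * s i.
  move=> E; rewrite /s /c -sinB; congr sin; rewrite -[LHS]E; ring.
(* [sin de] is the determinant of the system for [P] and [Q] given by two consecutive [y]. The three
   products of sines in [rhoE] use the pairs [(2, 3)], [(0, 1)] and [(1, 2)]. *)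
have d01 : sin de = s 1 * c 0 - c 1 * s 0 by apply: sde; ring.
have d12 : sin de = s 2 * c 1 - c 2 * s 1 by apply: sde; ring.
have d23 : sin de = s 3 * c 2 - c 3 * s 2 by apply: sde; ring.
have bnd (f : R -> R) : (forall j, `|f j| <= 1) ->
   `|(S 3 * f 3 * 1 * Z 2 - S 2 * f 2 * 1 * Z 3) + (S 1 * f 1 * 1 * Z 0 - S 0 * f 0 * 1 * Z 1)
     - (cos (2 * al) * S 2 * f 2 * Z 1 - cos (2 * al) * S 1 * f 1 * Z 2)
     - (cos (2 * al) * S 2 * f 2 * Z 1 - cos (2 * al) * S 1 * f 1 * Z 2)|
    <= 4 * (`|Z 0| + `|Z 1| + `|Z 2| + `|Z 3|).
  move=> f1.
  have n1 : `|1 : R| <= 1 by rewrite normr1.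
  have b2 := norm_mul4 (Z 2) (S1 3) (f1 3) n1.
  have b3 := norm_mul4 (Z 3) (S1 2) (f1 2) n1.
  have b0 := norm_mul4 (Z 0) (S1 1) (f1 1) n1.
  have b1 := norm_mul4 (Z 1) (S1 0) (f1 0) n1.
  have b5 := norm_mul4 (Z 1) C1 (S1 2) (f1 2).
  have b6 := norm_mul4 (Z 2) C1 (S1 1) (f1 1).
  apply: (le_trans (ler_normB _ _)).
  apply: (le_trans (lerD (ler_normB _ _) (ler_normB _ _))).
  apply: (le_trans (lerD (lerD (ler_normD _ _) (ler_normB _ _)) (lexx _))).
  apply: (le_trans (lerD (lerD (lerD (ler_normB _ _) (ler_normB _ _)) (lexx _)) (lexx _))).
  have z0 := normr_ge0 (Z 0); have z3 := normr_ge0 (Z 3).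
  have z1 := normr_ge0 (Z 1); have z2 := normr_ge0 (Z 2).
  lra.
split.
  rewrite -normrN; apply: le_trans (bnd c c1).
  rewrite le_eqVlt; apply/orP; left; apply/eqP; congr `|_|.
  rewrite rhoE [X in - (X * P)]mulrBr [X in - ((X - _) * P)]mulrDr.
  rewrite {1}d23 [X in _ + X * (S 0 * S 1)]d01 [X in _ - X * (2 * _ * _)]d12.
  by rewrite /Z /y -/(S 0) -/(S 1) -/(S 2) -/(S 3) -/(s 0) -/(s 1) -/(s 2) -/(s 3) -/(c 0) -/(c 1) -/(c 2) -/(c 3); ring.
apply: le_trans (bnd s s1).
rewrite -[leRHS]normrN.
rewrite le_eqVlt; apply/orP; left; apply/eqP.
rewrite rhoE [X in (X * Q)]mulrBr [X in ((X - _) * Q)]mulrDr.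
rewrite {1}d23 [X in _ + X * (S 0 * S 1)]d01 [X in _ - X * (2 * _ * _)]d12.
rewrite -normrN; congr `|_|.
by rewrite /Z /y -/(S 0) -/(S 1) -/(S 2) -/(S 3) -/(s 0) -/(s 1) -/(s 2) -/(s 3) -/(c 0) -/(c 1) -/(c 2) -/(c 3); ring.
Qed.

Lemma sin_mul_nat (n : nat) (t : R) : `|sin (n%:R * t)| <= n%:R * `|sin t|.
Proof.
elim: n => [|n IH]; first by rewrite mul0r sin0 normr0 mul0r.
rewrite -natr1 !mulrDl !mul1r sinD; apply: (le_trans (ler_normD _ _)).
rewrite !normrM; apply: lerD.
  by apply: le_trans IH; rewrite ler_piMr// cos_max.
by rewrite ler_piMl// cos_max.
Qed.

(** For [|d1| < 1] the angle [de] stays between [(1 - |d1|) / 2] and [1], and [|al| <= 1 / 2]; the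
    factor thus degenerates only at the axis, and no faster than [sin t ^+ 2]. *)
Lemma rho_lower (d1 d2 t de al : R) : `|d1| < 1 -> d1 ^+ 2 + d2 ^+ 2 = 1 ->
  de = (1 - d1 * cos t) / 2 -> al = d2 * sin t / 2 ->
  (1 - `|d1|) * d2 ^+ 2 / 64 * sin t ^+ 2 <= 2 * (sin de * cos al * sin al ^+ 2).
Proof.
move=> d11 d12 deE alE.
have ct1 : `|d1 * cos t| <= `|d1| by rewrite normrM ler_piMr// cos_max.
move: ct1; rewrite ler_norml => /andP[c1 c2].
have de1 : 0 <= de <= 1 by rewrite deE; apply/andP; split; lra.
have sde := sin_half de1.
have d21 : `|d2| <= 1.
  rewrite -(@ler_pXn2r _ 2)// ?nnegrE// expr1n real_normK ?num_real//.
  by rewrite -d12 lerDr sqr_ge0.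
have al1 : `|al| <= 1.
  rewrite alE !normrM (gtr0_norm (_ : 0 < 2^-1)) ?invr_gt0//.
  have := mulr_ile1 (normr_ge0 _) (normr_ge0 _) d21 (sin_max t); set x := _ * _; lra.
have cal := cos_half al1; have sal := sin_mul_half al1.
have sal2 : al ^+ 2 / 4 <= sin al ^+ 2.
  have h : 0 <= (sin al - al / 2) ^+ 2 by exact: sqr_ge0.
  have E : (sin al - al / 2) ^+ 2 = sin al ^+ 2 - sin al * al + al ^+ 2 / 4 by field.
  rewrite E in h; lra.
have -> : (1 - `|d1|) * d2 ^+ 2 / 64 * sin t ^+ 2 =
   2 * ((1 - `|d1|) / 4 * (1 / 2) * (al ^+ 2 / 4)) by rewrite alE; field.
rewrite ler_pM2l//; apply: ler_pM => //.
- by rewrite mulr_ge0// divr_ge0// subr_ge0 ltW.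
- by rewrite divr_ge0 ?sqr_ge0.
- apply: ler_pM => //; first by rewrite divr_ge0// subr_ge0 ltW.
  by apply: le_trans sde; rewrite deE; lra.
Qed.

End phaseless_pointwise.

Section oscillator.
Variable R : realType.

(* The energy [E = e^-s (w' + w/2)^2 + k^2 e^s w^2] obeys [|E'| <= c e^-s E], so
   that [E exp (- c e^-s)] is nondecreasing; it can only tend to [0] at infinity
   by vanishing. *)
Lemma mode_unique (k nu2 sa : R) (w w1 : R -> R) : 0 < k ->
  (forall s, sa < s -> is_derive s 1 w (w1 s) /\
     is_derive s 1 w1 ((nu2 - k ^+ 2 * expR (2 * s)) * w s)) ->
  (forall e, 0 < e -> exists M, forall s, M < s ->
     expR (s / 2) * `|w s| <= e /\ expR (- (s / 2)) * `|w1 s| <= e) ->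
  forall s, sa < s -> w s = 0.
Proof.
move=> k0 Hw Hdec s sas.
pose c := `|nu2 - 1 / 4| / k; have c0 : 0 <= c by rewrite divr_ge0// ltW.
pose E s := expR (- s) * (w1 s + w s / 2) ^+ 2 + k ^+ 2 * (expR s * w s ^+ 2).
pose E1 s := 2 * expR (- s) * (w1 s + w s / 2) * ((nu2 - 1 / 4) * w s).
have E0 x : 0 <= E x.
  apply: addr_ge0; first by rewrite mulr_ge0 ?expR_ge0 ?sqr_ge0.
  by apply: mulr_ge0; [exact: sqr_ge0|rewrite mulr_ge0 ?expR_ge0 ?sqr_ge0].
have dE x : sa < x -> is_derive x 1 E (E1 x).
  move=> /Hw[dw dw1]; have dn := dN (dId x); rewrite /E; drvR; rewrite /E1.
  have -> : expR (2 * x) = expR x * expR x by rewrite -expRD; congr expR; ring.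
  have ee : expR (- x) * expR x = 1 by rewrite -expRD addNr expR0.
  set a := expR (- x) in ee *; set b := expR x in ee *; set W := w x; set W1 := w1 x.
  (* A multiple of [1 - a b = 0] is added so that the remaining identity is one of rational
     functions. *)
  have -> : 2 * a * (W1 + W / 2) * ((nu2 - 1 / 4) * W) = 2 * a * (W1 + W / 2) * ((nu2 - 1 / 4) * W)
     + (1 - a * b) * (2 * k ^+ 2 * b * W * (W1 + W / 2)) by rewrite ee subrr mul0r addr0.
  by field.
have E1b x : sa < x -> - (c * expR (- x) * E x) <= E1 x.
  move=> sx; rewrite lerNl; apply: le_trans (ler_norm _) _; rewrite normrN /E1.
  set V := w1 x + w x / 2; set W := w x.
  have en : expR (- x) = expR (- (x / 2)) ^+ 2 by rewrite expr2 -expRD; congr expR; field.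
  have ep : expR x = expR (x / 2) ^+ 2 by rewrite expr2 -expRD; congr expR; field.
  have ee : expR (- (x / 2)) * expR (x / 2) = 1 by rewrite -expRD addNr expR0.
  set a := expR (- (x / 2)) in en ee; set b := expR (x / 2) in ep ee.
  have a0 : 0 < a := expR_gt0 _; have b0 : 0 < b := expR_gt0 _.
  rewrite !normrM (ger0_norm (expR_ge0 _)) (gtr0_norm (ltr0n _ 2)).
  have -> : E x = (a * `|V|) ^+ 2 + (k * b * `|W|) ^+ 2.
    rewrite /E -/V -/W en ep !exprMn !real_normK ?num_real//; ring.
  have H : 2 * (a * `|V|) * (k * b * `|W|) <= (a * `|V|) ^+ 2 + (k * b * `|W|) ^+ 2.
    rewrite -subr_ge0; have -> : (a * `|V|) ^+ 2 + (k * b * `|W|) ^+ 2 - 2 * (a * `|V|) * (k * b * `|W|)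
      = (a * `|V| - k * b * `|W|) ^+ 2 by ring.
    exact: sqr_ge0.
  have cc : 0 <= c * expR (- x) by rewrite mulr_ge0 ?expR_ge0.
  have := ler_wpM2l cc H; apply: le_trans.
  rewrite le_eqVlt; apply/orP; left; apply/eqP; rewrite /c.
  transitivity (2 * expR (- x) * `|V| * (`|nu2 - 1 / 4| * `|W|) * (a * b)); first by rewrite ee mulr1.
  by field; exact: lt0r_neq0.
pose G s := E s * expR (- c * expR (- s)).
have dG x : sa < x -> is_derive x 1 G ((E1 x + c * expR (- x) * E x) * expR (- c * expR (- x))).
  by move=> /dE dEx; have dn := dN (dId x); rewrite /G; drvR; ring.
have Gmono s1 s2 : sa < s1 -> s1 <= s2 -> G s1 <= G s2.
  move=> h1 h12.
  have dG' x : s1 <= x <= s2 -> is_derive x 1 G ((E1 x + c * expR (- x) * E x) * expR (- c * expR (- x))).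
    by move=> /andP[hx _]; apply: dG; apply: lt_le_trans hx.
  have I1 : s1 <= s1 <= s2 by rewrite lexx.
  have I2 : s1 <= s2 <= s2 by rewrite lexx andbT.
  have [y /andP[hy _] Ey] := mvt_itv dG' I1 I2.
  rewrite -subr_ge0 Ey; apply: mulr_ge0; last by rewrite subr_ge0.
  apply: mulr_ge0; last exact: expR_ge0.
  by rewrite -lerBlDr sub0r; apply: E1b; apply: lt_le_trans hy.
have G0 : G s <= 0.
  apply/ler_addgt0Pl => e e0; rewrite addr0.
  (* For [x >= 0] the two squares in [E x] are at most [(2 e1)^2] and [k^2 e1^2]. *)
  pose K := 4 + k ^+ 2; have K0 : 0 < K by rewrite /K ltr_wpDr ?sqr_ge0.
  pose e1 := Num.min 1 (e / K); have e10 : 0 < e1 by rewrite lt_min ltr01 divr_gt0.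
  have [M HM] := Hdec e1 e10.
  have [x [sx Mx x0]] : exists x, [/\ s <= x, M < x & 0 <= x].
    exists (Num.max s (Num.max M 0) + 1); split.
    - by rewrite ler_wpDr// le_max lexx.
    - by rewrite ltr_pwDr// !le_max lexx !orbT.
    - by rewrite addr_ge0// !le_max lexx !orbT.
  apply: le_trans (Gmono _ _ sas sx) _.
  have [b1 b2] := HM x Mx.
  have Ex : E x <= e.
    have e1K : K * e1 ^+ 2 <= e.
      apply: (@le_trans _ _ (K * (1 * (e / K)))); last first.
        by rewrite mul1r mulrCA mulfV ?mulr1// lt0r_neq0.
      rewrite expr2; apply: ler_wpM2l; first exact: ltW.
      by apply: ler_pM; rewrite ?(ltW e10)// ge_min lexx ?orbT.
    apply: le_trans e1K.
    have en : expR (- x) = expR (- (x / 2)) ^+ 2 by rewrite expr2 -expRD; congr expR; field.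
    have ep : expR x = expR (x / 2) ^+ 2 by rewrite expr2 -expRD; congr expR; field.
    have ab : expR (- (x / 2)) <= expR (x / 2) by rewrite ler_expR; lra.
    rewrite /E en ep -!exprMn.
    have h1 : `|expR (x / 2) * w x| <= e1 by rewrite normrM (ger0_norm (expR_ge0 _)).
    have h2 : `|expR (- (x / 2)) * (w1 x + w x / 2)| <= 2 * e1.
      rewrite normrM (ger0_norm (expR_ge0 _)).
      apply: le_trans (ler_wpM2l (expR_ge0 _) (ler_normD _ _)) _.
      rewrite mulrDr; have -> : 2 * e1 = e1 + e1 by ring.
      apply: lerD => //; apply: le_trans b1; apply: ler_pM => //; rewrite ?expR_ge0//.
      by rewrite normrM ler_piMr// ger0_norm ?invr_ge0// invf_le1// ler1n.
    have -> : K * e1 ^+ 2 = (2 * e1) ^+ 2 + k ^+ 2 * e1 ^+ 2 by rewrite /K; ring.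
    have sq (y z : R) : 0 <= z -> `|y| <= z -> y ^+ 2 <= z ^+ 2.
      by move=> z0 yz; rewrite -(@real_normK _ y) ?num_real// lerXn2r// nnegrE.
    apply: lerD; first by apply: sq => //; rewrite mulr_ge0// ltW.
    rewrite exprMn; apply: ler_wpM2l; first exact: sqr_ge0.
    by apply: sq => //; exact: ltW.
  apply: le_trans Ex; rewrite /G ler_piMr//.
  by rewrite -expR0 ler_expR mulNr oppr_le0 mulr_ge0 ?expR_ge0.
have Es : E s <= 0.
  have := @expR_gt0 R (- c * expR (- s)); move: G0; rewrite /G => h e0.
  by rewrite -(ler_pM2r e0) mul0r.
have : k ^+ 2 * (expR s * w s ^+ 2) <= 0.
  by apply: le_trans Es; rewrite /E lerDr mulr_ge0 ?expR_ge0 ?sqr_ge0.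
rewrite pmulr_rle0 ?exprn_gt0// pmulr_rle0 ?expR_gt0// => h.
by apply/eqP; rewrite -sqrf_eq0 eq_le h sqr_ge0.
Qed.

End oscillator.

(** * From the phaseless identity to vanishing modes *)

Section phaseless_decay.
Variable R : realType.
Variables (k sa : R) (ua ub : R * R -> R).
Hypotheses (k0 : 0 < k) (Ha : helm k (upper (expR sa)) ua) (Hb : helm k (upper (expR sa)) ub)
  (ca : ext_cts (expR sa) ua) (cb : ext_cts (expR sa) ub) (Hrad : radiating k ua ub).
Variables (d1 d2 : R) (g : R -> R -> R) (Mg Cg : R).
Hypotheses (d1lt : `|d1| < 1) (d12 : d1 ^+ 2 + d2 ^+ 2 = 1)
  (cg : forall s, sa < s -> ctsI 0 pi (g s))
  (Hg : forall s, Mg < s -> expR s * itg 0 pi (fun t => `|g s t|) <= Cg)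
  (Hid : forall s t, sa < s -> 0 <= t <= pi ->
    sin (k * expR s * (d2 * sin t)) *
     (rotP k ua ub s t * sin (k * expR s * (1 - d1 * cos t))
      + rotQ k ua ub s t * cos (k * expR s * (1 - d1 * cos t))) = g s t).

Local Notation P := (rotP k ua ub).
Local Notation Q := (rotQ k ua ub).

(* Shifting [r] by [j / (2 k)] turns the phases by fixed angles. *)
Definition rshift (j s : R) : R := ln (expR s + j / (2 * k)).

Lemma rshiftK j s : 0 <= j -> expR (rshift j s) = expR s + j / (2 * k).
Proof.
by move=> j0; rewrite lnK// posrE ltr_wpDr ?expR_gt0// divr_ge0// mulr_ge0// ltW.
Qed.

Lemma rshift_ge j s : 0 <= j -> s <= rshift j s.
Proof.
move=> j0; by rewrite -ler_expR rshiftK// lerDl divr_ge0// mulr_ge0// ltW.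
Qed.

(** A bounded shift of [r] changes [s] by a multiple of [e^(-s)]; with the slope [e e^(s/2)] of
    [rot_lip] this leaves [e e^(-s/2)]. *)
Lemma rot_shift (e : R) : 0 < e -> exists2 M, sa <= M & forall s t j, M < s -> 0 <= t <= pi ->
  0 <= j <= 3 -> `|P (rshift j s) t - P s t| <= e * expR (- (s / 2)) /\
    `|Q (rshift j s) t - Q s t| <= e * expR (- (s / 2)).
Proof.
move=> e0; have e1 : 0 < e * k / 6 by rewrite divr_gt0// mulr_gt0.
have [M saM HM] := rot_lip sa Hrad e1.
have [L HL] : exists L : R, expR L = k^-1 by apply: expR_total; rewrite invr_gt0.
exists (Num.max M L); first by rewrite le_max saM.
move=> s t j; rewrite gt_max => /andP[Ms Ls] ht /andP[j0 j3].
have [E1 E2] := HM s (rshift j s) t Ms (rshift_ge s j0) ht.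
suff E : 2 * (e * k / 6) * expR (rshift j s / 2) * (rshift j s - s) <= e * expR (- (s / 2)).
  by split; [exact: le_trans E1 E|exact: le_trans E2 E].
have es := @expR_gt0 R s.
have ks : k^-1 <= expR s by rewrite -HL ler_expR ltW.
have jk : j / (2 * k) <= 3 / 2 * expR s.
  have -> : j / (2 * k) = j / 2 * k^-1 by field; exact: lt0r_neq0.
  apply: ler_pM => //; rewrite ?divr_ge0 ?invr_ge0 ?(ltW k0)//; lra.
have h1 : expR (rshift j s / 2) <= 2 * expR (s / 2).
  rewrite -(@ler_pXn2r _ 2)// ?nnegrE ?mulr_ge0 ?expR_ge0// exprMn !expR_half rshiftK//; lra.
have h2 : rshift j s - s <= 3 / (2 * k) * expR (- s).
  have := expR_ge1Dx (rshift j s - s); rewrite expRD rshiftK// mulrDl -expRD subrr expR0.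
  have : j / (2 * k) * expR (- s) <= 3 / (2 * k) * expR (- s).
    by rewrite ler_wpM2r ?expR_ge0// ler_wpM2r// invr_ge0 mulr_ge0// ltW.
  lra.
have e2 : expR (s / 2) * expR (- s) = expR (- (s / 2)) by rewrite -expRD; congr expR; field.
have -> : e * expR (- (s / 2)) = 2 * (e * k / 6) * (2 * expR (s / 2)) * (3 / (2 * k) * expR (- s)).
  rewrite -e2; field; exact: lt0r_neq0.
apply: ler_pM => //.
- by rewrite !mulr_ge0 ?expR_ge0// ltW.
- by rewrite subr_ge0 rshift_ge.
- by rewrite ler_wpM2l// mulr_ge0// ltW.
Qed.

Definition rotc : R := (1 - `|d1|) * d2 ^+ 2 / 64.
Local Notation c0 := rotc.

Lemma rotc_gt0 : 0 < c0.
Proof.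
have d1p : `|d1| ^+ 2 < 1 by rewrite expr_lt1.
rewrite /rotc divr_gt0// mulr_gt0 ?subr_gt0//.
by move: d1p; rewrite real_normK ?num_real//; have := d12; lra.
Qed.

(** The identity is used at four shifted radii with [P] and [Q] frozen at [s]; the term in [e] pays
    for the freezing. *)
Lemma phaseless_rot (e : R) : 0 < e -> exists2 M, sa <= M & forall s t, M < s -> 0 <= t <= pi ->
  let B := 4 * (`|g (rshift 0 s) t| + `|g (rshift 1 s) t| + `|g (rshift 2 s) t| + `|g (rshift 3 s) t|
     + e * expR (- (s / 2))) in
  c0 * (sin t ^+ 2 * `|P s t|) <= B /\ c0 * (sin t ^+ 2 * `|Q s t|) <= B.
Proof.
move=> e0; have e8 : 0 < e / 8 by rewrite divr_gt0.
have [M saM HM] := rot_shift e8; exists M => // s t Ms ht B.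
(* The increments of the two phases when [r] grows by [1 / (2 k)]. *)
pose de := (1 - d1 * cos t) / 2; pose al := d2 * sin t / 2.
pose ph := k * expR s * (1 - d1 * cos t); pose si := k * expR s * (d2 * sin t).
have sas : sa < s := le_lt_trans saM Ms.
have Zb j : 0 <= j <= 3 -> `|sin (si + j * al) * (P s t * sin (ph + j * de) + Q s t * cos (ph + j * de))|
    <= `|g (rshift j s) t| + e / 4 * expR (- (s / 2)).
  move=> hj; have [j0 _] := andP hj; have [b1 b2] := HM s t j Ms ht hj.
  rewrite -Hid//; last by apply: lt_le_trans sas (rshift_ge s j0).
  rewrite rshiftK//.
  have -> : k * (expR s + j / (2 * k)) * (d2 * sin t) = si + j * al.
    by rewrite /si /al; field; exact: lt0r_neq0.
  have -> : k * (expR s + j / (2 * k)) * (1 - d1 * cos t) = ph + j * de.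
    by rewrite /ph /de; field; exact: lt0r_neq0.
  set S := sin (si + _); set s1 := sin _; set c1 := cos _.
  rewrite -lerBlDl; apply: le_trans (lerB_dist _ _) _.
  rewrite -mulrBr normrM; apply: (@le_trans _ _ (1 * (e / 4 * expR (- (s / 2))))); last by rewrite mul1r.
  apply: ler_pM => //; first exact: sin_max.
  have -> : P s t * s1 + Q s t * c1 - (P (rshift j s) t * s1 + Q (rshift j s) t * c1) =
     - ((P (rshift j s) t - P s t) * s1 + (Q (rshift j s) t - Q s t) * c1) by ring.
  rewrite normrN; apply: (le_trans (ler_normD _ _)).
  have -> : e / 4 * expR (- (s / 2)) = e / 8 * expR (- (s / 2)) * 1 + e / 8 * expR (- (s / 2)) * 1 by field.
  rewrite !normrM; apply: lerD; apply: ler_pM => //; [exact: sin_max|exact: cos_max].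
have [i0 i1 i2 i3] : [/\ 0 <= (0 : R) <= 3, 0 <= (1 : R) <= 3, 0 <= (2 : R) <= 3 & 0 <= (3 : R) <= 3].
  by split; apply/andP; split; lra.
have z0 := Zb 0 i0; have z1 := Zb 1 i1; have z2 := Zb 2 i2; have z3 := Zb 3 i3.
have [p1 p2] := phaseless_pointwise (P s t) (Q s t) ph de si al.
have low := @rho_lower R d1 d2 t de al d1lt d12 erefl erefl; rewrite -/rotc in low.
have fin X : `|2 * (sin de * cos al * sin al ^+ 2) * X| <= B -> c0 * (sin t ^+ 2 * `|X|) <= B.
  move=> h; apply: le_trans h; rewrite normrM [leLHS]mulrA; apply: ler_wpM2r => //.
  by apply: le_trans low (ler_norm _).
by split; apply: fin; [apply: le_trans p1 _|apply: le_trans p2 _]; rewrite /B; lra.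
Qed.

(** [x <= 1 + x^2] for [x = e^(s/2) |f t|], integrated over [[0, pi]]. *)
Lemma itg_abs_of_sqr (C s : R) (f : R -> R) : ctsI 0 pi f ->
  expR s * itg 0 pi (fun t => f t ^+ 2) <= C ->
  expR (s / 2) * itg 0 pi (fun t => `|f t|) <= pi + C.
Proof.
move=> cf HC; have pi0 := @pi_ge0 R.
have e2 : expR (s / 2) * expR (s / 2) = expR s by rewrite -expRD; congr expR; field.
rewrite -itgZ; last exact: ctsI_abs.
have -> : pi + C = 1 * (pi - 0) + C by rewrite subr0 mul1r.
apply: (@le_trans _ _ (itg 0 pi (fun=> 1) + itg 0 pi (fun t => expR s * f t ^+ 2))); last first.
  by rewrite itg_cst// itgZ ?lerD2l//; exact: ctsIX.
rewrite -itgD; [|exact: ctsI_cst|by apply: ctsIZ; exact: ctsIX].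
apply: le_itg; first by apply: ctsIZ; exact: ctsI_abs.
  by apply: ctsID; [exact: ctsI_cst|apply: ctsIZ; exact: ctsIX].
move=> t _; rewrite -e2 -(@real_normK _ (f t)) ?num_real//.
have -> : expR (s / 2) * expR (s / 2) * `|f t| ^+ 2 = (expR (s / 2) * `|f t|) ^+ 2 by ring.
set x := _ * _; have h := sqr_ge0 (x - 1 / 2).
have E : (x - 1 / 2) ^+ 2 = x ^+ 2 - x + 1 / 4 by field.
rewrite E in h; lra.
Qed.

Lemma rot_abs_bound : exists2 M, sa <= M & exists2 K, 0 <= K & forall s, M < s ->
  expR (s / 2) * itg 0 pi (fun t => `|P s t|) <= K /\
  expR (s / 2) * itg 0 pi (fun t => `|Q s t|) <= K.
Proof.
have pi0 := @pi_ge0 R.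
have [M saM [C C0 HC]] := radiating_decay k0 Ha Hb ca cb Hrad.
exists M => //; exists (pi + (C + C)); first by lra.
move=> s Ms; have [H1 H2] := HC s Ms; have sas := le_lt_trans saM Ms.
have cA := ext_ctsI ca sas; have cB := ext_ctsI cb sas.
have key f : ctsI 0 pi f -> (forall t, f t ^+ 2 <= ext ua (pol (0, 0) s t) ^+ 2 + ext ub (pol (0, 0) s t) ^+ 2) ->
    expR (s / 2) * itg 0 pi (fun t => `|f t|) <= pi + (C + C).
  move=> cf Hf; apply: itg_abs_of_sqr => //; apply: le_trans (lerD H1 H2).
  rewrite -mulrDr ler_wpM2l ?expR_ge0// -itgD; [|exact: ctsIX|exact: ctsIX].
  apply: le_itg => //; first exact: ctsIX.
  by apply: ctsID; exact: ctsIX.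
split; apply: key; [exact: (rotP_cts ca cb sas)|move=> t|exact: (rotQ_cts ca cb sas)|move=> t].
  by rewrite -(rot_sqr _ _ (k * expR s)) /rotP lerDl sqr_ge0.
by rewrite -(rot_sqr _ _ (k * expR s)) /rotQ lerDr sqr_ge0.
Qed.

(** The integral of [|g|] is of order [e^(-s)], so it stays negligible after multiplication by
    [e^(s/2)]; the freezing error is exactly of order [e^(-s/2)] with an arbitrarily small
    constant. *)
Lemma sin2_rot_small (e : R) : 0 < e -> exists2 M, sa <= M & forall s, M < s ->
  expR (s / 2) * itg 0 pi (fun t => sin t ^+ 2 * `|P s t|) <= e /\
  expR (s / 2) * itg 0 pi (fun t => sin t ^+ 2 * `|Q s t|) <= e.
Proof.
move=> e0; have pi0 := @pi_gt0 R; have c00 := rotc_gt0.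
(* [4 e1 pi = c0 e / 2] is the share of the freezing error; the four integrals of [g] get the other
   half, [16 e2 = c0 e / 2]. *)
pose e1 := e * c0 / (8 * pi); have e10 : 0 < e1 := divr_gt0 (mulr_gt0 e0 c00) (mulr_gt0 (ltr0n _ 8) pi0).
have [M saM HM] := phaseless_rot e10.
pose e2 := e * c0 / 32; have e20 : 0 < e2 := divr_gt0 (mulr_gt0 e0 c00) (ltr0n _ 32).
have [L HL] : exists L : R, expR L = (`|Cg| + 1) / e2.
  by apply: expR_total; rewrite divr_gt0// ltr_wpDl.
exists (Num.max M (Num.max Mg (2 * L))); first by rewrite le_max saM.
move=> s; rewrite !gt_max => /andP[Ms /andP[Mgs Ls]].
have sas := le_lt_trans saM Ms.
have CgL : expR (- (s / 2)) * Cg <= e2.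
  apply: (@le_trans _ _ (expR (- L) * (`|Cg| + 1))).
    apply: (@le_trans _ _ (expR (- (s / 2)) * (`|Cg| + 1))).
      by rewrite ler_wpM2l ?expR_ge0// (le_trans (ler_norm _))// lerDl.
    by rewrite ler_wpM2r ?addr_ge0// ler_expR; lra.
  rewrite expRN HL invf_div divfK// gt_eqF// ltr_wpDl//.
have ee : expR (s / 2) * expR (- (s / 2)) = 1 by rewrite -expRD subrr expR0.
have sh j : 0 <= j -> sa < rshift j s by move=> j0; apply: lt_le_trans sas (rshift_ge s j0).
have cgj j : 0 <= j -> ctsI 0 pi (fun t => `|g (rshift j s) t|).
  by move=> j0; apply: ctsI_abs; apply: cg; exact: sh.
have gb j : 0 <= j -> expR (s / 2) * itg 0 pi (fun t => `|g (rshift j s) t|) <= e2.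
  move=> j0; apply: le_trans CgL.
  have := Hg (lt_le_trans Mgs (rshift_ge s j0)) => h.
  apply: le_trans (ler_wpM2l (expR_ge0 _) h); rewrite mulrA ler_wpM2r//.
    by apply: itg_ge0 => t _.
  rewrite -expRD ler_expR; have := rshift_ge s j0; lra.
have key f : ctsI 0 pi f -> (forall t, 0 <= t <= pi -> c0 * (sin t ^+ 2 * `|f t|) <=
    4 * (`|g (rshift 0 s) t| + `|g (rshift 1 s) t| + `|g (rshift 2 s) t| + `|g (rshift 3 s) t|
     + e1 * expR (- (s / 2)))) -> expR (s / 2) * itg 0 pi (fun t => sin t ^+ 2 * `|f t|) <= e.
  move=> cf Hf.
  have cs : ctsI 0 pi (fun t => sin t ^+ 2 * `|f t|).
    by apply: ctsIM; [move=> t _; ct|exact: ctsI_abs].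
  have [g0 g1 g2 g3] : [/\ ctsI 0 pi (fun t => `|g (rshift 0 s) t|), ctsI 0 pi (fun t => `|g (rshift 1 s) t|),
     ctsI 0 pi (fun t => `|g (rshift 2 s) t|) & ctsI 0 pi (fun t => `|g (rshift 3 s) t|)].
    by split; apply: cgj.
  have s1 := ctsID g0 g1; have s2 := ctsID s1 g2; have s3 := ctsID s2 g3.
  have cc : ctsI 0 pi (fun=> e1 * expR (- (s / 2))) := @ctsI_cst R 0 pi _.
  have s4 := ctsID s3 cc.
  have := le_itg (ctsIZ (c := c0) cs) (ctsIZ (c := 4) s4) Hf.
  rewrite itgZ// itgZ// !itgD// itg_cst ?(ltW pi0)// subr0.
  move/(ler_wpM2l (expR_ge0 (s / 2))).
  have E (I0 I1 I2 I3 : R) : expR (s / 2) * (4 * (I0 + I1 + I2 + I3 + e1 * expR (- (s / 2)) * pi)) =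
    4 * (expR (s / 2) * I0 + expR (s / 2) * I1 + expR (s / 2) * I2 + expR (s / 2) * I3) +
    4 * e1 * pi * (expR (s / 2) * expR (- (s / 2))) by ring.
  rewrite E ee mulr1 mulrCA => h.
  have b0 := gb 0 (lexx 0); have b1 := gb 1 ler01; have b2 := gb 2 (ler0n _ 2); have b3 := gb 3 (ler0n _ 3).
  rewrite -(ler_pM2l c00); apply: le_trans h _.
  have e1pi : 4 * e1 * pi = c0 * e / 2.
    by rewrite /e1; move: c0 (pi : R) pi0 => cc0 p p0; field; exact: lt0r_neq0.
  have e2E : e2 = c0 * e / 32 by rewrite /e2 (mulrC e).
  rewrite e1pi; lra.
split; apply: key.
- exact: (rotP_cts ca cb sas).
- by move=> t ht; have [] := HM s t Ms ht.
- exact: (rotQ_cts ca cb sas).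
- by move=> t ht; have [] := HM s t Ms ht.
Qed.

(** The weight [sin t ^+ 2] can be removed for a fixed mode: with [nu = n + 1], [|sin (nu t)| <= nu
    |sin t| <= nu eta + nu / (4 eta) sin^2 t], and the first term meets a bounded integral. *)
Lemma rot_modes_small (n : nat) (e : R) : 0 < e -> exists2 M, sa <= M & forall s, M < s ->
  expR (s / 2) * `|scoef (P s) n| <= e /\ expR (s / 2) * `|scoef (Q s) n| <= e.
Proof.
move=> e0; have [M1 saM1 [K K0 HK]] := rot_abs_bound.
have nu0 : 0 < n.+1%:R :> R by rewrite ltr0n.
set nu : R := n.+1%:R in nu0.
(* With [e2] below, [nu eta (K + 1)] and [nu / (4 eta) e2] both equal [e / 2]. *)
pose eta := e / (2 * nu * (K + 1)).
have K1 : 0 < K + 1 by rewrite ltr_wpDl.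
have eta0 : 0 < eta by rewrite divr_gt0// !mulr_gt0.
pose e2 := 2 * e * eta / nu; have e20 : 0 < e2 by apply: divr_gt0 => //; do 2!apply: mulr_gt0 => //.
have [M2 saM2 HM2] := sin2_rot_small e20.
exists (Num.max M1 M2); first by rewrite le_max saM1.
move=> s; rewrite gt_max => /andP[Ms1 Ms2]; have sas := le_lt_trans saM1 Ms1.
have key f : ctsI 0 pi f -> expR (s / 2) * itg 0 pi (fun t => `|f t|) <= K ->
    expR (s / 2) * itg 0 pi (fun t => sin t ^+ 2 * `|f t|) <= e2 ->
    expR (s / 2) * `|scoef f n| <= e.
  move=> cf h1 h2.
  have cs : ctsI 0 pi (fun t => sin t ^+ 2 * `|f t|).
    by apply: ctsIM; [move=> t _; ct|exact: ctsI_abs].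
  have cfs : ctsI 0 pi (fun t => f t * sin (nu * t)).
    by apply: ctsIM => //; move=> t _; exact: ct_sinn.
  have b : `|scoef f n| <= itg 0 pi (fun t => nu * eta * `|f t| + nu / (4 * eta) * (sin t ^+ 2 * `|f t|)).
    apply: le_trans (itg_abs_le cfs) _.
    apply: le_itg; first exact: ctsI_abs.
      by apply: ctsID; apply: ctsIZ => //; exact: ctsI_abs.
    move=> t _; rewrite normrM.
    have h : `|sin (nu * t)| <= nu * eta + nu / (4 * eta) * sin t ^+ 2.
      apply: le_trans (sin_mul_nat _ _) _; rewrite -/nu -(@real_normK _ (sin t)) ?num_real//.
      rewrite -subr_ge0; set x := `|sin t|.
      have -> : nu * eta + nu / (4 * eta) * x ^+ 2 - nu * x = nu / (4 * eta) * (x - 2 * eta) ^+ 2.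
        by field; exact: lt0r_neq0.
      by rewrite mulr_ge0 ?sqr_ge0// divr_ge0 ?(ltW nu0)// mulr_ge0// ltW.
    apply: le_trans (ler_wpM2l (normr_ge0 _) h) _.
    rewrite le_eqVlt; apply/orP; left; apply/eqP; ring.
  apply: le_trans (ler_wpM2l (expR_ge0 _) b) _.
  rewrite itgD; [|by apply: ctsIZ; exact: ctsI_abs|exact: ctsIZ].
  rewrite !itgZ//; last exact: ctsI_abs.
  rewrite mulrDr !(mulrCA (expR _)).
  have -> : e = nu * eta * (K + 1) + nu / (4 * eta) * e2.
    rewrite /e2 /eta; field; rewrite !gt_eqF//.
  apply: lerD; apply: ler_wpM2l => //.
  - by rewrite mulr_ge0// ltW.
  - by apply: le_trans h1 _; rewrite lerDl.
  - by rewrite divr_ge0 ?(ltW nu0)// mulr_ge0// ltW.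
have [k1 k2] := HK s Ms1; have [k3 k4] := HM2 s Ms2.
by split; apply: key => //; [exact: (rotP_cts ca cb sas)|exact: (rotQ_cts ca cb sas)].
Qed.

Lemma modes_small (n : nat) (e : R) : 0 < e -> exists2 M, sa <= M & forall s, M < s ->
  expR (s / 2) * `|sinmode ua n s| <= e /\ expR (s / 2) * `|sinmode ub n s| <= e.
Proof.
move=> e0; have e2 : 0 < e / 2 by rewrite divr_gt0.
have [M saM HM] := rot_modes_small n e2; exists M => // s Ms.
have [h1 h2] := HM s Ms; have sas := le_lt_trans saM Ms.
rewrite (scoef_rotP k ca cb n sas) in h1; rewrite (scoef_rotQ k ca cb n sas) in h2.
set p := rotPmode _ _ _ _ _ in h1; set q := rotQmode _ _ _ _ _ in h2.
have E := cos2Dsin2 (k * expR s); set c := cos _ in E; set sn := sin _ in E.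
have -> : sinmode ua n s = p * c - q * sn.
  rewrite -[LHS]mulr1 -E /p /q /rotPmode /rotQmode -/c -/sn; ring.
have -> : sinmode ub n s = p * sn + q * c.
  rewrite -[LHS]mulr1 -E /p /q /rotPmode /rotQmode -/c -/sn; ring.
have c1 : `|c| <= 1 := cos_max _; have s1 : `|sn| <= 1 := sin_max _.
have es := @expR_ge0 R (s / 2).
have tri x y : `|x| <= 1 -> `|y| <= 1 -> expR (s / 2) * (`|p * x| + `|q * y|) <= e.
  move=> x1 y1; rewrite mulrDr (splitr e); apply: lerD.
    by apply: le_trans h1; rewrite ler_wpM2l// normrM ler_piMr.
  by apply: le_trans h2; rewrite ler_wpM2l// normrM ler_piMr.
split.
  by apply: le_trans (tri _ _ c1 s1); rewrite ler_wpM2l// ler_normB.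
by apply: le_trans (tri _ _ s1 c1); rewrite ler_wpM2l// ler_normD.
Qed.

(** [radmode] controls [al1 + k e^s be] and [be1 - k e^s al]; the undifferentiated parts are small
    by [modes_small]. *)
Lemma modes_derive_small (n : nat) (e : R) : 0 < e -> exists2 M, sa <= M & forall s, M < s ->
  expR (- (s / 2)) * `|amode ua n s| <= e /\ expR (- (s / 2)) * `|amode ub n s| <= e.
Proof.
move=> e0; have pi0 := @pi_gt0 R.
have e1 : 0 < e / (16 * pi) by rewrite divr_gt0// mulr_gt0.
have e2 : 0 < e / (2 * k) by rewrite divr_gt0// mulr_gt0.
have [M1 saM1 HM1] := radiating_modes Ha Hb ca cb Hrad e1.
have [M2 saM2 HM2] := modes_small n e2.
exists (Num.max M1 M2); first by rewrite le_max saM1.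
move=> s; rewrite gt_max => /andP[Ms1 Ms2]; have sas := le_lt_trans saM1 Ms1.
have es := @expR_gt0 R (s / 2); have en := @expR_gt0 R (- (s / 2)).
have ee : expR (- (s / 2)) * expR (s / 2) = 1 by rewrite -expRD addNr expR0.
have eh : expR s = expR (s / 2) * expR (s / 2) by rewrite -expRD; congr expR; field.
have W : radmode k ua ub n s <= (e / 2 * expR (s / 2)) ^+ 2.
  have -> : (e / 2 * expR (s / 2)) ^+ 2 = (8 * (e / (16 * pi)) * pi) ^+ 2 * expR s.
    rewrite eh; move: (pi : R) pi0 => p p0; field; exact: lt0r_neq0.
  apply: le_trans (HM1 s n.+1 Ms1); rewrite big_ord_recr /= lerDr sumr_ge0// => i _.
  by rewrite /radmode addr_ge0// sqr_ge0.
have rt x : x ^+ 2 <= radmode k ua ub n s -> expR (- (s / 2)) * `|x| <= e / 2.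
  move=> h; have {}h := le_trans h W.
  have hx : `|x| <= e / 2 * expR (s / 2).
    rewrite -(@ler_pXn2r _ 2)// ?nnegrE ?mulr_ge0 ?(ltW es) ?divr_ge0 ?(ltW e0)//.
    by rewrite real_normK ?num_real.
  apply: le_trans (ler_wpM2l (ltW en) hx) _.
  by rewrite mulrCA ee mulr1.
have [m1 m2] := HM2 s Ms2.
have fin x y : expR (s / 2) * `|y| <= e / (2 * k) -> expR (- (s / 2)) * `|x + k * expR s * y| <= e / 2 ->
    expR (- (s / 2)) * `|x| <= e.
  move=> hy hx; have -> : x = (x + k * expR s * y) - k * expR s * y by ring.
  apply: le_trans (ler_wpM2l (ltW en) (ler_normB _ _)) _.
  rewrite mulrDr (splitr e); apply: lerD => //.
  rewrite !normrM (gtr0_norm k0) (gtr0_norm (expR_gt0 s)) eh.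
  have -> : expR (- (s / 2)) * (k * (expR (s / 2) * expR (s / 2)) * `|y|) =
    (expR (- (s / 2)) * expR (s / 2)) * (k * (expR (s / 2) * `|y|)) by ring.
  rewrite ee mul1r; have -> : e / 2 = k * (e / (2 * k)) by field; exact: lt0r_neq0.
  by rewrite ler_pM2l.
split.
  apply: (fin _ (sinmode ub n s)) => //; apply: rt.
  by rewrite /radmode lerDl sqr_ge0.
apply: (fin _ (- sinmode ua n s)); first by rewrite normrN.
by apply: rt; rewrite mulrN /radmode lerDr sqr_ge0.
Qed.

Lemma modes_eq0 (n : nat) (s : R) : sa < s -> sinmode ua n s = 0 /\ sinmode ub n s = 0.
Proof.
have key u : helm k (upper (expR sa)) u -> ext_cts (expR sa) u ->
    (forall e, 0 < e -> exists2 M, sa <= M & forall s, M < s -> expR (s / 2) * `|sinmode u n s| <= e) ->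
    (forall e, 0 < e -> exists2 M, sa <= M & forall s, M < s -> expR (- (s / 2)) * `|amode u n s| <= e) ->
    forall s, sa < s -> sinmode u n s = 0.
  move=> Hu cu H1 H2; apply: (mode_unique k0 (w1 := amode u n) (nu2 := n.+1%:R ^+ 2)).
    by move=> s' hs'; exact: (sinmode_derive Hu cu n (expR_lt2 hs')).
  move=> e e0; have [M1 _ h1] := H1 e e0; have [M2 _ h2] := H2 e e0.
  by exists (Num.max M1 M2) => s'; rewrite gt_max => /andP[? ?]; split; [exact: h1|exact: h2].
move=> sas; split; apply: key => // e e0.
- by have [M hM h] := modes_small n e0; exists M => // s' /h[].
- by have [M hM h] := modes_derive_small n e0; exists M => // s' /h[].
- by have [M hM h] := modes_small n e0; exists M => // s' /h[].
- by have [M hM h] := modes_derive_small n e0; exists M => // s' /h[].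
Qed.

End phaseless_decay.

Section zero_modes.
Variable R : realType.

Lemma itg_eq0 (f : R -> R) (a b : R) : a < b -> ctsI a b f ->
  (forall t, a <= t <= b -> 0 <= f t) ->
  itg a b f <= 0 -> forall t, a < t < b -> f t = 0.
Proof.
move=> ab cf fp H t /andP[at_ tb]; apply/eqP; apply: contraT => ft0.
have ht : a <= t <= b by rewrite !ltW.
have ft : 0 < f t by rewrite lt_neqAle eq_sym ft0 fp.
have e0 : 0 < f t / 2 by rewrite divr_gt0.
have [d d0 Hd] := (continuous_epsP f t).1 (cf t ht) _ e0.
pose r := Num.min (d / 2) (Num.min (t - a) (b - t)).
have r0 : 0 < r by rewrite !lt_min !subr_gt0 at_ tb divr_gt0.
have rd : r <= d / 2 by rewrite ge_min lexx.
have ra : r <= t - a by rewrite !ge_min lexx orbT.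
have rb : r <= b - t by rewrite !ge_min lexx !orbT.
have h1 : a <= t - r by lra.
have h2 : t - r <= t + r by lra.
have h3 : t + r <= b by lra.
have c2 : ctsI (t - r) b f by apply: ctsI_sub cf.
move: H; rewrite (itg_cat h1 _ cf); last by apply: le_trans h3.
rewrite (itg_cat h2 h3 c2) => H.
have p1 : 0 <= itg a (t - r) f.
  by apply: itg_ge0 => x /andP[x1 x2]; apply: fp; rewrite x1 (le_trans x2)//; lra.
have p3 : 0 <= itg (t + r) b f.
  by apply: itg_ge0 => x /andP[x1 x2]; apply: fp; rewrite x2 andbT (le_trans _ x1)//; lra.
have p2 : f t / 2 * (2 * r) <= itg (t - r) (t + r) f.
  have -> : 2 * r = t + r - (t - r) by ring.
  rewrite -itg_cst//; apply: le_itg; [exact: ctsI_cst|exact: ctsI_sub cf|].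
  move=> x /andP[x1 x2].
  have xt : `|x - t| < d by rewrite ltr_norml; apply/andP; split; lra.
  have := Hd x xt; rewrite ltr_norml => /andP[]; lra.
have : 0 < f t / 2 * (2 * r) by rewrite mulr_gt0// mulr_gt0.
lra.
Qed.

Lemma polar_upper (x : R * R) : 0 < x.2 -> exists s t, [/\ 0 < t < pi, x = pol (0, 0) s t
  & expR (2 * s) = x.1 ^+ 2 + x.2 ^+ 2].
Proof.
move=> x2; have n0 : 0 < x.1 ^+ 2 + x.2 ^+ 2 by rewrite ltr_wpDl ?sqr_ge0// exprn_gt0.
have [s1 Hs1] : exists s : R, expR s = x.1 ^+ 2 + x.2 ^+ 2 by exact: expR_total.
pose s := s1 / 2; have Hs : expR s ^+ 2 = x.1 ^+ 2 + x.2 ^+ 2.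
  by rewrite -Hs1 expR_half.
have es := @expR_gt0 R s; set r := expR s in Hs es.
have y2 : (x.1 / r) ^+ 2 + (x.2 / r) ^+ 2 = 1.
  have -> : (x.1 / r) ^+ 2 + (x.2 / r) ^+ 2 = (x.1 ^+ 2 + x.2 ^+ 2) / r ^+ 2.
    by field; exact: lt0r_neq0.
  by rewrite -Hs divff// lt0r_neq0// exprn_gt0.
have x2r : 0 < x.2 / r by rewrite divr_gt0.
have y1 : -1 < x.1 / r < 1.
  have : (x.1 / r) ^+ 2 < 1 by rewrite -y2 ltrDl exprn_gt0.
  by rewrite -ltr_norml -(@real_normK _ (x.1 / r)) ?num_real// expr_lt1.
pose t := acos (x.1 / r).
have [y1a y1b] := andP y1.
have ct : cos t = x.1 / r by rewrite acosK// in_itv /= !ltW.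
have ht : 0 < t < pi.
  by apply/andP; split; [apply: acos_gt0|apply: acos_ltpi]; rewrite ?y1a ?y1b ltW.
exists s, t; split => //; last by rewrite -expR_sqr.
have st : sin t = x.2 / r.
  have h := cos2Dsin2 t; rewrite ct in h.
  have h0 : 0 <= sin t by apply: sin_ge0; have [? ?] := andP ht; rewrite !ltW.
  apply/eqP; rewrite -(@eqrXn2 _ 2)// ?(ltW x2r)//.
  by apply/eqP; apply: (@addrI _ ((x.1 / r) ^+ 2)); rewrite h y2.
rewrite /pol /= ct st !add0r -/r [X in X.1]surjective_pairing.
by rewrite {1}[x]surjective_pairing; congr pair; field; exact: lt0r_neq0.
Qed.

Lemma zero_modes (sa : R) (u : R * R -> R) : ext_cts (expR sa) u ->
  (forall n s, sa < s -> sinmode u n s = 0) -> forall x, upper (expR sa) x -> u x = 0.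
Proof.
move=> cu H x [x2 xs]; have [s [t [ht Ex Es]]] := polar_upper x2.
have sas : sa < s by move: xs; rewrite -Es expR_sqr ltr_expR ltr_pM2l.
have pi0 := @pi_gt0 R.
rewrite Ex -ext_polE//; apply/eqP; rewrite -sqrf_eq0; apply/eqP.
have c2 := ctsIX (n := 2) (ext_ctsI cu sas).
apply: (itg_eq0 pi0 c2) => // [? _|]; first exact: sqr_ge0.
rewrite -[leRHS](mulr0 (2 / pi)); apply: parseval_le.
- exact: (ext_ctsI cu sas).
- by apply: ext_pol0; left.
- by apply: ext_pol0; right.
by move=> N; rewrite big1// => n _; rewrite scoef_sinmode H// expr0n.
Qed.

End zero_modes.

(** * Small cells *)

Section plane_integrals.
Variable R : realType.
Implicit Types (f g : R * R -> R).

Definition cont2 f : Prop := forall x, {for x, continuous f}.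

Definition itg2 (a b c d : R) f : R := itg a b (fun x => itg c d (fun y => f (x, y))).

Lemma cont2D f g : cont2 f -> cont2 g -> cont2 (fun x => f x + g x).
Proof. by move=> cf cg x; apply: ctD. Qed.
Lemma cont2M f g : cont2 f -> cont2 g -> cont2 (fun x => f x * g x).
Proof. by move=> cf cg x; apply: ctM. Qed.
Lemma cont2X f n : cont2 f -> cont2 (fun x => f x ^+ n).
Proof. by move=> cf x; apply: ctX. Qed.
Lemma cont2_cst (c : R) : cont2 (fun=> c).
Proof. by move=> x; apply: ct_cst. Qed.
Lemma cont2Z (c : R) f : cont2 f -> cont2 (fun x => c * f x).
Proof. by move=> cf; apply: cont2M => //; exact: cont2_cst. Qed.

Lemma cont2_slice f a b x : cont2 f -> ctsI a b (fun y => f (x, y)).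
Proof. by move=> cf y _; apply: (@ct_comp2 R R f (fun=> x) (fun y => y)); [exact: cf|exact: ct_cst|exact: ct_id]. Qed.

Lemma cont2_itg f a b c d : c <= d -> cont2 f -> ctsI a b (fun x => itg c d (fun y => f (x, y))).
Proof.
move=> cd cf x _; apply: (@continuous_itg R R (fun x y => f (x, y)) x c d 1) => //.
by move=> x' y _ _; apply: (@ct_comp2 R _ f fst snd); [exact: cf|exact: ct_fst|exact: ct_snd].
Qed.

Lemma itg2D f g a b c d : c <= d -> cont2 f -> cont2 g ->
  itg2 a b c d (fun x => f x + g x) = itg2 a b c d f + itg2 a b c d g.
Proof.
move=> cd cf cg; rewrite /itg2 -itgD; [|exact: cont2_itg|exact: cont2_itg].
by apply: eq_itg => x _; rewrite itgD//; exact: cont2_slice.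
Qed.

Lemma itg2Z (k : R) f a b c d : c <= d -> cont2 f ->
  itg2 a b c d (fun x => k * f x) = k * itg2 a b c d f.
Proof.
move=> cd cf; rewrite /itg2 -itgZ; last exact: cont2_itg.
by apply: eq_itg => x _; rewrite itgZ//; exact: cont2_slice.
Qed.

Lemma itg2_cst (k : R) a b c d : a <= b -> c <= d -> itg2 a b c d (fun=> k) = k * (d - c) * (b - a).
Proof.
move=> ab cd; rewrite /itg2 (@eq_itg _ _ _ _ (fun=> k * (d - c))) ?itg_cst// => x _.
Qed.

Lemma le_itg2 f g a b c d : c <= d -> cont2 f -> cont2 g ->
  (forall x, a <= x.1 <= b -> c <= x.2 <= d -> f x <= g x) -> itg2 a b c d f <= itg2 a b c d g.
Proof.
move=> cd cf cg fg; apply: le_itg; [exact: cont2_itg|exact: cont2_itg|] => x hx.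
by apply: le_itg; [exact: cont2_slice|exact: cont2_slice|] => y hy; exact: fg.
Qed.

Lemma itg_split (f : R -> R) (a s : R) n : 0 <= s -> (forall x, {for x, continuous f}) ->
  itg a (a + n%:R * s) f = \sum_(i < n) itg (a + i%:R * s) (a + i.+1%:R * s) f.
Proof.
move=> s0 cf; elim: n => [|n IH].
  by rewrite big_ord0 mul0r addr0 /itg set_itv1 Rintegral_set1.
rewrite big_ord_recr /= -IH -(itg_cat (a := a)) //.
- by rewrite lerDl mulr_ge0.
- by rewrite lerD2l ler_wpM2r// ler_nat.
Qed.

Lemma cauchy_schwarz1 (g : R -> R) (a b : R) : a < b -> ctsI a b g ->
  (itg a b g) ^+ 2 <= (b - a) * itg a b (fun x => g x ^+ 2).
Proof.
move=> ab cg; have s0 : 0 < b - a by rewrite subr_gt0.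
pose m := itg a b g / (b - a).
have : 0 <= itg a b (fun x => (g x - m) ^+ 2) by apply: itg_ge0 => x _; exact: sqr_ge0.
have cg2 := ctsIX (n := 2) cg.
rewrite (@eq_itg _ _ _ _ (fun x => g x ^+ 2 + ((- 2 * m) * g x + m ^+ 2))); last by move=> x _; ring.
have cc : ctsI a b (fun=> m ^+ 2) := @ctsI_cst R a b _.
have cz := ctsIZ (c := - 2 * m) cg.
rewrite itgD//; last exact: ctsID.
rewrite itgD// itgZ// itg_cst ?(ltW ab)//.
set I := itg _ _ g; set J := itg _ _ _ => H.
have -> : I ^+ 2 = (b - a) * (I ^+ 2 / (b - a)) by field; exact: lt0r_neq0.
rewrite ler_pM2l//.
have E : J + (- 2 * m * I + m ^+ 2 * (b - a)) = J - I ^+ 2 / (b - a).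
  by rewrite /m -/I; field; exact: lt0r_neq0.
by move: H; rewrite E subr_ge0.
Qed.

(** The oscillation of [g] is at most the integral of [|g1|], so [g] stays that close to its mean;
    [cauchy_schwarz1] squares the bound. *)
Lemma poincare1 (g g1 : R -> R) (a b : R) : a < b -> ctsI a b g1 ->
  (forall x, a <= x <= b -> is_derive x 1 g (g1 x)) ->
  itg a b (fun x => g x ^+ 2) <=
    (itg a b g) ^+ 2 / (b - a) + (b - a) ^+ 2 * itg a b (fun x => g1 x ^+ 2).
Proof.
move=> ab cg1 dg; have s0 : 0 < b - a by rewrite subr_gt0.
have cg : ctsI a b g by move=> x hx; apply: is_derive_continuous (dg x hx).
pose A := itg a b (fun x => `|g1 x|).
have ca := ctsI_abs cg1.
have A0 : 0 <= A by apply: itg_ge0.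
have osc0 x y : a <= x -> x <= y -> y <= b -> `|g y - g x| <= A.
  move=> ax xy yb; have xb := le_trans xy yb.
  have c1 : ctsI x y g1 by apply: ctsI_sub cg1.
  have dg' z : x <= z <= y -> is_derive z 1 g (g1 z).
    by move=> /andP[z1 z2]; apply: dg; rewrite (le_trans ax z1) (le_trans z2 yb).
  rewrite -(itg_FTC2 xy c1 dg').
  apply: le_trans (itg_abs_le c1) _; rewrite /A (itg_cat ax xb ca).
  have cxb : ctsI x b (fun x => `|g1 x|) by apply: ctsI_sub ca.
  rewrite (itg_cat xy yb cxb).
  have p1 : 0 <= itg a x (fun x => `|g1 x|) by apply: itg_ge0.
  have p2 : 0 <= itg y b (fun x => `|g1 x|) by apply: itg_ge0.
  lra.
have osc x y : a <= x <= b -> a <= y <= b -> `|g y - g x| <= A.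
  move=> /andP[x1 x2] /andP[y1 y2]; have [xy|/ltW yx] := leP x y; first exact: osc0.
  by rewrite distrC; exact: osc0.
pose m := itg a b g / (b - a).
have gm x : a <= x <= b -> `|g x - m| <= A.
  move=> hx.
  have E : itg a b (fun y => g x - g y) = (b - a) * (g x - m).
    rewrite itgB// ?itg_cst ?(ltW ab)//; last exact: ctsI_cst.
    by rewrite /m; field; exact: lt0r_neq0.
  have := itg_bound (M := A) (ltW ab) (ctsIB (@ctsI_cst R a b (g x)) cg) (fun y hy => osc y x hy hx).
  by rewrite E normrM gtr0_norm// mulrC ler_pM2r.
have A2 : A ^+ 2 <= (b - a) * itg a b (fun x => g1 x ^+ 2).
  apply: le_trans (cauchy_schwarz1 ab ca) _; rewrite ler_wpM2l ?(ltW s0)//.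
  rewrite le_eqVlt; apply/orP; left; apply/eqP; apply: eq_itg => x _.
  by rewrite real_normK ?num_real.
have cg2 := ctsIX (n := 2) cg.
have cgm : ctsI a b (fun x => g x - m) by apply: ctsIB => //; exact: ctsI_cst.
have : itg a b (fun x => (g x - m) ^+ 2) <= A ^+ 2 * (b - a).
  rewrite -itg_cst ?(ltW ab)//; apply: le_itg; [exact: ctsIX|exact: ctsI_cst|].
  move=> x hx; rewrite -(@real_normK _ (g x - m)) ?num_real// lerXn2r ?nnegrE//; exact: gm.
rewrite (@eq_itg _ _ _ _ (fun x => g x ^+ 2 + ((- 2 * m) * g x + m ^+ 2))); last by move=> x _; ring.
have cc : ctsI a b (fun=> m ^+ 2) := @ctsI_cst R a b _.
have cz := ctsIZ (c := - 2 * m) cg.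
rewrite itgD//; last exact: ctsID.
rewrite itgD// itgZ// itg_cst ?(ltW ab)//.
set I := itg _ _ g; set J := itg _ _ (fun x => g x ^+ 2) => H.
have E : J + (- 2 * m * I + m ^+ 2 * (b - a)) = J - I ^+ 2 / (b - a).
  by rewrite /m -/I; field; exact: lt0r_neq0.
rewrite E in H; have := ler_wpM2r (ltW s0) A2; set B := itg _ _ _ => H2.
have E2 : (b - a) * B * (b - a) = (b - a) ^+ 2 * B by ring.
rewrite E2 in H2; lra.
Qed.

(** [poincare1] on every vertical segment, then once more in [x] for the integrals [G] over these
    segments; [cauchy_schwarz1] bounds [G1 ^+ 2] by [s] times the integral of [fx ^+ 2]. *)
Lemma poincare2 (f fx fy : R * R -> R) (a b s : R) : 0 < s ->
  cont2 f -> cont2 fx -> cont2 fy ->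
  (forall x : R * R, is_derive x.1 1 (fun t => f (t, x.2)) (fx x)) ->
  (forall x : R * R, is_derive x.2 1 (fun t => f (x.1, t)) (fy x)) ->
  itg2 a (a + s) b (b + s) (fun x => f x ^+ 2) <=
    (itg2 a (a + s) b (b + s) f) ^+ 2 / s ^+ 2
     + s ^+ 2 * itg2 a (a + s) b (b + s) (fun x => fx x ^+ 2 + fy x ^+ 2).
Proof.
move=> s0 cf cfx cfy dfx dfy.
have as_ : a < a + s by rewrite ltrDl.
have bs : b < b + s by rewrite ltrDl.
have sE c : c + s - c = s by rewrite addrC addKr.
have cf2 := cont2X (n := 2) cf; have cfx2 := cont2X (n := 2) cfx; have cfy2 := cont2X (n := 2) cfy.
pose G x := itg b (b + s) (fun y => f (x, y)).
pose G1 x := itg b (b + s) (fun y => fx (x, y)).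
have dG (x : R) : is_derive x 1 G (G1 x).
  apply: (@is_derive_itg R (fun x y => f (x, y)) (fun x y => fx (x, y)) x b (b + s) 1 (ltW bs)) => //.
  - by move=> t y _ _; exact: (dfx (t, y)).
  - by move=> t y _ _; apply: (@ct_comp2 R _ f fst snd); [exact: cf|exact: ct_fst|exact: ct_snd].
  - by move=> y _; apply: (@ct_comp2 R _ fx fst snd); [exact: cfx|exact: ct_fst|exact: ct_snd].
have cG1 : ctsI a (a + s) G1 by apply: cont2_itg => //; exact: ltW.
have cG : ctsI a (a + s) G by apply: cont2_itg => //; exact: ltW.
have If2 : ctsI a (a + s) (fun x => itg b (b + s) (fun y => f (x, y) ^+ 2)) := cont2_itg (ltW bs) cf2.
have Ifx2 : ctsI a (a + s) (fun x => itg b (b + s) (fun y => fx (x, y) ^+ 2)) := cont2_itg (ltW bs) cfx2.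
have Ify2 : ctsI a (a + s) (fun x => itg b (b + s) (fun y => fy (x, y) ^+ 2)) := cont2_itg (ltW bs) cfy2.
have step1 : itg2 a (a + s) b (b + s) (fun x => f x ^+ 2) <=
    itg a (a + s) (fun x => s^-1 * G x ^+ 2 + s ^+ 2 * itg b (b + s) (fun y => fy (x, y) ^+ 2)).
  apply: le_itg.
  - exact: If2.
  - apply: ctsID; apply: ctsIZ; [exact: ctsIX|exact: Ify2].
  move=> x _.
  have := @poincare1 (fun y => f (x, y)) (fun y => fy (x, y)) _ _ bs (cont2_slice (x := x) cfy) (fun y _ => dfy (x, y)).
  by rewrite sE -/(G x) [_ / s]mulrC.
apply: le_trans step1 _.
rewrite itgD; [|by apply: ctsIZ; exact: ctsIX|by apply: ctsIZ; exact: Ify2].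
rewrite (@itgZ _ _ _ s^-1 _ (ctsIX (n := 2) cG)) (@itgZ _ _ _ (s ^+ 2) _ Ify2).
rewrite itg2D ?(ltW bs)// mulrDr addrA; apply: lerD => //.
have P := poincare1 as_ cG1 (fun x _ => dG x); rewrite sE in P.
have si : 0 < s^-1 by rewrite invr_gt0.
have := ler_wpM2l (ltW si) P => H; apply: le_trans H _.
rewrite mulrDr; apply: lerD.
  rewrite le_eqVlt; apply/orP; left; apply/eqP; rewrite /itg2 -/G; field; exact: lt0r_neq0.
have CS : itg a (a + s) (fun x => G1 x ^+ 2) <= s * itg2 a (a + s) b (b + s) (fun x => fx x ^+ 2).
  rewrite -itgZ; last exact: Ifx2.
  apply: le_itg; first exact: ctsIX.
    by apply: ctsIZ; exact: Ifx2.
  move=> x _; have := cauchy_schwarz1 bs (cont2_slice (x := x) cfx).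
  by rewrite sE.
apply: (@le_trans _ _ (s^-1 * (s ^+ 2 * (s * itg2 a (a + s) b (b + s) (fun x => fx x ^+ 2))))).
  by rewrite ler_pM2l// ler_pM2l ?exprn_gt0.
rewrite le_eqVlt; apply/orP; left; apply/eqP; field; exact: lt0r_neq0.
Qed.

Lemma itg2_split (f : R * R -> R) (a b s : R) n : 0 <= s -> cont2 f ->
  itg2 a (a + n%:R * s) b (b + n%:R * s) f =
  \sum_(i < n) \sum_(j < n) itg2 (a + i%:R * s) (a + i%:R * s + s) (b + j%:R * s) (b + j%:R * s + s) f.
Proof.
move=> s0 cf.
have ls (c : R) : c <= c + s by rewrite lerDl.
have E (c : R) i : c + i.+1%:R * s = c + i%:R * s + s by rewrite -natr1; ring.
have bn : b <= b + n%:R * s by rewrite lerDl mulr_ge0.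
rewrite /itg2 itg_split//; last first.
  by move=> x; apply: (cont2_itg (a := x) (b := x)) => //; rewrite lexx.
apply: eq_bigr => i _; rewrite E.
pose F (j : nat) x := itg (b + j%:R * s) (b + j%:R * s + s) (fun y => f (x, y)).
rewrite (@eq_itg _ _ _ _ (fun x => \sum_(j < n) F j x)).
  by rewrite (@itg_sum R _ _ n F)// => j; exact: cont2_itg.
move=> x _; rewrite itg_split//; last by move=> y; apply: (cont2_slice (a := y) (b := y)); rewrite ?lexx.
by apply: eq_bigr => j _; rewrite E.
Qed.

End plane_integrals.

(** * A continuously differentiable truncation *)

Section truncation.
Variable R : realType.

Lemma ct_max (V : normedModType R) (f g : V -> R) (x : V) : {for x, continuous f} ->
  {for x, continuous g} -> {for x, continuous (fun z => Num.max (f z) (g z))}.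
Proof. by move=> cf cg; apply: continuous_max. Qed.

(* [(t - e)^2 / t] for [t > e], and [0] otherwise. *)
Definition trp (e t : R) : R := (Num.max t e - e) ^+ 2 / Num.max t e.
Definition trp1 (e t : R) : R := 1 - e ^+ 2 / (Num.max t e) ^+ 2.

(* A C^1 truncation vanishing on [-e, e], with [0 <= trunc' <= 1] and
   [0 <= t trunc t <= t^2]. *)
Definition trunc (e t : R) : R := trp e t - trp e (- t).
Definition trunc1 (e t : R) : R := trp1 e t + trp1 e (- t).

Variable e : R.
Hypothesis e0 : 0 < e.

Lemma trp_small t : t <= e -> trp e t = 0.
Proof. by move=> te; rewrite /trp max_r// subrr expr0n mul0r. Qed.

Lemma trp_large t : e <= t -> trp e t = (t - e) ^+ 2 / t.
Proof. by move=> te; rewrite /trp max_l. Qed.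

Lemma trp1_small t : t <= e -> trp1 e t = 0.
Proof. by move=> te; rewrite /trp1 max_r// divff ?subrr// sqrf_eq0 gt_eqF. Qed.

Lemma trp1_large t : e <= t -> trp1 e t = 1 - e ^+ 2 / t ^+ 2.
Proof. by move=> te; rewrite /trp1 max_l. Qed.

Lemma trp1_cts t : {for t, continuous (trp1 e)}.
Proof.
rewrite /trp1; apply: ctB; first exact: ct_cst.
apply: ctM; first exact: ct_cst.
apply: ct_inv; first by rewrite sqrf_eq0 gt_eqF// lt_max e0 orbT.
by apply: ctX; apply: ct_max; [exact: ct_id|exact: ct_cst].
Qed.

Lemma trp_derive (t : R) : is_derive t 1 (trp e) (trp1 e t).
Proof.
have [te|te|->] := ltgtP t e.
- rewrite trp1_small; last exact: ltW.
  have d0 : 0 < e - t by rewrite subr_gt0.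
  have near y : `|y - t| < e - t -> 0 = trp e y.
    by move=> yt; rewrite trp_small//; have := ler_norm (y - t); lra.
  exact: (is_derive_near_eq d0 near (dC t 0)).
- rewrite trp1_large; last exact: ltW.
  have d0 : 0 < t - e by rewrite subr_gt0.
  have t0 : t != 0 by rewrite gt_eqF// (lt_trans e0).
  have near y : `|y - t| < t - e -> (y - e) ^+ 2 / y = trp e y.
    by move=> yt; rewrite trp_large//; have := ler_norm (t - y); rewrite distrC; lra.
  apply: (is_derive_near_eq d0 near).
  have dv := dinv t0 (dId t); drvR; field; exact: t0.
(* At the junction [t = e] the function is [0] on the left and [h^2 / (h + e) <= d h] on the
   right. *)
rewrite trp1_small//; apply/is_derive_epsP => d d0; exists (d * e); first by rewrite mulr_gt0.
move=> h hd; rewrite (trp_small (lexx e)) mul0r !subr0.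
have [h0|h0] := leP h 0.
  by rewrite trp_small ?gerDl// normr0 mulr_ge0// ltW.
rewrite trp_large ?lerDl ?(ltW h0)// (addrC e) addrK.
have eh : 0 < h + e by rewrite addr_gt0.
rewrite ger0_norm ?divr_ge0 ?sqr_ge0 ?(ltW eh)// ler_pdivrMr// gtr0_norm//.
rewrite gtr0_norm// in hd; have := mulr_gt0 d0 h0; have := mulr_gt0 h0 h0.
nra.
Qed.

Lemma trunc_derive (t : R) : is_derive t 1 (trunc e) (trunc1 e t).
Proof.
have d1 := trp_derive t; have d2 := trp_derive (- t); have dn := dN (dId t).
have d3 := is_derive_compR dn d2.
by rewrite /trunc; drvR; rewrite /trunc1; ring.
Qed.

Lemma trunc1_cts t : {for t, continuous (trunc1 e)}.
Proof.
rewrite /trunc1; apply: ctD; first exact: trp1_cts.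
by apply: (ct_comp (f := fun t => - t)); [exact: trp1_cts|apply: ctN; exact: ct_id].
Qed.

Lemma trunc_cts t : {for t, continuous (trunc e)}.
Proof. exact: is_derive_continuous (trunc_derive t). Qed.

Lemma trunc_small t : `|t| <= e -> trunc e t = 0 /\ trunc1 e t = 0.
Proof.
rewrite ler_norml => /andP[h1 h2]; have h3 : - t <= e by rewrite lerNl.
by rewrite /trunc /trunc1 !trp_small ?trp1_small// subrr addr0.
Qed.

Lemma trp_large_bounds t : e < t ->
  [/\ 0 <= trp1 e t <= 1, 0 <= t * trp e t <= t ^+ 2 & `|trp e t - t| <= 2 * e].
Proof.
move=> et; have t0 : 0 < t := lt_trans e0 et.
rewrite trp_large ?trp1_large ?(ltW et)//.
have E : (t - e) ^+ 2 / t = t - 2 * e + e ^+ 2 / t by field; exact: lt0r_neq0.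
have q0 : 0 <= e ^+ 2 / t by rewrite divr_ge0 ?sqr_ge0// ltW.
have q1 : e ^+ 2 / t <= e by rewrite ler_pdivrMr// expr2 ler_pM2l// ltW.
split.
- have r0 : 0 <= e ^+ 2 / t ^+ 2 by rewrite divr_ge0 ?sqr_ge0.
  have r1 : e ^+ 2 / t ^+ 2 <= 1.
    by rewrite ler_pdivrMr ?exprn_gt0// mul1r lerXn2r ?nnegrE ?ltW.
  apply/andP; split; lra.
- rewrite mulrCA divff ?mulr1 ?gt_eqF// sqr_ge0/=.
  by rewrite lerXn2r ?nnegrE ?subr_ge0 ?gerBl ?ltW.
- rewrite E ler_norml; apply/andP; split; lra.
Qed.

Lemma trunc_bounds t : [/\ 0 <= trunc1 e t <= 1, 0 <= trunc e t * t <= t ^+ 2 & `|trunc e t - t| <= 2 * e].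
Proof.
have [h|h] := leP `|t| e.
  have [-> ->] := trunc_small h; rewrite lexx ler01 mul0r lexx sqr_ge0 sub0r normrN.
  by split=> //; have := e0; lra.
have [t0|t0] := leP 0 t.
  rewrite ger0_norm// in h; have [h1 h2 h3] := trp_large_bounds h.
  have n : - t <= e by have := e0; lra.
  by rewrite /trunc1 /trunc (trp_small n) (trp1_small n) addr0 subr0 [trp e t * t]mulrC.
rewrite ltr0_norm// in h; have [h1 h2 h3] := trp_large_bounds h.
have n : t <= e by have := e0; lra.
rewrite /trunc1 /trunc (trp_small n) (trp1_small n) add0r sub0r mulNr -mulrN [trp e (- t) * _]mulrC.
rewrite -[t ^+ 2]sqrrN; split => //; rewrite -normrN; have -> // : - (- trp e (- t) - t) = trp e (- t) - - t by ring.
Qed.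

End truncation.

(** * Solutions with vanishing means over small squares *)

Section small_cells.
Variable R : realType.

(** Continuity of this extension expresses zero boundary values for an arbitrary open [D]. *)
Definition zext (D : set (R * R)) (v : R * R -> R) (x : R * R) : R :=
  if `[< D x >] then v x else 0.

Lemma zext_in D v x : D x -> zext D v x = v x.
Proof. by move=> Dx; rewrite /zext asboolT. Qed.

Lemma zext_out D v x : ~ D x -> zext D v x = 0.
Proof. by move=> Dx; rewrite /zext asboolF. Qed.

Section truncated_energy.
Variables (D : set (R * R)) (L k e : R) (v p q p1 p2 q1 q2 : R * R -> R).
Hypotheses (oD : open D) (L0 : 0 < L) (DL : forall x, D x -> `|x| < L) (e0 : 0 < e).
Hypotheses (Dv : C1on D v p q) (Dp : C1on D p p1 p2) (Dq : C1on D q q1 q2)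
  (Hv : forall x, D x -> p1 x + q2 x = - k ^+ 2 * v x) (cv : cont2 (zext D v)).

(** The purpose of the truncation: near a point outside [D] continuity makes [v] small, so whatever
    vanishes where [|v| <= e] vanishes in a whole neighbourhood. Extensions by zero of truncated
    quantities are therefore as regular as inside [D]. *)
Lemma zext_near (x : R * R) (f : R * R -> R) : ~ D x ->
  (forall y, D y -> `|v y| <= e -> f y = 0) ->
  exists2 d, 0 < d & forall y, `|y - x| < d -> zext D f y = 0.
Proof.
move=> nDx Hf; have [d d0 Hd] := (continuous_epsP _ _).1 (@cv x) _ e0.
exists d => // y /Hd; rewrite (zext_out v nDx) subr0.
have [Dy|nDy _] := pselect (D y); last exact: zext_out.
by rewrite !zext_in// => /ltW; exact: Hf.
Qed.

Lemma zext_cts (f : R * R -> R) : (forall y, D y -> `|v y| <= e -> f y = 0) ->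
  (forall x, D x -> {for x, continuous f}) -> cont2 (zext D f).
Proof.
move=> Hf cf x; have [Dx|nDx] := pselect (D x).
  have [d d0 Hd] := open_box oD Dx; apply: (ct_near d0 _ (cf x Dx)) => y yx.
  by rewrite zext_in//; exact: Hd.
have [d d0 Hd] := zext_near nDx Hf.
by apply: (@ct_near _ _ (fun=> 0) _ _ _ d0) => [y /Hd ->|]; last exact: ct_cst.
Qed.

Lemma norm_fst_sub (x : R * R) (t : R) : `|(t, x.2) - x| = `|t - x.1|.
Proof. by rewrite prod_normE /= subrr normr0 max_l. Qed.

Lemma norm_snd_sub (x : R * R) (t : R) : `|(x.1, t) - x| = `|t - x.2|.
Proof. by rewrite prod_normE /= subrr normr0 max_r. Qed.

Lemma zext_derive1 (f f1 : R * R -> R) : (forall y, D y -> `|v y| <= e -> f y = 0) ->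
  (forall x : R * R, D x -> is_derive x.1 1 (fun t => f (t, x.2)) (f1 x)) ->
  forall x : R * R, is_derive x.1 1 (fun t => zext D f (t, x.2)) (zext D f1 x).
Proof.
move=> Hf df x; have [Dx|nDx] := pselect (D x).
  have [d d0 Hd] := open_box oD Dx; rewrite zext_in//.
  apply: (is_derive_near_eq d0 _ (df x Dx)) => t tx.
  by rewrite zext_in//; apply: Hd; rewrite norm_fst_sub.
have [d d0 Hd] := zext_near nDx Hf; rewrite zext_out//.
apply: (is_derive_near_eq d0 _ (dC x.1 0)) => t tx.
by rewrite Hd// norm_fst_sub.
Qed.

Lemma zext_derive2 (f f2 : R * R -> R) : (forall y, D y -> `|v y| <= e -> f y = 0) ->
  (forall x : R * R, D x -> is_derive x.2 1 (fun t => f (x.1, t)) (f2 x)) ->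
  forall x : R * R, is_derive x.2 1 (fun t => zext D f (x.1, t)) (zext D f2 x).
Proof.
move=> Hf df x; have [Dx|nDx] := pselect (D x).
  have [d d0 Hd] := open_box oD Dx; rewrite zext_in//.
  apply: (is_derive_near_eq d0 _ (df x Dx)) => t tx.
  by rewrite zext_in//; apply: Hd; rewrite norm_snd_sub.
have [d d0 Hd] := zext_near nDx Hf; rewrite zext_out//.
apply: (is_derive_near_eq d0 _ (dC x.2 0)) => t tx.
by rewrite Hd// norm_snd_sub.
Qed.

Local Notation box f := (itg2 (- L) L (- L) L f).

Lemma LL : - L <= L. Proof. by have := L0; lra. Qed.

Lemma zext_edge f (x : R * R) : L <= `|x.1| \/ L <= `|x.2| -> zext D f x = 0.
Proof.
move=> h; apply: zext_out => /DL; rewrite prod_norm_lt => /andP[h1 h2].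
by case: h; rewrite leNgt ?h1 ?h2.
Qed.

Lemma normL : `|L| = L /\ `|- L| = L.
Proof. by rewrite normrN gtr0_norm. Qed.

(** The variable [x] is the outer one in the iterated integral, so the derivative is first taken out
    of the inner integral; the order of integration is never exchanged. *)
Lemma box_derive1 (f f1 : R * R -> R) : cont2 (zext D f) -> cont2 (zext D f1) ->
  (forall x : R * R, is_derive x.1 1 (fun t => zext D f (t, x.2)) (zext D f1 x)) ->
  box (zext D f1) = 0.
Proof.
move=> cf cf1 df.
pose G x := itg (- L) L (fun y => zext D f (x, y)).
have dG (x : R) : is_derive x 1 G (itg (- L) L (fun y => zext D f1 (x, y))).
  apply: (@is_derive_itg R (fun x y => zext D f (x, y)) (fun x y => zext D f1 (x, y)) x (- L) L 1 LL) => //.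
  - by move=> t y _ _; exact: (df (t, y)).
  - by move=> t y _ _; apply: (@ct_comp2 R _ (zext D f) fst snd); [exact: cf|exact: ct_fst|exact: ct_snd].
  - by move=> y _; apply: (@ct_comp2 R _ (zext D f1) fst snd); [exact: cf1|exact: ct_fst|exact: ct_snd].
have [n1 n2] := normL.
rewrite /itg2 (itg_FTC2 LL _ (fun x _ => dG x)); last by apply: cont2_itg => //; exact: LL.
have G0 x : `|x| = L -> G x = 0.
  move=> xL; rewrite -[RHS](itg0 (- L) L); apply: eq_itg => y _.
  by apply: zext_edge; left; rewrite /= xL.
by rewrite !G0// subrr.
Qed.

Lemma box_derive2 (f f2 : R * R -> R) : cont2 (zext D f2) ->
  (forall x : R * R, is_derive x.2 1 (fun t => zext D f (x.1, t)) (zext D f2 x)) ->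
  box (zext D f2) = 0.
Proof.
move=> cf2 df; have [n1 n2] := normL.
rewrite /itg2 -[RHS](itg0 (- L) L); apply: eq_itg => x _.
have dF (y : R) : - L <= y <= L -> is_derive y 1 (fun y => zext D f (x, y)) (zext D f2 (x, y)).
  by move=> _; exact: (df (x, y)).
rewrite (itg_FTC2 LL (cont2_slice (x := x) cf2) dF).
by rewrite !zext_edge ?subrr//; right; rewrite /= ?n1 ?n2.
Qed.

Local Notation Z := (zext D (fun x => trunc e (v x))).
Local Notation Zx := (zext D (fun x => trunc1 e (v x) * p x)).
Local Notation Zy := (zext D (fun x => trunc1 e (v x) * q x)).

Lemma trunc_comp_cts (f : R -> R) (x : R * R) : D x -> (forall t, {for t, continuous f}) ->
  {for x, continuous (fun x => f (v x))}.
Proof. by move=> Dx cf; apply: ct_comp => //; have [] := Dv Dx. Qed.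

Lemma Z_regular : [/\ cont2 Z, cont2 Zx, cont2 Zy,
  forall x : R * R, is_derive x.1 1 (fun t => Z (t, x.2)) (Zx x)
  & forall x : R * R, is_derive x.2 1 (fun t => Z (x.1, t)) (Zy x)].
Proof.
have z0 y : D y -> `|v y| <= e -> trunc e (v y) = 0 by move=> _ /trunc_small[].
have z1 y : D y -> `|v y| <= e -> trunc1 e (v y) = 0 by move=> _ /trunc_small[].
split.
- by apply: zext_cts => // x Dx; apply: trunc_comp_cts => //; exact: trunc_cts.
- apply: zext_cts => [y Dy h|x Dx]; first by rewrite z1// mul0r.
  by apply: ctM; [apply: trunc_comp_cts => //; exact: trunc1_cts|have [] := Dv Dx].
- apply: zext_cts => [y Dy h|x Dx]; first by rewrite z1// mul0r.
  by apply: ctM; [apply: trunc_comp_cts => //; exact: trunc1_cts|have [] := Dv Dx].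
- apply: zext_derive1 => [y Dy h|x Dx]; first by rewrite z0.
  have [_ _ _ d1 _] := Dv Dx.
  have := is_derive_compR d1 (trunc_derive e0 (v (x.1, x.2))).
  by rewrite -surjective_pairing.
- apply: zext_derive2 => [y Dy h|x Dx]; first by rewrite z0.
  have [_ _ _ _ d1] := Dv Dx.
  have := is_derive_compR d1 (trunc_derive e0 (v (x.1, x.2))).
  by rewrite -surjective_pairing.
Qed.

(* Integrate the divergence of [trunc e v * grad v] over the square. *)
Lemma truncated_energy : box (fun x => Zx x ^+ 2 + Zy x ^+ 2) <= k ^+ 2 * box (fun x => zext D v x ^+ 2).
Proof.
have z0 y : `|v y| <= e -> trunc e (v y) = 0 by move=> /trunc_small[].
have z1 y : `|v y| <= e -> trunc1 e (v y) = 0 by move=> /trunc_small[].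
have [cZ cZx cZy _ _] := Z_regular.
pose F x := trunc e (v x) * p x; pose Fx x := trunc1 e (v x) * p x * p x + trunc e (v x) * p1 x.
pose G x := trunc e (v x) * q x; pose Gy x := trunc1 e (v x) * q x * q x + trunc e (v x) * q2 x.
have c0 x : D x -> {for x, continuous (fun x => trunc e (v x))}.
  by move=> Dx; apply: trunc_comp_cts => //; exact: trunc_cts.
have c1 x : D x -> {for x, continuous (fun x => trunc1 e (v x))}.
  by move=> Dx; apply: trunc_comp_cts => //; exact: trunc1_cts.
have cF : cont2 (zext D F).
  apply: zext_cts => [y _ h|x Dx]; first by rewrite /F z0// mul0r.
  by have h0 := c0 x Dx; have [_ h1 h2 _ _] := Dv Dx; rewrite /F; ct.
have cFx : cont2 (zext D Fx).
  apply: zext_cts => [y _ h|x Dx]; first by rewrite /Fx z0// z1// !mul0r addr0.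
  by have h0 := c0 x Dx; have h4 := c1 x Dx; have [_ h1 h2 _ _] := Dv Dx; have [_ h3 _ _ _] := Dp Dx; rewrite /Fx; ct.
have cGy : cont2 (zext D Gy).
  apply: zext_cts => [y _ h|x Dx]; first by rewrite /Gy z0// z1// !mul0r addr0.
  by have h0 := c0 x Dx; have h4 := c1 x Dx; have [_ h1 h2 _ _] := Dv Dx; have [_ _ h3 _ _] := Dq Dx; rewrite /Gy; ct.
have bF : box (zext D Fx) = 0.
  apply: (box_derive1 cF cFx); apply: zext_derive1 => [y _ h|x Dx]; first by rewrite /F z0// mul0r.
  have [_ _ _ d1 _] := Dv Dx; have [_ _ _ d2 _] := Dp Dx.
  have d3 := is_derive_compR d1 (trunc_derive e0 (v (x.1, x.2))).
  by rewrite /F; drvR; rewrite -surjective_pairing /Fx; ring.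
have bG : box (zext D Gy) = 0.
  apply: (@box_derive2 G _ cGy); apply: zext_derive2 => [y _ h|x Dx]; first by rewrite /G z0// mul0r.
  have [_ _ _ _ d1] := Dv Dx; have [_ _ _ _ d2] := Dq Dx.
  have d3 := is_derive_compR d1 (trunc_derive e0 (v (x.1, x.2))).
  by rewrite /G; drvR; rewrite -surjective_pairing /Gy; ring.
have cv2 := cont2X (n := 2) cv.
have cS := cont2D cFx cGy; have cK := cont2Z (c := k ^+ 2) cv2.
apply: (@le_trans _ _ (box (fun x => (zext D Fx x + zext D Gy x) + k ^+ 2 * zext D v x ^+ 2))); last first.
  by rewrite (itg2D _ _ LL cS cK) (itg2D _ _ LL cFx cGy) (itg2Z _ _ _ LL cv2) bF bG !add0r.
apply: le_itg2; [exact: LL|by apply: cont2D; exact: cont2X|exact: cont2D|].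
move=> x _ _; have [Dx|nDx] := pselect (D x); last first.
  by rewrite !(zext_out _ nDx) !expr0n /= mulr0 !addr0.
rewrite !zext_in// /Fx /Gy.
have [b1 b2 _] := trunc_bounds e0 (v x).
set T1 := trunc1 _ _ in b1 *; set T := trunc _ _ in b2 *.
have [t0 t1] := andP b1; have [_ t2] := andP b2.
(* The pointwise inequality behind the energy bound: [T1 ^+ 2 <= T1] for the gradient terms, and
   [T * v x <= v x ^+ 2] after the equation has replaced [p1 + q2]. *)
have -> : T1 * p x * p x + T * p1 x + (T1 * q x * q x + T * q2 x) = T1 * (p x ^+ 2 + q x ^+ 2) + T * (p1 x + q2 x) by ring.
rewrite Hv// !exprMn -mulrDr.
have h1 : T1 ^+ 2 * (p x ^+ 2 + q x ^+ 2) <= T1 * (p x ^+ 2 + q x ^+ 2).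
  by apply: ler_wpM2r; [rewrite addr_ge0 ?sqr_ge0|rewrite expr2 ler_piMl].
have h2 := ler_wpM2l (sqr_ge0 k) t2.
have E : T * (- k ^+ 2 * v x) = - (k ^+ 2 * (T * v x)) by ring.
rewrite E -[leLHS]addr0 -addrA; apply: lerD => //; rewrite addrC subr_ge0; exact: h2.
Qed.

(** Truncation moves [v] by at most [2 e], so the cell means of [Z] are of order [e]. The inequality
    of Poincare and the energy bound give [|Z|^2 <= 16 L^2 e^2 + (s k)^2 |v|^2] for integrals over
    the box; [4 (s k)^2 <= 1] lets the left side absorb the last term. *)
Lemma small_cells_bound (n : nat) (s : R) : (0 < n)%N -> s = 2 * L / n%:R -> 4 * (s * k) ^+ 2 <= 1 ->
  (forall i j, (i < n)%N -> (j < n)%N ->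
    itg2 (- L + i%:R * s) (- L + i%:R * s + s) (- L + j%:R * s) (- L + j%:R * s + s) (zext D v) = 0) ->
  box (fun x => zext D v x ^+ 2) <= 128 * L ^+ 2 * e ^+ 2.
Proof.
move=> n0 sE sk H.
have nr : 0 < n%:R :> R by rewrite ltr0n.
have s0 : 0 < s by rewrite sE divr_gt0// mulr_gt0.
have LE : L = - L + n%:R * s by rewrite sE; field; exact: lt0r_neq0.
have ls (c : R) : c <= c + s by rewrite lerDl ltW.
have sE2 (c : R) : c + s - c = s by rewrite addrC addKr.
have [cZ cZx cZy dZx dZy] := Z_regular.
have Zv x : `|Z x - zext D v x| <= 2 * e.
  have [Dx|nDx] := pselect (D x); last first.
    by rewrite !(zext_out _ nDx) subrr normr0 mulr_ge0// ltW.
  by rewrite !zext_in//; have [] := trunc_bounds e0 (v x).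
have cell i j : (i < n)%N -> (j < n)%N ->
    `|itg2 (- L + i%:R * s) (- L + i%:R * s + s) (- L + j%:R * s) (- L + j%:R * s + s) Z| <= 2 * e * s ^+ 2.
  move=> hi hj.
  set a := - L + i%:R * s; set b := - L + j%:R * s.
  have Hij : itg2 a (a + s) b (b + s) (zext D v) = 0 by exact: H.
  have E : itg2 a (a + s) b (b + s) (fun=> 2 * e) = 2 * e * s ^+ 2.
    by rewrite itg2_cst// !sE2; ring.
  have cc := @cont2_cst R (2 * e).
  rewrite ler_norml; apply/andP; split.
    rewrite lerNl -subr_ge0 opprK -E -(itg2D _ _ (ls b)) //.
    rewrite -Hij; apply: le_itg2 => //; first exact: cont2D.
    by move=> x _ _; have := Zv x; rewrite ler_norml => /andP[h _]; rewrite -lerBlDr -opprB lerNl.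
  rewrite -E -[leRHS]add0r -Hij -itg2D//; apply: le_itg2 => //; first exact: cont2D.
  by move=> x _ _; have := Zv x; rewrite ler_norml => /andP[_ h]; rewrite -lerBlDl.
have cZ2 := cont2X (n := 2) cZ.
have cg := cont2D (cont2X (n := 2) cZx) (cont2X (n := 2) cZy).
have P : box (fun x => Z x ^+ 2) <= 16 * L ^+ 2 * e ^+ 2 + s ^+ 2 * box (fun x => Zx x ^+ 2 + Zy x ^+ 2).
  have Bs f : cont2 f -> box f = \sum_(i < n) \sum_(j < n)
      itg2 (- L + i%:R * s) (- L + i%:R * s + s) (- L + j%:R * s) (- L + j%:R * s + s) f.
    by move=> cf; have := itg2_split (- L) (- L) n (ltW s0) cf; rewrite -LE.
  rewrite !Bs//.
  have -> : 16 * L ^+ 2 * e ^+ 2 = \sum_(i < n) \sum_(j < n) (4 * e ^+ 2 * s ^+ 2).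
    have sN c : \sum_(i < n) (c : R) = c * n%:R by rewrite sumr_const card_ord mulr_natr.
    rewrite !sN sE; move: (n%:R) nr => N N0; field; exact: lt0r_neq0.
  rewrite mulr_sumr -big_split /=; apply: ler_sum => i _.
  rewrite mulr_sumr -big_split /=; apply: ler_sum => j _.
  apply: le_trans (poincare2 (- L + i%:R * s) (- L + j%:R * s) s0 cZ cZx cZy dZx dZy) _.
  rewrite lerD2r ler_pdivrMr ?exprn_gt0//.
  have := cell i j (ltn_ord i) (ltn_ord j).
  set I := itg2 _ _ _ _ _ => h.
  have -> : 4 * e ^+ 2 * s ^+ 2 * s ^+ 2 = (2 * e * s ^+ 2) ^+ 2 by ring.
  by rewrite -(@real_normK _ I) ?num_real// lerXn2r// nnegrE ?mulr_ge0 ?sqr_ge0// ltW.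
have cv2 := cont2X (n := 2) cv.
have Q : box (fun x => zext D v x ^+ 2) <= 2 * box (fun x => Z x ^+ 2) + 32 * L ^+ 2 * e ^+ 2.
  have -> : 32 * L ^+ 2 * e ^+ 2 = box (fun=> 8 * e ^+ 2).
    by rewrite itg2_cst ?LL//; ring.
  rewrite -itg2Z ?LL// -itg2D ?LL//; [|exact: cont2Z|exact: cont2_cst].
  apply: le_itg2; [exact: LL|exact: cv2|by apply: cont2D; [exact: cont2Z|exact: cont2_cst]|].
  move=> x _ _; have := Zv x; rewrite -(@ler_pXn2r _ 2)// ?nnegrE ?mulr_ge0 ?(ltW e0)//.
  rewrite real_normK ?num_real// => h.
  have h2 := sqr_ge0 (Z x + (Z x - zext D v x)).
  have E1 : (Z x + (Z x - zext D v x)) ^+ 2 = 2 * Z x ^+ 2 + 2 * (Z x - zext D v x) ^+ 2 - zext D v x ^+ 2 by ring.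
  rewrite E1 in h2; have E2 : (2 * e) ^+ 2 = 4 * e ^+ 2 by ring.
  rewrite E2 in h; lra.
have T := truncated_energy.
set J := box (fun x => zext D v x ^+ 2) in Q T *.
have J0 : 0 <= J by apply: itg_ge0 => x _; apply: itg_ge0 => y _; exact: sqr_ge0.
have h1 := ler_wpM2l (sqr_ge0 s) T.
have h2 := ler_wpM2r J0 sk.
have E : 4 * (s * k) ^+ 2 * J = 4 * (s ^+ 2 * (k ^+ 2 * J)) by ring.
rewrite E mul1r in h2; lra.
Qed.

End truncated_energy.

(** The number of cells is fixed before [v] and depends on [L] and [k] only, so solutions with zero
    boundary values are subject to a fixed finite number of conditions. The truncation level then
    tends to [0]. *)
Lemma small_cells_zero (D : set (R * R)) (L k : R) : open D -> 0 < L ->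
  (forall x, D x -> `|x| < L) -> exists n : nat, exists2 s : R, 0 < s & forall v,
    helm k D v -> cont2 (zext D v) ->
    (forall i j, (i < n)%N -> (j < n)%N ->
      itg2 (- L + i%:R * s) (- L + i%:R * s + s) (- L + j%:R * s) (- L + j%:R * s + s) (zext D v) = 0) ->
    forall x, D x -> v x = 0.
Proof.
move=> oD L0 DL.
pose n := (Num.bound (4 * L * `|k|)).+1.
have nr : 0 < n%:R :> R by rewrite ltr0n.
exists n, (2 * L / n%:R); first by rewrite divr_gt0// mulr_gt0.
set s := 2 * L / n%:R.
have sk : 4 * (s * k) ^+ 2 <= 1.
  have h : 2 * (s * `|k|) <= 1.
    rewrite /s; have -> : 2 * (2 * L / n%:R * `|k|) = 4 * L * `|k| / n%:R by field; exact: lt0r_neq0.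
    rewrite ler_pdivrMr// mul1r.
    have b0 : 0 <= 4 * L * `|k| by rewrite !mulr_ge0// ltW.
    apply: ltW; apply: lt_le_trans (archi_boundP b0) _.
    by rewrite ler_nat.
  have -> : 4 * (s * k) ^+ 2 = (2 * (s * `|k|)) ^+ 2 by rewrite !exprMn real_normK ?num_real//; ring.
  have s0 : 0 <= s by rewrite divr_ge0// mulr_ge0// ltW.
  by apply: exprn_ile1 => //; rewrite mulr_ge0// mulr_ge0.
move=> v [p [q [p1 [p2 [q1 [q2 [Dv Dp Dq Hv]]]]]]] cv H x Dx.
pose J := itg2 (- L) L (- L) L (fun x => zext D v x ^+ 2).
have nL : - L < L by lra.
have J0 : J <= 0.
  apply/ler_addgt0Pl => e e0; rewrite addr0.
  pose C := 128 * L ^+ 2; have C0 : 0 < C by rewrite mulr_gt0 ?exprn_gt0.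
  pose d := Num.min 1 (e / C); have d0 : 0 < d by rewrite lt_min ltr01 divr_gt0.
  apply: le_trans (small_cells_bound oD L0 DL d0 Dv Dp Dq Hv cv _ erefl sk H) _ => //.
  rewrite -/C mulrC -ler_pdivlMr// expr2; apply: (@le_trans _ _ (1 * d)).
    by rewrite ler_wpM2r ?(ltW d0)// ge_min lexx.
  by rewrite mul1r ge_min lexx orbT.
have cv2 := cont2X (n := 2) cv.
have := DL x Dx; rewrite prod_norm_lt !ltr_norml => /andP[hx1 hx2].
have G0 := itg_eq0 nL (cont2_itg (ltW nL) cv2) (fun t _ => itg_ge0 (fun y _ => sqr_ge0 (zext D v (t, y)))) J0 hx1.
have c2 : ctsI (- L) L (fun y => zext D v (x.1, y) ^+ 2) := cont2_slice (x := x.1) cv2.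
have G1 : itg (- L) L (fun y => zext D v (x.1, y) ^+ 2) <= 0 by rewrite G0.
have /eqP := itg_eq0 nL c2 (fun y _ => sqr_ge0 _) G1 hx2.
by rewrite sqrf_eq0 -surjective_pairing zext_in// => /eqP.
Qed.

End small_cells.

(** * Plane waves along a ray *)

Section plane_wave_independence.
Variable R : realType.

(** The antiderivative of [cos (w r)] vanishing at [0]: bounded in [r] except for [w = 0]. *)
Definition sinint (w r : R) : R := if w == 0 then r else sin (w * r) / w.

Lemma sinint_derive (w r : R) : is_derive r 1 (sinint w) (cos (w * r)).
Proof.
rewrite /sinint; have [->|w0] := eqVneq w 0; first by rewrite mul0r cos0; exact: dId.
by drvR; field.
Qed.

Lemma sinint_bound (w r : R) : w != 0 -> `|sinint w r| <= `|w|^-1.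
Proof.
by move=> w0; rewrite /sinint (negbTE w0) normrM normfV ler_piMl ?invr_ge0// sin_max.
Qed.

Lemma is_derive_sum (F : nat -> R -> R) (F1 : nat -> R) (r : R) N :
  (forall n, is_derive r 1 (F n) (F1 n)) ->
  is_derive r 1 (fun r => \sum_(n < N) F n r) (\sum_(n < N) F1 n).
Proof.
move=> dF; elim: N => [|N IH].
  rewrite big_ord0; apply: is_derive_congr (dC r 0) _ erefl => y.
  by rewrite big_ord0.
have dN' := dF N; rewrite big_ord_recr /=.
by apply: is_derive_congr (dD IH dN') _ erefl => y; rewrite big_ord_recr.
Qed.

(* The mean value of a trigonometric sum tending to zero at infinity isolates
   the coefficient of the frequency zero. *)
Lemma trig_sum_coef (N j : nat) (c om : nat -> R) : (j < N)%N -> om j = 0 ->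
  (forall n, (n < N)%N -> n != j -> om n != 0) ->
  (forall e, 0 < e -> exists M, forall r, M < r -> `|\sum_(n < N) c n * cos (om n * r)| <= e) ->
  c j = 0.
Proof.
move=> jN omj om0 H; apply/eqP; rewrite -normr_le0; apply/ler_addgt0Pl => e e0; rewrite addr0.
have e2 : 0 < e / 2 by rewrite divr_gt0.
have [M HM] := H _ e2.
pose F r := \sum_(n < N) c n * sinint (om n) r.
pose f r := \sum_(n < N) c n * cos (om n * r).
have dF (r : R) : is_derive r 1 F (f r).
  exact: (@is_derive_sum (fun n r => c n * sinint (om n) r) _ r N
    (fun n => dZ (c n) (sinint_derive (om n) r))).
pose rest r := \sum_(n < N | n != Ordinal jN) c n * sinint (om n) r.
pose B := \sum_(n < N | n != Ordinal jN) `|c n| * `|om n|^-1.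
have B0 : 0 <= B by apply: sumr_ge0 => n _; rewrite mulr_ge0// invr_ge0.
have FE r : F r = c j * r + rest r.
  by rewrite /F (bigD1 (Ordinal jN))//= omj /sinint eqxx.
have restB r : `|rest r| <= B.
  apply: (le_trans (ler_norm_sum _ _ _)); apply: ler_sum => n nj.
  by rewrite normrM ler_wpM2l// sinint_bound// om0.
(* Long enough for the bounded remainders, [2 B] in total, to be at most [e T / 2]. *)
pose T := 4 * B / e + 1.
have T0 : 0 < T by rewrite /T ltr_wpDl// divr_ge0 ?mulr_ge0// ltW.
have I1 : M + 1 <= M + 1 <= M + 1 + T by rewrite lexx lerDl ltW.
have I2 : M + 1 <= M + 1 + T <= M + 1 + T by rewrite lexx lerDl ltW.
have fb r : M + 1 <= r <= M + 1 + T -> `|f r| <= e / 2.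
  by move=> /andP[h _]; apply: HM; apply: lt_le_trans h; rewrite ltrDl.
have := mvt_le (fun r _ => dF r) fb I1 I2.
rewrite !FE (addrC (M + 1) T) addrK (gtr0_norm T0).
have -> : c j * (T + (M + 1)) + rest (T + (M + 1)) - (c j * (M + 1) + rest (M + 1)) =
   c j * T + (rest (T + (M + 1)) - rest (M + 1)) by ring.
move=> h.
have h2 : `|c j| * T <= e / 2 * T + (B + B).
  rewrite -(gtr0_norm T0) -normrM (gtr0_norm T0).
  have -> : c j * T = (c j * T + (rest (T + (M + 1)) - rest (M + 1))) - (rest (T + (M + 1)) - rest (M + 1)) by ring.
  apply: (le_trans (ler_normB _ _)); apply: lerD => //.
  by apply: (le_trans (ler_normB _ _)); apply: lerD.
rewrite -(ler_pM2r T0); apply: le_trans h2 _.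
have -> : e * T = e / 2 * T + (2 * B + e / 2) by rewrite /T; field; exact: lt0r_neq0.
by rewrite lerD2l; lra.
Qed.

(* The direction [d'] of the wave reflected by [x_2 = 0]. *)
Definition refl2 (d : R * R) : R * R := (d.1, - d.2).

Definition pw_re (k : R) (x d : R * R) : R := cos (k * dotp x d) - cos (k * dotp x (refl2 d)).
Definition pw_im (k : R) (x d : R * R) : R := sin (k * dotp x d) - sin (k * dotp x (refl2 d)).

(** The vector [(sg, 1)] is orthogonal to none of the [y n], because [sg] exceeds every
    [|(y n).2 / (y n).1|] (which reads [0] when the denominator vanishes, a case treated apart). *)
Lemma generic_direction (N : nat) (y : nat -> R * R) :
  (forall n, (n < N)%N -> y n != (0, 0)) ->
  exists s t, 0 < t < pi /\ forall n, (n < N)%N -> dotp (pol (0, 0) s t) (y n) != 0.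
Proof.
move=> Hy; pose sg := 1 + \sum_(n < N) `|(y n).2 / (y n).1|.
have [s [t [ht E _]]] := polar_upper (x := (sg, 1)) ltr01.
exists s, t; split => // n nN; rewrite -E /dotp /= mul1r.
have [y1|y1] := eqVneq (y n).1 0.
  rewrite y1 mulr0 add0r; apply: contra (Hy n nN) => /eqP y2.
  by rewrite [y n]surjective_pairing y1 y2.
have le : `|(y n).2 / (y n).1| < sg.
  rewrite /sg (bigD1 (Ordinal nN))//= addrCA ltrDl ltr_pwDl// sumr_ge0//.
apply/eqP => H; have E2 : (y n).2 / (y n).1 = - sg.
  have -> : (y n).2 = - (sg * (y n).1) by rewrite -[RHS]addr0 -H; ring.
  by field.
move: le; rewrite E2 normrN ltNge ler_norm//.
Qed.

Lemma dotp_pol (s t : R) (d : R * R) : dotp (pol (0, 0) s t) d = expR s * (cos t * d.1 + sin t * d.2).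
Proof. by rewrite /dotp /pol /= !add0r; ring. Qed.

(** Equality would give [d = (cos t, sin t)], which points upward. So no incident wave radiates
    along the ray. *)
Lemma unit_dot_lt1 (t : R) (d : R * R) : d.1 ^+ 2 + d.2 ^+ 2 = 1 -> d.2 < 0 -> 0 < t < pi ->
  cos t * d.1 + sin t * d.2 != 1.
Proof.
move=> d1 d20 ht; have st := sin_gt0_pi ht; apply/eqP => H.
have E : (cos t - d.1) ^+ 2 + (sin t - d.2) ^+ 2 = 0.
  have -> : (cos t - d.1) ^+ 2 + (sin t - d.2) ^+ 2 =
   (cos t ^+ 2 + sin t ^+ 2) + (d.1 ^+ 2 + d.2 ^+ 2) - 2 * (cos t * d.1 + sin t * d.2) by ring.
  by rewrite cos2Dsin2 d1 H; ring.
have : 0 < (sin t - d.2) ^+ 2 by rewrite exprn_gt0// subr_gt0 (lt_trans d20).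
have := sqr_ge0 (cos t - d.1); lra.
Qed.

Lemma sum_identity (N : nat) (f g p q u w : nat -> R) (K a b : R) :
  (forall n, K * (f n + g n) = (p n - K * q n) * a - (u n + K * w n) * b) ->
  K * (\sum_(n < N) f n + \sum_(n < N) g n) =
  (\sum_(n < N) p n - K * \sum_(n < N) q n) * a - (\sum_(n < N) u n + K * \sum_(n < N) w n) * b.
Proof.
move=> H; elim: N => [|N IH]; first by rewrite !big_ord0; ring.
rewrite !big_ord_recr /= addrACA mulrDr IH H; ring.
Qed.

(** Along the ray of angle [t], [d/ds - i k r] multiplies a plane wave by [i k r (la - 1)], with
    [la] the cosine of its angle to the ray. Multiplying the sum by the conjugate of the [j]-th wave
    and taking the imaginary part gives [k r] times a sum of cosines in [r] which Sommerfeld's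
    condition sends to [0]; its constant coefficient is [c j (la j - 1)]. *)
Lemma plane_waves_not_radiating (k : R) (N : nat) (d : nat -> R * R) (c : nat -> R) : 0 < k ->
  (forall n, (d n).1 ^+ 2 + (d n).2 ^+ 2 = 1 /\ (d n).2 < 0) -> injective d ->
  radiating k (fun x => \sum_(n < N) c n * pw_re k x (d n))
              (fun x => \sum_(n < N) c n * pw_im k x (d n)) ->
  forall n, (n < N)%N -> c n = 0.
Proof.
move=> k0 Hd dinj Hrad j jN.
(* The ray must separate direction [j] from the other incident and from all reflected directions.
   The slot [n = j], where the difference would be zero, receives the harmless vector [(1, 0)]. *)
pose y n := if (n < N)%N then (if n == j then (1, 0) else ((d n).1 - (d j).1, (d n).2 - (d j).2))
  else ((refl2 (d (n - N)%N)).1 - (d j).1, (refl2 (d (n - N)%N)).2 - (d j).2).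
have y0 n : (n < N + N)%N -> y n != (0, 0).
  move=> _; rewrite /y; case: ifP => _.
    have [//|nj] := eqVneq n j; first by rewrite xpair_eqE oner_eq0.
    apply: contra nj; rewrite xpair_eqE !subr_eq0 => /andP[/eqP h1 /eqP h2].
    by apply/eqP/dinj; rewrite [LHS]surjective_pairing h1 h2 -surjective_pairing.
  rewrite xpair_eqE negb_and; apply/orP; right; rewrite subr_eq0 /=.
  have [_ a1] := Hd (n - N)%N; have [_ a2] := Hd j.
  by apply/eqP => h; move: a2; rewrite -h oppr_lt0 ltNge ltW.
have [s0 [t [ht Hst]]] := generic_direction y0.
pose la n := cos t * (d n).1 + sin t * (d n).2.
pose mu n := cos t * (d n).1 + sin t * - (d n).2.
have laj n : (n < N)%N -> n != j -> la n != la j.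
  move=> nN nj; have := Hst n (ltn_addr N nN); rewrite /y nN (negbTE nj) dotp_pol /=.
  apply: contra => /eqP E; rewrite mulf_eq0; apply/orP; right.
  move: E; rewrite /la => E; apply/eqP.
  rewrite !mulrBr addrACA -opprD E; ring.
have muj n : (n < N)%N -> mu n != la j.
  move=> nN; have := Hst (n + N)%N; rewrite ltn_add2r => /(_ nN).
  rewrite /y ltnNge leq_addl /= addnK dotp_pol /=.
  apply: contra => /eqP E; rewrite mulf_eq0; apply/orP; right.
  move: E; rewrite /la /mu => E; apply/eqP.
  rewrite !mulrBr addrACA -opprD E; ring.
(* Incident waves occupy the first [N] slots, reflected ones the next [N], with their opposite
   sign. *)
pose c2 n := if (n < N)%N then c n * (la n - 1) else - (c (n - N)%N * (mu (n - N)%N - 1)).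
pose om n := if (n < N)%N then k * (la n - la j) else k * (mu (n - N)%N - la j).
have jNN : (j < N + N)%N by rewrite ltn_addr.
have la1 : la j - 1 != 0.
  by rewrite subr_eq0; have [h1 h2] := Hd j; apply: unit_dot_lt1.
suff : c2 j = 0.
  by rewrite /c2 jN => /eqP; rewrite mulf_eq0 (negbTE la1) orbF => /eqP.
apply: (trig_sum_coef (om := om) jNN).
- by rewrite /om jN subrr mulr0.
- move=> n nNN nj; rewrite /om; case: ifP => nN; apply: mulf_neq0; rewrite ?subr_eq0 ?lt0r_neq0//.
    exact: laj.
  by apply: muj; rewrite ltn_subLR// leqNgt nN.
move=> e e0; have e1 : 0 < e * k / 2 by rewrite divr_gt0// mulr_gt0.
have [M HM] := Hrad _ e1.
exists (Num.max 1 (expR M)) => r; rewrite gt_max => /andP[r1 rM].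
have r0 : 0 < r by apply: lt_trans r1.
have [s Es] : exists s : R, expR s = r by exact: expR_total.
have Ms : M < s by rewrite -ltr_expR Es.
have [da [db [dda ddb Ea Eb]]] := HM s t Ms ht.
have dpw n : is_derive s 1 (fun s => c n * pw_re k (pol (0, 0) s t) (d n))
    (c n * (- sin (k * (r * la n)) * (k * (r * la n)) + sin (k * (r * mu n)) * (k * (r * mu n)))).
  have -> : (fun s => c n * pw_re k (pol (0, 0) s t) (d n)) =
      fun s => c n * (cos (k * (expR s * la n)) - cos (k * (expR s * mu n))).
    by apply/funext => s'; rewrite /pw_re !dotp_pol.
  by drvR; rewrite Es; ring.
have dpi n : is_derive s 1 (fun s => c n * pw_im k (pol (0, 0) s t) (d n))
    (c n * (cos (k * (r * la n)) * (k * (r * la n)) - cos (k * (r * mu n)) * (k * (r * mu n)))).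
  have -> : (fun s => c n * pw_im k (pol (0, 0) s t) (d n)) =
      fun s => c n * (sin (k * (expR s * la n)) - sin (k * (expR s * mu n))).
    by apply/funext => s'; rewrite /pw_im !dotp_pol.
  by drvR; rewrite Es; ring.
have daE := is_derive_uniq dda (is_derive_sum N dpw).
have dbE := is_derive_uniq ddb (is_derive_sum N dpi).
set B := k * r * la j.
have key : k * r * \sum_(n < N + N) c2 n * cos (om n * r) =
   (db - k * expR s * \sum_(n < N) c n * pw_re k (pol (0, 0) s t) (d n)) * cos B
   - (da + k * expR s * \sum_(n < N) c n * pw_im k (pol (0, 0) s t) (d n)) * sin B.
  rewrite daE dbE Es big_split_ord /=.
  have c2l n : (n < N)%N -> c2 n * cos (om n * r) = c n * (la n - 1) * cos (k * (la n - la j) * r).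
    by move=> nN; rewrite /c2 /om nN.
  have c2r n : c2 (N + n)%N * cos (om (N + n)%N * r) = - (c n * (mu n - 1)) * cos (k * (mu n - la j) * r).
    by rewrite /c2 /om ltnNge leq_addr /= addKn.
  rewrite (eq_bigr (fun n : 'I_N => c n * (la n - 1) * cos (k * (la n - la j) * r))); last by move=> n _; exact: c2l.
  rewrite [X in _ + X](eq_bigr (fun n : 'I_N => - (c n * (mu n - 1)) * cos (k * (mu n - la j) * r))) //.
  apply: (@sum_identity N (fun n => c n * (la n - 1) * cos (k * (la n - la j) * r))
    (fun n => - (c n * (mu n - 1)) * cos (k * (mu n - la j) * r))
    (fun n => c n * (cos (k * (r * la n)) * (k * (r * la n)) - cos (k * (r * mu n)) * (k * (r * mu n))))
    (fun n => c n * pw_re k (pol (0, 0) s t) (d n))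
    (fun n => c n * (- sin (k * (r * la n)) * (k * (r * la n)) + sin (k * (r * mu n)) * (k * (r * mu n))))
    (fun n => c n * pw_im k (pol (0, 0) s t) (d n))) => n.
  rewrite /pw_re /pw_im !dotp_pol Es -/(la n) -/(mu n).
  have -> : k * (la n - la j) * r = k * (r * la n) - B by rewrite /B; ring.
  have -> : k * (mu n - la j) * r = k * (r * mu n) - B by rewrite /B; ring.
  rewrite !cosB; ring.
have kr : 0 < k * r by rewrite mulr_gt0.
rewrite -(ler_pM2l kr) -(gtr0_norm kr) -normrM key (gtr0_norm kr).
apply: (le_trans (ler_normB _ _)); rewrite !normrM.
have es : expR (s / 2) <= r.
  rewrite -Es ler_expR; have : 0 < s by rewrite -ltr_expR expR0 Es.
  lra.
have bd x z : `|x| <= e * k / 2 * expR (s / 2) -> `|z| <= 1 -> `|x| * `|z| <= e * k / 2 * r.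
  move=> hx hz; rewrite -[leRHS]mulr1; apply: ler_pM => //; apply: le_trans hx _.
  by rewrite ler_wpM2l// ltW.
have -> : k * r * e = e * k / 2 * r + e * k / 2 * r by field.
by apply: lerD; apply: bd => //; [exact: cos_max|exact: sin_max].
Qed.

(** The [N] rows of a matrix with [M < N] columns are linearly dependent. *)
Lemma kernel_vector (M N : nat) (A : nat -> nat -> R) : (M < N)%N ->
  exists c : nat -> R, (exists2 n, (n < N)%N & c n != 0) /\
    forall m, (m < M)%N -> \sum_(n < N) c n * A n m = 0.
Proof.
move=> MN; pose X := \matrix_(n < N, m < M) A n m.
have : kermx X != 0.
  rewrite kermx_eq0 /row_free; apply/eqP => h.
  by have := rank_leq_col X; rewrite h leqNgt MN.
case/rowV0Pn => v /sub_kermxP vX v0.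
have [n vn] : exists n, v 0 n != 0.
  apply/existsP; apply: contraNT v0; rewrite negb_exists => /forallP h.
  by apply/eqP/rowP => n; rewrite mxE; apply/eqP; have := h n; rewrite negbK.
pose c i := if insub i is Some i' then v 0 i' else 0.
have cE (i : 'I_N) : c i = v 0 i by rewrite /c valK.
exists c; split; first by exists n; rewrite ?cE.
move=> m mM; have := congr1 (fun Y : 'rV_M => Y 0 (Ordinal mM)) vX.
rewrite !mxE => E; rewrite -[RHS]E; apply: eq_bigr => i _.
by rewrite cE mxE.
Qed.

End plane_wave_independence.

(** * Uniqueness for real fields *)

Section helmholtz_algebra.
Variables (R : realType) (k : R).

Lemma C1onD (D : set (R * R)) u p q u' p' q' : C1on D u p q -> C1on D u' p' q' ->
  C1on D (fun x => u x + u' x) (fun x => p x + p' x) (fun x => q x + q' x).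
Proof.
move=> H H' x Dx; have [a1 a2 a3 a4 a5] := H x Dx; have [b1 b2 b3 b4 b5] := H' x Dx.
by split; [exact: ctD|exact: ctD|exact: ctD|exact: dD|exact: dD].
Qed.

Lemma C1onZ (D : set (R * R)) (c : R) u p q : C1on D u p q ->
  C1on D (fun x => c * u x) (fun x => c * p x) (fun x => c * q x).
Proof.
move=> H x Dx; have [a1 a2 a3 a4 a5] := H x Dx.
by split; [apply: ctM|apply: ctM|apply: ctM|exact: (dZ c a4)|exact: (dZ c a5)] => //; exact: ct_cst.
Qed.

Lemma helmD (D : set (R * R)) u v : helm k D u -> helm k D v -> helm k D (fun x => u x + v x).
Proof.
move=> [p [q [p1 [p2 [q1 [q2 [H1 H2 H3 H4]]]]]]] [p' [q' [p1' [p2' [q1' [q2' [H1' H2' H3' H4']]]]]]].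
exists (fun x => p x + p' x), (fun x => q x + q' x), (fun x => p1 x + p1' x), (fun x => p2 x + p2' x),
  (fun x => q1 x + q1' x), (fun x => q2 x + q2' x); split; try exact: C1onD.
by move=> x Dx; rewrite addrACA H4// H4'// mulrDr.
Qed.

Lemma helmZ (D : set (R * R)) (c : R) u : helm k D u -> helm k D (fun x => c * u x).
Proof.
move=> [p [q [p1 [p2 [q1 [q2 [H1 H2 H3 H4]]]]]]].
exists (fun x => c * p x), (fun x => c * q x), (fun x => c * p1 x), (fun x => c * p2 x),
  (fun x => c * q1 x), (fun x => c * q2 x); split; try exact: C1onZ.
by move=> x Dx; rewrite -mulrDr H4// mulrCA.
Qed.

Lemma helm_ext (D : set (R * R)) u v : (forall x, u x = v x) -> helm k D u -> helm k D v.
Proof. by move=> /funext ->. Qed.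

Lemma helmB (D : set (R * R)) u v : helm k D u -> helm k D v -> helm k D (fun x => u x - v x).
Proof.
move=> Hu Hv; apply: (@helm_ext _ (fun x => u x + (-1) * v x)).
  by move=> x; rewrite mulN1r.
by apply: helmD => //; exact: helmZ.
Qed.

Lemma helm0 (D : set (R * R)) : helm k D (fun=> 0).
Proof.
have C0 : C1on D (fun=> 0 : R) (fun=> 0) (fun=> 0).
  by move=> x _; split; [exact: ct_cst|exact: ct_cst|exact: ct_cst|exact: dC|exact: dC].
by exists (fun=> 0), (fun=> 0), (fun=> 0), (fun=> 0), (fun=> 0), (fun=> 0); split => // x _; rewrite mulr0 addr0.
Qed.

Lemma helm_sum (D : set (R * R)) N (c : nat -> R) (u : nat -> R * R -> R) :
  (forall n, helm k D (u n)) -> helm k D (fun x => \sum_(n < N) c n * u n x).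
Proof.
move=> Hu; elim: N => [|N IH].
  by apply: helm_ext (helm0 D) => x; rewrite big_ord0.
by apply: helm_ext (helmD IH (helmZ (c N) (Hu N))) => x; rewrite big_ord_recr.
Qed.

Lemma helm_sub (D E : set (R * R)) u : E `<=` D -> helm k D u -> helm k E u.
Proof.
move=> ED [p [q [p1 [p2 [q1 [q2 [H1 H2 H3 H4]]]]]]].
by exists p, q, p1, p2, q1, q2; split => x /ED; [exact: H1|exact: H2|exact: H3|exact: H4].
Qed.

Lemma helm_sin_wave (D : set (R * R)) (v z : R * R) : v.1 ^+ 2 + v.2 ^+ 2 = 1 ->
  helm k D (fun x => sin (k * (v.1 * (x.1 - z.1) + v.2 * (x.2 - z.2)))).
Proof.
move=> v1; have [H1 H2 H3 H4] := plane_wave_C1 k v1 z.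
apply: (@helm_sub setT) => //.
by do 6!eexists; split; [exact: H1|exact: H2|exact: H3|move=> x _; exact: H4].
Qed.

Hypothesis k0 : 0 < k.

Lemma helm_sin (D : set (R * R)) (v : R * R) : v.1 ^+ 2 + v.2 ^+ 2 = 1 ->
  helm k D (fun x => sin (k * dotp x v)).
Proof.
move=> v1; apply: helm_ext (helm_sin_wave D (0, 0) v1) => x.
by rewrite /dotp /= !subr0; congr (sin (k * _)); ring.
Qed.

(** A sine wave with its centre moved back by a quarter of a wavelength, [pi / (2 k)]. *)
Lemma helm_cos (D : set (R * R)) (v : R * R) : v.1 ^+ 2 + v.2 ^+ 2 = 1 ->
  helm k D (fun x => cos (k * dotp x v)).
Proof.
move=> v1; pose c := pi / 2 / k.
apply: helm_ext (helm_sin_wave D (- (c * v.1), - (c * v.2)) v1) => x.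
have -> : k * (v.1 * (x.1 - - (c * v.1)) + v.2 * (x.2 - - (c * v.2))) =
   k * dotp x v + k * c * (v.1 ^+ 2 + v.2 ^+ 2) by rewrite /dotp; ring.
have -> : k * c = pi / 2 by rewrite /c; field; exact: lt0r_neq0.
by rewrite v1 mulr1 sinD cos_pihalf sin_pihalf mulr0 mulr1 add0r.
Qed.

Lemma helm_pw (D : set (R * R)) (d : R * R) : d.1 ^+ 2 + d.2 ^+ 2 = 1 ->
  helm k D (pw_re k ^~ d) /\ helm k D (pw_im k ^~ d).
Proof.
move=> d1; have d1' : (refl2 d).1 ^+ 2 + (refl2 d).2 ^+ 2 = 1 by rewrite /= sqrrN.
by split; apply: helmB; [exact: helm_cos|exact: helm_cos|exact: helm_sin|exact: helm_sin].
Qed.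

Lemma ct_pw (x d : R * R) : {for x, continuous (pw_re k ^~ d)} /\ {for x, continuous (pw_im k ^~ d)}.
Proof. by rewrite /pw_re /pw_im /dotp; split; ct. Qed.

Lemma pw_axis (x d : R * R) : x.2 = 0 -> pw_re k x d = 0 /\ pw_im k x d = 0.
Proof.
by move=> x2; rewrite /pw_re /pw_im /dotp /refl2 /= x2 !mul0r !subrr.
Qed.

End helmholtz_algebra.

Section radiating_algebra.
Variables (R : realType) (k : R).

Lemma radiatingD (a b a' b' : R * R -> R) : radiating k a b -> radiating k a' b' ->
  radiating k (fun x => a x + a' x) (fun x => b x + b' x).
Proof.
move=> H H' e e0; have e2 : 0 < e / 2 by rewrite divr_gt0.
have [M HM] := H _ e2; have [M' HM'] := H' _ e2.
exists (Num.max M M') => s t; rewrite gt_max => /andP[Ms M's] ht.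
have [da [db [d1 d2 E1 E2]]] := HM s t Ms ht; have [da' [db' [d1' d2' E1' E2']]] := HM' s t M's ht.
exists (da + da'), (db + db'); split; [exact: dD|exact: dD| |].
  rewrite mulrDr addrACA (splitr e) [leRHS]mulrDl; apply: (le_trans (ler_normD _ _)); exact: lerD.
rewrite mulrDr opprD addrACA (splitr e) [leRHS]mulrDl; apply: (le_trans (ler_normD _ _)); exact: lerD.
Qed.

Lemma radiatingZ (c : R) (a b : R * R -> R) : radiating k a b ->
  radiating k (fun x => c * a x) (fun x => c * b x).
Proof.
move=> H e e0; have c1 : 0 < `|c| + 1 by rewrite ltr_wpDl.
have e2 : 0 < e / (`|c| + 1) by rewrite divr_gt0.
have [M HM] := H _ e2; exists M => s t Ms ht.
have [da [db [d1 d2 E1 E2]]] := HM s t Ms ht.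
exists (c * da), (c * db); split; [exact: (dZ c d1)|exact: (dZ c d2)| |].
  have -> : c * da + k * expR s * (c * b (pol (0, 0) s t)) = c * (da + k * expR s * b (pol (0, 0) s t)) by ring.
  rewrite normrM; apply: le_trans (ler_wpM2l (normr_ge0 c) E1) _.
  by rewrite mulrA ler_wpM2r ?expR_ge0// mulrA ler_pdivrMr// mulrC ler_wpM2l ?(ltW e0)// lerDl.
have -> : c * db - k * expR s * (c * a (pol (0, 0) s t)) = c * (db - k * expR s * a (pol (0, 0) s t)) by ring.
rewrite normrM; apply: le_trans (ler_wpM2l (normr_ge0 c) E2) _.
by rewrite mulrA ler_wpM2r ?expR_ge0// mulrA ler_pdivrMr// mulrC ler_wpM2l ?(ltW e0)// lerDl.
Qed.

Lemma radiating_eq (sa : R) (a b a' b' : R * R -> R) :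
  (forall x, upper (expR sa) x -> a x = a' x /\ b x = b' x) -> radiating k a b -> radiating k a' b'.
Proof.
move=> E H e e0; have [M HM] := H e e0; exists (Num.max M sa) => s t.
rewrite gt_max => /andP[Ms sas] ht.
have up s' : sa < s' -> upper (expR sa) (pol (0, 0) s' t).
  move=> h; split; last by rewrite pol_norm2; exact: expR_lt2.
  by rewrite /pol /= add0r mulr_gt0 ?expR_gt0// sin_gt0_pi.
have [da [db [d1 d2 E1 E2]]] := HM s t Ms ht; exists da, db.
have [Ea Eb] := E _ (up s sas).
have r0 : 0 < s - sa by rewrite subr_gt0.
have near y : `|y - s| < s - sa -> sa < y.
  by move=> h; have := ler_norm (s - y); rewrite distrC; lra.
split; rewrite -?Ea -?Eb //.
  by apply: (is_derive_near_eq r0 _ d1) => y /near /up /E[].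
by apply: (is_derive_near_eq r0 _ d2) => y /near /up /E[].
Qed.

Lemma radiating0 : radiating k (fun=> 0) (fun=> 0).
Proof.
move=> e e0; exists 0 => s t _ _; exists 0, 0; split; [exact: dC|exact: dC| |];
 by rewrite mulr0 ?subr0 ?addr0 normr0 mulr_ge0 ?expR_ge0// ltW.
Qed.

Lemma radiating_ext (a b a' b' : R * R -> R) : (forall x, a x = a' x) -> (forall x, b x = b' x) ->
  radiating k a b -> radiating k a' b'.
Proof. by move=> /funext -> /funext ->. Qed.

Lemma radiating_sum N (c : nat -> R) (a b : nat -> R * R -> R) :
  (forall n, radiating k (a n) (b n)) ->
  radiating k (fun x => \sum_(n < N) c n * a n x) (fun x => \sum_(n < N) c n * b n x).
Proof.
move=> H; elim: N => [|N IH].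
  by apply: radiating_ext radiating0 => x; rewrite big_ord0.
by apply: radiating_ext (radiatingD IH (radiatingZ (c N) (H N))) => x; rewrite big_ord_recr.
Qed.

End radiating_algebra.

Section surfaces.
Variables (R : realType).

Lemma ext_axis_cts (f : R * R -> R) : (forall x, {for x, continuous f}) ->
  (forall x : R * R, x.2 = 0 -> f x = 0) -> forall x, {for x, continuous (ext f)}.
Proof.
move=> cf f0 x; apply/continuous_epsP => e e0; have [x2|x2|x2] := ltgtP 0 x.2.
- have [d d0 Hd] := (continuous_epsP f x).1 (cf x) e e0.
  exists (Num.min d x.2); first by rewrite lt_min d0.
  move=> y; rewrite lt_min => /andP[yd yx]; rewrite /ext x2.
  move: yx; rewrite prod_norm_lt => /andP[_ /=]; rewrite ltr_norml => /andP[h _].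
  have -> : 0 < y.2 by rewrite -(ltrD2r (- x.2)) sub0r.
  exact: Hd.
- exists (- x.2); first by rewrite oppr_gt0.
  move=> y; rewrite prod_norm_lt => /andP[_ /=]; rewrite ltr_norml => /andP[_ h].
  have E z : z.2 <= 0 -> ext f z = 0 by rewrite leNgt /ext => /negbTE ->.
  by rewrite !E ?subrr ?normr0 ?(ltW x2)// -(lerD2r (- x.2)) sub0r ltW.
have [d d0 Hd] := (continuous_epsP f x).1 (cf x) e e0.
exists d => // y yx; rewrite /ext -x2 ltxx subr0.
case: ifP => _; last by rewrite normr0.
by have := Hd y yx; rewrite (f0 x)// subr0.
Qed.

Variables (h : R -> R) (a H0 sa : R).
Hypotheses (ha : forall t, a < `|t| -> h t = 0) (hH : forall t, `|h t| <= H0)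
  (sa_large : a ^+ 2 + H0 ^+ 2 <= expR sa ^+ 2) (a0 : 0 <= a).

(** The disc of radius [e^sa] contains the box [[-a, a] x [-H0, H0]], outside which the surface is
    the axis. *)
Lemma outer_above (x : R * R) : expR sa ^+ 2 < x.1 ^+ 2 + x.2 ^+ 2 -> (domain_above h x <-> 0 < x.2).
Proof.
move=> hx; rewrite /domain_above /=; have [x1|x1] := ltP a `|x.1|; first by rewrite ha.
have n1 : x.1 ^+ 2 <= a ^+ 2 by rewrite -(@real_normK _ x.1) ?num_real// lerXn2r ?nnegrE.
have H00 : 0 <= H0 by apply: le_trans (hH 0).
have n2 : H0 < `|x.2|.
  rewrite -(@ltr_pXn2r _ 2)// ?nnegrE// real_normK ?num_real//.
  by have := sa_large; lra.
have := hH x.1; rewrite ler_norml => /andP[h1 h2].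
split => hh.
  move: n2; have [//|x2] := ltP 0 x.2; rewrite ler0_norm//; lra.
by move: n2; rewrite gtr0_norm//; lra.
Qed.

Lemma upper_above : upper (expR sa) `<=` domain_above h.
Proof. by move=> x [x2 xn]; apply/outer_above. Qed.

Lemma ext_zext (u : R * R -> R) (x : R * R) : expR sa ^+ 2 < x.1 ^+ 2 + x.2 ^+ 2 ->
  ext u x = zext (domain_above h) u x.
Proof.
move=> hx; have E := outer_above hx; rewrite /ext /zext; case: ifPn => x2.
  by rewrite asboolT//; apply/E.
by rewrite asboolF// => /E; apply/negP.
Qed.

Lemma ext_cts_zext (u : R * R -> R) : cont2 (zext (domain_above h) u) -> ext_cts (expR sa) u.
Proof.
move=> cu x hx.
have cE : {for x, continuous (fun x : R * R => x.1 ^+ 2 + x.2 ^+ 2)} by ct.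
have e0 : 0 < x.1 ^+ 2 + x.2 ^+ 2 - expR sa ^+ 2 by rewrite subr_gt0.
have [d d0 Hd] := (continuous_epsP _ _).1 cE _ e0.
apply: (ct_near d0 _ (cu x)) => y /Hd; rewrite ltr_norml => /andP[h1 _].
by rewrite ext_zext//; lra.
Qed.

End surfaces.

Section real_form.
Variable R : realType.

(* Real form of [is_scattered_field]; [zext] states the boundary values. *)
Definition scat (k : R) (h : R -> R) (d : R * R) (ua ub : R * R -> R) : Prop :=
  [/\ helm k (domain_above h) (fun x => pw_re k x d + ua x),
    helm k (domain_above h) (fun x => pw_im k x d + ub x),
    cont2 (zext (domain_above h) (fun x => pw_re k x d + ua x)),
    cont2 (zext (domain_above h) (fun x => pw_im k x d + ub x))
    & radiating k ua ub].

Lemma helm_cancel (k : R) (D : set (R * R)) (f u : R * R -> R) : helm k D f ->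
  helm k D (fun x => f x + u x) -> helm k D u.
Proof.
by move=> hf hu; apply: helm_ext (helmB hu hf) => x; rewrite addrC addKr.
Qed.

Lemma ext_ctsB (a : R) (u v : R * R -> R) : ext_cts a u -> ext_cts a v -> ext_cts a (fun x => u x - v x).
Proof.
move=> cu cv x hx; have -> : ext (fun x => u x - v x) = fun x => ext u x - ext v x.
  by apply/funext => y; rewrite /ext; case: ifP => _; rewrite ?subrr.
by apply: ctB; [exact: cu|exact: cv].
Qed.

Section phaseless_equal.
Variables (k a H0 sa : R) (h1 h2 : R -> R) (d : R * R) (a1 b1 a2 b2 : R * R -> R).
Hypotheses (k0 : 0 < k) (a0 : 0 <= a) (sa_large : a ^+ 2 + H0 ^+ 2 <= expR sa ^+ 2)
  (ha1 : forall t, a < `|t| -> h1 t = 0) (hH1 : forall t, `|h1 t| <= H0)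
  (ha2 : forall t, a < `|t| -> h2 t = 0) (hH2 : forall t, `|h2 t| <= H0)
  (d1 : d.1 ^+ 2 + d.2 ^+ 2 = 1) (d20 : d.2 < 0).

(** The incident and reflected waves solve the equation and cancel on the axis, so what holds for
    the total field far out passes to the scattered one. *)
Lemma scat_upper (h : R -> R) (ua ub : R * R -> R) :
  (forall t, a < `|t| -> h t = 0) -> (forall t, `|h t| <= H0) -> scat k h d ua ub ->
  [/\ helm k (upper (expR sa)) ua, helm k (upper (expR sa)) ub,
    ext_cts (expR sa) ua & ext_cts (expR sa) ub].
Proof.
move=> ha hH [Ha Hb ca cb _]; have [pr pi_] := helm_pw k0 (domain_above h) d1.
have U := @upper_above R h a H0 sa ha hH sa_large a0.
have ctspw f : (forall x, {for x, continuous f}) -> (forall x : R * R, x.2 = 0 -> f x = 0) ->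
    ext_cts (expR sa) f by move=> cf f0 x _; exact: ext_axis_cts.
split.
- by apply: (helm_sub U); exact: helm_cancel pr Ha.
- by apply: (helm_sub U); exact: helm_cancel pi_ Hb.
- have -> : ua = fun x => (pw_re k x d + ua x) - pw_re k x d by apply/funext => x; rewrite addrC addKr.
  apply: ext_ctsB; first exact: (ext_cts_zext ha hH sa_large a0 ca).
  by apply: ctspw => [x|x /(pw_axis k d)[]//]; have [] := ct_pw k x d.
- have -> : ub = fun x => (pw_im k x d + ub x) - pw_im k x d by apply/funext => x; rewrite addrC addKr.
  apply: ext_ctsB; first exact: (ext_cts_zext ha hH sa_large a0 cb).
  by apply: ctspw => [x|x /(pw_axis k d)[]//]; have [] := ct_pw k x d.
Qed.

Lemma d1_lt1 : `|d.1| < 1.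
Proof.
rewrite -(@ltr_pXn2r _ 2)// ?nnegrE// expr1n real_normK ?num_real// -d1 ltrDl.
by rewrite exprn_even_gt0//= lt_eqF.
Qed.

Hypotheses (S1 : scat k h1 d a1 b1) (S2 : scat k h2 d a2 b2)
  (same : forall x, upper (expR sa) x ->
    (pw_re k x d + a1 x) ^+ 2 + (pw_im k x d + b1 x) ^+ 2 =
    (pw_re k x d + a2 x) ^+ 2 + (pw_im k x d + b2 x) ^+ 2).

(** The sum of the two waves is [V = 2 i sin be exp (i ph)]. In [|V + u_1|^2 = |V + u_2|^2] the
    cross term is [2 Re (conj V * w) = 4 sin be Im (exp (- i ph) w)], whence the [4]; [w] is then
    written through its rotation by the angle [K]. *)
Lemma phase_identity (K be ph A1 B1 A2 B2 : R) :
  (cos (ph + be) - cos (ph - be) + A1) ^+ 2 + (sin (ph + be) - sin (ph - be) + B1) ^+ 2 =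
  (cos (ph + be) - cos (ph - be) + A2) ^+ 2 + (sin (ph + be) - sin (ph - be) + B2) ^+ 2 ->
  sin be * (((A1 - A2) * cos K + (B1 - B2) * sin K) * sin (K - ph)
     + ((B1 - B2) * cos K - (A1 - A2) * sin K) * cos (K - ph)) =
  (A2 ^+ 2 + B2 ^+ 2 - (A1 ^+ 2 + B1 ^+ 2)) / 4.
Proof.
rewrite !(cosB, sinB, cosD, sinD).
set cb := cos be; set sb := sin be; set cp := cos ph; set sp := sin ph => H.
have E : ((A1 - A2) * cos K + (B1 - B2) * sin K) * (sin K * cp - cos K * sp)
     + ((B1 - B2) * cos K - (A1 - A2) * sin K) * (cos K * cp + sin K * sp) =
   (cos K ^+ 2 + sin K ^+ 2) * ((B1 - B2) * cp - (A1 - A2) * sp) by ring.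
rewrite E cos2Dsin2 mul1r; apply: (@mulfI _ 4) => //.
rewrite [RHS]mulrC divfK//; move: H => /eqP; rewrite -subr_eq0 => /eqP H.
apply/eqP; rewrite -subr_eq0 -[X in _ == X]H; apply/eqP; ring.
Qed.

Lemma phaseless_equal (x : R * R) : upper (expR sa) x -> a1 x = a2 x /\ b1 x = b2 x.
Proof.
have [Ha1 Hb1 ca1 cb1] := scat_upper ha1 hH1 S1; have [Ha2 Hb2 ca2 cb2] := scat_upper ha2 hH2 S2.
have [_ _ _ _ r1] := S1; have [_ _ _ _ r2] := S2.
pose wa x := a1 x - a2 x; pose wb x := b1 x - b2 x.
have Hwa : helm k (upper (expR sa)) wa := helmB Ha1 Ha2.
have Hwb : helm k (upper (expR sa)) wb := helmB Hb1 Hb2.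
have cwa : ext_cts (expR sa) wa := ext_ctsB ca1 ca2.
have cwb : ext_cts (expR sa) wb := ext_ctsB cb1 cb2.
have rw : radiating k wa wb.
  apply: radiating_ext (radiatingD r1 (radiatingZ (-1) r2)) => y; by rewrite mulN1r.
pose g s t := (ext a2 (pol (0, 0) s t) ^+ 2 + ext b2 (pol (0, 0) s t) ^+ 2
   - (ext a1 (pol (0, 0) s t) ^+ 2 + ext b1 (pol (0, 0) s t) ^+ 2)) / 4.
have cg s : sa < s -> ctsI 0 pi (g s).
  move=> hs t ht; have e1 := ext_ctsI ca1 hs ht; have e2 := ext_ctsI cb1 hs ht.
  by have e3 := ext_ctsI ca2 hs ht; have e4 := ext_ctsI cb2 hs ht; rewrite /g; ct.
have [M1 saM1 [C1 C10 HC1]] := radiating_decay k0 Ha1 Hb1 ca1 cb1 r1.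
have [M2 saM2 [C2 C20 HC2]] := radiating_decay k0 Ha2 Hb2 ca2 cb2 r2.
have Hg s : Num.max M1 M2 < s -> expR s * itg 0 pi (fun t => `|g s t|) <= C1 + C1 + (C2 + C2).
  rewrite gt_max => /andP[s1 s2]; have hs := le_lt_trans saM1 s1.
  have [g1 g2] := HC1 s s1; have [g3 g4] := HC2 s s2.
  have q1 := ctsIX (n := 2) (ext_ctsI ca1 hs); have q2 := ctsIX (n := 2) (ext_ctsI cb1 hs).
  have q3 := ctsIX (n := 2) (ext_ctsI ca2 hs); have q4 := ctsIX (n := 2) (ext_ctsI cb2 hs).
  apply: (@le_trans _ _ (expR s * itg 0 pi (fun t => (ext a1 (pol (0, 0) s t) ^+ 2 + ext b1 (pol (0, 0) s t) ^+ 2)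
     + (ext a2 (pol (0, 0) s t) ^+ 2 + ext b2 (pol (0, 0) s t) ^+ 2)))).
    apply: ler_wpM2l; first exact: expR_ge0.
    apply: le_itg; first by apply: ctsI_abs; exact: cg.
      by apply: ctsID; exact: ctsID.
    move=> t _; rewrite /g ler_norml.
    have p1 := sqr_ge0 (ext a1 (pol (0, 0) s t)); have p2 := sqr_ge0 (ext b1 (pol (0, 0) s t)).
    have p3 := sqr_ge0 (ext a2 (pol (0, 0) s t)); have p4 := sqr_ge0 (ext b2 (pol (0, 0) s t)).
    move: (ext a1 _ ^+ 2) (ext b1 _ ^+ 2) (ext a2 _ ^+ 2) (ext b2 _ ^+ 2) p1 p2 p3 p4 => A B C D *.
    by apply/andP; split; lra.
  rewrite itgD; [|exact: ctsID|exact: ctsID].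
  by rewrite itgD// itgD// !mulrDr; apply: lerD; apply: lerD.
have Hid s t : sa < s -> 0 <= t <= pi ->
    sin (k * expR s * (d.2 * sin t)) *
     (rotP k wa wb s t * sin (k * expR s * (1 - d.1 * cos t))
      + rotQ k wa wb s t * cos (k * expR s * (1 - d.1 * cos t))) = g s t.
  move=> hs ht; have [h|{}ht] := itvcc_cases ht.
    rewrite /g /rotP /rotQ !ext_pol0// !mul0r subrr addr0 !mul0r addr0 mulr0 expr0n /=; ring.
  have up : upper (expR sa) (pol (0, 0) s t).
    split; last by rewrite pol_norm2; exact: expR_lt2.
    by rewrite /pol /= add0r mulr_gt0 ?expR_gt0// sin_gt0_pi.
  have := same up; rewrite /g /rotP /rotQ !ext_polE// /pw_re /pw_im !dotp_pol /refl2 /= /wa /wb.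
  have -> : k * (expR s * (cos t * d.1 + sin t * d.2)) = k * expR s * (d.1 * cos t) + k * expR s * (d.2 * sin t) by ring.
  have -> : k * (expR s * (cos t * d.1 + sin t * - d.2)) = k * expR s * (d.1 * cos t) - k * expR s * (d.2 * sin t) by ring.
  have -> : k * expR s * (1 - d.1 * cos t) = k * expR s - k * expR s * (d.1 * cos t) by ring.
  exact: phase_identity.
have Z n s (hs : sa < s) := modes_eq0 k0 Hwa Hwb cwa cwb rw d1_lt1 d1 cg Hg Hid n hs.
move=> ux; split; apply/eqP; rewrite -subr_eq0; apply/eqP.
  by apply: (zero_modes (u := wa) cwa) ux => n s hs; have [] := Z n s hs.
by apply: (zero_modes (u := wb) cwb) ux => n s hs; have [] := Z n s hs.
Qed.

End phaseless_equal.

Lemma itg2_sum (a b c e : R) N (w : nat -> R) (f : nat -> R * R -> R) : c <= e ->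
  (forall n, cont2 (f n)) ->
  itg2 a b c e (fun x => \sum_(n < N) w n * f n x) = \sum_(n < N) w n * itg2 a b c e (f n).
Proof.
move=> ce cf; rewrite /itg2.
have E n : w n * itg a b (fun x => itg c e (fun y => f n (x, y))) =
   itg a b (fun x => w n * itg c e (fun y => f n (x, y))) by rewrite itgZ//; exact: cont2_itg.
rewrite (eq_bigr (fun n : 'I_N => itg a b (fun x => w n * itg c e (fun y => f n (x, y))))); last by move=> n _; exact: E.
rewrite -(@itg_sum R a b N (fun n x => w n * itg c e (fun y => f n (x, y)))); last first.
  by move=> n; apply: ctsIZ; exact: cont2_itg.
apply: eq_itg => x _.
rewrite (@itg_sum R c e N (fun n y => w n * f n (x, y))); last first.
  by move=> n; apply: ctsIZ; exact: cont2_slice.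
by apply: eq_bigr => n _; rewrite itgZ//; exact: cont2_slice.
Qed.

Lemma cont2_sum N (w : nat -> R) (f : nat -> R * R -> R) : (forall n, cont2 (f n)) ->
  cont2 (fun x => \sum_(n < N) w n * f n x).
Proof.
move=> cf; elim: N => [|N IH].
  have -> : (fun x => \sum_(n < 0) w n * f n x) = fun=> 0 by apply/funext => x; rewrite big_ord0.
  exact: cont2_cst.
have -> : (fun x => \sum_(n < N.+1) w n * f n x) = fun x => \sum_(n < N) w n * f n x + w N * f N x.
  by apply/funext => x; rewrite big_ord_recr.
by apply: cont2D => //; exact: cont2Z.
Qed.

Lemma zext_sum (D : set (R * R)) N (w : nat -> R) (f : nat -> R * R -> R) :
  zext D (fun x => \sum_(n < N) w n * f n x) = fun x => \sum_(n < N) w n * zext D (f n) x.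
Proof.
apply/funext => x; rewrite /zext; case: ifP => // _.
by rewrite big1// => n _; rewrite mulr0.
Qed.

(** * The bounded set between the surfaces *)

Section gap.
Variables (k a H0 sa : R) (h1 h2 : R -> R).
Hypotheses (k0 : 0 < k) (a0 : 0 <= a) (sa_large : a ^+ 2 + H0 ^+ 2 <= expR sa ^+ 2)
  (ch1 : continuous h1) (ch2 : continuous h2)
  (ha1 : forall t, a < `|t| -> h1 t = 0) (hH1 : forall t, `|h1 t| <= H0)
  (ha2 : forall t, a < `|t| -> h2 t = 0) (hH2 : forall t, `|h2 t| <= H0).

Definition gap : set (R * R) := [set x | h2 x.1 < x.2 /\ x.2 < h1 x.1].

Lemma open_below : open [set x : R * R | x.2 < h1 x.1].
Proof.
have ch x : {for x, continuous (fun x : R * R => h1 x.1 - x.2)}.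
  apply: ctB; last exact: ct_snd.
  by apply: (ct_comp (f := fst)); [exact: ch1|exact: ct_fst].
rewrite (_ : mkset _ = (fun x : R * R => h1 x.1 - x.2) @^-1` [set y | 0 < y]).
  by apply: open_comp => [? _|]; [exact: ch|exact: open_gt].
by apply/seteqP; split=> x /=; rewrite subr_gt0.
Qed.

Lemma open_gap : open gap.
Proof.
by rewrite (_ : gap = domain_above h2 `&` [set x : R * R | x.2 < h1 x.1]) //; apply: openI;
  [exact: open_above|exact: open_below].
Qed.

Lemma gap_bounded (x : R * R) : gap x -> `|x| < a + H0 + 1.
Proof.
move=> [g1 g2]; have H00 : 0 <= H0 := le_trans (normr_ge0 _) (hH1 0).
have x1 : `|x.1| <= a.
  by rewrite leNgt; apply/negP => h; move: g1 g2; rewrite ha1// ha2// => p /(lt_trans p); rewrite ltxx.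
have := hH1 x.1; have := hH2 x.1; rewrite !ler_norml => /andP[p1 p2] /andP[p3 p4].
rewrite prod_norm_lt; apply/andP; split.
  by apply: le_lt_trans x1 _; have := H00; lra.
by rewrite ltr_norml; apply/andP; split; have := a0; lra.
Qed.

(** A boundary point of the gap lies either on the lower graph, where the extension of [t] already
    vanishes, or on the upper one strictly above the lower, where [tz] applies. *)
Lemma gap_cts (t : R * R -> R) : cont2 (zext (domain_above h2) t) ->
  (forall x, h2 x.1 < x.2 -> x.2 = h1 x.1 -> t x = 0) -> cont2 (zext gap t).
Proof.
move=> ct tz x; have [gx|ngx] := pselect (gap x).
  have [e e0 He] := open_box open_gap gx; apply: (ct_near e0 _ (ct x)) => y /He gy.
  by rewrite !zext_in//; case: gy.
have [hx|hx] := ltP (h1 x.1) x.2.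
  have [e e0 He] := open_box (open_above ch1) (hx : domain_above h1 x).
  apply: (@ct_near _ _ (fun=> 0) _ _ _ e0); last exact: ct_cst.
  move=> y /He hy; rewrite zext_out// => -[_ y2].
  by move: (lt_trans y2 hy); rewrite ltxx.
have T0 : zext (domain_above h2) t x = 0.
  have [hx2|hx2] := ltP (h2 x.1) x.2; last first.
    by apply: zext_out => h; move: (lt_le_trans h hx2); rewrite ltxx.
  rewrite zext_in//; apply: tz => //; apply/eqP; rewrite eq_le hx /= leNgt.
  by apply/negP => h; apply: ngx.
apply/continuous_epsP => e e0; have [d d0 Hd] := (continuous_epsP _ _).1 (ct x) e e0.
exists d => // y /Hd; rewrite T0 (zext_out _ ngx) !subr0.
have [gy|ngy] := pselect (gap y); last by rewrite (zext_out _ ngy) normr0.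
by rewrite !zext_in//; case: gy.
Qed.

(** At a point of the graph of [h1] lying above [h2], [t2] is the limit from above of the common
    values, and [t1] has boundary value zero there. *)
Lemma trace_zero (t1 t2 : R * R -> R) : cont2 (zext (domain_above h1) t1) -> cont2 (zext (domain_above h2) t2) ->
  (forall x, domain_above h1 x -> domain_above h2 x -> t1 x = t2 x) ->
  forall x, h2 x.1 < x.2 -> x.2 = h1 x.1 -> t2 x = 0.
Proof.
move=> c1 c2 E x hx xE; apply/eqP; rewrite -normr_le0; apply/ler_addgt0Pl => e e0; rewrite addr0.
have e2 : 0 < e / 2 by rewrite divr_gt0.
have [d1 d10 H1] := (continuous_epsP _ _).1 (c1 x) _ e2.
have [d2 d20 H2] := (continuous_epsP _ _).1 (c2 x) _ e2.
pose m := Num.min d1 d2 / 2.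
have mm : 0 < Num.min d1 d2 by rewrite lt_min d10.
have m0 : 0 < m by rewrite divr_gt0.
have m1 : m < Num.min d1 d2 by rewrite /m; lra.
pose y : R * R := (x.1, x.2 + m).
have yx : `|y - x| < Num.min d1 d2.
  by rewrite prod_norm_lt /= subrr normr0 mm (addrC x.2) addrK gtr0_norm.
have y1 : domain_above h1 y by rewrite /domain_above /= -xE ltrDl.
have y2 : domain_above h2 y by rewrite /domain_above /= ltr_wpDr// ltW.
move: yx; rewrite lt_min => /andP[yd1 yd2].
have nx1 : ~ domain_above h1 x by rewrite /domain_above /= xE ltxx.
have := H1 y yd1; have := H2 y yd2.
rewrite (zext_out _ nx1) subr0 !zext_in// E// => h3 h4.
have -> : t2 x = t2 y - (t2 y - t2 x) by ring.
apply: (le_trans (ler_normB _ _)); rewrite (splitr e); apply: lerD; exact: ltW.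
Qed.

Variables (d : nat -> R * R) (a1 b1 a2 b2 : nat -> R * R -> R).
Hypotheses (Hd : forall n, (d n).1 ^+ 2 + (d n).2 ^+ 2 = 1 /\ (d n).2 < 0) (dinj : injective d)
  (S1 : forall n, scat k h1 (d n) (a1 n) (b1 n)) (S2 : forall n, scat k h2 (d n) (a2 n) (b2 n))
  (same : forall n x, domain_above h1 x -> domain_above h2 x -> a1 n x = a2 n x /\ b1 n x = b2 n x).

Lemma no_gap (t0 : R) : h1 t0 <= h2 t0.
Proof.
rewrite leNgt; apply/negP => gt0.
pose tr n x := pw_re k x (d n) + a2 n x; pose ti n x := pw_im k x (d n) + b2 n x.
have Htr n : helm k (domain_above h2) (tr n) by have [] := S2 n.
have Hti n : helm k (domain_above h2) (ti n) by have [] := S2 n.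
have ctr n : cont2 (zext gap (tr n)).
  have [_ _ c1 _ _] := S1 n; have [_ _ c2 _ _] := S2 n.
  apply: gap_cts => //; apply: (trace_zero c1 c2) => x x1 x2.
  by have [-> _] := same n x1 x2.
have cti n : cont2 (zext gap (ti n)).
  have [_ _ _ c1 _] := S1 n; have [_ _ _ c2 _] := S2 n.
  apply: gap_cts => //; apply: (trace_zero c1 c2) => x x1 x2.
  by have [_ ->] := same n x1 x2.
have gap2 : gap `<=` domain_above h2 by move=> x [].
have H00 : 0 <= H0 := le_trans (normr_ge0 _) (hH1 0).
pose L := a + H0 + 1; have L0 : 0 < L by rewrite /L ltr_wpDl// addr_ge0.
have [n [s s0 small]] := @small_cells_zero R gap L k open_gap L0 gap_bounded.
pose cell (i j : nat) (f : R * R -> R) :=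
  itg2 (- L + i%:R * s) (- L + i%:R * s + s) (- L + j%:R * s) (- L + j%:R * s + s) f.
(* One row for each direction; the first [n * n] columns hold the cell integrals of the real part,
   the next [n * n] those of the imaginary part. Hence [2 n^2 + 1] directions suffice for a real
   combination. *)
pose A idx m := if (m < n * n)%N then cell (m %/ n)%N (m %% n)%N (zext gap (tr idx))
  else cell ((m - n * n) %/ n)%N ((m - n * n) %% n)%N (zext gap (ti idx)).
have [c [[n1 n1N cn1] Hc]] := kernel_vector A (ltnSn (n * n + n * n)).
set N := (n * n + n * n).+1 in n1N Hc.
have ls (x : R) : x <= x + s by rewrite lerDl ltW.
have idx i j : (i < n)%N -> (j < n)%N -> [/\ (i * n + j < n * n)%N, ((i * n + j) %/ n)%N = i & ((i * n + j) %% n)%N = j].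
  move=> hi hj; have n0 : (0 < n)%N by apply: leq_ltn_trans hi.
  split; last 2 first.
  - by rewrite divnMDl// divn_small// addn0.
  - by rewrite modnMDl modn_small.
  by apply: (@leq_trans (i * n + n)); rewrite ?ltn_add2l// -mulSnr leq_mul2r hi orbT.
pose vr x := \sum_(m < N) c m * tr m x; pose vi x := \sum_(m < N) c m * ti m x.
have Hvr : helm k (domain_above h2) vr by exact: helm_sum.
have Hvi : helm k (domain_above h2) vi by exact: helm_sum.
have vr0 x : gap x -> vr x = 0.
  apply: small; first exact: helm_sub Hvr.
    by rewrite zext_sum; exact: (@cont2_sum N c _ ctr).
  move=> i j hi hj; rewrite zext_sum (@itg2_sum _ _ _ _ N c _ (ls _) ctr).
  have [m1 m2 m3] := idx i j hi hj; rewrite -[RHS](Hc (i * n + j)%N); last first.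
    by rewrite ltn_addr.
  by apply: eq_bigr => m _; rewrite /A m1 m2 m3.
have vi0 x : gap x -> vi x = 0.
  apply: small; first exact: helm_sub Hvi.
    by rewrite zext_sum; exact: (@cont2_sum N c _ cti).
  move=> i j hi hj; rewrite zext_sum (@itg2_sum _ _ _ _ N c _ (ls _) cti).
  have [m1 m2 m3] := idx i j hi hj; rewrite -[RHS](Hc (n * n + (i * n + j))%N); last first.
    by rewrite ltn_add2l.
  by apply: eq_bigr => m _; rewrite /A ltnNge leq_addr /= addKn m2 m3.
pose x0 : R * R := (t0, (h1 t0 + h2 t0) / 2).
have gx0 : gap x0 by split; rewrite /x0 /=; lra.
have [e e0 He] := open_box open_gap gx0.
have hH2' x : h2 x <= H0 by apply: le_trans (ler_norm _) (hH2 x).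
have zero x : domain_above h2 x -> vr x = 0 /\ vi x = 0.
  move=> hx.
  have := region_identity k0 ch2 hH2' Hvr Hvi (helm0 k _) (helm0 k _) e0 (x0 := x0) _ hx.
  rewrite /sqsum expr0n /= addr0 subr0 => H.
  have /eqP : vr x ^+ 2 + vi x ^+ 2 = 0.
    apply: H => y /He gy; split; first exact: gap2.
    by rewrite vr0// vi0// expr0n /= addr0 subr0.
  by rewrite paddr_eq0 ?sqr_ge0// !sqrf_eq0 => /andP[/eqP-> /eqP->].
(* The combined total field is zero, so the combined plane waves are minus the combined scattered
   fields, which radiate. *)
have rad : radiating k (fun x => \sum_(m < N) c m * pw_re k x (d m)) (fun x => \sum_(m < N) c m * pw_im k x (d m)).
  have r2 m : radiating k (a2 m) (b2 m) by have [] := S2 m.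
  apply: (@radiating_eq _ _ sa) (radiatingZ (-1) (radiating_sum N c r2)) => x ux.
  have [z1 z2] := zero x (upper_above ha2 hH2 sa_large a0 ux).
  split; apply/eqP; rewrite mulN1r eq_sym -subr_eq0 opprK -big_split /=.
    by rewrite -[X in _ == X]z1; apply/eqP; rewrite /vr; apply: eq_bigr => m _; rewrite -mulrDr.
  by rewrite -[X in _ == X]z2; apply/eqP; rewrite /vi; apply: eq_bigr => m _; rewrite -mulrDr.
by move: cn1; rewrite (plane_waves_not_radiating k0 Hd dinj rad n1N) eqxx.
Qed.

End gap.

Lemma real_uniqueness (k a H0 : R) (h1 h2 : R -> R) (d : nat -> R * R) (a1 b1 a2 b2 : nat -> R * R -> R)
    (x0 : R * R) (e : R) : 0 < k -> 0 <= a -> continuous h1 -> continuous h2 ->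
  (forall t, a < `|t| -> h1 t = 0) -> (forall t, `|h1 t| <= H0) ->
  (forall t, a < `|t| -> h2 t = 0) -> (forall t, `|h2 t| <= H0) ->
  (forall n, (d n).1 ^+ 2 + (d n).2 ^+ 2 = 1 /\ (d n).2 < 0) -> injective d ->
  (forall n, scat k h1 (d n) (a1 n) (b1 n)) -> (forall n, scat k h2 (d n) (a2 n) (b2 n)) ->
  0 < e ->
  (forall n x, `|x - x0| < e -> [/\ domain_above h1 x, domain_above h2 x &
    (pw_re k x (d n) + a1 n x) ^+ 2 + (pw_im k x (d n) + b1 n x) ^+ 2 =
    (pw_re k x (d n) + a2 n x) ^+ 2 + (pw_im k x (d n) + b2 n x) ^+ 2]) ->
  forall t, h1 t = h2 t.
Proof.
move=> k0 a0 ch1 ch2 ha1 hH1 ha2 hH2 Hd dinj S1 S2 e0 Hx0.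
have H00 : 0 <= H0 := le_trans (normr_ge0 _) (hH1 0).
(* The points above both surfaces are those above the graph of the maximum, which makes
   [region_identity] applicable. *)
pose hm t := Num.max (h1 t) (h2 t).
have chm : continuous hm by move=> t; apply: ct_max; [exact: ch1|exact: ch2].
have hmH t : hm t <= H0.
  rewrite ge_max; apply/andP; split; apply: le_trans (ler_norm _) _; [exact: hH1|exact: hH2].
have am x : domain_above hm x <-> domain_above h1 x /\ domain_above h2 x.
  by rewrite /domain_above /= gt_max; split => [/andP|[-> ->]].
have am1 : domain_above hm `<=` domain_above h1 by move=> x /am[].
have am2 : domain_above hm `<=` domain_above h2 by move=> x /am[].
have [sa Hsa] : exists sa : R, expR sa = 1 + a + H0.
  by apply: expR_total; rewrite -addrA ltr_pwDl// addr_ge0.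
have sa_large : a ^+ 2 + H0 ^+ 2 <= expR sa ^+ 2.
  by rewrite Hsa; have := mulr_ge0 a0 H00; nra.
have U1 := upper_above ha1 hH1 sa_large a0; have U2 := upper_above ha2 hH2 sa_large a0.
have same n x : domain_above h1 x -> domain_above h2 x -> a1 n x = a2 n x /\ b1 n x = b2 n x.
  move=> x1 x2; have [Hr1 Hi1 _ _ _] := S1 n; have [Hr2 Hi2 _ _ _] := S2 n.
  have [dn1 dn2] := Hd n.
  have mod y : domain_above hm y -> sqsum (fun x => pw_re k x (d n) + a1 n x) (fun x => pw_im k x (d n) + b1 n x)
     (fun x => pw_re k x (d n) + a2 n x) (fun x => pw_im k x (d n) + b2 n x) y = 0.
    apply: (region_identity k0 chm hmH (helm_sub am1 Hr1) (helm_sub am1 Hi1) (helm_sub am2 Hr2) (helm_sub am2 Hi2) e0 (x0 := x0)).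
    move=> z /(Hx0 n)[z1 z2 zE]; split; first exact/am.
    by rewrite /sqsum zE subrr.
  have up y : upper (expR sa) y -> a1 n y = a2 n y /\ b1 n y = b2 n y.
    apply: (phaseless_equal k0 a0 sa_large ha1 hH1 ha2 hH2 dn1 dn2 (S1 n) (S2 n)) => z uz.
    apply/eqP; rewrite -subr_eq0; apply/eqP; apply: mod; apply/am.
    by split; [exact: U1|exact: U2].
  (* Any ball in the outer region would do: the equality of the fields is continued from there to
     all points above both surfaces. *)
  pose y0 : R * R := (0, expR sa + 1).
  have uy0 : upper (expR sa) y0.
    have es := @expR_gt0 R sa; split; rewrite /y0 /=; first by rewrite addr_gt0.
    rewrite expr0n /= add0r ltrXn2r ?nnegrE ?ltrDl ?addr_ge0 ?(ltW es)//.
  have [e1 e10 He1] := open_box (@open_upper R _) uy0.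
  pose ur y := (pw_re k y (d n) + a1 n y) - (pw_re k y (d n) + a2 n y).
  pose ui y := (pw_im k y (d n) + b1 n y) - (pw_im k y (d n) + b2 n y).
  have urE y : ur y = a1 n y - a2 n y by rewrite /ur; ring.
  have uiE y : ui y = b1 n y - b2 n y by rewrite /ui; ring.
  have Hur : helm k (domain_above hm) ur := helmB (helm_sub am1 Hr1) (helm_sub am2 Hr2).
  have Hui : helm k (domain_above hm) ui := helmB (helm_sub am1 Hi1) (helm_sub am2 Hi2).
  have amx : domain_above hm x by apply/am.
  have := region_identity k0 chm hmH Hur Hui (helm0 k _) (helm0 k _) e10 (x0 := y0) _ amx.
  rewrite /sqsum expr0n /= addr0 subr0 urE uiE => H.
  have /eqP : (a1 n x - a2 n x) ^+ 2 + (b1 n x - b2 n x) ^+ 2 = 0.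
    apply: H => y /He1 uy; split; first by apply/am; split; [exact: U1|exact: U2].
    by rewrite urE uiE; have [-> ->] := up y uy; rewrite !subrr expr0n /= !addr0 subrr.
  by rewrite paddr_eq0 ?sqr_ge0// !sqrf_eq0 !subr_eq0 => /andP[/eqP-> /eqP->].
move=> t; apply/eqP; rewrite eq_le; apply/andP; split.
  exact: (no_gap k0 a0 sa_large ch1 ch2 ha1 hH1 ha2 hH2 Hd dinj S1 S2 same).
(* The same argument with the surfaces exchanged excludes the opposite strict inequality. *)
apply: (no_gap k0 a0 sa_large ch2 ch1 ha2 hH2 ha1 hH1 Hd dinj S2 S1) => n x x2 x1.
by have [-> ->] := same n x x1 x2.
Qed.

End real_form.

(** * From complex to real fields *)

Section partial_derivatives.
Variable R : realType.
Implicit Types (f : R * R -> R) (x w : R * R).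

(** A directional derivative depends only on the increments along the line, so partial and radial
    derivatives in the plane become derivatives in one real variable. *)
Lemma is_derive_transport (V W : normedModType R) (f : V -> R) (g : W -> R) (x v : V) (y w : W) (l : R) :
  (forall h : R, f (h *: v + x) - f x = g (h *: w + y) - g y) -> is_derive x v f l -> is_derive y w g l.
Proof.
move=> E [H1 H2].
have EE : (fun h : R => h^-1 *: ((f \o shift x) (h *: v) - f x)) =
    fun h : R => h^-1 *: ((g \o shift y) (h *: w) - g y).
  by apply/funext => h /=; rewrite E.
split; first by rewrite /derivable -EE.
by rewrite -H2 /derive EE.
Qed.

Lemma is_derive_dir f x w (l : R) : is_derive (0 : R) 1 (fun t => f (t *: w + x)) l <-> is_derive x w f l.
Proof.
split; apply: is_derive_transport => h.
  by rewrite !addr0 scale0r add0r [h *: 1]mulr1.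
by rewrite !addr0 scale0r add0r [h *: 1]mulr1.
Qed.

Lemma is_derive_e1 f x (l : R) : is_derive x.1 1 (fun t => f (t, x.2)) l <-> is_derive x (e1 R) f l.
Proof.
have E (h : R) : h *: e1 R + x = (h *: 1 + x.1, x.2).
  by rewrite [LHS]surjective_pairing /= [h *: 0]mulr0 add0r.
by split; apply: is_derive_transport => h; rewrite E -surjective_pairing.
Qed.

Lemma is_derive_e2 f x (l : R) : is_derive x.2 1 (fun t => f (x.1, t)) l <-> is_derive x (e2 R) f l.
Proof.
have E (h : R) : h *: e2 R + x = (x.1, h *: 1 + x.2).
  by rewrite [LHS]surjective_pairing /= [h *: 0]mulr0 add0r.
by split; apply: is_derive_transport => h; rewrite E -surjective_pairing.
Qed.

Lemma C1on_Ck (D : set (R * R)) f : Ck_on 1 D f ->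
  C1on D f ('D_(e1 R) f) ('D_(e2 R) f).
Proof.
move=> [cf df] x Dx.
have m1 : e1 R \in [:: e1 R; e2 R] by rewrite inE eqxx.
have m2 : e2 R \in [:: e1 R; e2 R] by rewrite !inE eqxx orbT.
have [d1 [c1 _]] := df _ m1; have [d2 [c2 _]] := df _ m2.
split; [exact: cf|exact: c1|exact: c2| |].
  by apply/is_derive_e1; apply: DeriveDef => //; exact: d1.
by apply/is_derive_e2; apply: DeriveDef => //; exact: d2.
Qed.

Lemma C2_Ck (D : set (R * R)) f : Ck_on 2 D f -> exists p q p1 p2 q1 q2,
  [/\ C1on D f p q, C1on D p p1 p2 & C1on D q q1 q2].
Proof.
move=> [cf df].
have m1 : e1 R \in [:: e1 R; e2 R] by rewrite inE eqxx.
have m2 : e2 R \in [:: e1 R; e2 R] by rewrite !inE eqxx orbT.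
have [d1 H1] := df _ m1; have [d2 H2] := df _ m2.
have C : Ck_on 1 D f.
  split; first exact: cf.
  move=> v hv; have [dv Hv] := df v hv; split; first exact: dv.
  exact: (conj Hv.1 I).
by do 6!eexists; split; [exact: C1on_Ck C|exact: C1on_Ck H1|exact: C1on_Ck H2].
Qed.

Lemma C1on_derive (D : set (R * R)) f p q x : C1on D f p q -> D x ->
  'D_(e1 R) f x = p x /\ 'D_(e2 R) f x = q x.
Proof.
move=> C Dx; have [_ _ _ /is_derive_e1 d1 /is_derive_e2 d2] := C x Dx.
by split; apply: derive_val.
Qed.

Lemma C1on_laplacian (D : set (R * R)) f p q p1 p2 q1 q2 x : open D -> C1on D f p q ->
  C1on D p p1 p2 -> C1on D q q1 q2 -> D x ->
  'D_(e1 R) ('D_(e1 R) f) x = p1 x /\ 'D_(e2 R) ('D_(e2 R) f) x = q2 x.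
Proof.
move=> oD Cf Cp Cq Dx; have [e e0 He] := open_box oD Dx.
have [_ _ _ d1 _] := Cp x Dx; have [_ _ _ _ d2] := Cq x Dx.
have E1 t : `|t - x.1| < e -> p (t, x.2) = 'D_(e1 R) f (t, x.2).
  by move=> h; have [->] := C1on_derive Cf (He (t, x.2) ltac:(by rewrite norm_fst_sub)).
have E2 t : `|t - x.2| < e -> q (x.1, t) = 'D_(e2 R) f (x.1, t).
  by move=> h; have [_ ->] := C1on_derive Cf (He (x.1, t) ltac:(by rewrite norm_snd_sub)).
have D1 := (is_derive_e1 ('D_(e1 R) f) x (p1 x)).1 (is_derive_near_eq e0 E1 d1).
have D2 := (is_derive_e2 ('D_(e2 R) f) x (q2 x)).1 (is_derive_near_eq e0 E2 d2).
by split; apply: derive_val.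
Qed.

(** [d/ds = r d/dr]; the chain rule is applied twice, along the exponential parametrisation of the
    ray and along the straight one. *)
Lemma C1on_radial (D : set (R * R)) f p q (s t : R) : open D -> C1on D f p q -> D (pol (0, 0) s t) ->
  is_derive s 1 (fun s => f (pol (0, 0) s t)) (expR s * 'D_((cos t, sin t)) f (pol (0, 0) s t)).
Proof.
move=> oD Cf Dx; have [d1 d2] := dpolr (0, 0) s t.
have H := C1on_chain oD Cf d1 d2 Dx.
set x := pol (0, 0) s t in Dx *.
have x0 : (x.1 + 0 * cos t, x.2 + 0 * sin t) = x by rewrite !mul0r !addr0 -surjective_pairing.
have dx : is_derive (0 : R) 1 (fun r : R => x.1 + r * cos t) (cos t) by drvR; ring.
have dy : is_derive (0 : R) 1 (fun r : R => x.2 + r * sin t) (sin t) by drvR; ring.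
have H2 := C1on_chain oD Cf dx dy; rewrite x0 in H2; have {}H2 := H2 Dx.
have E : (fun r : R => f (x.1 + r * cos t, x.2 + r * sin t)) = fun r => f (r *: (cos t, sin t) + x).
  by apply/funext => r; congr f; rewrite [RHS]surjective_pairing /= !(addrC (r *: _)).
rewrite E in H2; have /is_derive_dir H3 := H2.
have -> : 'D_((cos t, sin t)) f x = p x * cos t + q x * sin t by apply: derive_val.
by apply: is_derive_congr H _ _ => //; rewrite -/x /x /pol /=; ring.
Qed.

End partial_derivatives.

Section complex_fields.
Variable R : realType.

Lemma Re_total (k : R) us (x d : R * R) :
  complex.Re (total_field k us x d) = pw_re k x d + complex.Re (us x d).
Proof. by rewrite /total_field; case: (us x d) => a b. Qed.

Lemma Im_total (k : R) us (x d : R * R) :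
  complex.Im (total_field k us x d) = pw_im k x d + complex.Im (us x d).
Proof. by rewrite /total_field; case: (us x d) => a b. Qed.

Lemma normc_sqr_eq (z w : R[i]) : `|z| = `|w| ->
  complex.Re z ^+ 2 + complex.Im z ^+ 2 = complex.Re w ^+ 2 + complex.Im w ^+ 2.
Proof.
rewrite !normc_def => /(congr1 (@complex.Re R)) /= E.
have p (u : R[i]) : 0 <= complex.Re u ^+ 2 + complex.Im u ^+ 2 by rewrite addr_ge0 ?sqr_ge0.
by rewrite -(sqr_sqrtr (p z)) E sqr_sqrtr.
Qed.

Lemma normc_lt_parts (z : R[i]) (e : R) : `|z| < (e%:C)%C -> `|complex.Re z| < e /\ `|complex.Im z| < e.
Proof.
rewrite normc_def ltcR => H.
have le (a b : R) : `|a| <= Num.sqrt (a ^+ 2 + b ^+ 2).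
  by rewrite -sqrtr_sqr ler_wsqrtr// lerDl sqr_ge0.
split; first exact: le_lt_trans (le _ _) H.
by apply: le_lt_trans (le _ (complex.Re z)) _; rewrite addrC.
Qed.

Section one_field.
Variables (k : R) (h : R -> R) (us : R * R -> R * R -> R[i]) (d : R * R).
Hypotheses (k0 : 0 < k) (ch : continuous h) (d1 : d.1 ^+ 2 + d.2 ^+ 2 = 1)
  (scattered : is_scattered_field k h us d).

Let ua x := complex.Re (us x d).
Let ub x := complex.Im (us x d).

Lemma scattered_C2 : Ck_on 2 (domain_above h) ua /\ Ck_on 2 (domain_above h) ub.
Proof. by have [] := scattered. Qed.

Lemma scattered_helm : helm k (domain_above h) (fun x => pw_re k x d + ua x) /\
  helm k (domain_above h) (fun x => pw_im k x d + ub x).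
Proof.
have oD := open_above ch; have [Ca Cb] := scattered_C2.
have [[p [q [p1 [p2 [q1 [q2 [P1 P2 P3 _]]]]]]] [r [t [r1 [r2 [t1 [t2 [T1 T2 T3 _]]]]]]]] := helm_pw k0 (domain_above h) d1.
have [p' [q' [p1' [p2' [q1' [q2' [P1' P2' P3']]]]]]] := C2_Ck Ca.
have [r' [t' [r1' [r2' [t1' [t2' [T1' T2' T3']]]]]]] := C2_Ck Cb.
have A1 := C1onD P1 P1'; have A2 := C1onD P2 P2'; have A3 := C1onD P3 P3'.
have B1 := C1onD T1 T1'; have B2 := C1onD T2 T2'; have B3 := C1onD T3 T3'.
have Re_E : (fun y => complex.Re (total_field k us y d)) = fun x => pw_re k x d + ua x.
  by apply/funext => y; rewrite Re_total.
have Im_E : (fun y => complex.Im (total_field k us y d)) = fun x => pw_im k x d + ub x.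
  by apply/funext => y; rewrite Im_total.
have [_ _ H _ _] := scattered.
have L x : domain_above h x ->
   (p1 x + p1' x) + (q2 x + q2' x) + k ^+ 2 * (pw_re k x d + ua x) = 0 /\
   (r1 x + r1' x) + (t2 x + t2' x) + k ^+ 2 * (pw_im k x d + ub x) = 0.
  move=> Dx; have := H x Dx; rewrite /laplacian /cderive /= Re_E Im_E.
  have [-> ->] := C1on_laplacian oD A1 A2 A3 Dx.
  have [-> ->] := C1on_laplacian oD B1 B2 B3 Dx.
  have -> : total_field k us x d = ((pw_re k x d + ua x) +i* (pw_im k x d + ub x))%C.
    by rewrite -Re_total -Im_total; case: (total_field k us x d).
  by move/eqP; rewrite eq_complex /= !mul0r subr0 addr0 => /andP[/eqP-> /eqP->].
split.
  do 6!eexists; split; [exact: A1|exact: A2|exact: A3|] => x Dx /=.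
  by apply/eqP; rewrite mulNr -addr_eq0; apply/eqP; have [] := L x Dx.
do 6!eexists; split; [exact: B1|exact: B2|exact: B3|] => x Dx /=.
by apply/eqP; rewrite mulNr -addr_eq0; apply/eqP; have [] := L x Dx.
Qed.

(** Sommerfeld's bound on [sqrt r (u_r - i k u)] is multiplied by [sqrt r = e^(s/2)], which gives
    the bound on [u_s - i k r u] in each component. *)
Lemma scattered_radiating (sa : R) : upper (expR sa) `<=` domain_above h -> radiating k ua ub.
Proof.
move=> U e e0; have oD := open_above ch; have [Ca Cb] := scattered_C2.
have [p [q [p1 [p2 [q1 [q2 [P1 _ _]]]]]]] := C2_Ck Ca.
have [r [t' [r1 [r2 [t1 [t2 [T1 _ _]]]]]]] := C2_Ck Cb.
have [_ _ _ _ S] := scattered; have [M HM] := S e e0.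
have [L HL] : exists L : R, expR L = `|M| + 1 by apply: expR_total; rewrite ltr_wpDl.
exists (Num.max L sa) => s t; rewrite gt_max => /andP[Ls sas] ht.
have up : upper (expR sa) (pol (0, 0) s t).
  split; last by rewrite pol_norm2; exact: expR_lt2.
  by rewrite /pol /= add0r mulr_gt0 ?expR_gt0// sin_gt0_pi.
have Dx := U _ up.
have nx : enorm (pol (0, 0) s t) = expR s.
  rewrite /enorm pol_norm2 -expR_sqr sqrtr_sqr ger0_norm ?expR_ge0//.
have Mx : M < enorm (pol (0, 0) s t).
  rewrite nx; apply: le_lt_trans (ler_norm M) _; apply: (@lt_trans _ _ (expR L)); last by rewrite ltr_expR.
  by rewrite HL ltrDl.
have := HM _ Dx Mx.
have wE : (enorm (pol (0, 0) s t))^-1 *: pol (0, 0) s t = (cos t, sin t).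
  rewrite nx [LHS]surjective_pairing /pol /= !add0r; congr pair; rewrite [_ *: _]mulrA mulVf ?mul1r// gt_eqF// expR_gt0//.
rewrite /radial_derive /cderive wE nx.
set x := pol (0, 0) s t; set da := 'D_ _ _ x; set db := 'D_ _ _ x.
have -> : us x d = (ua x +i* ub x)%C by rewrite /ua /ub; case: (us x d).
have sq : Num.sqrt (expR s) = expR (s / 2) by rewrite -(expR_half s) sqrtr_sqr ger0_norm ?expR_ge0.
rewrite sq => /normc_lt_parts /=.
rewrite !(mul0r, mul1r, mulr0, subr0, add0r, sub0r, addr0, oppr0) => -[n1 n2].
exists (expR s * da), (expR s * db); split.
- exact: (C1on_radial oD P1 Dx).
- exact: (C1on_radial oD T1 Dx).
- have -> : expR s * da + k * expR s * ub x = expR (s / 2) * (expR (s / 2) * (da + k * ub x)).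
    by rewrite -(expR_half s); ring.
  rewrite normrM (ger0_norm (expR_ge0 _)) mulrC ler_wpM2r ?expR_ge0// ltW//.
  by move: n1; congr (`|_| < _); ring.
have -> : expR s * db - k * expR s * ua x = expR (s / 2) * (expR (s / 2) * (db - k * ua x)).
  by rewrite -(expR_half s); ring.
by rewrite normrM (ger0_norm (expR_ge0 _)) mulrC ler_wpM2r ?expR_ge0// ltW.
Qed.

Lemma above_closure (x : R * R) : h x.1 <= x.2 -> closure (domain_above h) x.
Proof.
move=> hx B /nbhs_ballP[e /= e0 He]; exists (x.1, x.2 + e / 2); split.
  by rewrite /domain_above /= (le_lt_trans hx)// ltrDl divr_gt0.
apply: He; rewrite -ball_normE /= prod_norm_lt /= subrr normr0 e0 /=.
by rewrite opprD addNKr normrN gtr0_norm ?divr_gt0//; lra.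
Qed.

(** Continuity relative to the closed domain, for the complex modulus, unfolded for both components
    at points on or above the surface. *)
Lemma scattered_near (x : R * R) (e : R) : h x.1 <= x.2 -> 0 < e -> exists2 r : R, 0 < r &
  forall y, domain_above h y -> `|y - x| < r -> `|ua y - ua x| < e /\ `|ub y - ub x| < e.
Proof.
move=> hx e0; have [_ C _ _ _] := scattered.
have cx := (@subspace_continuousP _ _ _ _).1 C x (above_closure hx).
have e0' : 0 < (e%:C)%C :> R[i] by rewrite ltcR.
move/cvgrPdist_lt : cx => /(_ _ e0').
rewrite near_withinE => /nbhs_ballP[r /= r0 Hr]; exists r => // y Dy yx.
have E : `|us x d - us y d| < (e%:C)%C.
  apply: (Hr y); first by rewrite -ball_normE /= distrC.
  exact: (@subset_closure _ (domain_above h) y Dy).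
have ReB (z w : R[i]) : complex.Re (z - w) = complex.Re z - complex.Re w by case: z; case: w.
have ImB (z w : R[i]) : complex.Im (z - w) = complex.Im z - complex.Im w by case: z; case: w.
have [n1 n2] := normc_lt_parts E; rewrite ReB in n1; rewrite ImB in n2.
by split; rewrite distrC.
Qed.

(** On the surface the field is continuous from above only; the vanishing of the total field there
    makes the zero extension fit from the other side. *)
Lemma scattered_zext : cont2 (zext (domain_above h) (fun x => pw_re k x d + ua x)) /\
  cont2 (zext (domain_above h) (fun x => pw_im k x d + ub x)).
Proof.
have oD := open_above ch; have [Ha Hb] := scattered_helm; have [_ _ _ Z _] := scattered.
have key (f u : R * R -> R) : (forall x, {for x, continuous f}) ->
    (forall x, domain_above h x -> {for x, continuous (fun x => f x + u x)}) ->
    (forall x e, h x.1 <= x.2 -> 0 < e -> exists2 r : R, 0 < r &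
      forall y, domain_above h y -> `|y - x| < r -> `|u y - u x| < e) ->
    (forall x : R * R, x.2 = h x.1 -> f x + u x = 0) -> cont2 (zext (domain_above h) (fun x => f x + u x)).
  move=> cf cu nu z x; have [xh|xh|xh] := ltgtP (h x.1) x.2.
  - have [e e0 He] := open_box oD (xh : domain_above h x); apply: (ct_near e0 _ (cu x xh)) => y /He Dy.
    by rewrite zext_in.
  - have [e e0 He] := open_box (open_below ch) (xh : [set x : R * R | x.2 < h x.1] x).
    apply: (@ct_near _ _ (fun=> 0) _ _ _ e0); last exact: ct_cst.
    move=> y /He /= hy; rewrite zext_out// => hy2; by move: (lt_trans hy hy2); rewrite ltxx.
  have nx : ~ domain_above h x by rewrite /domain_above /= xh ltxx.
  apply/continuous_epsP => e e0; have e2 : 0 < e / 2 by rewrite divr_gt0.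
  have hx : h x.1 <= x.2 by rewrite xh.
  have [r1 r10 H1] := nu x _ hx e2.
  have [r2 r20 H2] := (continuous_epsP f x).1 (cf x) _ e2.
  exists (Num.min r1 r2); first by rewrite lt_min r10.
  move=> y; rewrite lt_min => /andP[y1 y2]; rewrite (zext_out _ nx) subr0.
  have [Dy|nDy] := pselect (domain_above h y); last by rewrite (zext_out _ nDy) normr0.
  rewrite zext_in//; have -> : f y + u y = (f y - f x) + (u y - u x).
    by rewrite addrACA -opprD (z x (esym xh)) subr0.
  apply: le_lt_trans (ler_normD _ _) _; rewrite (splitr e); apply: ltrD; first exact: H2.
  exact: H1.
have Cc g (H : helm k (domain_above h) g) x : domain_above h x -> {for x, continuous g}.
  by move: H => [p [q [p1 [p2 [q1 [q2 [P _ _ _]]]]]]] /P[].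
split; apply: key.
- by move=> x; have [] := ct_pw k x d.
- exact: Cc.
- move=> x e hx e0; have [r r0 Hr] := scattered_near hx e0; exists r => // y Dy yx.
  by have [] := Hr y Dy yx.
- by move=> x xh; rewrite -Re_total Z.
- by move=> x; have [] := ct_pw k x d.
- exact: Cc.
- move=> x e hx e0; have [r r0 Hr] := scattered_near hx e0; exists r => // y Dy yx.
  by have [] := Hr y Dy yx.
- by move=> x xh; rewrite -Im_total Z.
Qed.

Lemma scattered_scat (sa : R) : upper (expR sa) `<=` domain_above h -> scat k h d ua ub.
Proof.
move=> U; have [H1 H2] := scattered_helm; have [H3 H4] := scattered_zext.
by split => //; exact: scattered_radiating U.
Qed.

End one_field.

Lemma locally_rough_bounds (h : R -> R) : locally_rough h ->
  continuous h /\ exists a H0, [/\ 0 <= a, forall t, a < `|t| -> h t = 0 & forall t, `|h t| <= H0].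
Proof.
move=> [dh _ ch].
have ch0 : continuous h.
  by move=> t; apply: differentiable_continuous; apply/derivable1_diffP; exact: (dh 0%N t isT).
split => //.
have [N [Nr HN]] := compact_bounded ch.
pose a := `|N| + 1; have a0 : 0 <= a by rewrite addr_ge0.
have Na : N < a by rewrite (le_lt_trans (ler_norm N))// ltrDl.
have ha t : a < `|t| -> h t = 0.
  move=> ta; apply/eqP; apply: contraT => ht; have /= := HN a Na t (@subset_closure _ [set x : R | h x != 0] t ht).
  by rewrite leNgt ta.
have [B B0 HB] := compact_abs_bound (@segment_compact R (- a) a) (fun x _ => ch0 x).
exists a, B; split => // t; have [ta|ta] := ltP a `|t|; first by rewrite ha// normr0.
by apply: HB; rewrite /= in_itv /= -ler_norml.
Qed.

End complex_fields.

Local Open Scope complex_scope.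

Theorem theorem2p3 (R : realType) (k : R) (k_gt0 : 0 < k)
  (h1 h2 : R -> R) (rough1 : locally_rough h1) (rough2 : locally_rough h2)
  (us1 us2 : R * R -> R * R -> R[i])
  (scattered1 : forall d : R * R, lower_directions d ->
     is_scattered_field k h1 us1 d)
  (scattered2 : forall d : R * R, lower_directions d ->
     is_scattered_field k h2 us2 d)
  (Omega : set (R * R))
  (Omega_neq0 : Omega !=set0) (Omega_open : open Omega)
  (Omega_connected : connected Omega) (Omega_bounded : bounded_set Omega)
  (Omega_above : Omega `<=` domain_above h1 `&` domain_above h2)
  (d : nat -> R * R) (d_lower : forall n : nat, lower_directions (d n))
  (d_distinct : injective d)
  (same_modulus : forall (x : R * R) (n : nat), Omega x ->
     `|total_field k us1 x (d n)| = `|total_field k us2 x (d n)|) :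
  surface h1 = surface h2.
Proof.
have [ch1 [A1 [H1 [A10 hA1 hH1]]]] := locally_rough_bounds rough1.
have [ch2 [A2 [H2 [A20 hA2 hH2]]]] := locally_rough_bounds rough2.
pose a := Num.max A1 A2; pose H0 := Num.max H1 H2.
have a0 : 0 <= a by rewrite le_max A10.
have ha1 t : a < `|t| -> h1 t = 0 by rewrite gt_max => /andP[/hA1].
have ha2 t : a < `|t| -> h2 t = 0 by rewrite gt_max => /andP[_ /hA2].
have hb1 t : `|h1 t| <= H0 by rewrite le_max hH1.
have hb2 t : `|h2 t| <= H0 by rewrite le_max hH2 orbT.
have H00 : 0 <= H0 := le_trans (normr_ge0 _) (hb1 0).
have [sa Hsa] : exists sa : R, expR sa = 1 + a + H0.
  by apply: expR_total; rewrite -addrA ltr_pwDl// addr_ge0.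
have sa_large : a ^+ 2 + H0 ^+ 2 <= expR sa ^+ 2.
  by rewrite Hsa; have := mulr_ge0 a0 H00; nra.
have Hd n : (d n).1 ^+ 2 + (d n).2 ^+ 2 = 1 /\ (d n).2 < 0.
  have [n1 n2] := d_lower n; split => //.
  have p : 0 <= (d n).1 ^+ 2 + (d n).2 ^+ 2 by rewrite addr_ge0 ?sqr_ge0.
  by rewrite -(sqr_sqrtr p) -/(enorm (d n)) n1 expr1n.
have S1 n := scattered_scat k_gt0 ch1 (Hd n).1 (scattered1 (d n) (d_lower n)) (upper_above ha1 hb1 sa_large a0).
have S2 n := scattered_scat k_gt0 ch2 (Hd n).1 (scattered2 (d n) (d_lower n)) (upper_above ha2 hb2 sa_large a0).
have [x0 Ox0] := Omega_neq0; have [e e0 He] := open_box Omega_open Ox0.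
suff E : h1 = h2 by rewrite E.
apply/funext.
apply: (real_uniqueness k_gt0 a0 ch1 ch2 ha1 hb1 ha2 hb2 Hd d_distinct S1 S2 e0 (x0 := x0)) => n x /He Ox.
have [x1 x2] := Omega_above x Ox; split => //.
have := normc_sqr_eq (same_modulus x n Ox).
by rewrite !Re_total !Im_total.
Qed.
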